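(* Let $\sigma>0$, $|\theta|<\pi/2$, $\eta\in(0,1)$; let $\varepsilon\to0$, $k=\varepsilon^\sigma$, and let the period be $d=\varepsilon/\eta$. Let $u_\varepsilon$ be the solution of the scattering problem for the perforated slab with slit width $\varepsilon$, period $d$ and incident magnetic field $u^i=e^{i(\kappa x_1-\zeta(x_2-1))}$, $\kappa=k\sin\theta$, $\zeta=k\cos\theta$, and $E_\varepsilon=[E_{\varepsilon,1},E_{\varepsilon,2},0]$ the associated electric field. Then inside the slit, uniformly on $\{0<x_1<\varepsilon,\ \delta\le x_2\le1-\delta\}$ for every $\delta\in(0,1/2)$, $$u_\varepsilon=1+O(\varepsilon^\sigma),\qquad E_{\varepsilon,1}=O(1),$$ so that no field enhancement occurs.
   Context: Geometry: a perfectly conducting slab $0<x_2<1$ perforated by the slits $\bigcup_{n\in\mathbb{Z}}\big((0,\varepsilon)\times(0,1)+(nd,0)\big)$; $\Omega_\varepsilon$ is the union of $\{x_2>1\}$, $\{x_2<0\}$ and the slits (including their open ends). Scattering problem: the total field $u_\varepsilon=u^i+u^s_\varepsilon$ above the slab (and $u_\varepsilon=u_\varepsilon^s$ below) satisfies $\Delta u_\varepsilon+k^2u_\varepsilon=0$ in $\Omega_\varepsilon$, $\partial_\nu u_\varepsilon=0$ on $\partial\Omega_\varepsilon$, $u_\varepsilon(x_1+d,x_2)=e^{i\kappa d}u_\varepsilon(x_1,x_2)$, and the outgoing condition $u^s_\varepsilon=\sum_nu_n^{s,\pm}e^{i\kappa_nx_1\pm i\zeta_nx_2}$ in $\{x_2>1\}$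 ($+$) and $\{x_2<0\}$ ($-$), with $\kappa_n=\kappa+2\pi n/d$, $\zeta_n=\sqrt{k^2-\kappa_n^2}$ if $|\kappa_n|<k$ and $\zeta_n=i\sqrt{\kappa_n^2-k^2}$ if $|\kappa_n|>k$. The magnetic field is $H_\varepsilon=[0,0,u_\varepsilon]$ and the electric field is defined by $[\partial_{x_2}u_\varepsilon,-\partial_{x_1}u_\varepsilon,0]=-i\omega\tau_0E_\varepsilon$, where $\tau_0,\mu_0>0$ are the vacuum permittivity and permeability and $k=\omega\sqrt{\tau_0\mu_0}$. *)

(* Defs.v *)
(* Stdlib reals with Coquelicot. *)
From Stdlib Require Export Reals ZArith.
From Coquelicot Require Export Coquelicot.
Open Scope R_scope.

Definition cexp (z : C) : C := (exp (Re z) * cos (Im z), exp (Re z) * sin (Im z)).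

(** * Complex-valued functions of two real variables *)

(* Componentwise partial derivatives; Coquelicot's total [Derive] is only
   meaningful together with [ex_d1], [ex_d2]. *)
Definition d1 (u : R * R -> C) (x : R * R) : C :=
  (Derive (fun s => Re (u (s, snd x))) (fst x),
   Derive (fun s => Im (u (s, snd x))) (fst x)).

Definition d2 (u : R * R -> C) (x : R * R) : C :=
  (Derive (fun t => Re (u (fst x, t))) (snd x),
   Derive (fun t => Im (u (fst x, t))) (snd x)).

Definition ex_d1 (u : R * R -> C) (x : R * R) : Prop :=
  ex_derive (fun s => Re (u (s, snd x))) (fst x) /\
  ex_derive (fun s => Im (u (s, snd x))) (fst x).

Definition ex_d2 (u : R * R -> C) (x : R * R) : Prop :=
  ex_derive (fun t => Re (u (fst x, t))) (snd x) /\
  ex_derive (fun t => Im (u (fst x, t))) (snd x).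

Definition C1_on (D : R * R -> Prop) (u : R * R -> C) : Prop :=
  forall x, D x ->
    ex_d1 u x /\ ex_d2 u x /\ continuous (d1 u) x /\ continuous (d2 u) x.

Definition C2_on (D : R * R -> Prop) (u : R * R -> C) : Prop :=
  C1_on D u /\ C1_on D (d1 u) /\ C1_on D (d2 u).

Definition laplacian (u : R * R -> C) (x : R * R) : C :=
  Cplus (d1 (d1 u) x) (d2 (d2 u) x).

(** * The perforated slab *)

Definition slit (eps d : R) (n : Z) (x : R * R) : Prop :=
  IZR n * d < fst x < IZR n * d + eps /\ 0 <= snd x <= 1.

Definition Omega (eps d : R) (x : R * R) : Prop :=
  1 < snd x \/ snd x < 0 \/ exists n : Z, slit eps d n x.

(* The boundary of [Omega eps d] without its corner points
   (nd, 0), (nd, 1), (nd + eps, 0), (nd + eps, 1), where no normal exists. *)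
Definition vertical_wall (eps d : R) (x : R * R) : Prop :=
  0 < snd x < 1 /\
  exists n : Z, fst x = IZR n * d \/ fst x = IZR n * d + eps.

Definition horizontal_wall (eps d : R) (x : R * R) : Prop :=
  (snd x = 0 \/ snd x = 1) /\
  exists n : Z, IZR n * d + eps < fst x < IZR (n + 1) * d.

(* Homogeneous Neumann condition: the normal derivative, computed in Omega, tends
   to zero at every boundary point that is not a corner. *)
Definition neumann (eps d : R) (u : R * R -> C) : Prop :=
  (forall y, vertical_wall eps d y ->
     filterlim (d1 u) (within (Omega eps d) (locally y)) (locally (RtoC 0))) /\
  (forall y, horizontal_wall eps d y ->
     filterlim (d2 u) (within (Omega eps d) (locally y)) (locally (RtoC 0))).

(* Finite energy in bounded parts of D, i.e. u is H^1 on every bounded part of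
   D, including near the corners.  This is the edge condition: it discards the
   solutions with non-integrable gradient at the corners and is what makes the
   solution of the scattering problem unique.  As [Omega] intersected with a box
   is a finite union of rectangles and the integrand is nonnegative, it is enough
   to bound the integrals over the closed rectangles contained in D. *)
Definition energy_density (u : R * R -> C) (x : R * R) : R :=
  Cmod (u x) ^ 2 + Cmod (d1 u x) ^ 2 + Cmod (d2 u x) ^ 2.

Definition locally_finite_energy (D : R * R -> Prop) (u : R * R -> C) : Prop :=
  forall r : R, exists M : R, forall a b c e : R,
    a <= b -> c <= e ->
    (forall s t, a <= s <= b -> c <= t <= e ->
       D (s, t) /\ Rabs s <= r /\ Rabs t <= r) ->
    RInt (fun s => RInt (fun t => energy_density u (s, t)) c e) a b <= M.

(** * The radiation condition *)

Definition kappa_n (d kappa : R) (n : Z) : R := kappa + 2 * PI * IZR n / d.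

(* At |kappa_n| = k both branches would give 0. *)
Definition zeta_n (d k kappa : R) (n : Z) : C :=
  let kn := kappa_n d kappa n in
  if Rlt_dec (Rabs kn) k
  then RtoC (sqrt (k ^ 2 - kn ^ 2))
  else Cmult Ci (RtoC (sqrt (kn ^ 2 - k ^ 2))).

(* exp (i (p x_1 + q x_2)), with complex wave numbers p and q *)
Definition plane_wave (p q : C) (x : R * R) : C :=
  cexp (Cmult Ci (Cplus (Cmult p (RtoC (fst x))) (Cmult q (RtoC (snd x))))).

(* Convergence of a series indexed by Z: both one-sided series converge. *)
Definition is_biseries (f : Z -> C) (l : C) : Prop :=
  exists l1 l2 : C,
    is_series (V := C_R_NormedModule) (fun n : nat => f (Z.of_nat n)) l1 /\
    is_series (V := C_R_NormedModule) (fun n : nat => f (- Z.of_nat (S n))%Z) l2 /\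
    l = Cplus l1 l2.

Definition upward_outgoing (d k kappa : R) (us : R * R -> C) : Prop :=
  exists a : Z -> C, forall x, 1 < snd x ->
    is_biseries (fun n => Cmult (a n)
      (plane_wave (RtoC (kappa_n d kappa n)) (zeta_n d k kappa n) x)) (us x).

Definition downward_outgoing (d k kappa : R) (us : R * R -> C) : Prop :=
  exists a : Z -> C, forall x, snd x < 0 ->
    is_biseries (fun n => Cmult (a n)
      (plane_wave (RtoC (kappa_n d kappa n)) (Copp (zeta_n d k kappa n)) x)) (us x).

(** * The scattering problem *)

Definition incident_field (kappa zeta : R) (x : R * R) : C :=
  cexp (Cmult Ci (RtoC (kappa * fst x - zeta * (snd x - 1)))).

(* u is the total field for the incident field ui, which is present above the
   slab only; values of u outside [Omega eps d] are irrelevant. *)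
Record scattering_solution (eps d k kappa : R) (ui u : R * R -> C) : Prop := {
  sol_C2 : C2_on (Omega eps d) u;
  sol_helmholtz : forall x, Omega eps d x ->
    Cplus (laplacian u x) (Cmult (RtoC (k ^ 2)) (u x)) = RtoC 0;
  sol_neumann : neumann eps d u;
  sol_energy : locally_finite_energy (Omega eps d) u;
  sol_quasiperiodic : forall x, Omega eps d x ->
    u (fst x + d, snd x) = Cmult (cexp (Cmult Ci (RtoC (kappa * d)))) (u x);
  sol_above : upward_outgoing d k kappa (fun x => Cminus (u x) (ui x));
  sol_below : downward_outgoing d k kappa u
}.

(** * The electric field *)

(* The field E with [d2 u, - d1 u, 0] = - i omega tau0 E. *)
Definition electric_field (omega tau0 : R) (u : R * R -> C) (x : R * R) : C * C * C :=
  let c := Copp (Cmult Ci (RtoC (omega * tau0))) in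
  (Cdiv (d2 u x) c, Cdiv (Copp (d1 u x)) c, RtoC 0).

Definition E1 (omega tau0 : R) (u : R * R -> C) (x : R * R) : C :=
  fst (fst (electric_field omega tau0 u x)).

(* Main.v *)
Require Import Defs.
From Stdlib Require Import Lra Psatz ClassicalEpsilon List.
Open Scope R_scope.

(** Write u = a + i b and consider one period.  Testing the equation with the
    conjugate of u gives an energy identity.  Only finite energy is known at the
    corners, so u is damped by the factor (1 + gamma |u|^2)^(-1/2), which makes the
    flux bounded by the energy density; a logarithmic choice of the radius then
    shows that small corner neighbourhoods carry no flux, and gamma tends to 0.
    In the two half-planes the field is a plane wave of order 0 plus an evanescent
    part that has mean zero on each line once the phase e^{i kappa x_1} is removed;
    by Poincare's inequality (the period is small compared with the wavelength)
    the evanescent flux is non-positive and controls the trace.  Hence the energy X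
    in the slit is at most k^2 int_slit |u|^2 + 2 d zeta |R|, where R and T are the
    reflection and transmission coefficients.

    Integrating along the slit, u differs in L^2 from 1 + R and from T there by
    O(X^(1/2)), so 1 + R - T = O((X / eps)^(1/2)) up to the harmless phase
    e^{i kappa x_1}.  Testing with e^{-i kappa x_1} instead balances the two fluxes, so
    that 1 - R - T = O((X / eps)^(1/2) + k (int_slit |u|^2 / eps)^(1/2)), because
    eps / d = eta is fixed.  These relations close: R = O(k), X = O(k^2 eps) and
    int_slit |u - 1|^2 = O(k^2 eps).

    The pointwise bounds follow from Caccioppoli estimates with cut-offs and
    difference quotients in x_2 only.  They use the Neumann walls of the slit, so the
    constants depend on delta but not on eps; a Sobolev inequality on the thin
    rectangle gives |u - 1| + |d2 u| = O(k), and E_1 = O(k / omega) = O(1). *)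

(** * Integrals over rectangles *)

(** The field is only C^2 in the open domain and of finite energy at the corners, so no traces and
    no boundary regularity are available: every integral is a Riemann integral over a closed
    rectangle inside the domain, and walls and corners are reached only through limits. Without
    damping, u times its gradient is merely integrable there and Cauchy-Schwarz on a short segment
    near a corner fails for lack of a bound on u. The logarithm works because 1 / rho is not
    integrable at 0: the energies of the lines at distance rho have a bounded integral in rho, so
    rho times the line energy must be small for some rho. The estimates close although the energy
    bound is linear in R: the other two relations bound |R|^2 by a multiple of X / eps + k^2, so k
    |R| can be absorbed by Young's inequality. Derivatives of a C^2 solution need not solve the
    equation classically. Difference quotients in x_2 do, and they inherit the Neumann condition
    because the walls are invariant under vertical shifts. *)

Definition rect (a b c e s t : R) : Prop := a <= s <= b /\ c <= t <= e.
(** Continuity of [f] in the plane at each point of [D], not continuity of its restriction: at the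
    edge of a closed rectangle it also looks outside, which suits rectangles contained in the open
    domain. *)
Definition cont_on (D : R -> R -> Prop) (f : R -> R -> R) : Prop :=
  forall s t, D s t -> continuity_2d_pt f s t.
Definition I2 (f : R -> R -> R) (a b c e : R) : R :=
  RInt (fun s => RInt (fun t => f s t) c e) a b.

Lemma RInt_plus_R (f g : R -> R) a b : ex_RInt f a b -> ex_RInt g a b ->
  RInt (fun x => f x + g x) a b = RInt f a b + RInt g a b.
Proof. intros; apply (RInt_plus (V := R_CompleteNormedModule)); assumption. Qed.
Lemma RInt_minus_R (f g : R -> R) a b : ex_RInt f a b -> ex_RInt g a b ->
  RInt (fun x => f x - g x) a b = RInt f a b - RInt g a b.
Proof. intros; apply (RInt_minus (V := R_CompleteNormedModule)); assumption. Qed.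
Lemma RInt_scal_R (f : R -> R) l a b : ex_RInt f a b ->
  RInt (fun x => l * f x) a b = l * RInt f a b.
Proof. intros; apply (RInt_scal (V := R_CompleteNormedModule)); assumption. Qed.
Lemma RInt_const_R (a b c : R) : RInt (fun _ => c) a b = (b - a) * c.
Proof. apply (RInt_const (V := R_CompleteNormedModule)). Qed.
Lemma RInt_Chasles_R (f : R -> R) a b c : ex_RInt f a b -> ex_RInt f b c ->
  RInt f a c = RInt f a b + RInt f b c.
Proof. intros; symmetry; apply (RInt_Chasles (V := R_CompleteNormedModule)); assumption. Qed.
Lemma ex_RInt_plus_R (f g : R -> R) a b : ex_RInt f a b -> ex_RInt g a b ->
  ex_RInt (fun x => f x + g x) a b.
Proof. intros; apply (ex_RInt_plus (V := R_NormedModule)); assumption. Qed.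
Lemma ex_RInt_minus_R (f g : R -> R) a b : ex_RInt f a b -> ex_RInt g a b ->
  ex_RInt (fun x => f x - g x) a b.
Proof. intros; apply (ex_RInt_minus (V := R_NormedModule)); assumption. Qed.
Lemma ex_RInt_scal_R (f : R -> R) l a b : ex_RInt f a b ->
  ex_RInt (fun x => l * f x) a b.
Proof. intros; apply (ex_RInt_scal (V := R_NormedModule)); assumption. Qed.
Lemma ex_RInt_const_R (c a b : R) : ex_RInt (fun _ => c) a b.
Proof. apply (ex_RInt_const (V := R_NormedModule)). Qed.
Lemma RInt_ext_R (f g : R -> R) a b : a <= b -> (forall x, a <= x <= b -> f x = g x) ->
  RInt f a b = RInt g a b.
Proof.
  intros H E. apply RInt_ext. intros x. rewrite Rmin_left, Rmax_right by lra.
  intros; apply E; lra.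
Qed.
Lemma ex_RInt_ext_R (f g : R -> R) a b : a <= b -> (forall x, a <= x <= b -> f x = g x) ->
  ex_RInt f a b -> ex_RInt g a b.
Proof.
  intros H E. apply ex_RInt_ext. intros x. rewrite Rmin_left, Rmax_right by lra.
  intros; apply E; lra.
Qed.
Lemma ex_RInt_cont (f : R -> R) a b : a <= b ->
  (forall x, a <= x <= b -> continuous f x) -> ex_RInt f a b.
Proof.
  intros H C. apply (ex_RInt_continuous (V := R_CompleteNormedModule)).
  rewrite Rmin_left, Rmax_right by lra. exact C.
Qed.
Lemma RInt_FTC (f f' : R -> R) a b : a <= b ->
  (forall x, a <= x <= b -> is_derive f x (f' x)) ->
  (forall x, a <= x <= b -> continuous f' x) -> RInt f' a b = f b - f a.
Proof.
  intros H D C. apply is_RInt_unique.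
  apply (is_RInt_derive (V := R_CompleteNormedModule) f f');
    rewrite Rmin_left, Rmax_right by lra; assumption.
Qed.
Lemma ex_RInt_sub (f : R -> R) a b c e : a <= c -> c <= e -> e <= b ->
  ex_RInt f a b -> ex_RInt f c e.
Proof.
  intros. apply (ex_RInt_Chasles_1 (V := R_CompleteNormedModule) f c e b); [lra|].
  apply (ex_RInt_Chasles_2 (V := R_CompleteNormedModule) f a c b); [lra|assumption].
Qed.

Lemma cont_2d_fst f s t : continuity_2d_pt f s t -> continuous (fun x => f x t) s.
Proof.
  intros H. apply continuity_pt_filterlim. intros e He.
  destruct (H (mkposreal e He)) as [dl Hd].
  exists dl. split; [apply cond_pos|]. intros y [_ Hy].
  apply (Hd y t Hy). rewrite Rminus_diag, Rabs_R0. apply cond_pos.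
Qed.
Lemma cont_2d_snd f s t : continuity_2d_pt f s t -> continuous (fun y => f s y) t.
Proof.
  intros H. apply continuity_pt_filterlim. intros e He.
  destruct (H (mkposreal e He)) as [dl Hd].
  exists dl. split; [apply cond_pos|]. intros y [_ Hy].
  refine (Hd s y _ Hy). rewrite Rminus_diag, Rabs_R0. apply cond_pos.
Qed.
Lemma cont_2d_of_fst (f : R -> R) s t : continuous f s -> continuity_2d_pt (fun x _ => f x) s t.
Proof.
  intros H. apply (continuity_1d_2d_pt_comp f (fun x _ => x)).
  apply continuity_pt_filterlim, H. apply continuity_2d_pt_id1.
Qed.
Lemma cont_2d_of_snd (f : R -> R) s t : continuous f t -> continuity_2d_pt (fun _ y => f y) s t.
Proof.
  intros H. apply (continuity_1d_2d_pt_comp f (fun _ y => y)).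
  apply continuity_pt_filterlim, H. apply continuity_2d_pt_id2.
Qed.
Lemma cont_2d_pow2 f s t : continuity_2d_pt f s t -> continuity_2d_pt (fun x y => f x y ^ 2) s t.
Proof.
  intros H. apply continuity_2d_pt_ext with (fun x y => f x y * f x y).
  intros; ring. apply continuity_2d_pt_mult; assumption.
Qed.
Lemma cont_2d_swap f s t : continuity_2d_pt f s t -> continuity_2d_pt (fun x y => f y x) t s.
Proof.
  intros H e. destruct (H e) as [dl Hd]. exists dl. intros u v Hu Hv. apply (Hd v u Hv Hu).
Qed.
Lemma cont_2d_abs f s t : continuity_2d_pt f s t -> continuity_2d_pt (fun x y => Rabs (f x y)) s t.
Proof.
  intros H. apply (continuity_1d_2d_pt_comp Rabs f); [|assumption].
  apply continuity_pt_filterlim, continuous_Rabs.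
Qed.

Ltac c2d := repeat match goal with
  | |- continuity_2d_pt (fun _ _ => ?c) _ _ => apply continuity_2d_pt_const
  | |- continuity_2d_pt (fun s t => @?f s t + @?g s t) _ _ => apply (continuity_2d_pt_plus f g)
  | |- continuity_2d_pt (fun s t => @?f s t - @?g s t) _ _ => apply (continuity_2d_pt_minus f g)
  | |- continuity_2d_pt (fun s t => @?f s t * @?g s t) _ _ => apply (continuity_2d_pt_mult f g)
  | |- continuity_2d_pt (fun s t => - @?f s t) _ _ => apply (continuity_2d_pt_opp f)
  | |- continuity_2d_pt (fun s t => @?f s t ^ 2) _ _ => apply (cont_2d_pow2 f)
  | |- continuity_2d_pt (fun s t => Rabs (@?f s t)) _ _ => apply (cont_2d_abs f)
  | |- continuity_2d_pt (fun s t => cos (@?f s t)) _ _ =>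
      apply (continuity_1d_2d_pt_comp cos f); [apply continuity_cos|]
  | |- continuity_2d_pt (fun s t => sin (@?f s t)) _ _ =>
      apply (continuity_1d_2d_pt_comp sin f); [apply continuity_sin|]
  | |- continuity_2d_pt (fun s _ => s) _ _ => apply continuity_2d_pt_id1
  | |- continuity_2d_pt (fun _ t => t) _ _ => apply continuity_2d_pt_id2
  | H : cont_on _ ?f |- continuity_2d_pt ?f _ _ => apply H
  | H : cont_on _ ?f |- continuity_2d_pt (fun s t => ?f s t) _ _ => apply H
  | H : continuity_2d_pt ?f ?s ?t |- continuity_2d_pt (fun x y => ?f x y) ?s ?t => exact H
  end; try assumption.

(** * Extension from a rectangle and exchange of integrals *)

Definition clamp (a b x : R) : R := Rmax a (Rmin b x).
Lemma clamp_in a b x : a <= b -> a <= clamp a b x <= b.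
Proof. intros. unfold clamp. split. apply Rmax_l. apply Rmax_lub. lra. apply Rmin_l. Qed.
Lemma clamp_id a b x : a <= x <= b -> clamp a b x = x.
Proof. intros. unfold clamp. rewrite Rmin_right, Rmax_right by lra. reflexivity. Qed.
Lemma clamp_lip a b x y : Rabs (clamp a b x - clamp a b y) <= Rabs (x - y).
Proof.
  unfold clamp, Rmax, Rmin. repeat destruct Rle_dec; unfold Rabs; repeat destruct Rcase_abs; lra.
Qed.

(** The retraction of the plane onto the rectangle is 1-Lipschitz in each variable, so composing
    with it gives a function that is continuous everywhere and agrees with [f] on the rectangle.
    Fubini's theorem then only has to be proved for globally continuous integrands. *)
Lemma clamp_cont f a b c e : a <= b -> c <= e -> cont_on (rect a b c e) f ->
  forall s t, continuity_2d_pt (fun s t => f (clamp a b s) (clamp c e t)) s t.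
Proof.
  intros Hab Hce H s t ep.
  destruct (H (clamp a b s) (clamp c e t)) with (eps := ep) as [dl Hd].
  split; apply clamp_in; assumption.
  exists dl. intros u v Hu Hv. apply Hd.
  eapply Rle_lt_trans; [apply clamp_lip|exact Hu].
  eapply Rle_lt_trans; [apply clamp_lip|exact Hv].
Qed.

Lemma Derive_RInt_upper (f : R -> R) a x : (forall y, continuous f y) ->
  is_derive (fun z => RInt f a z) x (f x).
Proof.
  intros H. apply (is_derive_RInt (V := R_CompleteNormedModule) f _ a).
  exists (mkposreal 1 Rlt_0_1). intros y _. apply (RInt_correct (V := R_CompleteNormedModule)).
  apply (ex_RInt_continuous (V := R_CompleteNormedModule)). intros; apply H. apply H.
Qed.

Section GlobalFubini.
Variable f : R -> R -> R.
Hypothesis Hf : forall s t, continuity_2d_pt f s t.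

Lemma ex_RInt_s a b t : ex_RInt (fun s => f s t) a b.
Proof.
  apply (ex_RInt_continuous (V := R_CompleteNormedModule)). intros. apply (cont_2d_fst f), Hf.
Qed.

Lemma RInt_param_cont_le a b t0 : a <= b -> continuous (fun t => RInt (fun s => f s t) a b) t0.
Proof.
  intros Hab. apply continuity_pt_filterlim. intros ep Hep.
  (* The denominator [b - a + 1] stays positive when a = b, and the factor 1/2 leaves room for the
     strict inequality. *)
  assert (Hep' : 0 < ep / (b - a + 1) / 2) by (apply Rdiv_lt_0_compat; [apply Rdiv_lt_0_compat|]; lra).
  destruct (uniform_continuity_2d_1d f a b t0 (fun x _ => Hf x t0) (mkposreal _ Hep')) as [dl Hd].
  exists dl. split; [apply cond_pos|]. intros t [_ Ht].
  change (Rabs (t - t0) < dl) in Ht.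
  change (Rabs (RInt (fun s => f s t) a b - RInt (fun s => f s t0) a b) < ep).
  rewrite <- RInt_minus_R by apply ex_RInt_s.
  apply Rle_lt_trans with ((b - a) * (ep / (b - a + 1) / 2)).
  - apply abs_RInt_le_const; [assumption| |].
    apply ex_RInt_minus_R; apply ex_RInt_s.
    intros s Hs. left.
    apply (Hd s t0 s t); try assumption.
    + split; destruct dl; simpl; lra.
    + apply Rabs_def2 in Ht. split; destruct dl; simpl in *; lra.
    + rewrite Rminus_diag, Rabs_R0. apply cond_pos.
  - replace ((b - a) * (ep / (b - a + 1) / 2)) with (ep * ((b - a) / (b - a + 1) / 2)) by (field; lra).
    assert ((b - a) / (b - a + 1) < 1) by (apply (Rmult_lt_reg_r (b - a + 1)); [lra|]; field_simplify; lra).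
    nra.
Qed.
Lemma RInt_param_cont a b t0 : continuous (fun t => RInt (fun s => f s t) a b) t0.
Proof.
  destruct (Rle_dec a b) as [H|H]. apply RInt_param_cont_le, H.
  apply continuous_ext with (fun t => opp (RInt (fun s => f s t) b a)).
  - intros t. apply (opp_RInt_swap (V := R_CompleteNormedModule)). apply ex_RInt_s.
  - apply (continuous_opp (V := R_NormedModule)). apply RInt_param_cont_le. lra.
Qed.

Lemma param_derive a c e x :
  is_derive (fun z => RInt (fun t => RInt (fun s => f s t) a z) c e) x (RInt (fun t => f x t) c e).
Proof.
  assert (HD : forall z t, is_derive (fun z => RInt (fun s => f s t) a z) z (f z t)).
  { intros z t. apply (Derive_RInt_upper (fun s => f s t)). intros y. apply (cont_2d_fst f), Hf. }
  rewrite (RInt_ext (fun t => f x t)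
     (fun t => Derive (fun u => RInt (fun s => f s t) a u) x)).
  2:{ intros t _. symmetry. apply is_derive_unique, HD. }
  apply (is_derive_RInt_param (fun z t => RInt (fun s => f s t) a z) c e x).
  - exists (mkposreal 1 Rlt_0_1). intros y _ t _. eexists; apply HD.
  - intros t _. apply continuity_2d_pt_ext with f.
    intros; symmetry; apply is_derive_unique, HD. apply Hf.
  - exists (mkposreal 1 Rlt_0_1). intros y _.
    apply (ex_RInt_continuous (V := R_CompleteNormedModule)). intros.
    apply RInt_param_cont.
Qed.
End GlobalFubini.

Lemma RInt_param_cont_t f (Hf : forall s t, continuity_2d_pt f s t) c e s0 :
  continuous (fun s => RInt (fun t => f s t) c e) s0.
Proof. apply (RInt_param_cont (fun t s => f s t)). intros; apply cont_2d_swap, Hf. Qed.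

(** As functions of the upper limit b both sides vanish at a and have the same derivative, by
    [param_derive]; the fundamental theorem of calculus concludes. *)
Lemma fubini_global f (Hf : forall s t, continuity_2d_pt f s t) a b c e : a <= b ->
  RInt (fun s => RInt (fun t => f s t) c e) a b = RInt (fun t => RInt (fun s => f s t) a b) c e.
Proof.
  intros Hab.
  rewrite (RInt_FTC (fun z => RInt (fun t => RInt (fun s => f s t) a z) c e)); [| assumption | |].
  - rewrite (RInt_ext (fun t => RInt (fun s => f s t) a a) (fun _ => 0)).
    rewrite RInt_const_R. lra.
    intros t _. apply (RInt_point (V := R_CompleteNormedModule)).
  - intros. apply param_derive, Hf.
  - intros. apply RInt_param_cont_t, Hf.
Qed.

Section OnRect.
Variables a b c e : R.
Hypothesis Hab : a <= b.
Hypothesis Hce : c <= e.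
Let cl (f : R -> R -> R) := fun s t => f (clamp a b s) (clamp c e t).

Lemma cl_eq f s t : rect a b c e s t -> cl f s t = f s t.
Proof. intros [? ?]. unfold cl. rewrite !clamp_id by assumption. reflexivity. Qed.

Lemma ex_RInt_in f s : cont_on (rect a b c e) f -> a <= s <= b -> ex_RInt (fun t => f s t) c e.
Proof.
  intros H Hs. apply ex_RInt_cont; [assumption|]. intros. apply (cont_2d_snd f), H. split; assumption.
Qed.
Lemma ex_RInt_in' f t : cont_on (rect a b c e) f -> c <= t <= e -> ex_RInt (fun s => f s t) a b.
Proof.
  intros H Hs. apply ex_RInt_cont; [assumption|]. intros. apply (cont_2d_fst f), H. split; assumption.
Qed.
Lemma ex_RInt_out f : cont_on (rect a b c e) f -> ex_RInt (fun s => RInt (fun t => f s t) c e) a b.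
Proof.
  intros H. apply ex_RInt_ext_R with (fun s => RInt (fun t => cl f s t) c e); [assumption| |].
  - intros s Hs. apply RInt_ext_R; [assumption|]. intros t Ht. apply cl_eq. split; assumption.
  - apply ex_RInt_cont; [assumption|]. intros. apply (RInt_param_cont_t (cl f)).
    apply clamp_cont; assumption.
Qed.
Lemma ex_RInt_out' f : cont_on (rect a b c e) f -> ex_RInt (fun t => RInt (fun s => f s t) a b) c e.
Proof.
  intros H. apply ex_RInt_ext_R with (fun t => RInt (fun s => cl f s t) a b); [assumption| |].
  - intros s Hs. apply RInt_ext_R; [assumption|]. intros t Ht. apply cl_eq. split; assumption.
  - apply ex_RInt_cont; [assumption|]. intros. apply (RInt_param_cont (cl f)).
    apply clamp_cont; assumption.
Qed.
Lemma I2_swap f : cont_on (rect a b c e) f ->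
  I2 f a b c e = RInt (fun t => RInt (fun s => f s t) a b) c e.
Proof.
  intros H. unfold I2.
  transitivity (RInt (fun s => RInt (fun t => cl f s t) c e) a b).
  - apply RInt_ext_R; [assumption|]. intros s Hs. apply RInt_ext_R; [assumption|].
    intros t Ht. symmetry; apply cl_eq. split; assumption.
  - rewrite fubini_global; [|apply clamp_cont; assumption|assumption].
    apply RInt_ext_R; [assumption|]. intros s Hs. apply RInt_ext_R; [assumption|].
    intros t Ht. apply cl_eq. split; assumption.
Qed.
Lemma I2_ext f g : (forall s t, rect a b c e s t -> f s t = g s t) -> I2 f a b c e = I2 g a b c e.
Proof.
  intros H. apply RInt_ext_R; [assumption|]. intros s Hs. apply RInt_ext_R; [assumption|].
  intros t Ht. apply H. split; assumption.
Qed.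
Lemma I2_le f g : cont_on (rect a b c e) f -> cont_on (rect a b c e) g ->
  (forall s t, rect a b c e s t -> f s t <= g s t) -> I2 f a b c e <= I2 g a b c e.
Proof.
  intros Hf Hg H. apply RInt_le; try (apply ex_RInt_out; assumption); [assumption|].
  intros s Hs. apply RInt_le; [assumption|apply ex_RInt_in; [assumption|lra] ..|].
  intros t Ht. apply H. split; lra.
Qed.
Lemma I2_plus f g : cont_on (rect a b c e) f -> cont_on (rect a b c e) g ->
  I2 (fun s t => f s t + g s t) a b c e = I2 f a b c e + I2 g a b c e.
Proof.
  intros Hf Hg. unfold I2. rewrite <- RInt_plus_R by (apply ex_RInt_out; assumption).
  apply RInt_ext_R; [assumption|]. intros s Hs. apply RInt_plus_R; apply ex_RInt_in; assumption.
Qed.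
Lemma I2_minus f g : cont_on (rect a b c e) f -> cont_on (rect a b c e) g ->
  I2 (fun s t => f s t - g s t) a b c e = I2 f a b c e - I2 g a b c e.
Proof.
  intros Hf Hg. unfold I2. rewrite <- RInt_minus_R by (apply ex_RInt_out; assumption).
  apply RInt_ext_R; [assumption|]. intros s Hs. apply RInt_minus_R; apply ex_RInt_in; assumption.
Qed.
Lemma I2_scal f l : cont_on (rect a b c e) f ->
  I2 (fun s t => l * f s t) a b c e = l * I2 f a b c e.
Proof.
  intros Hf. unfold I2. rewrite <- RInt_scal_R by (apply ex_RInt_out; assumption).
  apply RInt_ext_R; [assumption|]. intros s Hs. apply RInt_scal_R; apply ex_RInt_in; assumption.
Qed.
Lemma I2_const l : I2 (fun _ _ => l) a b c e = (b - a) * (e - c) * l.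
Proof. unfold I2. rewrite !RInt_const_R. ring. Qed.
Lemma I2_nonneg f : cont_on (rect a b c e) f ->
  (forall s t, rect a b c e s t -> 0 <= f s t) -> 0 <= I2 f a b c e.
Proof.
  intros Hf H. replace 0 with (I2 (fun _ _ => 0) a b c e) by (rewrite I2_const; ring).
  apply I2_le; try assumption. intros s t _. apply continuity_2d_pt_const.
Qed.
Lemma I2_split_s f m : a <= m <= b -> cont_on (rect a b c e) f ->
  I2 f a b c e = I2 f a m c e + I2 f m b c e.
Proof.
  intros Hm H. apply RInt_Chasles_R.
  apply (ex_RInt_sub _ a b); try lra. apply ex_RInt_out, H.
  apply (ex_RInt_sub _ a b); try lra. apply ex_RInt_out, H.
Qed.
Lemma I2_split_t f m : c <= m <= e -> cont_on (rect a b c e) f ->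
  I2 f a b c e = I2 f a b c m + I2 f a b m e.
Proof.
  intros Hm H.
  unfold I2. rewrite <- RInt_plus_R.
  - apply RInt_ext_R; [assumption|]. intros s Hs.
    apply RInt_Chasles_R; apply (ex_RInt_sub _ c e); try lra; apply ex_RInt_in; assumption.
  - apply ex_RInt_ext_R with (fun s => RInt (fun t => cl f s t) c m); [assumption| |].
    + intros s Hs. apply RInt_ext_R; [lra|]. intros t Ht. apply cl_eq. split; lra.
    + apply ex_RInt_cont; [assumption|]. intros. apply (RInt_param_cont_t (cl f)).
      apply clamp_cont; assumption.
  - apply ex_RInt_ext_R with (fun s => RInt (fun t => cl f s t) m e); [assumption| |].
    + intros s Hs. apply RInt_ext_R; [lra|]. intros t Ht. apply cl_eq. split; lra.
    + apply ex_RInt_cont; [assumption|]. intros. apply (RInt_param_cont_t (cl f)).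
      apply clamp_cont; assumption.
Qed.
End OnRect.

Lemma cont_on_sub D D' f : (forall s t, D' s t -> D s t) -> cont_on D f -> cont_on D' f.
Proof. intros H Hf s t Hs. apply Hf, H, Hs. Qed.

Lemma I2_mono_dom f a b c e a' b' c' e' :
  a <= a' -> a' <= b' -> b' <= b -> c <= c' -> c' <= e' -> e' <= e ->
  cont_on (rect a b c e) f -> (forall s t, rect a b c e s t -> 0 <= f s t) ->
  I2 f a' b' c' e' <= I2 f a b c e.
Proof.
  intros.
  assert (G : forall x y z w, a <= x -> x <= y -> y <= b -> c <= z -> z <= w -> w <= e ->
     0 <= I2 f x y z w).
  { intros. apply I2_nonneg; try lra.
    apply (cont_on_sub (rect a b c e)); [|assumption]. intros s t [? ?]; split; lra.
    intros s t [? ?]; apply H6; split; lra. }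
  assert (Hc : forall x y z w, a <= x -> x <= y -> y <= b -> c <= z -> z <= w -> w <= e ->
     cont_on (rect x y z w) f).
  { intros. apply (cont_on_sub (rect a b c e)); [|assumption]. intros s t [? ?]; split; lra. }
  rewrite (I2_split_s a b c e ltac:(lra) ltac:(lra) f a') by (try apply Hc; lra).
  rewrite (I2_split_s a' b c e ltac:(lra) ltac:(lra) f b') by (try apply Hc; lra).
  rewrite (I2_split_t a' b' c e ltac:(lra) ltac:(lra) f c') by (try apply Hc; lra).
  rewrite (I2_split_t a' b' c' e ltac:(lra) ltac:(lra) f e') by (try apply Hc; lra).
  pose proof (G a a' c e). pose proof (G b' b c e). pose proof (G a' b' c c').
  pose proof (G a' b' e' e). lra.
Qed.

Lemma green_rect (F1 F2 F11 F22 : R -> R -> R) a b c e : a <= b -> c <= e ->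
  (forall s t, rect a b c e s t -> is_derive (fun x => F1 x t) s (F11 s t)) ->
  (forall s t, rect a b c e s t -> is_derive (fun y => F2 s y) t (F22 s t)) ->
  cont_on (rect a b c e) F11 -> cont_on (rect a b c e) F22 ->
  I2 (fun s t => F11 s t + F22 s t) a b c e =
  RInt (fun t => F1 b t - F1 a t) c e + RInt (fun s => F2 s e - F2 s c) a b.
Proof.
  intros Hab Hce H1 H2 C1 C2. rewrite I2_plus by assumption. f_equal.
  - rewrite I2_swap by assumption. apply RInt_ext_R; [assumption|]. intros t Ht.
    apply (RInt_FTC (fun x => F1 x t)); [assumption| |].
    intros; apply H1; split; assumption. intros; apply (cont_2d_fst F11), C1; split; assumption.
  - apply RInt_ext_R; [assumption|]. intros s Hs.
    apply (RInt_FTC (fun x => F2 s x)); [assumption| |].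
    intros; apply H2; split; assumption. intros; apply (cont_2d_snd F22), C2; split; assumption.
Qed.

Global Opaque RInt ex_RInt.

(** * Sobolev inequality on thin rectangles *)

(** Compactness turns the limit at each wall point into one threshold valid along a compact piece of
    wall. This is how the Neumann condition is used away from the corners. *)
Lemma uniform_on_segment (P : R -> R -> Prop) c e :
  (forall y, c <= y <= e -> exists dl, 0 < dl /\
     forall h t, 0 < h < dl -> Rabs (t - y) < dl -> P h t) ->
  exists dl, 0 < dl /\ forall h t, 0 < h < dl -> c <= t <= e -> P h t.
Proof.
  intros H.
  assert (H' : forall y, { dl : posreal | c <= y <= e ->
     forall h t, 0 < h < dl -> Rabs (t - y) < dl -> P h t }).
  { intros y. apply constructive_indefinite_description.
    destruct (classic (c <= y <= e)) as [Hy|Hy].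
    - destruct (H y Hy) as [dl [Hdl K]]. exists (mkposreal dl Hdl). intros _. exact K.
    - exists (mkposreal 1 Rlt_0_1). intros; contradiction. }
  destruct (compactness_value_1d c e (fun y => proj1_sig (H' y))) as [d Hd].
  exists d. split; [apply cond_pos|]. intros h t Hh Ht. apply NNPP. intros N.
  apply (Hd t Ht). intros [y [Hy [Hty Hdy]]]. apply N.
  apply (proj2_sig (H' y) Hy); [|exact Hty]. lra.
Qed.

Lemma bounded_on_rect f a b c e : cont_on (rect a b c e) f ->
  exists m, 0 < m /\ forall s t, rect a b c e s t -> Rabs (f s t) <= m.
Proof.
  intros H.
  (* Compactness only supplies a lower bound for the gauge [dl], so the size of f is encoded in the
     gauge: a large value of f forces [dl] to be small. *)
  assert (H' : forall x y, { dl : posreal | rect a b c e x y -> dl * (1 + Rabs (f x y)) <= 1 /\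
     forall s t, Rabs (s - x) < dl -> Rabs (t - y) < dl -> Rabs (f s t - f x y) < 1 }).
  { intros x y. apply constructive_indefinite_description.
    destruct (classic (rect a b c e x y)) as [Hy|Hy].
    - destruct (H x y Hy (mkposreal 1 Rlt_0_1)) as [dl K].
      pose proof (Rabs_pos (f x y)).
      assert (Hp : 0 < Rmin dl (/ (1 + Rabs (f x y)))).
      { apply Rmin_pos. apply cond_pos. apply Rinv_0_lt_compat. lra. }
      exists (mkposreal _ Hp). simpl. intros _. split.
      + apply Rle_trans with (/ (1 + Rabs (f x y)) * (1 + Rabs (f x y))).
        apply Rmult_le_compat_r. lra. apply Rmin_r. right; field; lra.
      + intros s t Hs Ht. apply K; (eapply Rlt_le_trans; [eassumption|apply Rmin_l]).
    - exists (mkposreal 1 Rlt_0_1). intros; contradiction. }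
  destruct (compactness_value_2d a b c e (fun x y => proj1_sig (H' x y))) as [d Hd].
  exists (1 + / d). split. pose proof (Rinv_0_lt_compat d (cond_pos d)). lra.
  intros s t [Hs Ht]. apply NNPP. intros N.
  apply (Hd s t Hs Ht). intros [x [y [Hx [Hy [Hsx [Hty Hdy]]]]]]. apply N.
  destruct (proj2_sig (H' x y) (conj Hx Hy)) as [K1 K2].
  specialize (K2 s t Hsx Hty). pose proof (cond_pos d) as Hdp.
  pose proof (Rabs_pos (f x y)).
  assert (Rabs (f x y) <= / d).
  { apply (Rmult_le_reg_l d); [assumption|]. rewrite Rinv_r by lra. nra. }
  pose proof (Rabs_triang_inv (f s t) (f x y)). lra.
Qed.

(** Cauchy-Schwarz against the constant 1, obtained by expanding the nonnegative integral of (f -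
    m)^2 with m the mean of f. *)
Lemma RInt_sqr_le (f : R -> R) a b : a <= b -> ex_RInt f a b -> ex_RInt (fun x => f x ^ 2) a b ->
  RInt f a b ^ 2 <= (b - a) * RInt (fun x => f x ^ 2) a b.
Proof.
  intros Hab H1 H2. destruct (Req_dec a b) as [E|E].
  - subst b. assert (E : forall g : R -> R, RInt g a a = 0) by (intros; apply (RInt_point (V := R_CompleteNormedModule))).
    rewrite !E. lra.
  - assert (Em : forall F : R, exists m, F = m * (b - a)).
    { intros F. exists (F / (b - a)). field; lra. }
    destruct (Em (RInt f a b)) as [m H0].
    assert (X : ex_RInt (fun x => 2 * m * f x) a b) by (apply ex_RInt_scal_R; exact H1).
    assert (X' : ex_RInt (fun x => f x ^ 2 - 2 * m * f x) a b) by (apply ex_RInt_minus_R; [exact H2|exact X]).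
    assert (H : 0 <= RInt (fun x => (f x ^ 2 - 2 * m * f x) + m ^ 2) a b).
    { apply RInt_ge_0; [exact Hab| |].
      apply ex_RInt_plus_R; [exact X'|apply ex_RInt_const_R].
      intros. pose proof (pow2_ge_0 (f x - m)). lra. }
    rewrite (RInt_plus_R (fun x => f x ^ 2 - 2 * m * f x) (fun _ => m ^ 2) a b X' (ex_RInt_const_R _ _ _)) in H.
    rewrite (RInt_minus_R (fun x => f x ^ 2) (fun x => 2 * m * f x) a b H2 X) in H.
    rewrite (RInt_scal_R f (2 * m) a b H1), RInt_const_R in H.
    set (S := RInt (fun x => f x ^ 2) a b) in *. set (F := RInt f a b) in *.
    clearbody S F. subst F.
    assert (H0 : m ^ 2 * (b - a) <= S) by lra. clear - H0 Hab.
    replace ((m * (b - a)) ^ 2) with ((b - a) * (m ^ 2 * (b - a))) by ring.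
    apply Rmult_le_compat_l; lra.
Qed.

Lemma I2_sqr_le f a b c e : a <= b -> c <= e -> cont_on (rect a b c e) f ->
  I2 f a b c e ^ 2 <= (b - a) * (e - c) * I2 (fun s t => f s t ^ 2) a b c e.
Proof.
  intros Hab Hce H.
  assert (H2 : cont_on (rect a b c e) (fun s t => f s t ^ 2)) by (intros s t K; c2d).
  destruct (Req_dec ((b - a) * (e - c)) 0) as [E|E].
  - rewrite E. replace (I2 f a b c e) with 0. lra.
    destruct (Rmult_integral _ _ E) as [E'|E'].
    + replace b with a by lra. symmetry. apply (RInt_point (V := R_CompleteNormedModule)).
    + replace e with c by lra. symmetry. unfold I2.
      rewrite (RInt_ext_R _ (fun _ => 0)); [rewrite RInt_const_R; ring|assumption|].
      intros; apply (RInt_point (V := R_CompleteNormedModule)).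
  - set (A := (b - a) * (e - c)) in *. assert (0 < A) by (unfold A in *; nra).
    assert (Em : forall F : R, exists m, F = m * A).
    { intros F. exists (F / A). field; lra. }
    destruct (Em (I2 f a b c e)) as [m H3].
    assert (0 <= I2 (fun s t => f s t ^ 2 - 2 * m * f s t + m ^ 2) a b c e).
    { apply I2_nonneg; [assumption ..| |]. intros s t K; c2d.
      intros. pose proof (pow2_ge_0 (f s t - m)). lra. }
    rewrite I2_plus, I2_minus, I2_scal, I2_const in H1 by (try assumption; intros s t K; c2d).
    fold A in H1.
    set (S := I2 (fun s t => f s t ^ 2) a b c e) in *. set (F := I2 f a b c e) in *.
    clearbody S F A. subst F.
    assert (m ^ 2 * A <= S) by lra. clear H1 H2.
    replace ((m * A) ^ 2) with (A * (m ^ 2 * A)) by ring.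
    apply Rmult_le_compat_l; lra.
Qed.

Lemma RInt_nonneg (f : R -> R) a b : a <= b -> ex_RInt f a b ->
  (forall x, a <= x <= b -> 0 <= f x) -> 0 <= RInt f a b.
Proof. intros; apply RInt_ge_0; try assumption. intros; apply H1; lra. Qed.
Lemma RInt_le_R (f g : R -> R) a b : a <= b -> ex_RInt f a b -> ex_RInt g a b ->
  (forall x, a <= x <= b -> f x <= g x) -> RInt f a b <= RInt g a b.
Proof. intros; apply RInt_le; try assumption. intros; apply H2; lra. Qed.
Lemma RInt_mono_dom (f : R -> R) a b a' b' : a <= a' -> a' <= b' -> b' <= b -> ex_RInt f a b ->
  (forall x, a <= x <= b -> 0 <= f x) -> RInt f a' b' <= RInt f a b.
Proof.
  intros. rewrite (RInt_Chasles_R f a a' b), (RInt_Chasles_R f a' b' b);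
    try (apply (ex_RInt_sub f a b); lra || assumption).
  assert (0 <= RInt f a a') by (apply RInt_nonneg; [lra|apply (ex_RInt_sub f a b); lra || assumption|intros; apply H3; lra]).
  assert (0 <= RInt f b' b) by (apply RInt_nonneg; [lra|apply (ex_RInt_sub f a b); lra || assumption|intros; apply H3; lra]).
  lra.
Qed.

Lemma cont_pow2 (f : R -> R) x : continuous f x -> continuous (fun y => f y ^ 2) x.
Proof.
  intros. apply continuous_ext with (fun y => f y * f y). intros; simpl; ring.
  apply (continuous_mult (K := R_AbsRing)); assumption.
Qed.

Lemma increment_sqr (g g' : R -> R) c e x y : c <= e ->
  (forall t, c <= t <= e -> is_derive g t (g' t)) ->
  (forall t, c <= t <= e -> continuous g' t) ->
  c <= x <= e -> c <= y <= e ->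
  (g x - g y) ^ 2 <= (e - c) * RInt (fun t => g' t ^ 2) c e.
Proof.
  intros Hce HD HC.
  assert (G : forall x y, c <= x <= y -> y <= e -> (g x - g y) ^ 2 <= (e - c) * RInt (fun t => g' t ^ 2) c e).
  { clear x y. intros x y Hx Hy.
    assert (E : RInt g' x y = g y - g x).
    { apply RInt_FTC; intros; try apply HD; try apply HC; lra. }
    replace ((g x - g y) ^ 2) with (RInt g' x y ^ 2) by (rewrite E; ring).
    assert (X2 : ex_RInt (fun t => g' t ^ 2) c e).
    { apply ex_RInt_cont; [assumption|]. intros; apply cont_pow2, HC; lra. }
    eapply Rle_trans. apply RInt_sqr_le. lra.
    apply ex_RInt_cont; [lra|]. intros; apply HC; lra.
    apply (ex_RInt_sub _ c e); lra || assumption.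
    apply Rmult_le_compat; try lra.
    apply RInt_nonneg; [lra|apply (ex_RInt_sub _ c e); lra || assumption|intros; nra].
    apply RInt_mono_dom; try lra. assumption. intros; nra. }
  intros Hx Hy. destruct (Rle_dec x y).
  - apply G; lra.
  - replace ((g x - g y) ^ 2) with ((g y - g x) ^ 2) by ring. apply G; lra.
Qed.

(** Integrate g(x)^2 <= 2 g(t)^2 + 2 (g(x) - g(t))^2 over t and bound the increment by
    [increment_sqr]. *)
Lemma sobolev_1d (g g' : R -> R) c e x : c < e ->
  (forall t, c <= t <= e -> is_derive g t (g' t)) ->
  (forall t, c <= t <= e -> continuous g' t) -> c <= x <= e ->
  g x ^ 2 <= 2 / (e - c) * RInt (fun t => g t ^ 2) c e + 2 * (e - c) * RInt (fun t => g' t ^ 2) c e.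
Proof.
  intros Hce HD HC Hx.
  assert (X : ex_RInt (fun t => g t ^ 2) c e).
  { apply ex_RInt_cont; [lra|]. intros; apply cont_pow2.
    apply (ex_derive_continuous (K := R_AbsRing) (V := R_NormedModule)). eexists; apply HD; assumption. }
  set (K := RInt (fun t => g' t ^ 2) c e : R).
  assert (RInt (fun _ => g x ^ 2) c e <= RInt (fun t => 2 * g t ^ 2 + 2 * ((e - c) * K)) c e).
  { apply RInt_le_R; [lra|apply ex_RInt_const_R| |].
    apply ex_RInt_plus_R; [apply ex_RInt_scal_R; assumption|apply ex_RInt_const_R].
    intros t Ht. pose proof (increment_sqr g g' c e x t ltac:(lra) HD HC Hx Ht) as H. fold K in H.
    pose proof (pow2_ge_0 (g x - 2 * g t)). lra. }
  rewrite RInt_const_R in H.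
  rewrite (RInt_plus_R (fun t => 2 * g t ^ 2) (fun _ => 2 * ((e - c) * K)) c e
    (ex_RInt_scal_R _ _ _ _ X) (ex_RInt_const_R _ _ _)) in H.
  rewrite (RInt_scal_R (fun t => g t ^ 2)) in H by assumption. rewrite RInt_const_R in H.
  apply (Rmult_le_reg_l (e - c)); [lra|].
  replace ((e - c) * (2 / (e - c) * RInt (fun t => g t ^ 2) c e + 2 * (e - c) * K)) with
    (2 * RInt (fun t => g t ^ 2) c e + (e - c) * (2 * ((e - c) * K))) by (field; lra).
  lra.
Qed.

(** The one-dimensional inequality is used in s on a horizontal line, then in t on every vertical
    line for f and for f1; the only second derivative that occurs is the mixed one. The width
    appears as 1 / (b - a) in front of f and f2: integrals of size k^2 eps over a rectangle of width
    eps yield a pointwise bound of size k^2. *)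
Lemma sobolev_rect (f f1 f2 f12 : R -> R -> R) a b c e : a < b -> c < e ->
  cont_on (rect a b c e) f -> cont_on (rect a b c e) f1 ->
  cont_on (rect a b c e) f2 -> cont_on (rect a b c e) f12 ->
  (forall s t, rect a b c e s t -> is_derive (fun x => f x t) s (f1 s t)) ->
  (forall s t, rect a b c e s t -> is_derive (fun y => f s y) t (f2 s t)) ->
  (forall s t, rect a b c e s t -> is_derive (fun y => f1 s y) t (f12 s t)) ->
  forall s t, rect a b c e s t ->
  f s t ^ 2 <=
   2 / (b - a) * (2 / (e - c) * I2 (fun s t => f s t ^ 2) a b c e + 2 * (e - c) * I2 (fun s t => f2 s t ^ 2) a b c e)
   + 2 * (b - a) * (2 / (e - c) * I2 (fun s t => f1 s t ^ 2) a b c e + 2 * (e - c) * I2 (fun s t => f12 s t ^ 2) a b c e).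
Proof.
  intros Hab Hce C0 C1 C2 C12 D1 D2 D12 s0 t0 [Hs Ht].
  assert (S : forall g h, cont_on (rect a b c e) g -> cont_on (rect a b c e) h ->
    (forall s t, rect a b c e s t -> is_derive (fun y => g s y) t (h s t)) ->
    RInt (fun s => g s t0 ^ 2) a b <= 2 / (e - c) * I2 (fun s t => g s t ^ 2) a b c e + 2 * (e - c) * I2 (fun s t => h s t ^ 2) a b c e).
  { intros g h Cg Ch Dg.
    assert (Cg2 : cont_on (rect a b c e) (fun s t => g s t ^ 2)) by (intros s t K; c2d).
    assert (Ch2 : cont_on (rect a b c e) (fun s t => h s t ^ 2)) by (intros s t K; c2d).
    unfold I2. rewrite <- !RInt_scal_R by (apply ex_RInt_out; lra || assumption).
    rewrite <- RInt_plus_R by (apply ex_RInt_scal_R; apply ex_RInt_out; lra || assumption).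
    apply RInt_le_R; [lra| | |].
    - apply (ex_RInt_in' a b c e ltac:(lra) (fun s t => g s t ^ 2)); assumption.
    - apply ex_RInt_plus_R; apply ex_RInt_scal_R; apply ex_RInt_out; lra || assumption.
    - intros s Hs'. apply (sobolev_1d (fun t => g s t) (fun t => h s t)); try assumption.
      intros; apply Dg; split; assumption.
      intros; apply (cont_2d_snd h), Ch; split; assumption. }
  eapply Rle_trans.
  - apply (sobolev_1d (fun s => f s t0) (fun s => f1 s t0) a b); try assumption.
    intros; apply D1; split; assumption.
    intros; apply (cont_2d_fst f1), C1; split; assumption.
  - apply Rplus_le_compat.
    + apply Rmult_le_compat_l. left; apply Rdiv_lt_0_compat; lra. apply S; assumption.
    + apply Rmult_le_compat_l. lra. apply S; assumption.
Qed.

(** * Difference quotients *)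

Lemma is_der_eq (f : R -> R) (x l l' : R) : is_derive f x l -> l = l' -> is_derive f x l'.
Proof. intros H <-; exact H. Qed.
Lemma is_der_plus (f g : R -> R) (x a b : R) : is_derive f x a -> is_derive g x b ->
  is_derive (fun y => f y + g y) x (a + b).
Proof. intros. apply (is_derive_plus (K := R_AbsRing) (V := R_NormedModule)); assumption. Qed.
Lemma is_der_minus (f g : R -> R) (x a b : R) : is_derive f x a -> is_derive g x b ->
  is_derive (fun y => f y - g y) x (a - b).
Proof. intros. apply (is_derive_minus (K := R_AbsRing) (V := R_NormedModule)); assumption. Qed.
Lemma is_der_opp (f : R -> R) (x a : R) : is_derive f x a -> is_derive (fun y => - f y) x (- a).
Proof. intros. apply (is_derive_opp (K := R_AbsRing) (V := R_NormedModule)); assumption. Qed.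
Lemma is_der_mult (f g : R -> R) (x a b : R) : is_derive f x a -> is_derive g x b ->
  is_derive (fun y => f y * g y) x (a * g x + f x * b).
Proof. intros. apply (is_derive_mult (K := R_AbsRing) f g); try assumption. intros; apply Rmult_comm. Qed.
Lemma is_der_const (c x : R) : is_derive (fun _ => c) x 0.
Proof. apply (is_derive_const (K := R_AbsRing) (V := R_NormedModule)). Qed.
Lemma is_der_id (x : R) : is_derive (fun y => y) x 1.
Proof. apply (is_derive_id (K := R_AbsRing)). Qed.
Lemma is_der_pow2 (f : R -> R) (x a : R) : is_derive f x a -> is_derive (fun y => f y ^ 2) x (2 * f x * a).
Proof.
  intros. apply is_der_eq with (a * f x + f x * a); [|ring].
  apply (is_derive_ext (fun y => f y * f y)); [|apply is_der_mult; assumption].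
  intros t. change (f t * f t = f t ^ 2). ring.
Qed.
Lemma is_der_cos (f : R -> R) (x a : R) : is_derive f x a -> is_derive (fun y => cos (f y)) x (- sin (f x) * a).
Proof.
  intros H. apply is_der_eq with (a * - sin (f x)); [|ring].
  apply (is_derive_comp cos f x (- sin (f x)) a); [apply is_derive_cos|exact H].
Qed.
Lemma is_der_sin (f : R -> R) (x a : R) : is_derive f x a -> is_derive (fun y => sin (f y)) x (cos (f x) * a).
Proof.
  intros H. apply is_der_eq with (a * cos (f x)); [|ring].
  apply (is_derive_comp sin f x (cos (f x)) a); [apply is_derive_sin|exact H].
Qed.
Lemma is_der_shift (f : R -> R) h (x a : R) : is_derive f (x + h) a -> is_derive (fun y => f (y + h)) x a.
Proof.
  intros H. apply is_der_eq with (1 * a); [|ring].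
  apply (is_derive_comp f (fun y => y + h)); [exact H|].
  apply is_der_eq with (1 + 0); [|ring]. apply is_der_plus. apply is_der_id. apply is_der_const.
Qed.

Ltac der_core := repeat match goal with
  | |- is_derive (fun _ => ?c) _ _ => apply is_der_const
  | |- is_derive (fun y => y) _ _ => apply is_der_id
  | |- is_derive (fun y => @?f y + @?g y) ?x _ => apply (is_der_plus f g x)
  | |- is_derive (fun y => @?f y - @?g y) ?x _ => apply (is_der_minus f g x)
  | |- is_derive (fun y => @?f y * @?g y) ?x _ => apply (is_der_mult f g x)
  | |- is_derive (fun y => @?f y / ?c) ?x _ => apply (is_der_mult f (fun _ => / c) x)
  | |- is_derive (fun y => - @?f y) ?x _ => apply (is_der_opp f x)
  | |- is_derive (fun y => @?f y ^ 2) ?x _ => apply (is_der_pow2 f x)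
  | |- is_derive (fun y => cos (@?f y)) ?x _ => apply (is_der_cos f x)
  | |- is_derive (fun y => sin (@?f y)) ?x _ => apply (is_der_sin f x)
  end.
Ltac der := eapply is_der_eq; [der_core; eauto | ].

Lemma cont_2d_shift f h s t : continuity_2d_pt f s (t + h) ->
  continuity_2d_pt (fun x y => f x (y + h)) s t.
Proof.
  intros H e. destruct (H e) as [dl Hd]. exists dl. intros u v Hu Hv. apply Hd. exact Hu.
  replace (v + h - (t + h)) with (v - t) by ring. exact Hv.
Qed.
Lemma RInt_shift (q : R -> R) a b x : ex_RInt q (a + x) (b + x) ->
  RInt (fun t => q (t + x)) a b = RInt q (a + x) (b + x).
Proof.
  intros H. pose proof (RInt_comp_lin (V := R_CompleteNormedModule) q 1 x a b) as E.
  rewrite !Rmult_1_l in E. rewrite <- (E H). apply RInt_ext. intros y _.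
  change (q (y + x) = 1 * q (1 * y + x)). rewrite !Rmult_1_l. reflexivity.
Qed.

Definition dquot (h : R) (f : R -> R -> R) (s t : R) : R := (f s (t + h) - f s t) * / h.

(** The quotient is the mean of g' over [t, t + h]. Cauchy-Schwarz on this interval, then Fubini in
    t and in the shift, give the bound with constant 1. *)
Lemma diff_quot_L2_1d (g g' : R -> R) c e h : c <= e -> 0 < h ->
  (forall t, c <= t <= e + h -> is_derive g t (g' t)) ->
  (forall t, c <= t <= e + h -> continuous g' t) ->
  RInt (fun t => ((g (t + h) - g t) * / h) ^ 2) c e <= RInt (fun t => g' t ^ 2) c (e + h).
Proof.
  intros Hce Hh HD HC.
  (* g'^2 is frozen outside [c, e + h], so that shifts and the exchange of integrals take place
     among functions continuous on the whole line. *)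
  set (q := fun t => g' (clamp c (e + h) t) ^ 2).
  assert (Cq : forall t, continuous q t).
  { intros t. apply cont_pow2.
    assert (K : forall s t, continuity_2d_pt (fun _ y => g' (clamp c (e + h) y)) s t).
    { intros s1 t1. apply (clamp_cont (fun _ y => g' y) 0 1 c (e + h)); try lra.
      intros s2 t2 [_ H2]. apply (cont_2d_of_snd g'), HC, H2. }
    apply (cont_2d_snd (fun _ y => g' (clamp c (e + h) y)) 0 t), K. }
  assert (Eq : forall t, c <= t <= e + h -> q t = g' t ^ 2).
  { intros t Ht. unfold q. rewrite clamp_id by lra. reflexivity. }
  assert (Xq : forall a b, ex_RInt q a b).
  { intros a b. apply (ex_RInt_continuous (V := R_CompleteNormedModule)). intros; apply Cq. }
  rewrite (RInt_ext_R (fun t => g' t ^ 2) q) by (try lra; intros; symmetry; apply Eq; assumption).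
  assert (C2 : forall s t, continuity_2d_pt (fun t x => q (t + x)) s t).
  { intros s t. apply (continuity_1d_2d_pt_comp q (fun t x => t + x)).
    apply continuity_pt_filterlim, Cq. c2d. }
  apply Rle_trans with (RInt (fun t => / h * RInt (fun x => q (t + x)) 0 h) c e).
  - apply RInt_le_R; [assumption| | |].
    + apply ex_RInt_cont; [assumption|]. intros t Ht. apply cont_pow2.
      apply (ex_derive_continuous (K := R_AbsRing) (V := R_NormedModule)).
      eexists. der. apply is_der_shift, HD; lra. apply HD; lra. reflexivity.
    + apply ex_RInt_scal_R. apply ex_RInt_cont; [assumption|]. intros t Ht.
      apply (RInt_param_cont_t (fun t x => q (t + x))), C2.
    + intros t Ht.
      replace (RInt (fun x => q (t + x)) 0 h) with (RInt q t (t + h)).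
      2:{ rewrite (RInt_ext (fun x => q (t + x)) (fun x => q (x + t))) by (intros; f_equal; ring).
          rewrite RInt_shift by apply Xq. f_equal; ring. }
      rewrite (RInt_ext_R q (fun t => g' t ^ 2)) by (try lra; intros; apply Eq; lra).
      assert (E : RInt g' t (t + h) = g (t + h) - g t).
      { apply RInt_FTC; intros; try lra. apply HD; lra. apply HC; lra. }
      rewrite <- E.
      assert (RInt g' t (t + h) ^ 2 <= (t + h - t) * RInt (fun t => g' t ^ 2) t (t + h)).
      { apply RInt_sqr_le; [lra| |]; apply ex_RInt_cont; try lra; intros.
        apply HC; lra. apply cont_pow2, HC; lra. }
      replace ((RInt g' t (t + h) * / h) ^ 2) with (/ h * (/ h * RInt g' t (t + h) ^ 2)) by ring.
      apply Rmult_le_compat_l. left; apply Rinv_0_lt_compat, Hh.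
      apply (Rmult_le_reg_l h); [assumption|]. rewrite <- Rmult_assoc, Rinv_r by lra. lra.
  - rewrite RInt_scal_R.
    2:{ apply ex_RInt_cont; [assumption|]. intros t Ht.
      apply (RInt_param_cont_t (fun t x => q (t + x))), C2. }
    apply (Rmult_le_reg_l h); [assumption|]. rewrite <- Rmult_assoc, Rinv_r, Rmult_1_l by lra.
    rewrite (fubini_global (fun t x => q (t + x)) C2) by assumption.
    rewrite <- (Rmult_comm (RInt q c (e + h))).
    assert (Ek : forall r : R, r * h = RInt (fun _ => r) 0 h) by (intros; rewrite RInt_const_R; ring).
    rewrite Ek.
    apply RInt_le_R; [lra| |apply ex_RInt_const_R|].
    + apply ex_RInt_cont; [lra|]. intros t Ht. apply (RInt_param_cont (fun t x => q (t + x))), C2.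
    + intros x Hx. rewrite RInt_shift by apply Xq.
      apply RInt_mono_dom; try lra. apply Xq. intros; apply pow2_ge_0.
Qed.

Lemma dquot_cont h f s t : continuity_2d_pt f s t -> continuity_2d_pt f s (t + h) ->
  continuity_2d_pt (dquot h f) s t.
Proof. intros. unfold dquot. c2d. apply cont_2d_shift; assumption. Qed.

Lemma dquot_L2 (f f2 : R -> R -> R) a b c e h : a <= b -> c <= e -> 0 < h ->
  cont_on (rect a b c (e + h)) f -> cont_on (rect a b c (e + h)) f2 ->
  (forall s t, rect a b c (e + h) s t -> is_derive (fun y => f s y) t (f2 s t)) ->
  I2 (fun s t => dquot h f s t ^ 2) a b c e <= I2 (fun s t => f2 s t ^ 2) a b c (e + h).
Proof.
  intros Hab Hce Hh C0 C2 D2.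
  apply RInt_le_R; [assumption| | |].
  - apply (ex_RInt_out a b c e Hab Hce (fun s t => dquot h f s t ^ 2)). intros s t [? ?].
    apply cont_2d_pow2, dquot_cont; apply C0; split; lra.
  - apply (ex_RInt_out a b c (e + h) Hab ltac:(lra) (fun s t => f2 s t ^ 2)). intros s t K. c2d.
  - intros s Hs. apply (diff_quot_L2_1d (fun t => f s t) (fun t => f2 s t)); try assumption.
    intros; apply D2; split; assumption.
    intros; apply (cont_2d_snd f2), C2; split; assumption.
Qed.

(** The quotient is the mean of f2 over a short vertical segment, and f2 is uniformly continuous on
    the taller rectangle. The extra height L lets the quotient be formed at the top edge t = e. *)
Lemma dquot_unif (f f2 : R -> R -> R) a b c e L g : a <= b -> c <= e -> 0 < L -> 0 < g ->
  cont_on (rect a b c (e + L)) f2 ->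
  (forall s t, rect a b c (e + L) s t -> is_derive (fun y => f s y) t (f2 s t)) ->
  exists h0, 0 < h0 /\ forall h s t, 0 < h < h0 -> rect a b c e s t -> Rabs (f2 s t - dquot h f s t) <= g.
Proof.
  intros Hab Hce HL Hg C2 D2.
  destruct (uniform_continuity_2d f2 a b c (e + L)) with (eps := mkposreal g Hg) as [dl Hd].
  intros; apply C2; split; assumption.
  exists (Rmin dl L). split. apply Rmin_pos; [apply cond_pos|assumption].
  intros h s t Hh [Hs Ht].
  assert (h < dl) by (eapply Rlt_le_trans; [apply Hh|apply Rmin_l]).
  assert (h < L) by (eapply Rlt_le_trans; [apply Hh|apply Rmin_r]).
  assert (X : forall x y, c <= x -> x <= y -> y <= e + L -> ex_RInt (fun y => f2 s y) x y).
  { intros; apply ex_RInt_cont; [assumption|]. intros; apply (cont_2d_snd f2), C2; split; lra. }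
  assert (E : RInt (fun y => f2 s y) t (t + h) = f s (t + h) - f s t).
  { apply (RInt_FTC (fun y => f s y)); intros; try lra. apply D2; split; lra.
    apply (cont_2d_snd f2), C2; split; lra. }
  unfold dquot. rewrite <- E.
  replace (f2 s t - RInt (fun y => f2 s y) t (t + h) * / h) with
     (- (/ h * RInt (fun y => f2 s y - f2 s t) t (t + h))).
  2:{ rewrite (RInt_minus_R (fun y => f2 s y) (fun _ => f2 s t) t (t + h) (X t (t + h) ltac:(lra) ltac:(lra) ltac:(lra)) (ex_RInt_const_R _ _ _)).
      rewrite RInt_const_R. generalize (RInt (fun y => f2 s y) t (t + h) : R). intros I. field; lra. }
  rewrite Rabs_Ropp, Rabs_mult, (Rabs_pos_eq (/ h)) by (left; apply Rinv_0_lt_compat; lra).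
  apply (Rmult_le_reg_l h); [lra|]. rewrite <- Rmult_assoc, Rinv_r, Rmult_1_l by lra.
  replace (h * g) with ((t + h - t) * g) by ring.
  apply abs_RInt_le_const; [lra| |].
  apply ex_RInt_minus_R. apply X; lra. apply ex_RInt_const_R.
  intros y Hy. left. apply (Hd s t s y); try lra.
  rewrite Rminus_diag, Rabs_R0; apply cond_pos.
  rewrite Rabs_pos_eq; lra.
Qed.

(** A solution in the open rectangle (0, eps) x (al, be) bundled with its derivatives, [z12] being
    the t-derivative of [z1]. The Neumann condition on the vertical sides is a limit, uniform on
    compact pieces. The heights are parameters because a quotient of step h lives on (al, be -
    h). *)
Record neumann_strip (k eps al be : R) (z z1 z2 z11 z22 z12 : R -> R -> R) : Prop := {
  ns_d1 : forall s t, 0 < s < eps -> al < t < be -> is_derive (fun x => z x t) s (z1 s t);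
  ns_d2 : forall s t, 0 < s < eps -> al < t < be -> is_derive (fun y => z s y) t (z2 s t);
  ns_d11 : forall s t, 0 < s < eps -> al < t < be -> is_derive (fun x => z1 x t) s (z11 s t);
  ns_d22 : forall s t, 0 < s < eps -> al < t < be -> is_derive (fun y => z2 s y) t (z22 s t);
  ns_d12 : forall s t, 0 < s < eps -> al < t < be -> is_derive (fun y => z1 s y) t (z12 s t);
  ns_c0 : cont_on (fun s t => 0 < s < eps /\ al < t < be) z;
  ns_c1 : cont_on (fun s t => 0 < s < eps /\ al < t < be) z1;
  ns_c2 : cont_on (fun s t => 0 < s < eps /\ al < t < be) z2;
  ns_c11 : cont_on (fun s t => 0 < s < eps /\ al < t < be) z11;
  ns_c22 : cont_on (fun s t => 0 < s < eps /\ al < t < be) z22;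
  ns_c12 : cont_on (fun s t => 0 < s < eps /\ al < t < be) z12;
  ns_eq : forall s t, 0 < s < eps -> al < t < be -> z11 s t + z22 s t + k ^ 2 * z s t = 0;
  ns_wall : forall c e g, al < c -> e < be -> 0 < g -> exists h0, 0 < h0 /\
     forall h t, 0 < h < h0 -> c <= t <= e -> Rabs (z1 h t) <= g /\ Rabs (z1 (eps - h) t) <= g
}.

(** A vertical translation preserves the equation and both walls, so the quotient solves the same
    problem in a shorter strip. A horizontal quotient would leave the slit. *)
Lemma ns_dquot k eps al be z z1 z2 z11 z22 z12 h : 0 < h ->
  neumann_strip k eps al be z z1 z2 z11 z22 z12 ->
  neumann_strip k eps al (be - h) (dquot h z) (dquot h z1) (dquot h z2) (dquot h z11) (dquot h z22) (dquot h z12).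
Proof.
  intros Hh [A1 A2 A3 A4 A5 B1 B2 B3 B4 B5 B6 C D]. unfold dquot. split; intros.
  - der. all: try (apply A1; lra). simpl; ring.
  - der. apply is_der_shift. all: try (apply A2; lra). simpl; ring.
  - der. all: try (apply A3; lra). simpl; ring.
  - der. apply is_der_shift. all: try (apply A4; lra). simpl; ring.
  - der. apply is_der_shift. all: try (apply A5; lra). simpl; ring.
  - intros s t [? ?]; apply dquot_cont; apply B1; split; lra.
  - intros s t [? ?]; apply dquot_cont; apply B2; split; lra.
  - intros s t [? ?]; apply dquot_cont; apply B3; split; lra.
  - intros s t [? ?]; apply dquot_cont; apply B4; split; lra.
  - intros s t [? ?]; apply dquot_cont; apply B5; split; lra.
  - intros s t [? ?]; apply dquot_cont; apply B6; split; lra.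
  - pose proof (C s t ltac:(lra) ltac:(lra)). pose proof (C s (t + h) ltac:(lra) ltac:(lra)).
    replace (_ + _) with ((z11 s (t + h) + z22 s (t + h) + k ^ 2 * z s (t + h) - (z11 s t + z22 s t + k ^ 2 * z s t)) * / h) by ring.
    rewrite H1, H2. ring.
  - destruct (D c (e + h) (g * h / 2)) as [h0 [P Q]]; try lra.
    { apply Rdiv_lt_0_compat; [apply Rmult_lt_0_compat|]; lra. }
    exists h0. split; [assumption|]. intros x t Hx Ht.
    destruct (Q x t Hx ltac:(lra)) as [Q1 Q2]. destruct (Q x (t + h) Hx ltac:(lra)) as [Q3 Q4].
    rewrite !Rabs_mult, (Rabs_pos_eq (/ h)) by (left; apply Rinv_0_lt_compat; lra).
    split; apply (Rmult_le_reg_r h); try lra; rewrite Rmult_assoc, Rinv_l, Rmult_1_r by lra;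
      apply Rabs_le_between; apply Rabs_le_between in Q1, Q2, Q3, Q4; lra.
Qed.

(** * Interior estimates in a strip with Neumann walls *)

Lemma le_of_forall_pos (x y : R) (C : R) : 0 <= C -> (forall g, 0 < g -> x <= y + C * g) -> x <= y.
Proof.
  intros HC H. destruct (Rle_dec x y) as [|N]; [assumption|exfalso].
  assert (P : 0 < (x - y) / (2 * (C + 1))) by (apply Rdiv_lt_0_compat; lra).
  specialize (H _ P).
  assert (E : C * ((x - y) / (2 * (C + 1))) = (x - y) / 2 * (C / (C + 1))) by (field; lra).
  rewrite E in H.
  assert (C / (C + 1) <= 1). { apply (Rmult_le_reg_r (C + 1)); [lra|]. field_simplify; lra. }
  nra.
Qed.

Lemma RInt_zero (f : R -> R) a b : a <= b -> (forall x, a <= x <= b -> f x = 0) -> RInt f a b = 0.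
Proof.
  intros H E. rewrite (RInt_ext_R f (fun _ => 0)) by assumption.
  rewrite RInt_const_R. apply Rmult_0_r.
Qed.

Section Strip.
Variables k eps al be : R.
Variables z z1 z2 z11 z22 z12 : R -> R -> R.
Hypothesis NS : neumann_strip k eps al be z z1 z2 z11 z22 z12.
Hypothesis Heps : 0 < eps.

Lemma ns_rect r c e s t : 0 < r -> al < c -> e < be ->
  rect r (eps - r) c e s t -> 0 < s < eps /\ al < t < be.
Proof. intros ? ? ? [? ?]. lra. Qed.

Lemma ns_cont_rect f r c e : cont_on (fun s t => 0 < s < eps /\ al < t < be) f ->
  0 < r -> al < c -> e < be -> cont_on (rect r (eps - r) c e) f.
Proof.
  intros H ? ? ?. apply (cont_on_sub _ _ _ (fun s t => ns_rect r c e s t H0 H1 H2) H).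
Qed.

(** Nothing is assumed about z itself at the walls. Near them |z1| <= 1, so z differs from its
    values on an inner compact rectangle by at most the distance travelled. Boundedness is what
    makes the wall flux z z1 tend to 0 in [caccioppoli]. *)
Lemma ns_bounded c e : al < c -> e < be ->
  exists m, 0 < m /\ forall s t, 0 < s < eps -> c <= t <= e -> Rabs (z s t) <= m.
Proof.
  intros Hc He.
  destruct (ns_wall _ _ _ _ _ _ _ _ _ _ NS c e 1 Hc He Rlt_0_1) as [h0 [Hh0 W]].
  set (q := Rmin (h0 / 2) (eps / 4)).
  assert (Hq : 0 < q) by (apply Rmin_pos; lra).
  assert (Hq1 : q <= h0 / 2) by apply Rmin_l. assert (Hq2 : q <= eps / 4) by apply Rmin_r.
  destruct (bounded_on_rect z q (eps - q) c e) as [m [Hm B]].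
  { apply ns_cont_rect; try assumption. apply (ns_c0 _ _ _ _ _ _ _ _ _ _ NS). }
  assert (I : forall x y t, 0 < x -> x <= y -> y < eps -> c <= t <= e ->
    (forall u, x <= u <= y -> Rabs (z1 u t) <= 1) -> Rabs (z y t - z x t) <= y - x).
  { intros x y t Hx Hxy Hy Ht Hu.
    assert (E : RInt (fun u => z1 u t) x y = z y t - z x t).
    { apply (RInt_FTC (fun u => z u t)); [assumption| |]; intros.
      apply (ns_d1 _ _ _ _ _ _ _ _ _ _ NS); lra.
      apply (cont_2d_fst z1), (ns_c1 _ _ _ _ _ _ _ _ _ _ NS); lra. }
    rewrite <- E. replace (y - x) with ((y - x) * 1) by ring.
    apply abs_RInt_le_const; [assumption| |assumption].
    apply ex_RInt_cont; [assumption|]. intros.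
    apply (cont_2d_fst z1), (ns_c1 _ _ _ _ _ _ _ _ _ _ NS); lra. }
  exists (m + q). split; [lra|]. intros s t Hs Ht.
  destruct (Rlt_dec s q) as [H1|H1]; [|destruct (Rlt_dec (eps - q) s) as [H2|H2]].
  - assert (Rabs (z q t - z s t) <= q - s).
    { apply I; try lra. intros u Hu. apply (W u t); lra. }
    assert (Rabs (z q t) <= m) by (apply B; split; lra).
    apply Rabs_le_between in H, H0. apply Rabs_le. lra.
  - assert (Rabs (z s t - z (eps - q) t) <= s - (eps - q)).
    { apply I; try lra. intros u Hu. replace u with (eps - (eps - u)) by ring. apply (W (eps - u) t); lra. }
    assert (Rabs (z (eps - q) t) <= m) by (apply B; split; lra).
    apply Rabs_le_between in H, H0. apply Rabs_le. lra.
  - assert (Rabs (z s t) <= m) by (apply B; split; lra). lra.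
Qed.

(* Tested with [chi ^ 2 * z], where [chi] vanishes at the two ends [c - L], [e + L]. *)
Lemma caccioppoli c e L A : 0 <= k <= 1 -> c <= e -> 0 < L -> al < c - L -> e + L < be ->
  (e + L) - (c - L) <= 1 ->
  (forall r, 0 < r < eps / 2 -> I2 (fun s t => z s t ^ 2) r (eps - r) (c - L) (e + L) <= A) ->
  forall r, 0 < r < eps / 2 ->
  I2 (fun s t => z1 s t ^ 2 + z2 s t ^ 2) r (eps - r) c e <= 6 / L ^ 4 * A.
Proof.
  intros Hk Hce HL Hc He Hlen HA r Hr.
  pose proof (ns_c0 _ _ _ _ _ _ _ _ _ _ NS) as C0. pose proof (ns_c1 _ _ _ _ _ _ _ _ _ _ NS) as C1.
  pose proof (ns_c2 _ _ _ _ _ _ _ _ _ _ NS) as C2. pose proof (ns_c11 _ _ _ _ _ _ _ _ _ _ NS) as C11.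
  pose proof (ns_c22 _ _ _ _ _ _ _ _ _ _ NS) as C22.
  set (c' := c - L) in *. set (e' := e + L) in *.
  destruct (ns_bounded c' e' Hc He) as [m [Hm B]].
  assert (HL4 : 0 < L ^ 4) by (apply pow_lt; assumption).
  apply (le_of_forall_pos _ _ (4 * m / L ^ 4)).
  { left; apply Rdiv_lt_0_compat; lra. }
  intros g Hg.
  destruct (ns_wall _ _ _ _ _ _ _ _ _ _ NS c' e' g Hc He Hg) as [h0 [Hh0 W]].
  set (q := Rmin (h0 / 2) r).
  assert (Hq : 0 < q) by (apply Rmin_pos; lra).
  assert (Hq1 : q <= h0 / 2) by apply Rmin_l. assert (Hq2 : q <= r) by apply Rmin_r.
  (* A polynomial cut-off: at most 1 because e' - c' <= 1, at least L^2 on [c, e] (hence L^4 after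
     squaring), with derivative e' + c' - 2 t bounded by 1. *)
  set (chi := fun t => (t - c') * (e' - t)).
  set (F1 := fun s t => chi t ^ 2 * (z s t * z1 s t)).
  set (F2 := fun s t => chi t ^ 2 * (z s t * z2 s t)).
  set (F11 := fun s t => chi t ^ 2 * (z1 s t ^ 2 + z s t * z11 s t)).
  set (F22 := fun s t => 2 * chi t * (e' + c' - 2 * t) * (z s t * z2 s t)
                + chi t ^ 2 * (z2 s t ^ 2 + z s t * z22 s t)).
  assert (Hce' : c' <= e') by (unfold c', e'; lra).
  assert (Rc : forall s t, rect q (eps - q) c' e' s t -> 0 < s < eps /\ al < t < be).
  { intros s t. apply ns_rect; assumption. }
  assert (G := green_rect F1 F2 F11 F22 q (eps - q) c' e' ltac:(lra) Hce').
  assert (G' : I2 (fun s t => F11 s t + F22 s t) q (eps - q) c' e' =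
     RInt (fun t => F1 (eps - q) t - F1 q t) c' e' + RInt (fun s => F2 s e' - F2 s c') q (eps - q)).
  { apply G; clear G.
    - intros s t Hst. destruct (Rc s t Hst). unfold F1, F11. der.
      apply (ns_d1 _ _ _ _ _ _ _ _ _ _ NS); assumption.
      apply (ns_d11 _ _ _ _ _ _ _ _ _ _ NS); assumption. simpl; ring.
    - intros s t Hst. destruct (Rc s t Hst). unfold F2, F22, chi. der.
      apply (ns_d2 _ _ _ _ _ _ _ _ _ _ NS); assumption.
      apply (ns_d22 _ _ _ _ _ _ _ _ _ _ NS); assumption. simpl; ring.
    - intros s t Hst. pose proof (Rc s t Hst). unfold F11, chi. c2d; auto.
    - intros s t Hst. pose proof (Rc s t Hst). unfold F22, chi. c2d; auto. }
  clear G.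
  assert (Z : RInt (fun s => F2 s e' - F2 s c') q (eps - q) = 0).
  { apply RInt_zero; [lra|]. intros; unfold F2, chi; ring. }
  rewrite Z in G'. clear Z.
  assert (Hchi : forall t, c' <= t <= e' -> 0 <= chi t <= 1).
  { intros t Ht. unfold chi. split. apply Rmult_le_pos; lra.
    apply Rle_trans with (1 * 1); [|lra]. apply Rmult_le_compat; lra. }
  assert (Bd : Rabs (RInt (fun t => F1 (eps - q) t - F1 q t) c' e') <= (e' - c') * (2 * m * g)).
  { apply abs_RInt_le_const; [assumption| |].
    - apply ex_RInt_cont; [assumption|]. intros t Ht.
      assert (Cl : forall f s, 0 < s < eps -> cont_on (fun s t => 0 < s < eps /\ al < t < be) f ->
        continuity_2d_pt (fun _ y => f s y) 0 t).
      { intros f s Hs Hf. apply (cont_2d_of_snd (fun y => f s y)), (cont_2d_snd f), Hf. lra. }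
      apply (cont_2d_snd (fun s t => F1 (eps - q) t - F1 q t) 0). unfold F1, chi.
      c2d; apply Cl; assumption || lra.
    - intros t Ht. destruct (W q t ltac:(lra) Ht) as [W1 W2].
      pose proof (B q t ltac:(lra) Ht) as B1. pose proof (B (eps - q) t ltac:(lra) Ht) as B2.
      pose proof (Hchi t Ht) as Hch.
      assert (P : forall x y, Rabs x <= m -> Rabs y <= g -> Rabs (chi t ^ 2 * (x * y)) <= m * g).
      { intros x y Hx Hy. rewrite !Rabs_mult. rewrite (Rabs_pos_eq (chi t ^ 2)) by apply pow2_ge_0.
        assert (Rabs x * Rabs y <= m * g) by (apply Rmult_le_compat; auto using Rabs_pos).
        assert (0 <= Rabs x * Rabs y) by (apply Rmult_le_pos; apply Rabs_pos).
        assert (chi t ^ 2 <= 1) by (simpl; rewrite Rmult_1_r; replace 1 with (1 * 1) by ring; apply Rmult_le_compat; lra).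
        apply Rle_trans with (1 * (Rabs x * Rabs y)); [apply Rmult_le_compat_r; assumption|lra]. }
      unfold F1. eapply Rle_trans; [apply Rabs_triang|]. rewrite Rabs_Ropp.
      pose proof (P _ _ B1 W1). pose proof (P _ _ B2 W2). lra. }
  assert (CR : forall f, cont_on (fun s t => 0 < s < eps /\ al < t < be) f -> cont_on (rect q (eps - q) c' e') f).
  { intros f Hf. apply ns_cont_rect; assumption. }
  apply CR in C0, C1, C2, C11, C22.
  (* The 3 is 2 + 1: Young's inequality turns the cross term 2 chi chi' z z2 into half of chi^2 z2^2
     plus 2 z^2, and k^2 chi^2 z^2 is at most z^2. *)
  assert (Lo : I2 (fun s t => (1 / 2) * (chi t ^ 2 * (z1 s t ^ 2 + z2 s t ^ 2)) - 3 * z s t ^ 2) q (eps - q) c' e'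
     <= I2 (fun s t => F11 s t + F22 s t) q (eps - q) c' e').
  { apply I2_le; [lra|assumption| | |].
    - intros s t Hst. unfold chi. c2d.
    - intros s t Hst. unfold F11, F22, chi. c2d.
    - intros s t Hst. destruct (Rc s t Hst) as [Hs Ht].
      pose proof (ns_eq _ _ _ _ _ _ _ _ _ _ NS s t Hs Ht) as E.
      destruct Hst as [_ Ht']. pose proof (Hchi t Ht') as Hch. unfold F11, F22.
      set (x := e' + c' - 2 * t) in *.
      assert (Hx : x ^ 2 <= 1). { unfold x. assert (-1 <= e' + c' - 2 * t <= 1) by lra. nra. }
      clearbody x. set (X := chi t) in *. clearbody X.
      replace (X ^ 2 * (z1 s t ^ 2 + z s t * z11 s t) +
        (2 * X * x * (z s t * z2 s t) + X ^ 2 * (z2 s t ^ 2 + z s t * z22 s t)))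
      with (X ^ 2 * (z1 s t ^ 2 + z2 s t ^ 2) + 2 * X * x * (z s t * z2 s t) - k ^ 2 * X ^ 2 * z s t ^ 2
         + X ^ 2 * z s t * (z11 s t + z22 s t + k ^ 2 * z s t)) by ring.
      rewrite E. generalize (z s t) (z1 s t) (z2 s t). intros p p1 p2.
      assert (k ^ 2 * X ^ 2 <= 1). { assert (k ^ 2 <= 1) by nra. assert (X ^ 2 <= 1) by nra. pose proof (pow2_ge_0 k). pose proof (pow2_ge_0 X). nra. }
      pose proof (pow2_ge_0 p). pose proof (pow2_ge_0 (X * p1)).
      pose proof (pow2_ge_0 (X * p2 + 2 * x * p)).
      assert (x ^ 2 * p ^ 2 <= 1 * p ^ 2) by (apply Rmult_le_compat_r; assumption).
      assert (k ^ 2 * X ^ 2 * p ^ 2 <= 1 * p ^ 2) by (apply Rmult_le_compat_r; assumption).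
      nra. }
  rewrite I2_minus, I2_scal, I2_scal in Lo; try lra; try (intros s t Hst; unfold chi; c2d).
  assert (Up : I2 (fun s t => L ^ 4 * (z1 s t ^ 2 + z2 s t ^ 2)) q (eps - q) c e <=
     I2 (fun s t => chi t ^ 2 * (z1 s t ^ 2 + z2 s t ^ 2)) q (eps - q) c' e').
  { apply Rle_trans with (I2 (fun s t => chi t ^ 2 * (z1 s t ^ 2 + z2 s t ^ 2)) q (eps - q) c e).
    - assert (S : forall s t, rect q (eps - q) c e s t -> rect q (eps - q) c' e' s t).
      { intros s t [? ?]; split; unfold c', e'; lra. }
      apply I2_le; [lra|assumption| | |].
      + intros s t Hst. apply S in Hst. c2d.
      + intros s t Hst. apply S in Hst. unfold chi. c2d.
      + intros s t [_ Ht]. apply Rmult_le_compat_r.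
        pose proof (pow2_ge_0 (z1 s t)). pose proof (pow2_ge_0 (z2 s t)). lra.
        replace (L ^ 4) with ((L * L) ^ 2) by ring. apply pow_incr. split. nra.
        unfold chi. apply Rmult_le_compat; unfold c', e'; lra.
    - apply I2_mono_dom; unfold c', e'; try lra.
      intros s t Hst. unfold chi. c2d.
      intros s t Hst. apply Rmult_le_pos. apply pow2_ge_0.
      pose proof (pow2_ge_0 (z1 s t)). pose proof (pow2_ge_0 (z2 s t)). lra. }
  rewrite I2_scal in Up; [|lra|assumption|].
  2:{ apply (cont_on_sub (rect q (eps - q) c' e')); [intros s t [? ?]; split; unfold c', e'; lra|].
      intros s t Hst; c2d. }
  assert (Mo : I2 (fun s t => z1 s t ^ 2 + z2 s t ^ 2) r (eps - r) c e <= I2 (fun s t => z1 s t ^ 2 + z2 s t ^ 2) q (eps - q) c e).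
  { apply I2_mono_dom; try lra.
    apply (cont_on_sub (rect q (eps - q) c' e')); [intros s t [? ?]; split; unfold c', e'; lra|].
      intros s t Hst; c2d. intros s t _. pose proof (pow2_ge_0 (z1 s t)). pose proof (pow2_ge_0 (z2 s t)). lra. }
  eapply Rle_trans; [exact Mo|].
  pose proof (HA q ltac:(lra)) as HAq. apply Rabs_le_between in Bd.
  assert (mg : 0 < m * g) by (apply Rmult_lt_0_compat; assumption).
  apply (Rmult_le_reg_l (L ^ 4)); [assumption|].
  replace (L ^ 4 * (6 / L ^ 4 * A + 4 * m / L ^ 4 * g)) with (6 * A + 4 * (m * g)) by (field; lra).
  assert ((e' - c') * (2 * m * g) <= 1 * (2 * m * g)) by (apply Rmult_le_compat_r; [nra|assumption]).
  lra.
Qed.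

End Strip.

(** The vertical quotient of z is a solution whose L^2 norm is controlled by that of z2. Caccioppoli
    bounds the quotient of z1, and then h tends to 0 with r fixed. Of the 2 L at the top, one L
    serves the cut-off and the other the shift; the 12 is twice the 6 of [caccioppoli]. *)
Lemma mixed_derivative_bound k eps al be z z1 z2 z11 z22 z12 c e L A :
  neumann_strip k eps al be z z1 z2 z11 z22 z12 -> 0 < eps ->
  0 <= k <= 1 -> c <= e -> 0 < L -> al < c - L -> e + 2 * L < be ->
  (e + L) - (c - L) <= 1 ->
  (forall r, 0 < r < eps / 2 -> I2 (fun s t => z2 s t ^ 2) r (eps - r) (c - L) (e + 2 * L) <= A) ->
  forall r, 0 < r < eps / 2 ->
  I2 (fun s t => z12 s t ^ 2) r (eps - r) c e <= 12 / L ^ 4 * A.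
Proof.
  intros NS Heps Hk Hce HL Hc He Hlen HA r Hr.
  pose proof (ns_c0 _ _ _ _ _ _ _ _ _ _ NS) as C0. pose proof (ns_c1 _ _ _ _ _ _ _ _ _ _ NS) as C1.
  pose proof (ns_c2 _ _ _ _ _ _ _ _ _ _ NS) as C2. pose proof (ns_c12 _ _ _ _ _ _ _ _ _ _ NS) as C12.
  assert (CR : forall f q c' e', cont_on (fun s t => 0 < s < eps /\ al < t < be) f ->
     0 < q -> al < c' -> e' < be -> cont_on (rect q (eps - q) c' e') f).
  { intros. apply (ns_cont_rect eps al be); assumption. }
  apply (le_of_forall_pos _ _ (2 * (eps * 1))); [lra|]. intros g0 Hg0.
  set (g := Rmin g0 1). assert (Hg : 0 < g) by (apply Rmin_pos; lra).
  assert (g <= g0) by apply Rmin_l. assert (g <= 1) by apply Rmin_r.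
  destruct (dquot_unif z1 z12 r (eps - r) c e L g) as [h0 [Hh0 U]]; try lra.
  { apply CR; try assumption; lra. }
  { intros s t [? ?]. apply (ns_d12 _ _ _ _ _ _ _ _ _ _ NS); lra. }
  set (h := Rmin (h0 / 2) (L / 2)). assert (Hh : 0 < h) by (apply Rmin_pos; lra).
  assert (Hh1 : h <= h0 / 2) by apply Rmin_l. assert (Hh2 : h <= L / 2) by apply Rmin_r.
  pose proof (ns_dquot _ _ _ _ _ _ _ _ _ _ h Hh NS) as NSh.
  assert (Ca : I2 (fun s t => dquot h z1 s t ^ 2 + dquot h z2 s t ^ 2) r (eps - r) c e <= 6 / L ^ 4 * A).
  { refine (caccioppoli _ _ _ _ _ _ _ _ _ _ NSh Heps c e L A Hk Hce HL Hc _ Hlen _ r Hr); [lra|].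
    clear r Hr U. intros r Hr. eapply Rle_trans; [|apply (HA r Hr)].
    eapply Rle_trans. apply (dquot_L2 z z2); try lra.
    apply CR; try assumption; lra. apply CR; try assumption; lra.
    intros s t [? ?]. apply (ns_d2 _ _ _ _ _ _ _ _ _ _ NS); lra.
    apply I2_mono_dom; try lra.
    intros s t Hst. apply cont_2d_pow2. revert s t Hst. apply CR; try assumption; lra.
    intros; apply pow2_ge_0. }
  assert (Cd : forall f, cont_on (fun s t => 0 < s < eps /\ al < t < be) f -> cont_on (rect r (eps - r) c e) (dquot h f)).
  { intros f Hf s t [? ?]. apply dquot_cont; apply Hf; lra. }
  pose proof (Cd _ C1) as D1. pose proof (Cd _ C2) as D2.
  assert (D12 : cont_on (rect r (eps - r) c e) z12) by (apply CR; try assumption; lra).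
  assert (E1 : I2 (fun s t => z12 s t ^ 2) r (eps - r) c e <=
    I2 (fun s t => 2 * (dquot h z1 s t ^ 2 + dquot h z2 s t ^ 2) + 2 * g ^ 2) r (eps - r) c e).
  { apply I2_le; try lra. intros s t Hst; c2d. intros s t Hst; c2d.
    intros s t Hst. specialize (U h s t ltac:(lra) Hst).
    pose proof (pow2_ge_0 (dquot h z2 s t)).
    assert ((z12 s t - dquot h z1 s t) ^ 2 <= g ^ 2).
    { rewrite <- (pow2_abs (_ - _)). apply pow_incr. split; [apply Rabs_pos|exact U]. }
    pose proof (pow2_ge_0 (z12 s t - 2 * dquot h z1 s t)). lra. }
  rewrite I2_plus, I2_scal, I2_const in E1; try lra; try (intros s t Hst; c2d).
  assert (Hg2 : g ^ 2 <= g0) by nra. pose proof (pow2_ge_0 g).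
  assert ((eps - r - r) * (e - c) * (2 * g ^ 2) <= eps * 1 * (2 * g0)).
  { apply Rmult_le_compat; try lra. apply Rmult_le_pos; lra. apply Rmult_le_compat; lra. }
  replace (12 / L ^ 4 * A) with (2 * (6 / L ^ 4 * A)) by (field; lra).
  lra.
Qed.

(** [z - m0] need not solve the equation, so m0 enters only in the Sobolev inequality for z, where
    z12 comes from [mixed_derivative_bound]. The same inequality for z2 would involve third
    derivatives, which need not exist: it is applied to the quotient of z instead, after two nested
    Caccioppoli estimates, and h tends to 0 only in the resulting pointwise bound. *)
Lemma interior_bounds (delta : R) : 0 < delta < 1 / 2 -> exists C, 0 < C /\
  forall k eps m0 A A' z z1 z2 z11 z22 z12, 0 < eps <= 1 -> 0 <= k <= 1 -> 0 <= A -> 0 <= A' ->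
  neumann_strip k eps 0 1 z z1 z2 z11 z22 z12 ->
  (forall r c e, 0 < r < eps / 2 -> 0 < c -> c <= e -> e < 1 ->
    I2 (fun s t => z1 s t ^ 2) r (eps - r) c e <= A /\
    I2 (fun s t => z2 s t ^ 2) r (eps - r) c e <= A /\
    I2 (fun s t => (z s t - m0) ^ 2) r (eps - r) c e <= A') ->
  forall s t, 0 < s < eps -> delta <= t <= 1 - delta ->
  (z s t - m0) ^ 2 <= C * (A + A') / eps /\ z2 s t ^ 2 <= C * A / eps.
Proof.
  (* delta / 8 leaves room at each end for two nested cut-offs and for the shifts of the difference
     quotients. *)
  intros Hdel. set (L := delta / 8). assert (HL : 0 < L) by (unfold L; lra).
  assert (HL4 : 0 < L ^ 4) by (apply pow_lt; assumption).
  set (q := 1 - delta - delta). assert (Hq : 0 < q <= 1) by (unfold q; lra).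
  assert (Hq' : 0 < / q) by (apply Rinv_0_lt_compat; lra).
  set (K := 12 / L ^ 4). assert (HK : 0 < K) by (apply Rdiv_lt_0_compat; lra).
  assert (Ha : 0 < 8 / q) by (apply Rdiv_lt_0_compat; lra).
  assert (Hb : 0 < (12 + 4 / q) * (1 + K)).
  { assert (0 < 4 / q) by (apply Rdiv_lt_0_compat; lra). apply Rmult_lt_0_compat; lra. }
  assert (Hbc : (12 + 4 / q) * (1 + K) <= (12 + 4 / q) * (1 + K) ^ 2).
  { replace ((12 + 4 / q) * (1 + K) ^ 2) with ((12 + 4 / q) * (1 + K) * (1 + K)) by ring.
    pose proof (Rmult_lt_0_compat _ _ Hb HK). lra. }
  exists (8 / q + (12 + 4 / q) * (1 + K) ^ 2). split.
  { lra. }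
  intros k eps m0 A A' z z1 z2 z11 z22 z12 Heps Hk HA HA' NS HI s t Hs Ht.
  pose proof (ns_c0 _ _ _ _ _ _ _ _ _ _ NS) as C0. pose proof (ns_c1 _ _ _ _ _ _ _ _ _ _ NS) as C1.
  pose proof (ns_c2 _ _ _ _ _ _ _ _ _ _ NS) as C2. pose proof (ns_c12 _ _ _ _ _ _ _ _ _ _ NS) as C12.
  set (r := Rmin (eps / 4) (Rmin (s / 2) ((eps - s) / 2))).
  assert (Hr : 0 < r) by (repeat apply Rmin_pos; lra).
  assert (Hr1 : r <= eps / 4) by apply Rmin_l.
  assert (Hr2 : r <= s / 2) by (eapply Rle_trans; [apply Rmin_r|apply Rmin_l]).
  assert (Hr3 : r <= (eps - s) / 2) by (eapply Rle_trans; [apply Rmin_r|apply Rmin_r]).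
  assert (CR : forall f q c' e', cont_on (fun s t => 0 < s < eps /\ 0 < t < 1) f ->
     0 < q -> 0 < c' -> e' < 1 -> cont_on (rect q (eps - q) c' e') f).
  { intros. apply (ns_cont_rect eps 0 1); assumption. }
  set (w := eps - r - r). assert (Hw : eps / 2 <= w <= eps) by (unfold w; lra).
  assert (Hwi : / w <= 2 / eps).
  { apply (Rmult_le_reg_l (w * eps)); [nra|]. field_simplify; lra. }
  assert (Hwi0 : 0 < / w) by (apply Rinv_0_lt_compat; lra).
  (* Common ending of both Sobolev estimates: the width w lies between eps / 2 and eps <= 1, so 2 /
     w and 2 w are both at most a multiple of 1 / eps. *)
  assert (Fin : forall J0 J1 J2 J12 B0 B1, 0 <= B0 -> 0 <= B1 -> J0 <= B0 -> J2 <= B1 -> J1 <= B1 -> J12 <= B1 ->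
     2 / w * (2 / q * J0 + 2 * q * J2) + 2 * w * (2 / q * J1 + 2 * q * J12) <=
      (8 / q * B0 + 8 * B1 + 4 / q * B1 + 4 * B1) / eps).
  { intros J0 J1 J2 J12 B0 B1 HB0 HB1 H0 H2 H1 H12.
    assert (P : 2 / q * J0 + 2 * q * J2 <= 2 / q * B0 + 2 * B1).
    { apply Rplus_le_compat. apply Rmult_le_compat_l; [|lra]. unfold Rdiv; nra. nra. }
    assert (P' : 2 / q * J1 + 2 * q * J12 <= 2 / q * B1 + 2 * B1).
    { apply Rplus_le_compat. apply Rmult_le_compat_l; [|lra]. unfold Rdiv; nra. nra. }
    assert (P0 : 0 <= 2 / q * B0 + 2 * B1). { unfold Rdiv. assert (0 <= / q * B0) by nra. nra. }
    assert (P1 : 0 <= 2 / q * B1 + 2 * B1). { unfold Rdiv. assert (0 <= / q * B1) by nra. nra. }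
    apply Rle_trans with (2 * (2 / eps) * (2 / q * B0 + 2 * B1) + 2 / eps * (2 / q * B1 + 2 * B1)).
    - apply Rplus_le_compat.
      + apply Rle_trans with (2 / w * (2 / q * B0 + 2 * B1)).
        apply Rmult_le_compat_l; [unfold Rdiv; nra|exact P].
        apply Rmult_le_compat_r; [exact P0|]. unfold Rdiv in *; lra.
      + apply Rle_trans with (2 * w * (2 / q * B1 + 2 * B1)).
        apply Rmult_le_compat_l; [lra|exact P'].
        apply Rmult_le_compat_r; [exact P1|].
        apply (Rmult_le_reg_r eps); [lra|]. unfold Rdiv. rewrite Rmult_assoc, Rmult_assoc, Rinv_l by lra. nra.
    - right. field. lra. }
  split.
  - assert (M12 : I2 (fun s t => z12 s t ^ 2) r (eps - r) delta (1 - delta) <= K * A).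
    { refine (mixed_derivative_bound k eps 0 1 z z1 z2 z11 z22 z12 delta (1 - delta) L A NS _ Hk _ HL _ _ _ _ r _); try (unfold L; lra).
      intros r' Hr'. apply (HI r' (delta - L) (1 - delta + 2 * L) Hr'); unfold L; lra. }
    destruct (HI r delta (1 - delta) ltac:(lra) ltac:(lra) ltac:(lra) ltac:(lra)) as [I1 [I2' I0]].
    pose proof (CR _ r delta (1 - delta) C0 ltac:(lra) ltac:(lra) ltac:(lra)) as D0.
    assert (S := sobolev_rect (fun s t => z s t - m0) z1 z2 z12 r (eps - r) delta (1 - delta) ltac:(lra) ltac:(lra)).
    eapply Rle_trans; [apply S; clear S|].
    + intros x y Hxy. c2d.
    + apply CR; try assumption; lra.
    + apply CR; try assumption; lra.
    + apply CR; try assumption; lra.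
    + intros x y [? ?]. der. apply (ns_d1 _ _ _ _ _ _ _ _ _ _ NS); lra. simpl; ring.
    + intros x y [? ?]. der. apply (ns_d2 _ _ _ _ _ _ _ _ _ _ NS); lra. simpl; ring.
    + intros x y [? ?]. apply (ns_d12 _ _ _ _ _ _ _ _ _ _ NS); lra.
    + split; lra.
    + fold w q. eapply Rle_trans; [apply (Fin _ _ _ _ A' (A * (1 + K)))|]; try lra; try nra.
      apply Rmult_le_compat_r. left; apply Rinv_0_lt_compat; lra.
      set (a := 8 / q) in *. set (b2 := (12 + 4 / q) * (1 + K) ^ 2) in *.
      replace (a * A' + 8 * (A * (1 + K)) + 4 / q * (A * (1 + K)) + 4 * (A * (1 + K))) with
        (a * A' + ((12 + 4 / q) * (1 + K)) * A) by ring.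
      assert (0 <= a * A) by (apply Rmult_le_pos; lra).
      assert (0 <= b2 * A') by (apply Rmult_le_pos; lra).
      assert ((12 + 4 / q) * (1 + K) * A <= b2 * A) by (apply Rmult_le_compat_r; lra).
      lra.
  - set (Ct := 8 / q + (12 + 4 / q) * (1 + K) ^ 2).
    set (B := Ct * A / eps).
    assert (HCt : 0 <= Ct) by (unfold Ct; lra).
    assert (HB : 0 <= B).
    { apply Rmult_le_pos. apply Rmult_le_pos; assumption. left; apply Rinv_0_lt_compat; lra. }
    assert (HKL : 6 / L ^ 4 * A <= K * A).
    { apply Rmult_le_compat_r; [assumption|]. unfold K, Rdiv.
      apply Rmult_le_compat_r; [left; apply Rinv_0_lt_compat; assumption|lra]. }
    (* For small h the quotient at (s, t) is within g of z2, while its bound B does not depend on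
       h. *)
    assert (Main : Rabs (z2 s t) <= sqrt B).
    { apply (le_of_forall_pos _ _ 1); [lra|]. intros g Hg.
      destruct (dquot_unif z z2 r (eps - r) delta (1 - delta) L g) as [h0 [Hh0 U]]; try (unfold L; lra).
      { apply CR; try assumption; unfold L; lra. }
      { intros x y [? ?]. apply (ns_d2 _ _ _ _ _ _ _ _ _ _ NS). lra. unfold L in *; lra. }
      set (h := Rmin (h0 / 2) L). assert (Hh : 0 < h) by (apply Rmin_pos; lra).
      assert (Hh1 : h <= h0 / 2) by apply Rmin_l. assert (Hh2 : h <= L) by apply Rmin_r.
      specialize (U h s t ltac:(lra) ltac:(split; lra)).
      pose proof (ns_dquot _ _ _ _ _ _ _ _ _ _ h Hh NS) as NSh.
      assert (Q0 : forall r c e, 0 < r < eps / 2 -> 0 < c -> c <= e -> e < 1 - h ->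
        I2 (fun s t => dquot h z s t ^ 2) r (eps - r) c e <= A).
      { intros r' c e Hr' Hc Hce He.
        eapply Rle_trans. apply (dquot_L2 z z2); try lra.
        apply CR; try assumption; lra. apply CR; try assumption; lra.
        intros x y [? ?]. apply (ns_d2 _ _ _ _ _ _ _ _ _ _ NS); lra.
        apply (HI r' c (e + h)); lra. }
      assert (Cd : forall f c e, cont_on (fun s t => 0 < s < eps /\ 0 < t < 1) f ->
        0 < c -> e < 1 - h -> forall r, 0 < r -> cont_on (rect r (eps - r) c e) (dquot h f)).
      { intros f c e Hf Hc He r' Hr' x y [? ?]. apply dquot_cont; apply Hf; lra. }
      assert (Q12 : forall r c e, 0 < r < eps / 2 -> 0 < c - L -> c <= e -> e + L < 1 - h ->
        e + L - (c - L) <= 1 ->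
        I2 (fun s t => dquot h z1 s t ^ 2) r (eps - r) c e <= K * A /\
        I2 (fun s t => dquot h z2 s t ^ 2) r (eps - r) c e <= K * A).
      { intros r' c e Hr' Hc Hce He Hl.
        assert (Q : I2 (fun s t => dquot h z1 s t ^ 2 + dquot h z2 s t ^ 2) r' (eps - r') c e <= 6 / L ^ 4 * A).
        { refine (caccioppoli _ _ _ _ _ _ _ _ _ _ NSh ltac:(lra) c e L A Hk Hce HL Hc He Hl _ r' Hr').
          intros r2 Hr2'. apply Q0; lra. }
        pose proof (Cd z1 c e C1 ltac:(lra) ltac:(lra) r' ltac:(lra)).
        pose proof (Cd z2 c e C2 ltac:(lra) ltac:(lra) r' ltac:(lra)).
        split; (eapply Rle_trans; [|eapply Rle_trans; [exact Q|exact HKL]]);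
          (apply I2_le; [lra|lra| | |]);
          match goal with |- cont_on _ _ => intros x y Hxy; c2d | _ => idtac end.
        intros x y _. pose proof (pow2_ge_0 (dquot h z2 x y)); lra.
        intros x y _. pose proof (pow2_ge_0 (dquot h z1 x y)); lra. }
      assert (M12 : I2 (fun s t => dquot h z12 s t ^ 2) r (eps - r) delta (1 - delta) <= K * (K * A)).
      { refine (mixed_derivative_bound k eps 0 (1 - h) _ _ _ _ _ _ delta (1 - delta) L (K * A) NSh _ Hk _ HL _ _ _ _ r _); try (unfold L in *; lra).
        intros r' Hr'. apply Q12; unfold L in *; lra. }
      destruct (Q12 r delta (1 - delta)) as [M1 M2]; try (unfold L in *; lra).
      pose proof (Q0 r delta (1 - delta) ltac:(lra) ltac:(lra) ltac:(lra) ltac:(unfold L in *; lra)) as M0.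
      assert (Y : dquot h z s t ^ 2 <= B).
      { eapply Rle_trans; [apply (sobolev_rect (dquot h z) (dquot h z1) (dquot h z2) (dquot h z12) r (eps - r) delta (1 - delta))|];
          try lra; try (apply Cd; try assumption; unfold L in *; lra).
        - intros x y [? ?]. apply (ns_d1 _ _ _ _ _ _ _ _ _ _ NSh); unfold L in *; lra.
        - intros x y [? ?]. apply (ns_d2 _ _ _ _ _ _ _ _ _ _ NSh); unfold L in *; lra.
        - intros x y [? ?]. apply (ns_d12 _ _ _ _ _ _ _ _ _ _ NSh); unfold L in *; lra.
        - split; lra.
        - fold w q.
          assert (0 <= K * A) by (apply Rmult_le_pos; lra). assert (0 <= K * (K * A)) by (apply Rmult_le_pos; lra).
          eapply Rle_trans; [apply (Fin _ _ _ _ A (A * (1 + K) * (1 + K)))|]; try lra.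
          unfold B. right. unfold Ct. field. lra. }
      assert (Rabs (dquot h z s t) <= sqrt B).
      { rewrite <- (sqrt_pow2 (Rabs (dquot h z s t))) by apply Rabs_pos.
        apply sqrt_le_1_alt. rewrite pow2_abs. exact Y. }
      pose proof (Rabs_triang_inv (z2 s t) (dquot h z s t)). lra. }
    rewrite <- pow2_abs. rewrite <- (pow2_sqrt B HB). apply pow_incr.
    split; [apply Rabs_pos|exact Main].
Qed.

(** * Divergence theorem on the perforated cell *)

Lemma RInt_affine (G : R -> R) m a b : ex_RInt G (m + a) (m + b) ->
  ex_RInt (fun x => G (m + x)) a b /\ RInt (fun x => G (m + x)) a b = RInt G (m + a) (m + b).
Proof.
  intros H. rewrite (Rplus_comm m a), (Rplus_comm m b) in *.
  assert (E : forall x, G (m + x) = G (x + m)) by (intros; f_equal; ring).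
  pose proof (ex_RInt_comp_lin (V := R_NormedModule) G 1 m a b) as X. rewrite !Rmult_1_l in X.
  split.
  - eapply ex_RInt_ext; [|apply X, H]. intros y _.
    change (1 * G (1 * y + m) = G (m + y)). rewrite !Rmult_1_l. symmetry; apply E.
  - rewrite <- RInt_shift by exact H. apply RInt_ext. intros; apply E.
Qed.
Lemma RInt_reflect (G : R -> R) m a b : ex_RInt G (m - b) (m - a) ->
  ex_RInt (fun x => G (m - x)) a b /\ RInt (fun x => G (m - x)) a b = RInt G (m - b) (m - a).
Proof.
  intros H. apply ex_RInt_swap in H.
  pose proof (is_RInt_comp_lin (V := R_NormedModule) G (-1) m a b (RInt G (m - a) (m - b))) as X.
  replace (-1 * a + m) with (m - a) in X by ring. replace (-1 * b + m) with (m - b) in X by ring.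
  specialize (X (RInt_correct _ _ _ H)).
  apply (is_RInt_scal (V := R_NormedModule) _ _ _ (-1)) in X.
  assert (Y : is_RInt (fun x => G (m - x)) a b (RInt G (m - b) (m - a))).
  { rewrite <- (opp_RInt_swap (V := R_CompleteNormedModule) G (m - a) (m - b)) by exact H.
    change (opp (RInt G (m - a) (m - b))) with (- RInt G (m - a) (m - b)).
    change (scal (-1) (RInt G (m - a) (m - b) : R_NormedModule)) with ((-1) * RInt G (m - a) (m - b)) in X.
    replace (- RInt G (m - a) (m - b)) with (-1 * RInt G (m - a) (m - b)) by ring.
    eapply is_RInt_ext; [|exact X]. intros y _.
    change (-1 * (-1 * G (-1 * y + m)) = G (m - y)).
    replace (-1 * y + m) with (m - y) by ring. ring. }
  split. eexists; exact Y. apply is_RInt_unique, Y.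
Qed.

(* Otherwise the sum of the f exceeds mu / rho on all of [r1, r2], and integrating
   1 / rho produces the logarithm. *)
Lemma good_radius (L : list (R -> R)) M mu r1 r2 : 0 < r1 -> r1 < r2 ->
  (forall f, In f L -> ex_RInt f r1 r2 /\ RInt f r1 r2 <= M /\ forall x, r1 <= x <= r2 -> 0 <= f x) ->
  INR (length L) * M < mu * ln (r2 / r1) ->
  exists rho, r1 <= rho <= r2 /\ forall f, In f L -> rho * f rho <= mu.
Proof.
  intros H1 H12 HL HM.
  set (S := fun x => fold_right (fun (f : R -> R) acc => f x + acc) 0 L).
  assert (P : ex_RInt S r1 r2 /\ RInt S r1 r2 <= INR (length L) * M /\
     forall x, r1 <= x <= r2 -> 0 <= S x /\ forall f, In f L -> f x <= S x).
  { unfold S. clear HM S. induction L as [|f L IH].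
    - simpl. split; [apply ex_RInt_const_R|]. split.
      rewrite RInt_const_R. right. rewrite Rmult_0_l. apply Rmult_0_r.
      intros; split; [lra|]; intros ? [].
    - destruct IH as [I1 [I2 I3]]. intros; apply HL; right; assumption.
      destruct (HL f (or_introl eq_refl)) as [J1 [J2 J3]].
      set (T := fun x => fold_right (fun (f : R -> R) acc => f x + acc) 0 L) in *.
      change (ex_RInt (fun x => f x + T x) r1 r2 /\ RInt (fun x => f x + T x) r1 r2 <= INR (length (f :: L)) * M /\
        forall x, r1 <= x <= r2 -> 0 <= f x + T x /\ forall f0, In f0 (f :: L) -> f0 x <= f x + T x).
      split; [apply ex_RInt_plus_R; assumption|]. split.
      + rewrite RInt_plus_R by assumption. change (length (f :: L)) with (Datatypes.S (length L)).
        rewrite S_INR. eapply Rle_trans; [apply Rplus_le_compat; [exact J2|exact I2]|]. right; ring.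
      + intros x Hx. destruct (I3 x Hx) as [K1 K2]. pose proof (J3 x Hx) as K0.
        fold (T x) in K1, K2. generalize dependent (T x). intros Tx K1 K2. split; [lra|].
        intros f0 [<-|Hf0]; [lra|]. pose proof (K2 f0 Hf0). lra. }
  destruct P as [P1 [P2 P3]].
  apply NNPP. intros N.
  assert (Q : forall x, r1 <= x <= r2 -> mu * / x <= S x).
  { intros x Hx. apply Rnot_lt_le. intros Hlt. apply N. exists x. split; [assumption|].
    intros f Hf. destruct (P3 x Hx) as [_ K]. specialize (K f Hf).
    apply Rle_trans with (x * (mu * / x)). apply Rmult_le_compat_l; lra.
    right. field. lra. }
  assert (mu * ln (r2 / r1) <= RInt S r1 r2); [|lra].
  assert (Ed : forall x, 0 < x -> is_derive (fun y => mu * ln y) x (mu * / x)).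
  { intros x Hx. der. apply is_derive_ln, Hx. simpl; ring. }
  assert (E : RInt (fun x => mu * / x) r1 r2 = mu * ln r2 - mu * ln r1).
  { apply (RInt_FTC (fun y => mu * ln y)); [lra| |]; intros x Hx. apply Ed; lra.
    apply (continuous_mult (K := R_AbsRing) (fun _ => mu)). apply continuous_const.
    apply continuous_Rinv. lra. }
  rewrite ln_div by lra. rewrite Rmult_minus_distr_l, <- E.
  apply RInt_le_R; [lra| |assumption|assumption].
  apply ex_RInt_cont; [lra|]. intros x Hx.
  apply (continuous_mult (K := R_AbsRing) (fun _ => mu)). apply continuous_const.
  apply continuous_Rinv. lra.
Qed.

(* The part of [Omega] relevant to one period 0 <= s <= d; the slits other than
   that of index 0 are left out. *)
Definition cell (eps s t : R) : Prop := 1 < t \/ t < 0 \/ (0 < s < eps /\ 0 <= t <= 1).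

Ltac in_cell :=
  match goal with |- cell _ ?s ?t => unfold cell;
    destruct (Rlt_dec 1 t); [left; assumption | destruct (Rlt_dec t 0); [right; left; assumption | right; right; split; lra]] end.
Ltac rect_cell := let s := fresh "s" in let t := fresh "t" in
  intros s t [? ?]; in_cell.

(** Cauchy-Schwarz written as a family of linear bounds: |f| <= lam q + K / lam for all lam > 0
    stands for f^2 <= 4 K q. On a segment of length at most 2 rho, with rho times the line energy at
    most mu^2, the choice lam = rho / mu makes both terms of order mu. *)
Lemma segment_small (f q : R -> R) K x y al be rho mu :
  0 < rho -> 0 < mu -> 0 <= K -> x <= y -> y - x <= 2 * rho -> al <= x -> y <= be ->
  ex_RInt f x y -> ex_RInt q al be -> (forall t, al <= t <= be -> 0 <= q t) ->
  (forall t lam, x <= t <= y -> 0 < lam -> Rabs (f t) <= lam * q t + K / lam) ->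
  rho * RInt q al be <= mu ^ 2 ->
  Rabs (RInt f x y) <= (1 + 2 * K) * mu.
Proof.
  intros Hr Hmu HK Hxy Hl Hax Hyb Xf Xq Pq Hf Hs.
  assert (Xq' : ex_RInt q x y) by (apply (ex_RInt_sub q al be); assumption).
  set (lam := rho / mu). assert (Hlam : 0 < lam) by (apply Rdiv_lt_0_compat; assumption).
  assert (A : Rabs (RInt f x y) <= RInt (fun t => lam * q t + K / lam) x y).
  { eapply Rle_trans. apply abs_RInt_le; assumption.
    apply RInt_le_R; [assumption| | |intros; apply Hf; assumption].
    apply (ex_RInt_norm f x y Xf).
    apply ex_RInt_plus_R; [apply ex_RInt_scal_R; assumption|apply ex_RInt_const_R]. }
  rewrite (RInt_plus_R (fun t => lam * q t) (fun _ => K / lam) x y (ex_RInt_scal_R _ _ _ _ Xq') (ex_RInt_const_R _ _ _)) in A.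
  rewrite (RInt_scal_R q lam x y Xq'), RInt_const_R in A.
  assert (B : RInt q x y <= RInt q al be) by (apply RInt_mono_dom; assumption).
  eapply Rle_trans; [exact A|]. clear A. revert B Hs. generalize (RInt q x y : R) (RInt q al be : R). intros I J HIJ Hs.
  assert (lam * I <= mu).
  { apply Rle_trans with (lam * J). apply Rmult_le_compat_l; lra.
    unfold lam. apply (Rmult_le_reg_l mu); [assumption|].
    replace (mu * (rho / mu * J)) with (rho * J) by (field; lra). nra. }
  assert ((y - x) * (K / lam) <= 2 * rho * (K / lam)).
  { apply Rmult_le_compat_r; [|assumption]. apply Rmult_le_pos; [assumption|left; apply Rinv_0_lt_compat; assumption]. }
  assert (2 * rho * (K / lam) = 2 * K * mu) by (unfold lam; field; lra).
  lra.
Qed.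

(** * Fluxes of a vector field that has only finite energy at the corners *)

Section Green.
Variables eps d K M : R.
Variables F1 F2 F11 F22 dens : R -> R -> R.
Hypothesis Heps : 0 < eps < d.
Hypothesis HK : 0 <= K.
Hypothesis HD1 : forall s t, cell eps s t -> is_derive (fun x => F1 x t) s (F11 s t).
Hypothesis HD2 : forall s t, cell eps s t -> is_derive (fun y => F2 s y) t (F22 s t).
Hypothesis C1 : cont_on (cell eps) F1.
Hypothesis C2 : cont_on (cell eps) F2.
Hypothesis C11 : cont_on (cell eps) F11.
Hypothesis C22 : cont_on (cell eps) F22.
Hypothesis Cd : cont_on (cell eps) dens.
Hypothesis Hdens : forall s t, cell eps s t -> 0 <= dens s t.
Hypothesis HM : forall a b c e, 0 <= a -> a <= b -> b <= d -> -2 <= c -> c <= e -> e <= 3 ->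
  (forall s t, rect a b c e s t -> cell eps s t) -> I2 dens a b c e <= M.
Hypothesis HF1 : forall s t lam, cell eps s t -> 0 < lam -> Rabs (F1 s t) <= lam * dens s t + K / lam.
Hypothesis HF2 : forall s t lam, cell eps s t -> 0 < lam -> Rabs (F2 s t) <= lam * dens s t + K / lam.
Hypothesis HF3 : forall s t lam, cell eps s t -> 0 < lam -> - (lam * dens s t + K / lam) <= F11 s t + F22 s t.
Hypothesis Hper : forall t, 1 < t \/ t < 0 -> F1 d t = F1 0 t.
Hypothesis HW1 : forall c e g, 0 < c -> e < 1 -> 0 < g -> exists h0, 0 < h0 /\
  forall h t, 0 < h < h0 -> c <= t <= e -> Rabs (F1 h t) <= g /\ Rabs (F1 (eps - h) t) <= g.
Hypothesis HW2 : forall a b g, eps < a -> b < d -> 0 < g -> exists h0, 0 < h0 /\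
  forall h s, 0 < h < h0 -> a <= s <= b -> Rabs (F2 s (1 + h)) <= g /\ Rabs (F2 s (- h)) <= g.

Let Dv := fun s t => F11 s t + F22 s t.

Lemma cell_cont f a b c e : cont_on (cell eps) f -> (forall s t, rect a b c e s t -> cell eps s t) ->
  cont_on (rect a b c e) f.
Proof. intros H1 H2. apply (cont_on_sub _ _ _ H2 H1). Qed.

Lemma ex_line_s f a b t : cont_on (cell eps) f -> a <= b -> (forall s, a <= s <= b -> cell eps s t) ->
  ex_RInt (fun s => f s t) a b.
Proof. intros Hf Hab H. apply ex_RInt_cont; [assumption|]. intros. apply (cont_2d_fst f), Hf, H; assumption. Qed.
Lemma ex_line_t f s c e : cont_on (cell eps) f -> c <= e -> (forall t, c <= t <= e -> cell eps s t) ->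
  ex_RInt (fun t => f s t) c e.
Proof. intros Hf Hab H. apply ex_RInt_cont; [assumption|]. intros. apply (cont_2d_snd f), Hf, H; assumption. Qed.

Lemma flux_identity a b c e : a <= b -> c <= e -> (forall s t, rect a b c e s t -> cell eps s t) ->
  RInt (fun s => F2 s e) a b - RInt (fun s => F2 s c) a b =
  I2 Dv a b c e - (RInt (fun t => F1 b t) c e - RInt (fun t => F1 a t) c e).
Proof.
  intros Hab Hce H.
  pose proof (green_rect F1 F2 F11 F22 a b c e Hab Hce) as G.
  unfold Dv. rewrite G; clear G.
  - rewrite (RInt_minus_R (fun t => F1 b t) (fun t => F1 a t)).
    rewrite (RInt_minus_R (fun s => F2 s e) (fun s => F2 s c)). ring.
    apply ex_line_s; auto. intros; apply H; split; lra.
    apply ex_line_s; auto. intros; apply H; split; lra.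
    apply ex_line_t; auto. intros; apply H; split; lra.
    apply ex_line_t; auto. intros; apply H; split; lra.
  - intros; apply HD1, H; assumption.
  - intros; apply HD2, H; assumption.
  - apply cell_cont; assumption.
  - apply cell_cont; assumption.
Qed.

(** [HF3] with lam = mu, over an area of at most mu^2. One side suffices: the positive gradient term
    in the divergence of the damped energy flux never has to be bounded above. *)
Lemma area_lower a b c e mu : 0 <= a -> a <= b -> b <= d -> -2 <= c -> c <= e -> e <= 3 ->
  (forall s t, rect a b c e s t -> cell eps s t) -> 0 < mu -> (b - a) * (e - c) <= mu ^ 2 ->
  - ((M + K) * mu) <= I2 Dv a b c e.
Proof.
  intros H0 Hab H1 H2 Hce H3 H Hmu Har.
  assert (Cde : cont_on (rect a b c e) dens) by (apply cell_cont; assumption).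
  assert (A : I2 (fun s t => - mu * dens s t - K / mu) a b c e <= I2 Dv a b c e).
  { apply I2_le; try assumption. intros s t Hst; c2d.
    unfold Dv. pose proof (cell_cont _ _ _ _ _ C11 H). pose proof (cell_cont _ _ _ _ _ C22 H).
    intros s t Hst; c2d. intros s t Hst. pose proof (HF3 s t mu (H _ _ Hst) Hmu). unfold Dv. lra. }
  rewrite (I2_minus a b c e Hab Hce (fun s t => - mu * dens s t) (fun _ _ => K / mu)) in A
    by (intros s t Hst; c2d).
  rewrite I2_scal, I2_const in A by assumption.
  pose proof (HM a b c e H0 Hab H1 H2 Hce H3 H) as HMM.
  assert (mu * I2 dens a b c e <= mu * M) by (apply Rmult_le_compat_l; lra).
  assert ((b - a) * (e - c) * (K / mu) <= mu ^ 2 * (K / mu)).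
  { apply Rmult_le_compat_r; [|assumption]. apply Rmult_le_pos; [assumption|left; apply Rinv_0_lt_compat; assumption]. }
  assert (mu ^ 2 * (K / mu) = K * mu) by (field; lra).
  lra.
Qed.

(* Energy on the lines at distance x from the walls and faces that bound the
   rectangles filling the cell up to its corners. *)
Definition lines rho2 h1 : list (R -> R) :=
  (fun x => RInt (fun t => dens x t) (- rho2) (1 + rho2)) ::
  (fun x => RInt (fun t => dens (eps - x) t) (- rho2) (1 + rho2)) ::
  (fun x => RInt (fun t => dens (eps + x) t) (1 + h1) (1 + rho2)) ::
  (fun x => RInt (fun t => dens (d - x) t) (1 + h1) (1 + rho2)) ::
  (fun x => RInt (fun t => dens (eps + x) t) (- rho2) (- h1)) ::
  (fun x => RInt (fun t => dens (d - x) t) (- rho2) (- h1)) ::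
  (fun x => RInt (fun s => dens s (1 + x)) 0 d) ::
  (fun x => RInt (fun s => dens s (- x)) 0 d) ::
  (fun x => RInt (fun s => dens s (1 - x)) h1 (eps - h1)) ::
  (fun x => RInt (fun s => dens s x) h1 (eps - h1)) :: nil.

(** As the radius varies, each of the ten lines sweeps a rectangle inside the cell, after a
    translation or a reflection for those measured from another side; the energy of that rectangle
    is at most M. The offset h1 keeps the swept rectangles off the metal. *)
Lemma lines_ok r1 r2 h1 : 0 < h1 -> h1 < r1 -> r1 < r2 -> r2 <= eps / 4 -> r2 <= (d - eps) / 4 -> r2 <= 1 / 4 ->
  forall f, In f (lines r2 h1) -> ex_RInt f r1 r2 /\ RInt f r1 r2 <= M /\ forall x, r1 <= x <= r2 -> 0 <= f x.
Proof.
  intros Hh Hh1 Hr H4 H5 H6.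
  assert (N1 : forall s c e, c <= e -> (forall t, c <= t <= e -> cell eps s t) -> 0 <= RInt (fun t => dens s t) c e).
  { intros s c e Hce H. apply RInt_nonneg; [assumption|apply ex_line_t; assumption|auto]. }
  assert (N2 : forall t a b, a <= b -> (forall s, a <= s <= b -> cell eps s t) -> 0 <= RInt (fun s => dens s t) a b).
  { intros s c e Hce H. apply RInt_nonneg; [assumption|apply ex_line_s; assumption|auto]. }
  assert (V : forall a b c e, 0 <= a -> a <= b -> b <= d -> -2 <= c -> c <= e -> e <= 3 ->
    (forall s t, rect a b c e s t -> cell eps s t) ->
    ex_RInt (fun x => RInt (fun t => dens x t) c e) a b /\ RInt (fun x => RInt (fun t => dens x t) c e) a b <= M).
  { intros a b c e ? ? ? ? ? ? H. split. apply ex_RInt_out; try assumption. apply cell_cont; assumption.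
    apply (HM a b c e); assumption. }
  assert (W : forall a b c e, 0 <= a -> a <= b -> b <= d -> -2 <= c -> c <= e -> e <= 3 ->
    (forall s t, rect a b c e s t -> cell eps s t) ->
    ex_RInt (fun x => RInt (fun s => dens s x) a b) c e /\ RInt (fun x => RInt (fun s => dens s x) a b) c e <= M).
  { intros a b c e ? ? ? ? ? ? H. assert (cont_on (rect a b c e) dens) by (apply cell_cont; assumption).
    split. apply ex_RInt_out'; assumption.
    rewrite <- I2_swap by assumption. apply (HM a b c e); assumption. }
  intros f Hf. unfold lines in Hf.
  destruct Hf as [<-|[<-|[<-|[<-|[<-|[<-|[<-|[<-|[<-|[<-|[]]]]]]]]]]].
  - destruct (V r1 r2 (- r2) (1 + r2)) as [V1 V2]; try lra. rect_cell.
    split; [exact V1|]; split; [exact V2|]. intros; apply N1; [lra|]. intros; in_cell.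
  - destruct (V (eps - r2) (eps - r1) (- r2) (1 + r2)) as [V1 V2]; try lra. rect_cell.
    destruct (RInt_reflect _ eps r1 r2 V1) as [X1 X2].
    split; [exact X1|]; split; [rewrite X2; exact V2|]. intros; apply N1; [lra|]. intros; in_cell.
  - destruct (V (eps + r1) (eps + r2) (1 + h1) (1 + r2)) as [V1 V2]; try lra. rect_cell.
    destruct (RInt_affine _ eps r1 r2 V1) as [X1 X2].
    split; [exact X1|]; split; [rewrite X2; exact V2|]. intros; apply N1; [lra|]. intros; in_cell.
  - destruct (V (d - r2) (d - r1) (1 + h1) (1 + r2)) as [V1 V2]; try lra. rect_cell.
    destruct (RInt_reflect _ d r1 r2 V1) as [X1 X2].
    split; [exact X1|]; split; [rewrite X2; exact V2|]. intros; apply N1; [lra|]. intros; in_cell.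
  - destruct (V (eps + r1) (eps + r2) (- r2) (- h1)) as [V1 V2]; try lra. rect_cell.
    destruct (RInt_affine _ eps r1 r2 V1) as [X1 X2].
    split; [exact X1|]; split; [rewrite X2; exact V2|]. intros; apply N1; [lra|]. intros; in_cell.
  - destruct (V (d - r2) (d - r1) (- r2) (- h1)) as [V1 V2]; try lra. rect_cell.
    destruct (RInt_reflect _ d r1 r2 V1) as [X1 X2].
    split; [exact X1|]; split; [rewrite X2; exact V2|]. intros; apply N1; [lra|]. intros; in_cell.
  - destruct (W 0 d (1 + r1) (1 + r2)) as [V1 V2]; try lra. rect_cell.
    destruct (RInt_affine _ 1 r1 r2 V1) as [X1 X2].
    split; [exact X1|]; split; [rewrite X2; exact V2|]. intros; apply N2; [lra|]. intros; in_cell.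
  - assert (E : forall x, - x = 0 - x) by (intros; ring).
    destruct (W 0 d (0 - r2) (0 - r1)) as [V1 V2]; try lra. rect_cell.
    destruct (RInt_reflect _ 0 r1 r2 V1) as [X1 X2].
    split; [|split].
    + eapply ex_RInt_ext; [|exact X1]. intros x _. rewrite E. reflexivity.
    + rewrite (RInt_ext _ (fun x => RInt (fun s => dens s (0 - x)) 0 d)) by (intros; rewrite E; reflexivity).
      rewrite X2; exact V2.
    + intros; apply N2; [lra|]. intros; in_cell.
  - destruct (W h1 (eps - h1) (1 - r2) (1 - r1)) as [V1 V2]; try lra. rect_cell.
    destruct (RInt_reflect _ 1 r1 r2 V1) as [X1 X2].
    split; [exact X1|]; split; [rewrite X2; exact V2|]. intros; apply N2; [lra|]. intros; in_cell.
  - destruct (W h1 (eps - h1) r1 r2) as [V1 V2]; try lra. rect_cell.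
    split; [exact V1|]; split; [exact V2|]. intros; apply N2; [lra|]. intros; in_cell.
Qed.

(** The cell is decomposed into a central column of the slit reaching rho beyond both openings, two
    strips along the slit walls and two along the horizontal faces, each stopping at distance h1
    from the metal, and two half-plane pieces whose lateral fluxes cancel by periodicity. Segments
    within rho of a corner are handled by [segment_small], segments along the metal by the tolerance
    g1. The constants 6, 18 and 4 count the small areas, the corner segments and the metal sides. *)
Lemma cell_green_at mu r1 r2 h1 rho tp tm g1 : 0 < mu -> 0 < h1 -> h1 < r1 -> r1 <= rho <= r2 -> 0 < r1 ->
  r2 <= eps / 4 -> r2 <= (d - eps) / 4 -> r2 <= 1 / 4 -> 1 + r2 <= tp <= 3 -> -2 <= tm <= - r2 ->
  2 * r2 * (1 + d) <= mu ^ 2 ->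
  0 <= g1 -> g1 * (1 + d) <= mu ->
  (forall t, r1 <= t <= 1 - r1 -> Rabs (F1 h1 t) <= g1 /\ Rabs (F1 (eps - h1) t) <= g1) ->
  (forall s, eps + r1 <= s <= d - r1 -> Rabs (F2 s (1 + h1)) <= g1 /\ Rabs (F2 s (- h1)) <= g1) ->
  (forall f, In f (lines r2 h1) -> rho * f rho <= mu ^ 2) ->
  I2 Dv rho (eps - rho) 0 1 + I2 Dv 0 d (1 + rho) tp + I2 Dv 0 d tm (- rho)
   - (6 * (M + K) + 18 * (1 + 2 * K) + 4) * mu
  <= RInt (fun s => F2 s tp) 0 d - RInt (fun s => F2 s tm) 0 d.
Proof.
  intros Hmu Hh1 Hh1r Hrho Hr1 H4 H5 H6 Htp Htm Har Hg1 Hgmu W1 W2 HL.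
  set (e1 := (1 + 2 * K) * mu). set (ea := (M + K) * mu).
  assert (LV1 := HL _ (or_introl eq_refl)).
  assert (LV2 := HL _ (or_intror (or_introl eq_refl))).
  assert (LV3 := HL _ (or_intror (or_intror (or_introl eq_refl)))).
  assert (LV4 := HL _ (or_intror (or_intror (or_intror (or_introl eq_refl))))).
  assert (LV5 := HL _ (or_intror (or_intror (or_intror (or_intror (or_introl eq_refl)))))).
  assert (LV6 := HL _ (or_intror (or_intror (or_intror (or_intror (or_intror (or_introl eq_refl))))))).
  assert (LH1 := HL _ (or_intror (or_intror (or_intror (or_intror (or_intror (or_intror (or_introl eq_refl)))))))).
  assert (LH2 := HL _ (or_intror (or_intror (or_intror (or_intror (or_intror (or_intror (or_intror (or_introl eq_refl))))))))).
  assert (LH3 := HL _ (or_intror (or_intror (or_intror (or_intror (or_intror (or_intror (or_intror (or_intror (or_introl eq_refl)))))))))).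
  assert (LH4 := HL _ (or_intror (or_intror (or_intror (or_intror (or_intror (or_intror (or_intror (or_intror (or_intror (or_introl eq_refl))))))))))).
  cbv beta in LV1, LV2, LV3, LV4, LV5, LV6, LH1, LH2, LH3, LH4. clear HL.
  assert (SV : forall s x y c e, x <= y -> y - x <= 2 * rho -> c <= x -> y <= e ->
     (forall t, c <= t <= e -> cell eps s t) -> rho * RInt (fun t => dens s t) c e <= mu ^ 2 ->
     - e1 <= RInt (fun t => F1 s t) x y <= e1).
  { intros s x y c e Hxy Hl Hcx Hye Hc Hs. apply Rabs_le_between.
    apply (segment_small (fun t => F1 s t) (fun t => dens s t) K x y c e rho mu); try lra.
    apply ex_line_t; auto. intros; apply Hc; lra. apply ex_line_t; auto; lra.
    intros; apply Hdens, Hc; assumption. intros; apply HF1; [apply Hc; lra|assumption]. }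
  assert (SH : forall t x y a b, x <= y -> y - x <= 2 * rho -> a <= x -> y <= b ->
     (forall s, a <= s <= b -> cell eps s t) -> rho * RInt (fun s => dens s t) a b <= mu ^ 2 ->
     - e1 <= RInt (fun s => F2 s t) x y <= e1).
  { intros t x y a b Hxy Hl Hcx Hye Hc Hs. apply Rabs_le_between.
    apply (segment_small (fun s => F2 s t) (fun s => dens s t) K x y a b rho mu); try lra.
    apply ex_line_s; auto. intros; apply Hc; lra. apply ex_line_s; auto; lra.
    intros; apply Hdens, Hc; assumption. intros; apply HF2; [apply Hc; lra|assumption]. }
  assert (AR : forall a b c e, 0 <= a -> a <= b -> b <= d -> -2 <= c -> c <= e -> e <= 3 ->
    (forall s t, rect a b c e s t -> cell eps s t) -> (b - a) * (e - c) <= mu ^ 2 -> - ea <= I2 Dv a b c e).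
  { intros. apply area_lower; assumption. }
  assert (Ga : forall l w, 0 <= l -> l <= 1 + d -> 0 <= w -> w <= r2 -> l * w <= mu ^ 2 /\ w * l <= mu ^ 2).
  { intros l w Hl0 Hl Hw0 Hw.
    assert (l * w <= (1 + d) * r2) by (apply Rmult_le_compat; lra).
    assert (0 < r2 * (1 + d)) by (apply Rmult_lt_0_compat; lra). lra. }
  assert (Gw : forall l, 0 <= l <= 1 + d -> l * g1 <= mu).
  { intros l Hl. assert (l * g1 <= (1 + d) * g1) by (apply Rmult_le_compat_r; lra). lra. }
  assert (Rp : RInt (fun s => F2 s tp) 0 d - RInt (fun s => F2 s (1 + rho)) 0 d = I2 Dv 0 d (1 + rho) tp).
  { rewrite (flux_identity 0 d (1 + rho) tp); try lra. 2: rect_cell.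
    rewrite (RInt_ext_R (fun t => F1 d t) (fun t => F1 0 t)). ring. lra. intros; apply Hper; lra. }
  assert (Rm : RInt (fun s => F2 s (- rho)) 0 d - RInt (fun s => F2 s tm) 0 d = I2 Dv 0 d tm (- rho)).
  { rewrite (flux_identity 0 d tm (- rho)); try lra. 2: rect_cell.
    rewrite (RInt_ext_R (fun t => F1 d t) (fun t => F1 0 t)). ring. lra. intros; apply Hper; lra. }
  assert (Rc := flux_identity rho (eps - rho) (- rho) (1 + rho) ltac:(lra) ltac:(lra) ltac:(rect_cell)).
  assert (Rc' : I2 Dv rho (eps - rho) (- rho) (1 + rho) =
    I2 Dv rho (eps - rho) (- rho) 0 + (I2 Dv rho (eps - rho) 0 1 + I2 Dv rho (eps - rho) 1 (1 + rho))).
  { assert (CD : cont_on (rect rho (eps - rho) (- rho) (1 + rho)) Dv).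
    { pose proof (cell_cont F11 rho (eps - rho) (- rho) (1 + rho) C11 ltac:(rect_cell)).
      pose proof (cell_cont F22 rho (eps - rho) (- rho) (1 + rho) C22 ltac:(rect_cell)).
      intros s t Hst. unfold Dv. c2d. }
    rewrite (I2_split_t rho (eps - rho) (- rho) (1 + rho) ltac:(lra) ltac:(lra) Dv 0) by (assumption || lra).
    rewrite (I2_split_t rho (eps - rho) 0 (1 + rho) ltac:(lra) ltac:(lra) Dv 1); try lra.
    apply (cont_on_sub (rect rho (eps - rho) (- rho) (1 + rho))); [intros s t [? ?]; split; lra|assumption]. }
  rewrite Rc' in Rc. clear Rc'.
  assert (Ac1 := AR rho (eps - rho) (- rho) 0 ltac:(lra) ltac:(lra) ltac:(lra) ltac:(lra) ltac:(lra) ltac:(lra) ltac:(rect_cell)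
     ltac:(first [apply (fun u v x y => proj1 (Ga _ _ u v x y)); lra | apply (fun u v x y => proj2 (Ga _ _ u v x y)); lra])).
  assert (Ac2 := AR rho (eps - rho) 1 (1 + rho) ltac:(lra) ltac:(lra) ltac:(lra) ltac:(lra) ltac:(lra) ltac:(lra) ltac:(rect_cell)
     ltac:(first [apply (fun u v x y => proj1 (Ga _ _ u v x y)); lra | apply (fun u v x y => proj2 (Ga _ _ u v x y)); lra])).
  assert (Sp : forall s, (forall t, - rho <= t <= 1 + rho -> cell eps s t) ->
    RInt (fun t => F1 s t) (- rho) (1 + rho) = RInt (fun t => F1 s t) (- rho) rho +
     (RInt (fun t => F1 s t) rho (1 - rho) + RInt (fun t => F1 s t) (1 - rho) (1 + rho))).
  { intros s Hs. rewrite (RInt_Chasles_R (fun t => F1 s t) (- rho) rho (1 + rho)), (RInt_Chasles_R (fun t => F1 s t) rho (1 - rho) (1 + rho)).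
    reflexivity. all: apply ex_line_t; auto; try lra; intros; apply Hs; lra. }
  rewrite (Sp rho) in Rc by (intros; in_cell). rewrite (Sp (eps - rho)) in Rc by (intros; in_cell). clear Sp.
  assert (B1 := SV rho (- rho) rho (- r2) (1 + r2) ltac:(lra) ltac:(lra) ltac:(lra) ltac:(lra) ltac:(intros; in_cell) LV1).
  assert (B2 := SV rho (1 - rho) (1 + rho) (- r2) (1 + r2) ltac:(lra) ltac:(lra) ltac:(lra) ltac:(lra) ltac:(intros; in_cell) LV1).
  assert (B3 := SV (eps - rho) (- rho) rho (- r2) (1 + r2) ltac:(lra) ltac:(lra) ltac:(lra) ltac:(lra) ltac:(intros; in_cell) LV2).
  assert (B4 := SV (eps - rho) (1 - rho) (1 + rho) (- r2) (1 + r2) ltac:(lra) ltac:(lra) ltac:(lra) ltac:(lra) ltac:(intros; in_cell) LV2).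
  assert (Ml := flux_identity h1 rho rho (1 - rho) ltac:(lra) ltac:(lra) ltac:(rect_cell)).
  assert (Al := AR h1 rho rho (1 - rho) ltac:(lra) ltac:(lra) ltac:(lra) ltac:(lra) ltac:(lra) ltac:(lra) ltac:(rect_cell)
     ltac:(first [apply (fun u v x y => proj1 (Ga _ _ u v x y)); lra | apply (fun u v x y => proj2 (Ga _ _ u v x y)); lra])).
  assert (Ml1 := SH (1 - rho) h1 rho h1 (eps - h1) ltac:(lra) ltac:(lra) ltac:(lra) ltac:(lra) ltac:(intros; in_cell) LH3).
  assert (Ml2 := SH rho h1 rho h1 (eps - h1) ltac:(lra) ltac:(lra) ltac:(lra) ltac:(lra) ltac:(intros; in_cell) LH4).
  assert (Wl : - mu <= RInt (fun t => F1 h1 t) rho (1 - rho) <= mu).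
  { apply Rabs_le_between. eapply Rle_trans; [|apply (Gw (1 - rho - rho)); lra].
    apply abs_RInt_le_const; [lra| |]. apply ex_line_t; auto. lra. intros; in_cell.
    intros t Ht. apply W1; lra. }
  assert (Mr := flux_identity (eps - rho) (eps - h1) rho (1 - rho) ltac:(lra) ltac:(lra) ltac:(rect_cell)).
  assert (Ar := AR (eps - rho) (eps - h1) rho (1 - rho) ltac:(lra) ltac:(lra) ltac:(lra) ltac:(lra) ltac:(lra) ltac:(lra) ltac:(rect_cell)
     ltac:(first [apply (fun u v x y => proj1 (Ga _ _ u v x y)); lra | apply (fun u v x y => proj2 (Ga _ _ u v x y)); lra])).
  assert (Mr1 := SH (1 - rho) (eps - rho) (eps - h1) h1 (eps - h1) ltac:(lra) ltac:(lra) ltac:(lra) ltac:(lra) ltac:(intros; in_cell) LH3).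
  assert (Mr2 := SH rho (eps - rho) (eps - h1) h1 (eps - h1) ltac:(lra) ltac:(lra) ltac:(lra) ltac:(lra) ltac:(intros; in_cell) LH4).
  assert (Wr : - mu <= RInt (fun t => F1 (eps - h1) t) rho (1 - rho) <= mu).
  { apply Rabs_le_between. eapply Rle_trans; [|apply (Gw (1 - rho - rho)); lra].
    apply abs_RInt_le_const; [lra| |]. apply ex_line_t; auto. lra. intros; in_cell.
    intros t Ht. apply W1; lra. }
  assert (Mt := flux_identity (eps + rho) (d - rho) (1 + h1) (1 + rho) ltac:(lra) ltac:(lra) ltac:(rect_cell)).
  assert (At := AR (eps + rho) (d - rho) (1 + h1) (1 + rho) ltac:(lra) ltac:(lra) ltac:(lra) ltac:(lra) ltac:(lra) ltac:(lra) ltac:(rect_cell)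
     ltac:(first [apply (fun u v x y => proj1 (Ga _ _ u v x y)); lra | apply (fun u v x y => proj2 (Ga _ _ u v x y)); lra])).
  assert (Mt1 := SV (d - rho) (1 + h1) (1 + rho) (1 + h1) (1 + r2) ltac:(lra) ltac:(lra) ltac:(lra) ltac:(lra) ltac:(intros; in_cell) LV4).
  assert (Mt2 := SV (eps + rho) (1 + h1) (1 + rho) (1 + h1) (1 + r2) ltac:(lra) ltac:(lra) ltac:(lra) ltac:(lra) ltac:(intros; in_cell) LV3).
  assert (Wt : - mu <= RInt (fun s => F2 s (1 + h1)) (eps + rho) (d - rho) <= mu).
  { apply Rabs_le_between. eapply Rle_trans; [|apply (Gw (d - rho - (eps + rho))); lra].
    apply abs_RInt_le_const; [lra| |]. apply ex_line_s; auto. lra. intros; in_cell.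
    intros t Ht. apply W2; lra. }
  assert (Mb := flux_identity (eps + rho) (d - rho) (- rho) (- h1) ltac:(lra) ltac:(lra) ltac:(rect_cell)).
  assert (Ab := AR (eps + rho) (d - rho) (- rho) (- h1) ltac:(lra) ltac:(lra) ltac:(lra) ltac:(lra) ltac:(lra) ltac:(lra) ltac:(rect_cell)
     ltac:(first [apply (fun u v x y => proj1 (Ga _ _ u v x y)); lra | apply (fun u v x y => proj2 (Ga _ _ u v x y)); lra])).
  assert (Mb1 := SV (d - rho) (- rho) (- h1) (- r2) (- h1) ltac:(lra) ltac:(lra) ltac:(lra) ltac:(lra) ltac:(intros; in_cell) LV6).
  assert (Mb2 := SV (eps + rho) (- rho) (- h1) (- r2) (- h1) ltac:(lra) ltac:(lra) ltac:(lra) ltac:(lra) ltac:(intros; in_cell) LV5).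
  assert (Wb : - mu <= RInt (fun s => F2 s (- h1)) (eps + rho) (d - rho) <= mu).
  { apply Rabs_le_between. eapply Rle_trans; [|apply (Gw (d - rho - (eps + rho))); lra].
    apply abs_RInt_le_const; [lra| |]. apply ex_line_s; auto. lra. intros; in_cell.
    intros t Ht. apply W2; lra. }
  assert (Sp : forall t, (forall s, 0 <= s <= d -> cell eps s t) ->
    RInt (fun s => F2 s t) 0 d = RInt (fun s => F2 s t) 0 rho +
     (RInt (fun s => F2 s t) rho (eps - rho) + (RInt (fun s => F2 s t) (eps - rho) (eps + rho) +
      (RInt (fun s => F2 s t) (eps + rho) (d - rho) + RInt (fun s => F2 s t) (d - rho) d)))).
  { intros t Ht. rewrite (RInt_Chasles_R (fun s => F2 s t) 0 rho d), (RInt_Chasles_R (fun s => F2 s t) rho (eps - rho) d),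
      (RInt_Chasles_R (fun s => F2 s t) (eps - rho) (eps + rho) d), (RInt_Chasles_R (fun s => F2 s t) (eps + rho) (d - rho) d).
    reflexivity. all: apply ex_line_s; auto; try lra; intros; apply Ht; lra. }
  assert (Spt := Sp (1 + rho) ltac:(intros; in_cell)). assert (Spb := Sp (- rho) ltac:(intros; in_cell)). clear Sp.
  assert (T1 := SH (1 + rho) 0 rho 0 d ltac:(lra) ltac:(lra) ltac:(lra) ltac:(lra) ltac:(intros; in_cell) LH1).
  assert (T2 := SH (1 + rho) (eps - rho) (eps + rho) 0 d ltac:(lra) ltac:(lra) ltac:(lra) ltac:(lra) ltac:(intros; in_cell) LH1).
  assert (T3 := SH (1 + rho) (d - rho) d 0 d ltac:(lra) ltac:(lra) ltac:(lra) ltac:(lra) ltac:(intros; in_cell) LH1).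
  assert (T4 := SH (- rho) 0 rho 0 d ltac:(lra) ltac:(lra) ltac:(lra) ltac:(lra) ltac:(intros; in_cell) LH2).
  assert (T5 := SH (- rho) (eps - rho) (eps + rho) 0 d ltac:(lra) ltac:(lra) ltac:(lra) ltac:(lra) ltac:(intros; in_cell) LH2).
  assert (T6 := SH (- rho) (d - rho) d 0 d ltac:(lra) ltac:(lra) ltac:(lra) ltac:(lra) ltac:(intros; in_cell) LH2).
  clear SV SH AR Ga Gw LV1 LV2 LV3 LV4 LV5 LV6 LH1 LH2 LH3 LH4 W1 W2.
  replace ((6 * (M + K) + 18 * (1 + 2 * K) + 4) * mu) with (6 * ea + 18 * e1 + 4 * mu) by (unfold ea, e1; ring).
  lra.
Qed.

(** The vector field is abstract because the result serves both the damped energy flux and the flux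
    against a plane wave. The order of choices matters: mu from g, then r2, then r1, then the wall
    distance h1 for the compact pieces fixed by r1, and rho last, since the lines depend on h1. *)
Lemma cell_green tp tm g r0 : 1 < tp <= 3 -> -2 <= tm < 0 -> 0 < g -> 0 < r0 ->
  exists rho, 0 < rho < r0 /\ 1 + rho < tp /\ tm < - rho /\
  I2 Dv rho (eps - rho) 0 1 + I2 Dv 0 d (1 + rho) tp + I2 Dv 0 d tm (- rho) - g
  <= RInt (fun s => F2 s tp) 0 d - RInt (fun s => F2 s tm) 0 d.
Proof.
  intros Htp Htm Hg Hr0.
  assert (HM0 : 0 <= M).
  { eapply Rle_trans; [|apply (HM 0 d 2 3)]; try lra. 2: rect_cell.
    apply I2_nonneg; try lra. apply cell_cont; [assumption|rect_cell].
    intros s t [? ?]. apply Hdens. in_cell. }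
  set (Ct := 6 * (M + K) + 18 * (1 + 2 * K) + 4). assert (HCt : 0 < Ct) by (unfold Ct; lra).
  set (mu := g / Ct). assert (Hmu : 0 < mu) by (apply Rdiv_lt_0_compat; assumption).
  assert (Hmu2 : 0 < mu ^ 2) by (apply pow_lt; assumption).
  set (r2 := Rmin (Rmin (r0 / 2) (Rmin (eps / 4) ((d - eps) / 4)))
     (Rmin (Rmin (1 / 4) ((tp - 1) / 2)) (Rmin (- tm / 2) (mu ^ 2 / (2 * (1 + d)))))).
  assert (Hr2 : 0 < r2).
  { repeat apply Rmin_pos; try lra. apply Rdiv_lt_0_compat; lra. }
  assert (L1 : r2 <= r0 / 2 /\ r2 <= eps / 4 /\ r2 <= (d - eps) / 4 /\ r2 <= 1 / 4 /\ r2 <= (tp - 1) / 2 /\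
    r2 <= - tm / 2 /\ r2 <= mu ^ 2 / (2 * (1 + d))).
  { unfold r2. repeat split.
    - eapply Rle_trans; [apply Rmin_l|]. apply Rmin_l.
    - eapply Rle_trans; [apply Rmin_l|]. eapply Rle_trans; [apply Rmin_r|]. apply Rmin_l.
    - eapply Rle_trans; [apply Rmin_l|]. eapply Rle_trans; [apply Rmin_r|]. apply Rmin_r.
    - eapply Rle_trans; [apply Rmin_r|]. eapply Rle_trans; [apply Rmin_l|]. apply Rmin_l.
    - eapply Rle_trans; [apply Rmin_r|]. eapply Rle_trans; [apply Rmin_l|]. apply Rmin_r.
    - eapply Rle_trans; [apply Rmin_r|]. eapply Rle_trans; [apply Rmin_r|]. apply Rmin_l.
    - eapply Rle_trans; [apply Rmin_r|]. eapply Rle_trans; [apply Rmin_r|]. apply Rmin_r. }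
  destruct L1 as [L1 [L2 [L3 [L4 [L5 [L6 L7]]]]]]. clearbody r2.
  (* With ten lines of energy at most M, [good_radius] asks for mu^2 ln (r2 / r1) > 10 M; the ratio
     exp T gives 10 M + 1. *)
  set (T := (10 * M + 1) / mu ^ 2). assert (HT : 0 < T) by (apply Rdiv_lt_0_compat; lra).
  set (r1 := r2 * exp (- T)).
  assert (Hex : 0 < exp (- T) < 1).
  { split; [apply exp_pos|]. rewrite <- exp_0. apply exp_increasing. lra. }
  assert (Hr1 : 0 < r1) by (apply Rmult_lt_0_compat; lra).
  assert (Hr12 : r1 < r2) by (unfold r1; nra).
  set (g1 := mu / (1 + d)). assert (Hg1 : 0 < g1) by (apply Rdiv_lt_0_compat; lra).
  destruct (HW1 r1 (1 - r1) g1) as [ha [Hha Wa]]; try lra.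
  destruct (HW2 (eps + r1) (d - r1) g1) as [hb [Hhb Wb]]; try lra.
  set (h1 := Rmin (r1 / 2) (Rmin (ha / 2) (hb / 2))).
  assert (Hh1 : 0 < h1) by (repeat apply Rmin_pos; lra).
  assert (Hh1a : h1 <= r1 / 2) by apply Rmin_l.
  assert (Hh1b : h1 <= ha / 2) by (eapply Rle_trans; [apply Rmin_r|apply Rmin_l]).
  assert (Hh1c : h1 <= hb / 2) by (eapply Rle_trans; [apply Rmin_r|apply Rmin_r]).
  destruct (good_radius (lines r2 h1) M (mu ^ 2) r1 r2 Hr1 Hr12) as [rho [Hrho HL]].
  { apply lines_ok; lra. }
  { unfold lines. cbn [length INR].
    replace (r2 / r1) with (exp T). rewrite ln_exp. unfold T.
    replace (mu ^ 2 * ((10 * M + 1) / mu ^ 2)) with (10 * M + 1) by (field; lra). lra.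
    unfold r1. rewrite exp_Ropp. pose proof (exp_pos T). field; lra. }
  exists rho. split; [lra|]. split; [lra|]. split; [lra|].
  eapply Rle_trans; [|apply (cell_green_at mu r1 r2 h1 rho tp tm g1)]; try lra.
  - fold Ct. unfold mu. replace (Ct * (g / Ct)) with g by (field; lra). lra.
  - apply (Rmult_le_compat_r (2 * (1 + d))) in L7; [|lra].
    replace (mu ^ 2 / (2 * (1 + d)) * (2 * (1 + d))) with (mu ^ 2) in L7 by (field; lra). lra.
  - unfold g1. right; field; lra.
  - intros t Ht. apply Wa; lra.
  - intros s Hs. apply Wb; lra.
  - exact HL.
Qed.
End Green.

(** * Evanescent fields in a half-strip *)

Record C2r (D : R -> R -> Prop) (z z1 z2 z11 z22 z12 : R -> R -> R) : Prop := {
  c2_d1 : forall s t, D s t -> is_derive (fun x => z x t) s (z1 s t);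
  c2_d2 : forall s t, D s t -> is_derive (fun y => z s y) t (z2 s t);
  c2_d11 : forall s t, D s t -> is_derive (fun x => z1 x t) s (z11 s t);
  c2_d22 : forall s t, D s t -> is_derive (fun y => z2 s y) t (z22 s t);
  c2_d12 : forall s t, D s t -> is_derive (fun y => z1 s y) t (z12 s t);
  c2_c0 : cont_on D z; c2_c1 : cont_on D z1; c2_c2 : cont_on D z2;
  c2_c11 : cont_on D z11; c2_c22 : cont_on D z22; c2_c12 : cont_on D z12
}.

(** When the mean vanishes, the integral over s of (f(x) - f(s))^2 is at least d f(x)^2, and each
    increment squared is at most d times the integral of f'^2. The constant is crude; its scaling in
    d is what counts. *)
Lemma poincare_mean_zero (f f' : R -> R) d : 0 < d ->
  (forall s, 0 <= s <= d -> is_derive f s (f' s)) -> (forall s, 0 <= s <= d -> continuous f' s) ->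
  RInt f 0 d = 0 -> RInt (fun s => f s ^ 2) 0 d <= d ^ 2 * RInt (fun s => f' s ^ 2) 0 d.
Proof.
  intros Hd HD HC H0.
  assert (Cf : forall s, 0 <= s <= d -> continuous f s).
  { intros s Hs. apply (ex_derive_continuous (K := R_AbsRing) (V := R_NormedModule)). eexists; apply HD, Hs. }
  assert (Xf : ex_RInt f 0 d) by (apply ex_RInt_cont; [lra|assumption]).
  assert (Xf2 : ex_RInt (fun s => f s ^ 2) 0 d).
  { apply ex_RInt_cont; [lra|]. intros; apply cont_pow2, Cf; assumption. }
  assert (I := increment_sqr f f' 0 d).
  revert I. generalize (RInt (fun s => f' s ^ 2) 0 d : R). intros K I.
  assert (Q : forall x, 0 <= x <= d -> f x ^ 2 <= d * K).
  { intros x Hx.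
    assert (A : RInt (fun s => (f s ^ 2 - 2 * f x * f s) + f x ^ 2) 0 d <= RInt (fun _ => d * K) 0 d).
    { apply RInt_le_R; [lra| |apply ex_RInt_const_R|].
      apply ex_RInt_plus_R; [apply ex_RInt_minus_R; [assumption|apply ex_RInt_scal_R; assumption]|apply ex_RInt_const_R].
      intros s Hs. specialize (I x s ltac:(lra) HD HC Hx Hs). lra. }
    assert (X2 : ex_RInt (fun s => 2 * f x * f s) 0 d) by (apply ex_RInt_scal_R; assumption).
    rewrite (RInt_plus_R (fun s => f s ^ 2 - 2 * f x * f s) (fun _ => f x ^ 2) 0 d
      (ex_RInt_minus_R _ _ _ _ Xf2 X2) (ex_RInt_const_R _ _ _)) in A.
    rewrite (RInt_minus_R (fun s => f s ^ 2) (fun s => 2 * f x * f s) 0 d Xf2 X2) in A.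
    rewrite (RInt_scal_R f (2 * f x) 0 d Xf), !RInt_const_R, H0 in A.
    assert (0 <= RInt (fun s => f s ^ 2) 0 d) by (apply RInt_nonneg; [lra|assumption|intros; apply pow2_ge_0]).
    apply (Rmult_le_reg_l d); [assumption|]. lra. }
  apply Rle_trans with (RInt (fun _ => d * K) 0 d).
  apply RInt_le_R; [lra|assumption|apply ex_RInt_const_R|assumption].
  rewrite RInt_const_R. right. rewrite Rminus_0_r. ring.
Qed.

Lemma deriv_int_above (f f2 : R -> R -> R) a b t : a <= b -> 1 < t ->
  (forall s t, 1 < t -> is_derive (fun y => f s y) t (f2 s t)) ->
  cont_on (fun _ t => 1 < t) f -> cont_on (fun _ t => 1 < t) f2 ->
  is_derive (fun y => RInt (fun s => f s y) a b) t (RInt (fun s => f2 s t) a b).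
Proof.
  intros Hab Ht HD C C2.
  assert (L : locally t (fun y => 1 < y)).
  { apply (open_gt 1). exact Ht. }
  rewrite (RInt_ext_R (fun s => f2 s t) (fun s => Derive (fun u => f s u) t)) by
    (try assumption; intros; symmetry; apply is_derive_unique, HD; assumption).
  apply (is_derive_RInt_param (fun u s => f s u) a b t).
  - apply (filter_imp (fun y => 1 < y)); [|exact L]. intros y Hy s _. eexists; apply HD, Hy.
  - intros s _. apply (continuity_2d_pt_ext_loc (fun u v => f2 v u)).
    + destruct L as [dl Hdl]. exists dl. intros u v Hu _. symmetry. apply is_derive_unique, HD.
      apply Hdl. exact Hu.
    + apply cont_2d_swap, C2, Ht.
  - apply (filter_imp (fun y => 1 < y)); [|exact L]. intros y Hy.
    apply ex_RInt_cont; [assumption|]. intros s _. apply (cont_2d_fst f), C, Hy.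
Qed.

Section HalfStrip.
Variables k d kap : R.
Variables A A1 A2 A11 A22 A12 B B1 B2 B11 B22 B12 : R -> R -> R.
Hypothesis Hd : 0 < d.
Hypothesis Hk : 0 <= k.
Hypothesis Hkd : k * d <= 1 / 10.
Hypothesis Hkap : Rabs kap <= k.
Hypothesis CA : C2r (fun _ t => 1 < t) A A1 A2 A11 A22 A12.
Hypothesis CB : C2r (fun _ t => 1 < t) B B1 B2 B11 B22 B12.
Hypothesis EA : forall s t, 1 < t -> A11 s t + A22 s t + k ^ 2 * A s t = 0.
Hypothesis EB : forall s t, 1 < t -> B11 s t + B22 s t + k ^ 2 * B s t = 0.
Hypothesis QP : forall t, 1 < t -> A d t * A1 d t + B d t * B1 d t = A 0 t * A1 0 t + B 0 t * B1 0 t.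
Hypothesis Mz1 : forall t, 1 < t -> RInt (fun s => cos (kap * s) * A s t + sin (kap * s) * B s t) 0 d = 0.
Hypothesis Mz2 : forall t, 1 < t -> RInt (fun s => cos (kap * s) * B s t - sin (kap * s) * A s t) 0 d = 0.
Hypothesis Dec : forall g, 0 < g -> exists T, forall t s, T <= t -> 0 <= s <= d -> A s t ^ 2 + B s t ^ 2 <= g.

Let V2 := fun s t => A s t ^ 2 + B s t ^ 2.
Let Gr := fun s t => A1 s t ^ 2 + B1 s t ^ 2 + A2 s t ^ 2 + B2 s t ^ 2.
Let G := fun t => RInt (fun s => V2 s t) 0 d.
Let J := fun t => RInt (fun s => A s t * A2 s t + B s t * B2 s t) 0 d.
Let E := fun t => RInt (fun s => Gr s t) 0 d.

Let rc f t tau : cont_on (fun _ t => 1 < t) f -> 1 < t -> cont_on (rect 0 d t tau) f.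
Proof. intros Hf Ht. apply (cont_on_sub (fun _ t => 1 < t)); [|assumption]. intros s y [_ ?]; lra. Qed.
Let ra f t a b : cont_on (fun _ t => 1 < t) f -> 1 < t -> a <= b -> ex_RInt (fun s => f s t) a b.
Proof. intros Hf Ht Hab. apply ex_RInt_cont; [assumption|]. intros s _. apply (cont_2d_fst f), Hf, Ht. Qed.
Let cV2 : cont_on (fun _ t => 1 < t) V2.
Proof. pose proof (c2_c0 _ _ _ _ _ _ _ CA). pose proof (c2_c0 _ _ _ _ _ _ _ CB). intros s t Ht. unfold V2. c2d. Qed.
Let cGr : cont_on (fun _ t => 1 < t) Gr.
Proof.
  pose proof (c2_c1 _ _ _ _ _ _ _ CA). pose proof (c2_c1 _ _ _ _ _ _ _ CB).
  pose proof (c2_c2 _ _ _ _ _ _ _ CA). pose proof (c2_c2 _ _ _ _ _ _ _ CB). intros s t Ht. unfold Gr. c2d.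
Qed.
Let cJ : cont_on (fun _ t => 1 < t) (fun s t => A s t * A2 s t + B s t * B2 s t).
Proof.
  pose proof (c2_c0 _ _ _ _ _ _ _ CA). pose proof (c2_c0 _ _ _ _ _ _ _ CB).
  pose proof (c2_c2 _ _ _ _ _ _ _ CA). pose proof (c2_c2 _ _ _ _ _ _ _ CB). intros s t Ht. c2d.
Qed.

Let xE t tau : 1 < t -> t <= tau -> ex_RInt E t tau.
Proof. intros. apply (ex_RInt_out' 0 d t tau); try lra. apply rc; assumption. Qed.

(** Multiplication by e^{-i kap s} produces the mean-zero functions p and q, at the price of terms
    kap q and kap p in their derivatives. These contribute 2 k^2 d^2 G, which is absorbed because k
    d <= 1/10. *)
Lemma strip_poincare t : 1 < t -> G t <= 4 * d ^ 2 * E t.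
Proof.
  intros Ht.
  pose proof (c2_c0 _ _ _ _ _ _ _ CA) as a0. pose proof (c2_c0 _ _ _ _ _ _ _ CB) as b0.
  pose proof (c2_c1 _ _ _ _ _ _ _ CA) as a1. pose proof (c2_c1 _ _ _ _ _ _ _ CB) as b1.
  set (p := fun s t => cos (kap * s) * A s t + sin (kap * s) * B s t).
  set (q := fun s t => cos (kap * s) * B s t - sin (kap * s) * A s t).
  set (p1 := fun s t => cos (kap * s) * A1 s t + sin (kap * s) * B1 s t + kap * q s t).
  set (q1 := fun s t => cos (kap * s) * B1 s t - sin (kap * s) * A1 s t - kap * p s t).
  assert (cp : cont_on (fun _ t => 1 < t) p) by (intros s y Hy; unfold p; c2d).
  assert (cq : cont_on (fun _ t => 1 < t) q) by (intros s y Hy; unfold q; c2d).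
  assert (cp1 : cont_on (fun _ t => 1 < t) p1) by (intros s y Hy; unfold p1; c2d).
  assert (cq1 : cont_on (fun _ t => 1 < t) q1) by (intros s y Hy; unfold q1; c2d).
  assert (P : RInt (fun s => p s t ^ 2) 0 d <= d ^ 2 * RInt (fun s => p1 s t ^ 2) 0 d).
  { apply (poincare_mean_zero (fun s => p s t) (fun s => p1 s t)); try assumption.
    intros s _. unfold p, p1, q. der. apply (c2_d1 _ _ _ _ _ _ _ CA); assumption.
    apply (c2_d1 _ _ _ _ _ _ _ CB); assumption. simpl; ring.
    intros s _. apply (cont_2d_fst p1), cp1, Ht. apply (Mz1 t Ht). }
  assert (Q : RInt (fun s => q s t ^ 2) 0 d <= d ^ 2 * RInt (fun s => q1 s t ^ 2) 0 d).
  { apply (poincare_mean_zero (fun s => q s t) (fun s => q1 s t)); try assumption.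
    intros s _. unfold q, q1, p. der. apply (c2_d1 _ _ _ _ _ _ _ CB); assumption.
    apply (c2_d1 _ _ _ _ _ _ _ CA); assumption. simpl; ring.
    intros s _. apply (cont_2d_fst q1), cq1, Ht. apply (Mz2 t Ht). }
  assert (S : forall s, cos (kap * s) ^ 2 + sin (kap * s) ^ 2 = 1).
  { intros s. pose proof (sin2_cos2 (kap * s)) as H. unfold Rsqr in H. lra. }
  assert (PQ : G t = RInt (fun s => p s t ^ 2) 0 d + RInt (fun s => q s t ^ 2) 0 d).
  { rewrite <- (RInt_plus_R (fun s => p s t ^ 2) (fun s => q s t ^ 2)).
    - apply RInt_ext_R; [lra|]. intros s _. unfold V2, p, q.
      replace ((cos (kap * s) * A s t + sin (kap * s) * B s t) ^ 2 + (cos (kap * s) * B s t - sin (kap * s) * A s t) ^ 2)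
       with ((cos (kap * s) ^ 2 + sin (kap * s) ^ 2) * (A s t ^ 2 + B s t ^ 2)) by ring. rewrite S. ring.
    - apply (ra (fun s t => p s t ^ 2)); try lra. intros s y Hy; c2d.
    - apply (ra (fun s t => q s t ^ 2)); try lra. intros s y Hy; c2d. }
  assert (R1 : RInt (fun s => p1 s t ^ 2) 0 d + RInt (fun s => q1 s t ^ 2) 0 d <= 2 * E t + 2 * k ^ 2 * G t).
  { rewrite <- (RInt_plus_R (fun s => p1 s t ^ 2) (fun s => q1 s t ^ 2)).
    2:{ apply (ra (fun s t => p1 s t ^ 2)); try lra. intros s y Hy; c2d. }
    2:{ apply (ra (fun s t => q1 s t ^ 2)); try lra. intros s y Hy; c2d. }
    unfold E, G. rewrite <- (RInt_scal_R (fun s => Gr s t)) by (apply ra; assumption || lra).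
    rewrite <- (RInt_scal_R (fun s => V2 s t)) by (apply ra; assumption || lra).
    rewrite <- (RInt_plus_R (fun s => 2 * Gr s t) (fun s => 2 * k ^ 2 * V2 s t)) by
      (apply ex_RInt_scal_R, ra; assumption || lra).
    apply RInt_le_R; [lra| | |].
    - apply (ra (fun s t => p1 s t ^ 2 + q1 s t ^ 2)); try lra. intros s y Hy; c2d.
    - apply ex_RInt_plus_R; apply ex_RInt_scal_R, ra; assumption || lra.
    - intros s _. unfold p1, q1, Gr, V2.
      set (x := cos (kap * s) * A1 s t + sin (kap * s) * B1 s t).
      set (y := cos (kap * s) * B1 s t - sin (kap * s) * A1 s t).
      assert (XY : x ^ 2 + y ^ 2 = A1 s t ^ 2 + B1 s t ^ 2).
      { unfold x, y. replace (_ + _) with ((cos (kap * s) ^ 2 + sin (kap * s) ^ 2) * (A1 s t ^ 2 + B1 s t ^ 2)) by ring. rewrite S. ring. }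
      assert (PQ' : p s t ^ 2 + q s t ^ 2 = A s t ^ 2 + B s t ^ 2).
      { unfold p, q. replace (_ + _) with ((cos (kap * s) ^ 2 + sin (kap * s) ^ 2) * (A s t ^ 2 + B s t ^ 2)) by ring. rewrite S. ring. }
      assert (kap ^ 2 <= k ^ 2) by (rewrite <- (pow2_abs kap); apply pow_incr; split; [apply Rabs_pos|assumption]).
      rewrite <- XY, <- PQ' .
      assert (kap ^ 2 * (p s t ^ 2 + q s t ^ 2) <= k ^ 2 * (p s t ^ 2 + q s t ^ 2)).
      { apply Rmult_le_compat_r; [|assumption]. pose proof (pow2_ge_0 (p s t)). pose proof (pow2_ge_0 (q s t)). lra. }
      pose proof (pow2_ge_0 (x - kap * q s t)). pose proof (pow2_ge_0 (y + kap * p s t)).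
      pose proof (pow2_ge_0 (A2 s t)). pose proof (pow2_ge_0 (B2 s t)).
      rewrite XY in *. lra. }
  assert (0 <= G t) by (apply RInt_nonneg; [lra|apply ra; assumption || lra|]; intros; unfold V2;
     pose proof (pow2_ge_0 (A x t)); pose proof (pow2_ge_0 (B x t)); lra).
  assert (k ^ 2 * d ^ 2 <= 1 / 100).
  { replace (k ^ 2 * d ^ 2) with ((k * d) ^ 2) by ring. replace (1 / 100) with ((1 / 10) ^ 2) by field.
    apply pow_incr. split; [apply Rmult_le_pos; lra|assumption]. }
  assert (0 <= d ^ 2) by apply pow2_ge_0.
  assert (d ^ 2 * (RInt (fun s => p1 s t ^ 2) 0 d + RInt (fun s => q1 s t ^ 2) 0 d) <= d ^ 2 * (2 * E t + 2 * k ^ 2 * G t)) by (apply Rmult_le_compat_l; assumption).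
  assert (k ^ 2 * d ^ 2 * G t <= 1 / 100 * G t) by (apply Rmult_le_compat_r; assumption).
  revert PQ P Q H2 H3 H. generalize (RInt (fun s => p s t ^ 2) 0 d : R) (RInt (fun s => q s t ^ 2) 0 d : R)
   (RInt (fun s => p1 s t ^ 2) 0 d : R) (RInt (fun s => q1 s t ^ 2) 0 d : R) (E t) (G t). intros. lra.
Qed.

Let Enn t : 1 < t -> 0 <= E t.
Proof.
  intros Ht. apply RInt_nonneg; [lra|apply ra; assumption || lra|]. intros s _. unfold Gr.
  pose proof (pow2_ge_0 (A1 s t)). pose proof (pow2_ge_0 (B1 s t)).
  pose proof (pow2_ge_0 (A2 s t)). pose proof (pow2_ge_0 (B2 s t)). lra.
Qed.

(** J' is the integral of the squared gradient minus k^2 times the mass, and by [strip_poincare] the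
    mass term is at most 4 k^2 d^2 E <= E / 25. *)
Lemma strip_flux_growth t tau : 1 < t -> t <= tau -> J t + / 2 * RInt E t tau <= J tau.
Proof.
  intros Ht Htau.
  pose proof (c2_c0 _ _ _ _ _ _ _ CA) as a0. pose proof (c2_c0 _ _ _ _ _ _ _ CB) as b0.
  pose proof (c2_c1 _ _ _ _ _ _ _ CA) as a1. pose proof (c2_c1 _ _ _ _ _ _ _ CB) as b1.
  pose proof (c2_c2 _ _ _ _ _ _ _ CA) as a2. pose proof (c2_c2 _ _ _ _ _ _ _ CB) as b2.
  pose proof (c2_c11 _ _ _ _ _ _ _ CA) as a11. pose proof (c2_c11 _ _ _ _ _ _ _ CB) as b11.
  pose proof (c2_c22 _ _ _ _ _ _ _ CA) as a22. pose proof (c2_c22 _ _ _ _ _ _ _ CB) as b22.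
  assert (Gn : I2 (fun s t => (A1 s t ^ 2 + A s t * A11 s t + (B1 s t ^ 2 + B s t * B11 s t)) + (A2 s t ^ 2 + A s t * A22 s t + (B2 s t ^ 2 + B s t * B22 s t))) 0 d t tau =
    RInt (fun t => (A d t * A1 d t + B d t * B1 d t) - (A 0 t * A1 0 t + B 0 t * B1 0 t)) t tau +
    RInt (fun s => (A s tau * A2 s tau + B s tau * B2 s tau) - (A s t * A2 s t + B s t * B2 s t)) 0 d).
  { apply (green_rect (fun s t => A s t * A1 s t + B s t * B1 s t) (fun s t => A s t * A2 s t + B s t * B2 s t)); try lra.
    - intros s y [_ Hy]. assert (Hy' : 1 < y) by lra. der. apply (c2_d1 _ _ _ _ _ _ _ CA s y Hy').
      apply (c2_d11 _ _ _ _ _ _ _ CA s y Hy'). apply (c2_d1 _ _ _ _ _ _ _ CB s y Hy').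
      apply (c2_d11 _ _ _ _ _ _ _ CB s y Hy'). simpl; ring.
    - intros s y [_ Hy]. assert (Hy' : 1 < y) by lra. der. apply (c2_d2 _ _ _ _ _ _ _ CA s y Hy').
      apply (c2_d22 _ _ _ _ _ _ _ CA s y Hy'). apply (c2_d2 _ _ _ _ _ _ _ CB s y Hy').
      apply (c2_d22 _ _ _ _ _ _ _ CB s y Hy'). simpl; ring.
    - apply rc; [|assumption]. intros s y Hy; c2d.
    - apply rc; [|assumption]. intros s y Hy; c2d. }
  rewrite (RInt_zero (fun t => (A d t * A1 d t + B d t * B1 d t) - (A 0 t * A1 0 t + B 0 t * B1 0 t)) t tau Htau) in Gn
    by (intros y Hy; rewrite (QP y) by lra; ring).
  rewrite (RInt_minus_R (fun s => A s tau * A2 s tau + B s tau * B2 s tau) (fun s => A s t * A2 s t + B s t * B2 s t)) in Gn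
    by (apply (ra (fun s t => A s t * A2 s t + B s t * B2 s t)); assumption || lra).
  fold (J tau) (J t) in Gn.
  rewrite (I2_ext 0 d t tau ltac:(lra) Htau _ (fun s t => Gr s t - k ^ 2 * V2 s t)) in Gn.
  2:{ intros s y [_ Hy]. unfold Gr, V2. pose proof (EA s y ltac:(lra)) as e1. pose proof (EB s y ltac:(lra)) as e2.
      replace (A11 s y) with (- A22 s y - k ^ 2 * A s y) by lra.
      replace (B11 s y) with (- B22 s y - k ^ 2 * B s y) by lra. ring. }
  assert (cD : cont_on (rect 0 d t tau) (fun s t => Gr s t - k ^ 2 * V2 s t)).
  { apply rc; [|assumption]. intros s y Hy; c2d. }
  rewrite I2_swap in Gn by (lra || assumption).
  assert (Lo : RInt (fun y => / 2 * E y) t tau <= RInt (fun y => RInt (fun s => Gr s y - k ^ 2 * V2 s y) 0 d) t tau).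
  { apply RInt_le_R; [assumption| | |].
    - apply ex_RInt_scal_R, xE; assumption.
    - apply (ex_RInt_out' 0 d t tau ltac:(lra) Htau (fun s t => Gr s t - k ^ 2 * V2 s t) cD).
    - intros y Hy. assert (Hy' : 1 < y) by lra.
      rewrite (RInt_minus_R (fun s => Gr s y) (fun s => k ^ 2 * V2 s y)) by (try apply ex_RInt_scal_R; apply ra; assumption || lra).
      rewrite (RInt_scal_R (fun s => V2 s y)) by (apply ra; assumption || lra).
      fold (E y) (G y).
      pose proof (strip_poincare y Hy') as P. pose proof (Enn y Hy') as En.
      assert (k ^ 2 * d ^ 2 <= 1 / 100).
      { replace (k ^ 2 * d ^ 2) with ((k * d) ^ 2) by ring. replace (1 / 100) with ((1 / 10) ^ 2) by field.
        apply pow_incr. split; [apply Rmult_le_pos; lra|assumption]. }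
      assert (k ^ 2 * G y <= k ^ 2 * (4 * d ^ 2 * E y)) by (apply Rmult_le_compat_l; [apply pow2_ge_0|assumption]).
      assert (k ^ 2 * d ^ 2 * E y <= 1 / 100 * E y) by (apply Rmult_le_compat_r; assumption).
      lra. }
  rewrite (RInt_scal_R E) in Lo by (apply xE; assumption). lra.
Qed.

Lemma strip_mass_increment t tau : 1 < t -> t <= tau -> G tau - G t = RInt (fun y => 2 * J y) t tau /\ ex_RInt J t tau.
Proof.
  intros Ht Htau.
  assert (X : ex_RInt J t tau).
  { apply (ex_RInt_out' 0 d t tau ltac:(lra) Htau (fun s t => A s t * A2 s t + B s t * B2 s t)). apply rc; assumption. }
  split; [|assumption].
  assert (Gn : I2 (fun s t => 0 + 2 * (A s t * A2 s t + B s t * B2 s t)) 0 d t tau =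
    RInt (fun t => 0 - 0) t tau + RInt (fun s => V2 s tau - V2 s t) 0 d).
  { apply (green_rect (fun _ _ => 0) V2 (fun _ _ => 0) (fun s t => 2 * (A s t * A2 s t + B s t * B2 s t))); try lra.
    - intros; apply is_der_const.
    - intros s y [_ Hy]. assert (Hy' : 1 < y) by lra. unfold V2. der. apply (c2_d2 _ _ _ _ _ _ _ CA s y Hy').
      apply (c2_d2 _ _ _ _ _ _ _ CB s y Hy'). simpl; ring.
    - intros s y _; c2d.
    - apply rc; [|assumption]. intros s y Hy. apply (continuity_2d_pt_mult (fun _ _ => 2)). c2d. apply cJ, Hy. }
  rewrite (RInt_zero (fun _ => 0 - 0)) in Gn by (try assumption; intros; ring).
  rewrite (RInt_minus_R (fun s => V2 s tau) (fun s => V2 s t)) in Gn by (apply ra; assumption || lra).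
  fold (G tau) (G t) in Gn. rewrite Rplus_0_l in Gn. rewrite <- Gn.
  rewrite (I2_ext 0 d t tau ltac:(lra) Htau _ (fun s t => 2 * (A s t * A2 s t + B s t * B2 s t))) by (intros; ring).
  rewrite (I2_scal 0 d t tau ltac:(lra) Htau (fun s t => A s t * A2 s t + B s t * B2 s t)) by (apply rc; assumption).
  rewrite (I2_swap 0 d t tau ltac:(lra) Htau) by (apply rc; assumption).
  rewrite (RInt_scal_R J) by assumption. reflexivity.
Qed.

Let Gdec g : 0 < g -> exists T, forall t, T <= t -> 1 < t -> G t <= g.
Proof.
  intros Hg. destruct (Dec (g / d)) as [T HT]. apply Rdiv_lt_0_compat; assumption.
  exists T. intros t Ht Ht1. replace g with ((d - 0) * (g / d)) by (field; lra).
  rewrite <- RInt_const_R. apply RInt_le_R; [lra|apply ra; assumption || lra|apply ex_RInt_const_R|].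
  intros s Hs. apply (HT t s Ht Hs).
Qed.

(* A positive flux would persist and make the mass [G] grow at least linearly. *)
Lemma strip_flux_nonpos t : 1 < t -> J t <= 0.
Proof.
  intros Ht. apply Rnot_lt_le. intros HJ.
  destruct (Gdec 1 Rlt_0_1) as [T HT].
  (* Over a height of at least 1 / J t the mass grows by at least 2, whereas beyond T it is at most
     1. *)
  set (tau := Rmax T (t + / J t)).
  assert (0 < / J t) by (apply Rinv_0_lt_compat; assumption).
  assert (H1 : T <= tau) by apply Rmax_l. assert (H2 : t + / J t <= tau) by apply Rmax_r.
  destruct (strip_mass_increment t tau Ht ltac:(lra)) as [I X].
  assert (RInt (fun _ => 2 * J t) t tau <= RInt (fun y => 2 * J y) t tau).
  { apply RInt_le_R; [lra|apply ex_RInt_const_R|apply ex_RInt_scal_R; assumption|].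
    intros y Hy. pose proof (strip_flux_growth t y Ht ltac:(lra)).
    assert (0 <= RInt E t y) by (apply RInt_nonneg; [lra|apply xE; lra|intros; apply Enn; lra]). lra. }
  rewrite RInt_const_R in H0.
  assert (0 <= G t) by (apply RInt_nonneg; [lra|apply ra; assumption || lra|]; intros; unfold V2;
     pose proof (pow2_ge_0 (A x t)); pose proof (pow2_ge_0 (B x t)); lra).
  pose proof (HT tau H1 ltac:(lra)).
  assert (/ J t * (2 * J t) <= (tau - t) * (2 * J t)) by (apply Rmult_le_compat_r; lra).
  replace (/ J t * (2 * J t)) with 2 in H5 by (field; lra). lra.
Qed.

Lemma strip_flux_bound t tau : 1 < t -> t <= tau -> J t <= - (/ 2 * RInt E t tau).
Proof.
  intros Ht Htau. pose proof (strip_flux_growth t tau Ht Htau).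
  pose proof (strip_flux_nonpos tau ltac:(lra)). lra.
Qed.

(** Since G decays and G' = 2 J, the mass at t is the integral of -2 J above t, and -2 J <= G / d +
    d E <= 5 d E by [strip_poincare]. *)
Lemma strip_trace t X : 1 < t -> (forall tau, t <= tau -> RInt E t tau <= X) -> G t <= 5 * d * X.
Proof.
  intros Ht HX. apply (le_of_forall_pos _ _ 1); [lra|]. intros g Hg. rewrite Rmult_1_l.
  destruct (Gdec g Hg) as [T HT].
  set (tau := Rmax T t). assert (H1 : T <= tau) by apply Rmax_l. assert (H2 : t <= tau) by apply Rmax_r.
  destruct (strip_mass_increment t tau Ht ltac:(lra)) as [I XJ].
  pose proof (HT tau H1 ltac:(lra)). pose proof (HX tau H2).
  assert (RInt (fun y => - (5 * d) * E y) t tau <= RInt (fun y => 2 * J y) t tau).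
  { apply RInt_le_R; [lra|apply ex_RInt_scal_R, xE; lra|apply ex_RInt_scal_R; assumption|].
    intros y Hy. assert (Hy' : 1 < y) by lra. pose proof (strip_poincare y Hy') as P.
    assert (Q : RInt (fun s => - / d * V2 s y - d * Gr s y) 0 d <= RInt (fun s => 2 * (A s y * A2 s y + B s y * B2 s y)) 0 d).
    { apply RInt_le_R; [lra| | |].
      - apply ex_RInt_minus_R; apply ex_RInt_scal_R, ra; assumption || lra.
      - apply ex_RInt_scal_R. apply (ra (fun s t => A s t * A2 s t + B s t * B2 s t)); assumption || lra.
      - intros s _. unfold V2, Gr.
        assert (Y : forall x z, - / d * x ^ 2 - d * z ^ 2 <= 2 * (x * z)).
        { intros x z. assert (Hq : 0 <= / d * (x + d * z) ^ 2) by (apply Rmult_le_pos; [left; apply Rinv_0_lt_compat; assumption|apply pow2_ge_0]).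
          replace (/ d * (x + d * z) ^ 2) with (/ d * x ^ 2 + 2 * (x * z) + d * z ^ 2) in Hq by (field; lra). lra. }
        pose proof (Y (A s y) (A2 s y)). pose proof (Y (B s y) (B2 s y)).
        assert (0 <= d * A1 s y ^ 2) by (apply Rmult_le_pos; [lra|apply pow2_ge_0]).
        assert (0 <= d * B1 s y ^ 2) by (apply Rmult_le_pos; [lra|apply pow2_ge_0]). lra. }
    rewrite (RInt_minus_R (fun s => - / d * V2 s y) (fun s => d * Gr s y)) in Q by (apply ex_RInt_scal_R, ra; assumption || lra).
    rewrite (RInt_scal_R (fun s => V2 s y)) in Q by (apply ra; assumption || lra).
    rewrite (RInt_scal_R (fun s => Gr s y)) in Q by (apply ra; assumption || lra).
    rewrite (RInt_scal_R (fun s => A s y * A2 s y + B s y * B2 s y)) in Q by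
      (apply (ra (fun s t => A s t * A2 s t + B s t * B2 s t)); assumption || lra).
    fold (G y) (E y) (J y) in Q.
    assert (Hq : / d * G y <= / d * (4 * d ^ 2 * E y)) by (apply Rmult_le_compat_l; [left; apply Rinv_0_lt_compat; assumption|assumption]).
    replace (/ d * (4 * d ^ 2 * E y)) with (4 * d * E y) in Hq by (field; lra). lra. }
  rewrite (RInt_scal_R E) in H3 by (apply xE; lra).
  assert (5 * d * RInt E t tau <= 5 * d * X) by (apply Rmult_le_compat_l; lra).
  lra.
Qed.

(** The vanishing means are differentiated in t under the integral sign, so the vertical derivative
    of the evanescent part is orthogonal to the plane wave as well. *)
Lemma strip_mean_derivative t : 1 < t ->
  RInt (fun s => cos (kap * s) * A2 s t + sin (kap * s) * B2 s t) 0 d = 0 /\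
  RInt (fun s => cos (kap * s) * B2 s t - sin (kap * s) * A2 s t) 0 d = 0.
Proof.
  intros Ht.
  pose proof (c2_c0 _ _ _ _ _ _ _ CA) as a0. pose proof (c2_c0 _ _ _ _ _ _ _ CB) as b0.
  pose proof (c2_c2 _ _ _ _ _ _ _ CA) as a2. pose proof (c2_c2 _ _ _ _ _ _ _ CB) as b2.
  assert (L : locally t (fun y => 1 < y)) by (apply (open_gt 1); exact Ht).
  assert (Z : forall f f2 : R -> R -> R, (forall s t, 1 < t -> is_derive (fun y => f s y) t (f2 s t)) ->
    cont_on (fun _ t => 1 < t) f -> cont_on (fun _ t => 1 < t) f2 ->
    (forall t, 1 < t -> RInt (fun s => f s t) 0 d = 0) -> RInt (fun s => f2 s t) 0 d = 0).
  { intros f f2 H1 H2 H3 H4.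
    pose proof (deriv_int_above f f2 0 d t ltac:(lra) Ht H1 H2 H3) as D.
    apply is_derive_unique in D. rewrite <- D.
    rewrite (Derive_ext_loc _ (fun _ => 0)). apply Derive_const.
    apply (filter_imp (fun y => 1 < y)); [|exact L]. intros y Hy. apply H4, Hy. }
  split.
  - apply (Z (fun s t => cos (kap * s) * A s t + sin (kap * s) * B s t)
      (fun s t => cos (kap * s) * A2 s t + sin (kap * s) * B2 s t)); [| | |exact Mz1].
    intros s y Hy. der. apply (c2_d2 _ _ _ _ _ _ _ CA s y Hy). apply (c2_d2 _ _ _ _ _ _ _ CB s y Hy). simpl; ring.
    intros s y Hy; c2d. intros s y Hy; c2d.
  - apply (Z (fun s t => cos (kap * s) * B s t - sin (kap * s) * A s t)
      (fun s t => cos (kap * s) * B2 s t - sin (kap * s) * A2 s t)); [| | |exact Mz2].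
    intros s y Hy. der. apply (c2_d2 _ _ _ _ _ _ _ CB s y Hy). apply (c2_d2 _ _ _ _ _ _ _ CA s y Hy). simpl; ring.
    intros s y Hy; c2d. intros s y Hy; c2d.
Qed.
End HalfStrip.

(** * Rayleigh expansions *)

(* [RInt] has its type in a Coquelicot structure, where [ring] does not recognise R. *)
Ltac req := match goal with |- @eq _ ?x ?y => change (@eq R x y) end.

Lemma exp_pow x n : exp x ^ n = exp (INR n * x).
Proof.
  induction n as [|n IH]. simpl. rewrite Rmult_0_l, exp_0. reflexivity.
  rewrite S_INR. simpl pow. rewrite IH, <- exp_plus. f_equal. ring.
Qed.
Lemma exp_mono x y : x <= y -> exp x <= exp y.
Proof. intros [H|H]. left; apply exp_increasing, H. rewrite H. lra. Qed.

Lemma series_tail (u : nat -> R) (l C y : R) : 0 <= y < 1 -> (forall n, Rabs (u n) <= C * y ^ n) ->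
  is_series u l -> forall N, Rabs (l - sum_n u N) <= C * y ^ S N / (1 - y).
Proof.
  intros Hy Hu Hl N.
  assert (H : is_series (fun k => u (S N + k)%nat) (l - sum_n u N)).
  { apply (is_series_incr_n u (S N)); [lia|]. simpl pred.
    change (is_series u ((l - sum_n u N) + sum_n u N)).
    assert (E : forall v w : R, v - w + w = v) by (intros; ring). rewrite E. exact Hl. }
  assert (G : is_series (fun k => C * y ^ S N * y ^ k) (C * y ^ S N * / (1 - y))).
  { apply (is_series_scal (K := R_AbsRing) (V := R_NormedModule) (C * y ^ S N) (fun k => y ^ k)).
    apply is_series_geom. rewrite Rabs_pos_eq; lra. }
  assert (B : forall k, 0 <= Rabs (u (S N + k)%nat) <= C * y ^ S N * y ^ k).
  { intros k. split; [apply Rabs_pos|]. eapply Rle_trans; [apply Hu|]. rewrite pow_add. right; ring. }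
  assert (X : ex_series (fun k => Rabs (u (S N + k)%nat))).
  { apply (ex_series_le (K := R_AbsRing) (V := R_CompleteNormedModule) _ (fun k => C * y ^ S N * y ^ k)).
    intros k. change (Rabs (Rabs (u (S N + k)%nat)) <= C * y ^ S N * y ^ k). rewrite Rabs_Rabsolu. apply B.
    eexists; exact G. }
  rewrite <- (is_series_unique _ _ H).
  eapply Rle_trans; [apply Series_Rabs, X|].
  eapply Rle_trans; [apply (Series_le _ (fun k => C * y ^ S N * y ^ k)); [exact B|eexists; exact G]|].
  rewrite (is_series_unique _ _ G). right. reflexivity.
Qed.

Lemma series_terms_bounded (u : nat -> R) (l : R) : is_series u l -> exists C, 0 < C /\ forall n, Rabs (u n) <= C.
Proof.
  intros H.
  assert (L : is_lim_seq u 0) by (apply ex_series_lim_0; eexists; exact H).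
  apply is_lim_seq_Reals in L. destruct (maj_by_pos u (exist _ 0 L)) as [C [HC K]].
  exists C. split; assumption.
Qed.

Lemma sum_n_RInt (u : nat -> R -> R) d N : (forall n, ex_RInt (u n) 0 d) -> (forall n, RInt (u n) 0 d = 0) ->
  ex_RInt (fun s => sum_n (fun n => u n s) N) 0 d /\ RInt (fun s => sum_n (fun n => u n s) N) 0 d = 0.
Proof.
  intros X Z. induction N as [|N [IX IZ]].
  - assert (E : forall s, u 0%nat s = sum_n (fun n => u n s) 0) by (intros; rewrite sum_O; reflexivity).
    split. eapply ex_RInt_ext; [|apply (X 0%nat)]. intros; apply E.
    transitivity (RInt (u 0%nat) 0 d); [|apply Z]. apply RInt_ext. intros; symmetry; apply E.
  - assert (E : forall s, sum_n (fun n => u n s) N + u (S N) s = sum_n (fun n => u n s) (S N)) by (intros; rewrite sum_Sn; reflexivity).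
    split. eapply ex_RInt_ext; [intros; apply E|]. apply ex_RInt_plus_R; [exact IX|apply X].
    rewrite (RInt_ext _ (fun s => sum_n (fun n => u n s) N + u (S N) s)) by (intros; symmetry; apply E).
    rewrite RInt_plus_R by (assumption || apply X). rewrite IZ, Z. apply Rplus_0_l.
Qed.

(* One side (positive or negative orders) of an expansion in evanescent modes. *)
Definition evan (al be z th : nat -> R) (s t : R) (n : nat) : R :=
  exp (- z n * t) * (al n * cos (th n * s) - be n * sin (th n * s)).

Section Evanescent.
Variables (al be z th : nat -> R) (d C t0 : R).
Hypothesis Hd : 0 < d.
Hypothesis HC : 0 < C.
Hypothesis Hz : forall n, INR (S n) / d <= z n.
Hypothesis Hal : forall n, Rabs (al n) * exp (- z n * t0) <= C.
Hypothesis Hbe : forall n, Rabs (be n) * exp (- z n * t0) <= C.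
Hypothesis Hth : forall n, th n <> 0 /\ cos (th n * d) = 1 /\ sin (th n * d) = 0.

(** [t0] is a reference height at which the terms are bounded. Above it the rates z n >= (n + 1) / d
    make the series geometric, with ratio exp (-(t - t0) / d). *)
Lemma evan_bound s t n : t0 <= t -> Rabs (evan al be z th s t n) <= 2 * C * exp (- (t - t0) / d) * exp (- (t - t0) / d) ^ n.
Proof.
  intros Ht. unfold evan. rewrite Rabs_mult, (Rabs_pos_eq (exp _)) by (left; apply exp_pos).
  replace (exp (- z n * t)) with (exp (- z n * t0) * exp (- z n * (t - t0))) by (rewrite <- exp_plus; f_equal; ring).
  assert (Y : exp (- z n * (t - t0)) <= exp (- (t - t0) / d) * exp (- (t - t0) / d) ^ n).
  { change (exp (- (t - t0) / d) * exp (- (t - t0) / d) ^ n) with (exp (- (t - t0) / d) ^ S n).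
    rewrite exp_pow. apply exp_mono.
    specialize (Hz n). assert ((t - t0) * (INR (S n) / d) <= (t - t0) * z n) by (apply Rmult_le_compat_l; lra).
    replace (INR (S n) * (- (t - t0) / d)) with (- ((t - t0) * (INR (S n) / d))) by (field; lra). lra. }
  assert (T : Rabs (al n * cos (th n * s) - be n * sin (th n * s)) <= Rabs (al n) + Rabs (be n)).
  { eapply Rle_trans; [apply Rabs_triang|]. rewrite Rabs_Ropp, !Rabs_mult.
    pose proof (COS_bound (th n * s)). pose proof (SIN_bound (th n * s)).
    assert (Rabs (cos (th n * s)) <= 1) by (apply Rabs_le; lra).
    assert (Rabs (sin (th n * s)) <= 1) by (apply Rabs_le; lra).
    pose proof (Rabs_pos (al n)). pose proof (Rabs_pos (be n)).
    apply Rplus_le_compat; rewrite <- Rmult_1_r; apply Rmult_le_compat_l; assumption. }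
  pose proof (exp_pos (- z n * t0)). pose proof (exp_pos (- z n * (t - t0))).
  rewrite (Rmult_comm (exp (- z n * t0))), Rmult_assoc, (Rmult_comm (2 * C * _)), Rmult_comm.
  replace (exp (- (t - t0) / d) ^ n * (2 * C * exp (- (t - t0) / d))) with (2 * C * (exp (- (t - t0) / d) * exp (- (t - t0) / d) ^ n)) by ring.
  apply Rmult_le_compat; try lra.
  apply Rmult_le_pos; [lra|apply Rabs_pos].
  apply Rle_trans with (exp (- z n * t0) * (Rabs (al n) + Rabs (be n))).
  apply Rmult_le_compat_l; lra. specialize (Hal n). specialize (Hbe n). lra.
Qed.

Lemma evan_cont t n s : continuous (fun s => evan al be z th s t n) s.
Proof.
  apply (cont_2d_fst (fun s _ => evan al be z th s t n) s 0). unfold evan. c2d.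
Qed.

Lemma evan_mean_zero t n : RInt (fun s => evan al be z th s t n) 0 d = 0.
Proof.
  destruct (Hth n) as [H0 [Hc Hs]].
  assert (E := RInt_FTC (fun s => exp (- z n * t) * / th n * (al n * sin (th n * s) + be n * cos (th n * s)))
    (fun s => evan al be z th s t n) 0 d ltac:(lra)).
  rewrite E; clear E.
  - rewrite Hc, Hs, !Rmult_0_r, cos_0, sin_0. req; ring.
  - intros s _. unfold evan. der. simpl. field. assumption.
  - intros s _. apply evan_cont.
Qed.

Lemma evan_y t : t0 < t -> 0 < exp (- (t - t0) / d) < 1.
Proof.
  intros Ht. split; [apply exp_pos|]. rewrite <- exp_0. apply exp_increasing.
  assert (0 < (t - t0) / d) by (apply Rdiv_lt_0_compat; lra). unfold Rdiv in *. lra.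
Qed.

(** The geometric sum is at most a multiple of its ratio y once y <= 1/2, and exp v >= 1 + v gives y
    <= d / (t - t0). Algebraic decay is enough for the arguments at infinity. *)
Lemma evan_sum_bound s t P : t0 + d <= t -> is_series (evan al be z th s t) P ->
  Rabs P <= 4 * C * (d / (t - t0)).
Proof.
  intros Ht HP. set (y := exp (- (t - t0) / d)).
  pose proof (evan_y t ltac:(lra)) as Hy. fold y in Hy.
  assert (Y : y <= / (1 + (t - t0) / d)).
  { unfold y. replace (- (t - t0) / d) with (- ((t - t0) / d)) by (field; lra). rewrite exp_Ropp.
    assert (0 < (t - t0) / d) by (apply Rdiv_lt_0_compat; lra).
    apply Rinv_le_contravar; [lra|]. apply exp_ineq1_le. }
  assert (T1 : 1 <= (t - t0) / d) by (apply (Rmult_le_reg_r d); [lra|]; unfold Rdiv; rewrite Rmult_assoc, Rinv_l by lra; lra).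
  assert (Y2 : y <= 1 / 2).
  { eapply Rle_trans; [exact Y|]. replace (1 / 2) with (/ 2) by field. apply Rinv_le_contravar; lra. }
  assert (Y3 : y <= d / (t - t0)).
  { eapply Rle_trans; [exact Y|]. replace (d / (t - t0)) with (/ ((t - t0) / d)) by (field; lra). apply Rinv_le_contravar; lra. }
  pose proof (series_tail (evan al be z th s t) P (2 * C * y) y ltac:(lra)
    (fun n => evan_bound s t n ltac:(lra)) HP 0) as B.
  rewrite sum_O in B. pose proof (evan_bound s t 0 ltac:(lra)) as B0. fold y in B0. simpl pow in B, B0.
  replace (2 * C * y * (y * 1) / (1 - y)) with (2 * C * y * (y / (1 - y))) in B by (field; lra).
  assert (y / (1 - y) <= 1). { apply (Rmult_le_reg_r (1 - y)); [lra|]. unfold Rdiv. rewrite Rmult_assoc, Rinv_l by lra. lra. }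
  assert (0 < C * y) by (apply Rmult_lt_0_compat; lra).
  assert (2 * C * y * (y / (1 - y)) <= 2 * C * y * 1) by (apply Rmult_le_compat_l; lra).
  assert (Rabs P <= 4 * (C * y)).
  { apply Rabs_le_between in B, B0. apply Rabs_le. lra. }
  assert (C * y <= C * (d / (t - t0))) by (apply Rmult_le_compat_l; lra).
  lra.
Qed.

(** The approximants are partial sums: each mode has mean zero over the period and the tail is small
    uniformly in s. This replaces termwise integration of the series. *)
Lemma evan_approx t P : t0 < t -> (forall s, is_series (evan al be z th s t) (P s)) ->
  forall g, 0 < g -> exists PN, ex_RInt PN 0 d /\ RInt PN 0 d = 0 /\ forall s, Rabs (P s - PN s) <= g.
Proof.
  intros Ht HP g Hg. set (y := exp (- (t - t0) / d)).
  pose proof (evan_y t ltac:(lra)) as Hy. fold y in Hy.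
  assert (Cy : 0 < 2 * C * y / (1 - y)).
  { apply Rdiv_lt_0_compat; [|lra]. assert (0 < C * y) by (apply Rmult_lt_0_compat; lra). lra. }
  destruct (pow_lt_1_zero y ltac:(rewrite Rabs_pos_eq; lra) (g / (2 * C * y / (1 - y)))) as [N HN].
  { apply Rdiv_lt_0_compat; assumption. }
  exists (fun s => sum_n (fun n => evan al be z th s t n) N).
  destruct (sum_n_RInt (fun n s => evan al be z th s t n) d N) as [X Z].
  - intros n. apply ex_RInt_cont; [lra|]. intros; apply evan_cont.
  - intros n. apply evan_mean_zero.
  - split; [exact X|]. split; [exact Z|]. intros s.
    eapply Rle_trans; [apply (series_tail (evan al be z th s t) (P s) (2 * C * y) y ltac:(lra)
      (fun n => evan_bound s t n ltac:(lra)) (HP s) N)|].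
    specialize (HN (S N) ltac:(lia)). rewrite Rabs_pos_eq in HN by (apply pow_le; lra).
    replace (2 * C * y * y ^ S N / (1 - y)) with (2 * C * y / (1 - y) * y ^ S N) by (field; lra).
    apply Rlt_le. apply (Rmult_lt_compat_l _ _ _ Cy) in HN.
    replace (2 * C * y / (1 - y) * (g / (2 * C * y / (1 - y)))) with g in HN; [exact HN|].
    field. repeat split; lra.
Qed.
End Evanescent.

Lemma is_series_fst (f : nat -> C) (l : C) : is_series (V := C_R_NormedModule) f l ->
  is_series (fun n => fst (f n)) (fst l).
Proof.
  intros H. unfold is_series in *.
  apply filterlim_ext with (fun n => fst (sum_n (G := C_R_NormedModule) f n)).
  - induction x as [|n IH]. rewrite !sum_O. reflexivity. rewrite !sum_Sn, <- IH. reflexivity.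
  - apply (filterlim_comp _ _ _ _ fst _ (locally l) _ H).
    apply (continuous_fst (U := R_UniformSpace) (V := R_UniformSpace)).
Qed.
Lemma is_series_snd (f : nat -> C) (l : C) : is_series (V := C_R_NormedModule) f l ->
  is_series (fun n => snd (f n)) (snd l).
Proof.
  intros H. unfold is_series in *.
  apply filterlim_ext with (fun n => snd (sum_n (G := C_R_NormedModule) f n)).
  - induction x as [|n IH]. rewrite !sum_O. reflexivity. rewrite !sum_Sn, <- IH. reflexivity.
  - apply (filterlim_comp _ _ _ _ snd _ (locally l) _ H).
    apply (continuous_snd (U := R_UniformSpace) (V := R_UniformSpace)).
Qed.

Lemma trig_multiple (j : Z) : cos (2 * PI * IZR j) = 1 /\ sin (2 * PI * IZR j) = 0.
Proof.
  assert (P : forall n : nat, cos (2 * PI * INR n) = 1 /\ sin (2 * PI * INR n) = 0).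
  { intros n. replace (2 * PI * INR n) with (0 + 2 * INR n * PI) by ring.
    rewrite cos_period, sin_period, cos_0, sin_0. split; reflexivity. }
  destruct j as [|p|p].
  - rewrite Rmult_0_r, cos_0, sin_0. split; reflexivity.
  - replace (IZR (Z.pos p)) with (INR (Pos.to_nat p)). apply P. rewrite INR_IZR_INZ, positive_nat_Z. reflexivity.
  - replace (IZR (Z.neg p)) with (- INR (Pos.to_nat p)).
    rewrite Ropp_mult_distr_r_reverse, cos_neg, sin_neg. destruct (P (Pos.to_nat p)) as [-> ->]. split; ring.
    rewrite INR_IZR_INZ, positive_nat_Z. rewrite <- opp_IZR. reflexivity.
Qed.

Section Orders.
Variables d k kap : R.
Hypothesis Hd : 0 < d.
Hypothesis Hk : 0 < k.
Hypothesis Hkd : k * d <= 1 / 10.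
Hypothesis Hkap : Rabs kap < k.

(** With k d <= 1/10 order 0 is the only propagating one: for j <> 0, |kappa_j| >= 2 pi |j| / d - k
    >= 5 |j| / d, while k <= |j| / (10 d). This leaves a decay rate of at least |j| / d. *)
Lemma evanescent_order j : (j <> 0)%Z ->
  exists z, IZR (Z.abs j) / d <= z /\ zeta_n d k kap j = Cmult Ci (RtoC z).
Proof.
  intros Hj.
  assert (HJ : 1 <= IZR (Z.abs j)) by (apply (IZR_le 1); lia).
  set (m := IZR (Z.abs j) / d).
  assert (Hm : k <= m / 10).
  { unfold m. apply (Rmult_le_reg_r d); [assumption|]. replace (IZR (Z.abs j) / d / 10 * d) with (IZR (Z.abs j) / 10) by (field; lra). lra. }
  assert (B : 5 * m <= Rabs (kappa_n d kap j)).
  { unfold kappa_n. replace (2 * PI * IZR j / d) with (2 * PI / d * IZR j) by (field; lra).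
    assert (Rabs (2 * PI / d * IZR j) = 2 * PI * m).
    { pose proof PI_RGT_0. rewrite Rabs_mult, <- abs_IZR, (Rabs_pos_eq (2 * PI / d)).
      unfold m. field; lra. left; apply Rdiv_lt_0_compat; lra. }
    pose proof (Rabs_triang_inv (2 * PI / d * IZR j) (- kap)). rewrite Rabs_Ropp in H0.
    replace (2 * PI / d * IZR j - - kap) with (kap + 2 * PI / d * IZR j) in H0 by ring.
    pose proof PI2_3_2. assert (3 * m <= PI * m) by (apply Rmult_le_compat_r; lra). lra. }
  assert (Km : (5 * m) ^ 2 <= kappa_n d kap j ^ 2) by (rewrite <- (pow2_abs (kappa_n d kap j)); apply pow_incr; lra).
  exists (sqrt (kappa_n d kap j ^ 2 - k ^ 2)). split.
  - rewrite <- (sqrt_pow2 m) by lra. apply sqrt_le_1_alt.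
    assert (k ^ 2 <= (m / 10) ^ 2) by (apply pow_incr; lra). nra.
  - unfold zeta_n. destruct Rlt_dec; [lra|reflexivity].
Qed.

Lemma evanescent_wave (c : C) kn z s t : Cmult c (plane_wave (RtoC kn) (Cmult Ci (RtoC z)) (s, t)) =
  (exp (- z * t) * (fst c * cos (kn * s) - snd c * sin (kn * s)),
   exp (- z * t) * (fst c * sin (kn * s) + snd c * cos (kn * s))).
Proof.
  destruct c as [x y]. unfold plane_wave, cexp, Cmult, Cplus, Ci, RtoC, Re, Im; simpl.
  apply injective_projections; simpl;
  repeat match goal with |- context [exp ?e] => progress replace (exp e) with (exp (- z * t)) by (f_equal; ring) end;
  repeat match goal with |- context [cos ?e] => progress replace (cos e) with (cos (kn * s)) by (f_equal; ring) end;
  repeat match goal with |- context [sin ?e] => progress replace (sin e) with (sin (kn * s)) by (f_equal; ring) end; ring.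
Qed.

(** [rot_re] and [rot_im] are the real and imaginary parts of e^{-i kap s} g(s, t), in which order n
    becomes a d-periodic mode of frequency 2 pi n / d. *)
Definition rot_re (g : R -> R -> C) s t := cos (kap * s) * fst (g s t) + sin (kap * s) * snd (g s t).
Definition rot_im (g : R -> R -> C) s t := cos (kap * s) * snd (g s t) - sin (kap * s) * fst (g s t).

(* The properties of the evanescent part that are needed: decay at infinity, and
   being a uniform limit of functions of mean zero on each line. *)
Definition negligible (p : R -> R -> R) : Prop :=
  (forall g, 0 < g -> exists T, forall t s, T <= t -> Rabs (p s t) <= g) /\
  (forall t g, 1 < t -> 0 < g -> exists PN, ex_RInt PN 0 d /\ RInt PN 0 d = 0 /\ forall s, Rabs (p s t - PN s) <= g).

Lemma negligible_plus p q : negligible p -> negligible q -> negligible (fun s t => p s t + q s t).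
Proof.
  intros [P1 P2] [Q1 Q2]. split.
  - intros g Hg. destruct (P1 (g / 2) ltac:(lra)) as [T1 H1]. destruct (Q1 (g / 2) ltac:(lra)) as [T2 H2].
    exists (Rmax T1 T2). intros t s Ht.
    pose proof (H1 t s (Rle_trans _ _ _ (Rmax_l _ _) Ht)). pose proof (H2 t s (Rle_trans _ _ _ (Rmax_r _ _) Ht)).
    eapply Rle_trans; [apply Rabs_triang|]. lra.
  - intros t g Ht Hg. destruct (P2 t (g / 2) Ht ltac:(lra)) as [F [X1 [Z1 H1]]].
    destruct (Q2 t (g / 2) Ht ltac:(lra)) as [G [X2 [Z2 H2]]].
    exists (fun s => F s + G s). split; [apply ex_RInt_plus_R; assumption|]. split.
    rewrite RInt_plus_R by assumption. rewrite Z1, Z2. apply Rplus_0_l.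
    intros s. replace (p s t + q s t - (F s + G s)) with ((p s t - F s) + (q s t - G s)) by ring.
    eapply Rle_trans; [apply Rabs_triang|]. pose proof (H1 s). pose proof (H2 s). lra.
Qed.

Lemma negligible_ext p q : (forall s t, 1 < t -> p s t = q s t) -> negligible p -> negligible q.
Proof.
  intros E [P1 P2]. split.
  - intros g Hg. destruct (P1 g Hg) as [T H]. exists (Rmax T 2). intros t s Ht.
    pose proof (Rmax_l T 2). pose proof (Rmax_r T 2). rewrite <- E by lra. apply H. lra.
  - intros t g Ht Hg. destruct (P2 t g Ht Hg) as [F [X [Z H]]]. exists F. split; [exact X|]. split; [exact Z|].
    intros s. rewrite <- E by assumption. apply H.
Qed.

Lemma negligible_mean_zero p t : negligible p -> 1 < t -> ex_RInt (fun s => p s t) 0 d -> RInt (fun s => p s t) 0 d = 0.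
Proof.
  intros [_ H] Ht X.
  assert (B : Rabs (RInt (fun s => p s t) 0 d) <= 0).
  { apply (le_of_forall_pos _ _ d); [lra|]. intros g Hg. destruct (H t g Ht Hg) as [F [XF [Z HF]]].
    replace (RInt (fun s => p s t) 0 d : R) with (RInt (fun s => p s t - F s) 0 d : R).
    rewrite Rplus_0_l. rewrite <- (Rminus_0_r d) at 2. apply abs_RInt_le_const; [lra| |intros; apply HF].
    apply ex_RInt_minus_R; assumption.
    rewrite RInt_minus_R by assumption. rewrite Z. apply Rminus_0_r. }
  pose proof (Rabs_pos (RInt (fun s => p s t) 0 d)).
  destruct (Req_dec (RInt (fun s => p s t) 0 d) 0) as [E|E]; [exact E|].
  apply Rabs_pos_lt in E. lra.
Qed.

(** [jj] runs through the orders of one sign. The terms of a convergent series are bounded; at s = 0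
    this bounds the coefficients with the weight e^{-z t0}, for any t0 > 1. Passing from the real to
    the imaginary part replaces the coefficient pair (al, be) by (be, -al). *)
Lemma one_sided_negligible (a : Z -> C) (jj : nat -> Z) (g : R -> R -> C) :
  (forall n, Z.abs (jj n) = Z.of_nat (S n)) ->
  (forall s t, 1 < t -> is_series (V := C_R_NormedModule) (fun n => Cmult (a (jj n))
     (plane_wave (RtoC (kappa_n d kap (jj n))) (zeta_n d k kap (jj n)) (s, t))) (g s t)) ->
  negligible (rot_re g) /\ negligible (rot_im g).
Proof.
  intros Hjj Hg.
  assert (Hj0 : forall n, (jj n <> 0)%Z) by (intros n; specialize (Hjj n); lia).
  set (zs := fun n => proj1_sig (constructive_indefinite_description _ (evanescent_order (jj n) (Hj0 n)))).
  assert (Hzs : forall n, INR (S n) / d <= zs n /\ zeta_n d k kap (jj n) = Cmult Ci (RtoC (zs n))).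
  { intros n. unfold zs. destruct constructive_indefinite_description as [z [Hz1 Hz2]]; simpl proj1_sig.
    rewrite Hjj, <- INR_IZR_INZ in Hz1. split; assumption. }
  set (al := fun n => fst (a (jj n))). set (be := fun n => snd (a (jj n))). set (th := fun n => 2 * PI * IZR (jj n) / d).
  assert (Hth : forall n, th n <> 0 /\ cos (th n * d) = 1 /\ sin (th n * d) = 0).
  { intros n. unfold th. replace (2 * PI * IZR (jj n) / d * d) with (2 * PI * IZR (jj n)) by (field; lra).
    split; [|apply trig_multiple]. pose proof PI_RGT_0.
    assert (IZR (jj n) <> 0) by (apply not_0_IZR, Hj0).
    assert (/ d <> 0) by (apply Rinv_neq_0_compat; lra).
    intros Z. apply Rmult_integral in Z. destruct Z as [Z|Z]; [|lra]. apply Rmult_integral in Z. destruct Z; lra. }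
  assert (W : forall s t n, Cmult (a (jj n)) (plane_wave (RtoC (kappa_n d kap (jj n))) (zeta_n d k kap (jj n)) (s, t)) =
   (exp (- zs n * t) * (al n * cos ((kap + th n) * s) - be n * sin ((kap + th n) * s)),
    exp (- zs n * t) * (al n * sin ((kap + th n) * s) + be n * cos ((kap + th n) * s)))).
  { intros s t n. rewrite (proj2 (Hzs n)). apply evanescent_wave. }
  assert (SR : forall s t, 1 < t -> is_series (evan al be zs th s t) (rot_re g s t)).
  { intros s t Ht. specialize (Hg s t Ht).
    pose proof (is_series_scal (K := R_AbsRing) (V := R_NormedModule) (cos (kap * s)) _ _ (is_series_fst _ _ Hg)) as S1.
    pose proof (is_series_scal (K := R_AbsRing) (V := R_NormedModule) (sin (kap * s)) _ _ (is_series_snd _ _ Hg)) as S2.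
    pose proof (is_series_plus _ _ _ _ S1 S2) as S3. eapply is_series_ext; [|exact S3].
    intros n. cbv beta. rewrite W. unfold evan. replace (th n * s) with ((kap + th n) * s - kap * s) by ring.
    rewrite cos_minus, sin_minus. cbn. ring. }
  assert (SI : forall s t, 1 < t -> is_series (evan be (fun n => - al n) zs th s t) (rot_im g s t)).
  { intros s t Ht. specialize (Hg s t Ht).
    pose proof (is_series_scal (K := R_AbsRing) (V := R_NormedModule) (cos (kap * s)) _ _ (is_series_snd _ _ Hg)) as S1.
    pose proof (is_series_scal (K := R_AbsRing) (V := R_NormedModule) (- sin (kap * s)) _ _ (is_series_fst _ _ Hg)) as S2.
    pose proof (is_series_plus _ _ _ _ S1 S2) as S3.
    replace (rot_im g s t) with (plus (scal (cos (kap * s)) (snd (g s t)) : R_NormedModule) (scal (- sin (kap * s)) (fst (g s t)) : R_NormedModule)).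
    2:{ unfold rot_im. cbn. ring. }
    eapply is_series_ext; [|exact S3].
    intros n. cbv beta. rewrite W. unfold evan. replace (th n * s) with ((kap + th n) * s - kap * s) by ring.
    rewrite cos_minus, sin_minus. cbn. ring. }
  assert (CB : forall t0, 1 < t0 -> exists C, 0 < C /\ forall n, Rabs (al n) * exp (- zs n * t0) <= C /\ Rabs (be n) * exp (- zs n * t0) <= C).
  { intros t0 Ht0. destruct (series_terms_bounded _ _ (is_series_fst _ _ (Hg 0 t0 Ht0))) as [C1 [HC1 K1]].
    destruct (series_terms_bounded _ _ (is_series_snd _ _ (Hg 0 t0 Ht0))) as [C2 [HC2 K2]].
    exists (C1 + C2). split; [lra|]. intros n. specialize (K1 n). specialize (K2 n). rewrite W in K1, K2.
    cbn [fst snd] in K1, K2. rewrite Rmult_0_r, cos_0, sin_0, Rabs_mult, (Rabs_pos_eq (exp _)) in K1 by (left; apply exp_pos).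
    rewrite Rmult_0_r, cos_0, sin_0, Rabs_mult, (Rabs_pos_eq (exp _)) in K2 by (left; apply exp_pos).
    replace (al n * 1 - be n * 0) with (al n) in K1 by ring. replace (al n * 0 + be n * 1) with (be n) in K2 by ring.
    split; lra. }
  assert (Fin : forall (u v : nat -> R) p, (forall n, Rabs (u n) = Rabs (al n) /\ Rabs (v n) = Rabs (be n) \/ Rabs (u n) = Rabs (be n) /\ Rabs (v n) = Rabs (al n)) ->
    (forall s t, 1 < t -> is_series (evan u v zs th s t) (p s t)) -> negligible p).
  { intros u v p Huv Hp. split.
    (* Decay is measured from the fixed height t0 = 2. The approximation on a given line uses the
       height halfway between 1 and t, since t may be close to 1. *)
    - intros gm Hgm. destruct (CB 2 ltac:(lra)) as [C [HC K]].
      exists (2 + d + 4 * C * d / gm). intros t s Ht.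
      assert (0 < 4 * C * d / gm) by (apply Rdiv_lt_0_compat; [repeat apply Rmult_lt_0_compat; lra|lra]).
      eapply Rle_trans; [apply (evan_sum_bound u v zs th d C 2 Hd HC) with (s := s) (t := t)|].
      + intros n; apply Hzs.
      + intros n; destruct (Huv n) as [[-> _]|[-> _]]; apply K.
      + intros n; destruct (Huv n) as [[_ ->]|[_ ->]]; apply K.
      + lra.
      + apply Hp. lra.
      + apply (Rmult_le_reg_r ((t - 2) / gm)). apply Rdiv_lt_0_compat; lra.
        replace (4 * C * (d / (t - 2)) * ((t - 2) / gm)) with (4 * C * d / gm) by (field; lra).
        replace (gm * ((t - 2) / gm)) with (t - 2) by (field; lra). lra.
    - intros t gm Ht Hgm. destruct (CB ((1 + t) / 2) ltac:(lra)) as [C [HC K]].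
      apply (evan_approx u v zs th d C ((1 + t) / 2) Hd HC) with (t := t) (P := fun s => p s t).
      + intros n; apply Hzs.
      + intros n; destruct (Huv n) as [[-> _]|[-> _]]; apply K.
      + intros n; destruct (Huv n) as [[_ ->]|[_ ->]]; apply K.
      + exact Hth.
      + lra.
      + intros s; apply Hp; assumption.
      + assumption. }
  split.
  - apply (Fin al be); [left; split; reflexivity|exact SR].
  - apply (Fin be (fun n => - al n)); [right; split; [reflexivity|apply Rabs_Ropp]|exact SI].
Qed.
End Orders.

(** * Splitting the field of a half-plane into its propagating order and an evanescent part *)

Lemma cos2_sin2 x : cos x ^ 2 + sin x ^ 2 = 1.
Proof. pose proof (sin2_cos2 x) as H. unfold Rsqr in H. lra. Qed.

Section TotalField.
Variables k d kap ze al1 be1 al2 be2 : R.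
Variables a a1 a2 a11 a22 a12 b b1 b2 b11 b22 b12 : R -> R -> R.
Hypothesis Hd : 0 < d.
Hypothesis Hk : 0 <= k.
Hypothesis Hkd : k * d <= 1 / 10.
Hypothesis Hkap : Rabs kap <= k.
Hypothesis Hze : ze ^ 2 + kap ^ 2 = k ^ 2.
Hypothesis Ca : C2r (fun _ t => 1 < t) a a1 a2 a11 a22 a12.
Hypothesis Cb : C2r (fun _ t => 1 < t) b b1 b2 b11 b22 b12.
Hypothesis Ea : forall s t, 1 < t -> a11 s t + a22 s t + k ^ 2 * a s t = 0.
Hypothesis Eb : forall s t, 1 < t -> b11 s t + b22 s t + k ^ 2 * b s t = 0.
Hypothesis Qa : forall t, 1 < t -> a d t = cos (kap * d) * a 0 t - sin (kap * d) * b 0 t.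
Hypothesis Qb : forall t, 1 < t -> b d t = sin (kap * d) * a 0 t + cos (kap * d) * b 0 t.
Hypothesis Qa1 : forall t, 1 < t -> a1 d t = cos (kap * d) * a1 0 t - sin (kap * d) * b1 0 t.
Hypothesis Qb1 : forall t, 1 < t -> b1 d t = sin (kap * d) * a1 0 t + cos (kap * d) * b1 0 t.

(** [wave] is the general solution of w'' = - ze^2 w and [wave'] its derivative: the real or
    imaginary part of the order-zero field, incident wave included, after removal of e^{i kap s}. *)
Definition wave c1 c2 t := c1 * cos (ze * t) + c2 * sin (ze * t).
Definition wave' c1 c2 t := ze * (c2 * cos (ze * t) - c1 * sin (ze * t)).
Let wr := wave al1 be1. Let wi := wave al2 be2. Let wr' := wave' al1 be1. Let wi' := wave' al2 be2.

Hypothesis Np : negligible d (fun s t => cos (kap * s) * a s t + sin (kap * s) * b s t - wr t).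
Hypothesis Nq : negligible d (fun s t => cos (kap * s) * b s t - sin (kap * s) * a s t - wi t).

Let P s t := cos (kap * s) * wr t - sin (kap * s) * wi t.
Let Q s t := sin (kap * s) * wr t + cos (kap * s) * wi t.
Let P' s t := cos (kap * s) * wr' t - sin (kap * s) * wi' t.
Let Q' s t := sin (kap * s) * wr' t + cos (kap * s) * wi' t.
Let A s t := a s t - P s t.
Let A1 s t := a1 s t + kap * Q s t.
Let A2 s t := a2 s t - P' s t.
Let A11 s t := a11 s t + kap ^ 2 * P s t.
Let A22 s t := a22 s t + ze ^ 2 * P s t.
Let A12 s t := a12 s t + kap * Q' s t.
Let B s t := b s t - Q s t.
Let B1 s t := b1 s t - kap * P s t.
Let B2 s t := b2 s t - Q' s t.
Let B11 s t := b11 s t + kap ^ 2 * Q s t.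
Let B22 s t := b22 s t + ze ^ 2 * Q s t.
Let B12 s t := b12 s t - kap * P' s t.

Ltac unf := unfold A, A1, A2, A11, A22, A12, B, B1, B2, B11, B22, B12, P, Q, P', Q', wr, wi, wr', wi', wave, wave'.
Ltac derunf := unf; der; [.. | simpl; ring].

Let CA : C2r (fun _ t => 1 < t) A A1 A2 A11 A22 A12.
Proof.
  destruct Ca as [D1 D2 D11 D22 D12 K0 K1 K2 K11 K22 K12]. split; intros s t Ht.
  - derunf.
  - derunf.
  - derunf.
  - derunf.
  - derunf.
  - unf. c2d.
  - unf. c2d.
  - unf. c2d.
  - unf. c2d.
  - unf. c2d.
  - unf. c2d.
Qed.
Let CB : C2r (fun _ t => 1 < t) B B1 B2 B11 B22 B12.
Proof.
  destruct Cb as [D1 D2 D11 D22 D12 K0 K1 K2 K11 K22 K12]. split; intros s t Ht.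
  - derunf.
  - derunf.
  - derunf.
  - derunf.
  - derunf.
  - unf. c2d.
  - unf. c2d.
  - unf. c2d.
  - unf. c2d.
  - unf. c2d.
  - unf. c2d.
Qed.
Let EA s t : 1 < t -> A11 s t + A22 s t + k ^ 2 * A s t = 0.
Proof. intros Ht. rewrite <- Hze. pose proof (Ea s t Ht) as E. rewrite <- Hze in E. unfold A11, A22, A. lra. Qed.
Let EB s t : 1 < t -> B11 s t + B22 s t + k ^ 2 * B s t = 0.
Proof. intros Ht. rewrite <- Hze. pose proof (Eb s t Ht) as E. rewrite <- Hze in E. unfold B11, B22, B. lra. Qed.
Let QP t : 1 < t -> A d t * A1 d t + B d t * B1 d t = A 0 t * A1 0 t + B 0 t * B1 0 t.
Proof.
  intros Ht. pose proof (cos2_sin2 (kap * d)) as S.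
  assert (E0 : A d t = cos (kap * d) * A 0 t - sin (kap * d) * B 0 t).
  { unfold A, B, P, Q. rewrite Qa by assumption. rewrite Rmult_0_r, cos_0, sin_0. ring. }
  assert (E1 : B d t = sin (kap * d) * A 0 t + cos (kap * d) * B 0 t).
  { unfold A, B, P, Q. rewrite Qb by assumption. rewrite Rmult_0_r, cos_0, sin_0. ring. }
  assert (E2 : A1 d t = cos (kap * d) * A1 0 t - sin (kap * d) * B1 0 t).
  { unfold A1, B1, P, Q. rewrite Qa1 by assumption. rewrite Rmult_0_r, cos_0, sin_0. ring. }
  assert (E3 : B1 d t = sin (kap * d) * A1 0 t + cos (kap * d) * B1 0 t).
  { unfold A1, B1, P, Q. rewrite Qb1 by assumption. rewrite Rmult_0_r, cos_0, sin_0. ring. }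
  rewrite E0, E1, E2, E3.
  replace (_ + _) with ((cos (kap * d) ^ 2 + sin (kap * d) ^ 2) * (A 0 t * A1 0 t + B 0 t * B1 0 t)) by ring.
  rewrite S. ring.
Qed.
Let rp s t : cos (kap * s) * A s t + sin (kap * s) * B s t = cos (kap * s) * a s t + sin (kap * s) * b s t - wr t.
Proof.
  unfold A, B, P, Q. rewrite <- (Rmult_1_l (wr t)) at 3. rewrite <- (cos2_sin2 (kap * s)). ring.
Qed.
Let rq s t : cos (kap * s) * B s t - sin (kap * s) * A s t = cos (kap * s) * b s t - sin (kap * s) * a s t - wi t.
Proof.
  unfold A, B, P, Q. rewrite <- (Rmult_1_l (wi t)) at 3. rewrite <- (cos2_sin2 (kap * s)). ring.
Qed.
Let lineX f t : cont_on (fun _ t => 1 < t) f -> 1 < t -> ex_RInt (fun s => f s t) 0 d.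
Proof. intros Hf Ht. apply ex_RInt_cont; [lra|]. intros s _. apply (cont_2d_fst f), Hf, Ht. Qed.

Let Mz1 t : 1 < t -> RInt (fun s => cos (kap * s) * A s t + sin (kap * s) * B s t) 0 d = 0.
Proof.
  intros Ht. apply (negligible_mean_zero d Hd (fun s t => cos (kap * s) * A s t + sin (kap * s) * B s t)); [|assumption|].
  eapply negligible_ext; [|exact Np]. intros; symmetry; apply rp.
  apply (lineX (fun s t => cos (kap * s) * A s t + sin (kap * s) * B s t)); [|assumption].
  pose proof (c2_c0 _ _ _ _ _ _ _ CA). pose proof (c2_c0 _ _ _ _ _ _ _ CB). intros s y Hy. c2d.
Qed.
Let Mz2 t : 1 < t -> RInt (fun s => cos (kap * s) * B s t - sin (kap * s) * A s t) 0 d = 0.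
Proof.
  intros Ht. apply (negligible_mean_zero d Hd (fun s t => cos (kap * s) * B s t - sin (kap * s) * A s t)); [|assumption|].
  eapply negligible_ext; [|exact Nq]. intros; symmetry; apply rq.
  apply (lineX (fun s t => cos (kap * s) * B s t - sin (kap * s) * A s t)); [|assumption].
  pose proof (c2_c0 _ _ _ _ _ _ _ CA). pose proof (c2_c0 _ _ _ _ _ _ _ CB). intros s y Hy. c2d.
Qed.
Let Dec g : 0 < g -> exists T, forall t s, T <= t -> 0 <= s <= d -> A s t ^ 2 + B s t ^ 2 <= g.
Proof.
  intros Hg. set (g' := Rmin 1 (g / 2)). assert (Hg' : 0 < g') by (apply Rmin_pos; lra).
  assert (g' <= 1) by apply Rmin_l. assert (g' <= g / 2) by apply Rmin_r.
  destruct (proj1 Np g' Hg') as [T1 H1]. destruct (proj1 Nq g' Hg') as [T2 H2].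
  exists (Rmax T1 T2). intros t s Ht _.
  pose proof (H1 t s (Rle_trans _ _ _ (Rmax_l _ _) Ht)) as K1. pose proof (H2 t s (Rle_trans _ _ _ (Rmax_r _ _) Ht)) as K2.
  rewrite <- rp in K1. rewrite <- rq in K2.
  replace (A s t ^ 2 + B s t ^ 2) with ((cos (kap * s) ^ 2 + sin (kap * s) ^ 2) * (A s t ^ 2 + B s t ^ 2)) by (rewrite cos2_sin2; ring).
  replace (_ * _) with ((cos (kap * s) * A s t + sin (kap * s) * B s t) ^ 2 + (cos (kap * s) * B s t - sin (kap * s) * A s t) ^ 2) by ring.
  assert (Sq : forall x, Rabs x <= g' -> x ^ 2 <= g').
  { intros x Hx. rewrite <- pow2_abs. pose proof (Rabs_pos x).
    apply Rle_trans with (g' ^ 2). apply pow_incr; lra. nra. }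
  pose proof (Sq _ K1). pose proof (Sq _ K2). lra.
Qed.

(** N is minus the flux of the evanescent part, nonnegative by [strip_flux_nonpos]. Mixed terms drop
    out because the evanescent part and its vertical derivative both have mean zero once the phase
    is removed. [strip_flux_bound] bounds the evanescent energy above the line by 2 N, whence 10 d N
    in the trace estimate. *)
Lemma half_strip_total t : 1 < t -> exists N, 0 <= N /\
  RInt (fun s => a s t * a2 s t + b s t * b2 s t) 0 d = d * (wr t * wr' t + wi t * wi' t) - N /\
  RInt (fun s => (a s t - (cos (kap * s) * wr t - sin (kap * s) * wi t)) ^ 2 +
     (b s t - (sin (kap * s) * wr t + cos (kap * s) * wi t)) ^ 2) 0 d <= 10 * d * N /\
  RInt (fun s => cos (kap * s) * a2 s t + sin (kap * s) * b2 s t) 0 d = d * wr' t /\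
  RInt (fun s => cos (kap * s) * b2 s t - sin (kap * s) * a2 s t) 0 d = d * wi' t.
Proof.
  intros Ht.
  exists (- RInt (fun s => A s t * A2 s t + B s t * B2 s t) 0 d).
  pose proof (c2_c0 _ _ _ _ _ _ _ CA) as cA. pose proof (c2_c0 _ _ _ _ _ _ _ CB) as cB.
  pose proof (c2_c2 _ _ _ _ _ _ _ CA) as cA2. pose proof (c2_c2 _ _ _ _ _ _ _ CB) as cB2.
  destruct (strip_mean_derivative d kap A A1 A2 A11 A22 A12 B B1 B2 B11 B22 B12 Hd CA CB Mz1 Mz2 t Ht) as [D1 D2].
  pose proof (strip_flux_nonpos k d kap A A1 A2 A11 A22 A12 B B1 B2 B11 B22 B12 Hd Hk Hkd Hkap CA CB EA EB QP Mz1 Mz2 Dec t Ht) as F1.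
  pose proof (strip_flux_bound k d kap A A1 A2 A11 A22 A12 B B1 B2 B11 B22 B12 Hd Hk Hkd Hkap CA CB EA EB QP Mz1 Mz2 Dec t) as F2.
  pose proof (strip_trace k d kap A A1 A2 A11 A22 A12 B B1 B2 B11 B22 B12 Hd Hk Hkd Hkap CA CB Mz1 Mz2 Dec t
    (- 2 * RInt (fun s => A s t * A2 s t + B s t * B2 s t) 0 d) Ht) as F3.
  pose proof (Mz1 t Ht) as M1. pose proof (Mz2 t Ht) as M2.
  assert (X : forall f, cont_on (fun _ t => 1 < t) f -> ex_RInt (fun s => f s t) 0 d) by (intros; apply lineX; assumption).
  assert (X1 : ex_RInt (fun s => A s t * A2 s t + B s t * B2 s t) 0 d).
  { apply (X (fun s t => A s t * A2 s t + B s t * B2 s t)). intros s y Hy; c2d. }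
  assert (X2 : ex_RInt (fun s => cos (kap * s) * A2 s t + sin (kap * s) * B2 s t) 0 d).
  { apply (X (fun s t => cos (kap * s) * A2 s t + sin (kap * s) * B2 s t)). intros s y Hy; c2d. }
  assert (X3 : ex_RInt (fun s => cos (kap * s) * B2 s t - sin (kap * s) * A2 s t) 0 d).
  { apply (X (fun s t => cos (kap * s) * B2 s t - sin (kap * s) * A2 s t)). intros s y Hy; c2d. }
  assert (X4 : ex_RInt (fun s => cos (kap * s) * A s t + sin (kap * s) * B s t) 0 d).
  { apply (X (fun s t => cos (kap * s) * A s t + sin (kap * s) * B s t)). intros s y Hy; c2d. }
  assert (X5 : ex_RInt (fun s => cos (kap * s) * B s t - sin (kap * s) * A s t) 0 d).
  { apply (X (fun s t => cos (kap * s) * B s t - sin (kap * s) * A s t)). intros s y Hy; c2d. }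
  split; [lra|]. split; [|split; [|split]].
  - rewrite (RInt_ext_R (fun s => a s t * a2 s t + b s t * b2 s t)
      (fun s => (A s t * A2 s t + B s t * B2 s t) + (wr t * (cos (kap * s) * A2 s t + sin (kap * s) * B2 s t)
        + (wi t * (cos (kap * s) * B2 s t - sin (kap * s) * A2 s t)
        + (wr' t * (cos (kap * s) * A s t + sin (kap * s) * B s t)
        + (wi' t * (cos (kap * s) * B s t - sin (kap * s) * A s t) + (wr t * wr' t + wi t * wi' t))))))); [|lra|].
    + assert (L5 : forall (f0 f1 f2 f3 f4 : R -> R) c1 c2 c3 c4 c5, ex_RInt f0 0 d -> ex_RInt f1 0 d ->
        ex_RInt f2 0 d -> ex_RInt f3 0 d -> ex_RInt f4 0 d -> RInt f1 0 d = 0 -> RInt f2 0 d = 0 -> RInt f3 0 d = 0 -> RInt f4 0 d = 0 ->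
        RInt (fun s => f0 s + (c1 * f1 s + (c2 * f2 s + (c3 * f3 s + (c4 * f4 s + c5))))) 0 d = d * c5 - - RInt f0 0 d).
      { intros f0 f1 f2 f3 f4 c1 c2 c3 c4 c5 ? ? ? ? ? Z1 Z2 Z3 Z4.
        repeat (rewrite RInt_plus_R; [|first [assumption | apply ex_RInt_scal_R; assumption]
         |repeat (apply ex_RInt_plus_R; [apply ex_RInt_scal_R; assumption|]); apply ex_RInt_const_R]).
        rewrite !RInt_scal_R by assumption. rewrite Z1, Z2, Z3, Z4, RInt_const_R. req. ring. }
      apply (L5 _ (fun s => cos (kap * s) * A2 s t + sin (kap * s) * B2 s t) (fun s => cos (kap * s) * B2 s t - sin (kap * s) * A2 s t)
       (fun s => cos (kap * s) * A s t + sin (kap * s) * B s t) (fun s => cos (kap * s) * B s t - sin (kap * s) * A s t)); assumption.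
    + intros s _.
      replace (wr t * wr' t + wi t * wi' t) with ((cos (kap * s) ^ 2 + sin (kap * s) ^ 2) * (wr t * wr' t + wi t * wi' t)) by (rewrite cos2_sin2; ring).
      unfold A, A2, B, B2, P, Q, P', Q'. ring.
  - replace (10 * d * - RInt (fun s => A s t * A2 s t + B s t * B2 s t) 0 d) with
      (5 * d * (-2 * RInt (fun s => A s t * A2 s t + B s t * B2 s t) 0 d)) by (req; ring).
    apply F3. intros tau Htau. specialize (F2 tau Ht Htau).
    match goal with H : _ <= - (/ 2 * ?z) |- ?y <= _ => change y with z; lra end.
  - rewrite (RInt_ext_R _ (fun s => (cos (kap * s) * A2 s t + sin (kap * s) * B2 s t) + wr' t)); [|lra|].
    + rewrite RInt_plus_R by (assumption || apply ex_RInt_const_R). rewrite D1, RInt_const_R. req; ring.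
    + intros s _. rewrite <- (Rmult_1_l (wr' t)). rewrite <- (cos2_sin2 (kap * s)). unfold A2, B2, P', Q'. ring.
  - rewrite (RInt_ext_R _ (fun s => (cos (kap * s) * B2 s t - sin (kap * s) * A2 s t) + wi' t)); [|lra|].
    + rewrite RInt_plus_R by (assumption || apply ex_RInt_const_R). rewrite D2, RInt_const_R. req; ring.
    + intros s _. rewrite <- (Rmult_1_l (wi' t)). rewrite <- (cos2_sin2 (kap * s)). unfold A2, B2, P', Q'. ring.
Qed.
End TotalField.

(** * Real and imaginary parts of the scattered field *)

(** [C1_on] asserts existence and continuity of the partial derivatives; joint continuity of the
    function itself is recovered from them. *)
Lemma continuity_of_partials (f f1 f2 : R -> R -> R) s t :
  locally_2d (fun u v => is_derive (fun x => f x v) u (f1 u v)) s t ->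
  is_derive (fun y => f s y) t (f2 s t) -> continuity_2d_pt f1 s t -> continuity_2d_pt f s t.
Proof.
  intros H1 H2 H3. apply differentiable_continuity_pt. exists (f1 s t), (f2 s t).
  apply filterdiff_differentiable_pt_lim.
  apply (is_derive_filterdiff f s t f1 (f2 s t)); [|exact H2|].
  - apply locally_2d_locally in H1. apply (filter_imp _ _ (fun u H => H) H1).
  - apply continuity_2d_pt_filterlim in H3. exact H3.
Qed.

Lemma cell_open eps s t : cell eps s t -> locally_2d (cell eps) s t.
Proof.
  assert (P : forall r u v : R, Rabs (u - s) < r -> Rabs (v - t) < r -> s - r < u < s + r /\ t - r < v < t + r).
  { intros r u v Hu Hv. apply Rabs_def2 in Hu, Hv. lra. }
  intros [H|[H|[Hs Ht]]].
  - exists (mkposreal (t - 1) ltac:(lra)). intros u v Hu Hv. simpl in Hu, Hv.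
    destruct (P _ _ _ Hu Hv). left. lra.
  - exists (mkposreal (- t) ltac:(lra)). intros u v Hu Hv. simpl in Hu, Hv.
    destruct (P _ _ _ Hu Hv). right; left. lra.
  - assert (Hr : 0 < Rmin s (eps - s)) by (apply Rmin_pos; lra).
    exists (mkposreal _ Hr). intros u v Hu Hv. simpl in Hu, Hv.
    destruct (P _ _ _ Hu Hv). pose proof (Rmin_l s (eps - s)). pose proof (Rmin_r s (eps - s)).
    in_cell.
Qed.

Lemma cell_Omega eps d s t : cell eps s t -> Omega eps d (s, t).
Proof.
  intros [H|[H|[Hs Ht]]]; [left; exact H|right; left; exact H|right; right].
  exists 0%Z. unfold slit. simpl. rewrite Rmult_0_l, Rplus_0_l. split; assumption.
Qed.

Definition ure (u : R * R -> C) (s t : R) : R := fst (u (s, t)).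
Definition uim (u : R * R -> C) (s t : R) : R := snd (u (s, t)).

Lemma cont_ure (u : R * R -> C) s t : continuous u (s, t) -> continuity_2d_pt (ure u) s t.
Proof.
  intros H. apply continuity_2d_pt_filterlim. unfold ure.
  change (continuous (fun z : R * R => fst (u (fst z, snd z))) (s, t)).
  apply (continuous_ext (fun z : R * R => fst (u z))). intros [x y]; reflexivity.
  apply (continuous_comp (U := prod_UniformSpace R_UniformSpace R_UniformSpace) u fst (s, t)); [exact H|apply (continuous_fst (U := R_UniformSpace) (V := R_UniformSpace))].
Qed.
Lemma cont_uim (u : R * R -> C) s t : continuous u (s, t) -> continuity_2d_pt (uim u) s t.
Proof.
  intros H. apply continuity_2d_pt_filterlim. unfold uim.
  change (continuous (fun z : R * R => snd (u (fst z, snd z))) (s, t)).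
  apply (continuous_ext (fun z : R * R => snd (u z))). intros [x y]; reflexivity.
  apply (continuous_comp (U := prod_UniformSpace R_UniformSpace R_UniformSpace) u snd (s, t)); [exact H|apply (continuous_snd (U := R_UniformSpace) (V := R_UniformSpace))].
Qed.

Lemma C1_real (D : R * R -> Prop) u s t : C1_on D u -> D (s, t) ->
  (is_derive (fun x => ure u x t) s (ure (d1 u) s t) /\ is_derive (fun y => ure u s y) t (ure (d2 u) s t)) /\
  (is_derive (fun x => uim u x t) s (uim (d1 u) s t) /\ is_derive (fun y => uim u s y) t (uim (d2 u) s t)) /\
  (continuity_2d_pt (ure (d1 u)) s t /\ continuity_2d_pt (ure (d2 u)) s t) /\
  (continuity_2d_pt (uim (d1 u)) s t /\ continuity_2d_pt (uim (d2 u)) s t).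
Proof.
  intros H Hst. destruct (H _ Hst) as [[E1 E2] [[E3 E4] [C1 C2]]].
  repeat split; try (apply cont_ure; assumption); try (apply cont_uim; assumption);
  (apply Derive_correct; assumption).
Qed.

Lemma C2_real eps d u : C2_on (Omega eps d) u ->
  C2r (cell eps) (ure u) (ure (d1 u)) (ure (d2 u)) (ure (d1 (d1 u))) (ure (d2 (d2 u))) (ure (d2 (d1 u))) /\
  C2r (cell eps) (uim u) (uim (d1 u)) (uim (d2 u)) (uim (d1 (d1 u))) (uim (d2 (d2 u))) (uim (d2 (d1 u))).
Proof.
  intros [H0 [H1 H2]].
  assert (K0 : forall s t, cell eps s t -> _) by exact (fun s t Hst => C1_real _ u s t H0 (cell_Omega eps d s t Hst)).
  assert (K1 : forall s t, cell eps s t -> _) by exact (fun s t Hst => C1_real _ _ s t H1 (cell_Omega eps d s t Hst)).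
  assert (K2 : forall s t, cell eps s t -> _) by exact (fun s t Hst => C1_real _ _ s t H2 (cell_Omega eps d s t Hst)).
  assert (L : forall s t, cell eps s t -> locally_2d (cell eps) s t) by apply cell_open.
  split; split; intros s t Hst;
    destruct (K0 s t Hst) as [[a1 a2] [[a3 a4] [[a5 a6] [a7 a8]]]];
    destruct (K1 s t Hst) as [[b1 b2] [[b3 b4] [[b5 b6] [b7 b8]]]];
    destruct (K2 s t Hst) as [[c1 c2] [[c3 c4] [[c5 c6] [c7 c8]]]].
  - exact a1.
  - exact a2.
  - exact b1.
  - exact c2.
  - exact b2.
  - apply (continuity_of_partials _ (ure (d1 u)) (ure (d2 u))); [|exact a2|exact a5].
    destruct (L s t Hst) as [dl Hd]. exists dl. intros x y Hx Hy. exact (proj1 (proj1 (K0 x y (Hd x y Hx Hy)))).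
  - exact a5.
  - exact a6.
  - exact b5.
  - exact c6.
  - exact b6.
  - exact a3.
  - exact a4.
  - exact b3.
  - exact c4.
  - exact b4.
  - apply (continuity_of_partials _ (uim (d1 u)) (uim (d2 u))); [|exact a4|exact a7].
    destruct (L s t Hst) as [dl Hd]. exists dl. intros x y Hx Hy. exact (proj1 (proj1 (proj2 (K0 x y (Hd x y Hx Hy))))).
  - exact a7.
  - exact a8.
  - exact b7.
  - exact c8.
  - exact b8.
Qed.

(** The reflection t -> 1 - t carries the lower half-plane onto the upper one, so the half-plane
    analysis is done only once; t-derivatives change sign. *)
Lemma C2r_reflect D z z1 z2 z11 z22 z12 : C2r D z z1 z2 z11 z22 z12 ->
  C2r (fun s t => D s (1 - t)) (fun s t => z s (1 - t)) (fun s t => z1 s (1 - t)) (fun s t => - z2 s (1 - t))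
   (fun s t => z11 s (1 - t)) (fun s t => z22 s (1 - t)) (fun s t => - z12 s (1 - t)).
Proof.
  intros [D1 D2 D11 D22 D12 K0 K1 K2 K11 K22 K12].
  assert (R : forall (f : R -> R) t l, is_derive f (1 - t) l -> is_derive (fun y => f (1 - y)) t (- l)).
  { intros f t l Hf. apply is_der_eq with (-1 * l); [|ring].
    apply (is_derive_comp f (fun y => 1 - y)); [exact Hf|]. der. ring. }
  assert (Cc : forall f s t, continuity_2d_pt f s (1 - t) -> continuity_2d_pt (fun x y => f x (1 - y)) s t).
  { intros f s t Hf e. destruct (Hf e) as [dl Hdl]. exists dl. intros x y Hx Hy. apply Hdl. exact Hx.
    replace (1 - y - (1 - t)) with (- (y - t)) by ring. rewrite Rabs_Ropp. exact Hy. }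
  split; intros s t Hst.
  - apply D1, Hst.
  - apply (R (fun y => z s y)), D2, Hst.
  - apply D11, Hst.
  - apply is_der_eq with (- - z22 s (1 - t)); [|ring]. apply (is_der_opp (fun y => z2 s (1 - y))).
    apply (R (fun y => z2 s y)), D22, Hst.
  - apply (R (fun y => z1 s y)), D12, Hst.
  - apply Cc, K0, Hst.
  - apply Cc, K1, Hst.
  - apply (continuity_2d_pt_opp (fun s t => z2 s (1 - t))), Cc, K2, Hst.
  - apply Cc, K11, Hst.
  - apply Cc, K22, Hst.
  - apply (continuity_2d_pt_opp (fun s t => z12 s (1 - t))), Cc, K12, Hst.
Qed.

Lemma C2r_sub (D D' : R -> R -> Prop) z z1 z2 z11 z22 z12 : (forall s t, D' s t -> D s t) ->
  C2r D z z1 z2 z11 z22 z12 -> C2r D' z z1 z2 z11 z22 z12.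
Proof.
  intros S [D1 D2 D11 D22 D12 K0 K1 K2 K11 K22 K12].
  split; try (apply (cont_on_sub D); assumption); auto.
Qed.

(** x0 + i y0 is the coefficient of order 0. The rest of the expansion splits into the positive and
    the negative orders, and [one_sided_negligible] covers each. *)
Lemma outgoing_real d k kap (f : R -> R -> C) : 0 < d -> 0 < k -> k * d <= 1 / 10 -> Rabs kap < k ->
  (exists a : Z -> C, forall s t, 1 < t -> is_biseries (fun n => Cmult (a n)
      (plane_wave (RtoC (kappa_n d kap n)) (zeta_n d k kap n) (s, t))) (f s t)) ->
  exists x0 y0, let ze := sqrt (k ^ 2 - kap ^ 2) in
  negligible d (fun s t => rot_re kap f s t - (x0 * cos (ze * t) - y0 * sin (ze * t))) /\
  negligible d (fun s t => rot_im kap f s t - (x0 * sin (ze * t) + y0 * cos (ze * t))).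
Proof.
  intros Hd Hk Hkd Hkap [a Ha]. exists (fst (a 0%Z)), (snd (a 0%Z)). set (ze := sqrt (k ^ 2 - kap ^ 2)).
  set (T := fun s t n => Cmult (a n) (plane_wave (RtoC (kappa_n d kap n)) (zeta_n d k kap n) (s, t))) in *.
  (* The sums of the two one-sided series are given point by point; they are chosen here as
     functions of the point, with no condition where t <= 1. *)
  assert (G : forall p : R * R, exists l : C * C, 1 < snd p ->
    is_series (V := C_R_NormedModule) (fun n : nat => T (fst p) (snd p) (Z.of_nat n)) (fst l) /\
    is_series (V := C_R_NormedModule) (fun n : nat => T (fst p) (snd p) (- Z.of_nat (S n))%Z) (snd l) /\
    f (fst p) (snd p) = Cplus (fst l) (snd l)).
  { intros [s t]. destruct (Rlt_dec 1 t) as [Ht|Ht].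
    - destruct (Ha s t Ht) as [l1 [l2 [S1 [S2 E]]]]. exists (l1, l2). intros _. split; [|split]; assumption.
    - exists (RtoC 0, RtoC 0). intros H; contradiction. }
  set (L := fun p => proj1_sig (constructive_indefinite_description _ (G p))).
  assert (HL : forall s t, 1 < t -> is_series (V := C_R_NormedModule) (fun n : nat => T s t (Z.of_nat n)) (fst (L (s, t))) /\
    is_series (V := C_R_NormedModule) (fun n : nat => T s t (- Z.of_nat (S n))%Z) (snd (L (s, t))) /\
    f s t = Cplus (fst (L (s, t))) (snd (L (s, t)))).
  { intros s t Ht. unfold L. destruct constructive_indefinite_description as [l Hl]; simpl proj1_sig. apply Hl, Ht. }
  clearbody L. clear G.
  set (g1 := fun s t => Cminus (fst (L (s, t))) (T s t 0%Z)).
  set (g2 := fun s t => snd (L (s, t))).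
  destruct (one_sided_negligible d k kap Hd Hk Hkd Hkap a (fun n => Z.of_nat (S n)) g1) as [N1 N2].
  { intros n; lia. }
  { intros s t Ht. destruct (HL s t Ht) as [S1 _].
    apply (is_series_incr_1 (K := R_AbsRing) (V := C_R_NormedModule) (fun n => T s t (Z.of_nat n))).
    change (is_series (V := C_R_NormedModule) (fun n : nat => T s t (Z.of_nat n)) (Cplus (g1 s t) (T s t 0%Z))).
    unfold g1. replace (Cplus _ _) with (fst (L (s, t))) by ring. exact S1. }
  destruct (one_sided_negligible d k kap Hd Hk Hkd Hkap a (fun n => (- Z.of_nat (S n))%Z) g2) as [N3 N4].
  { intros n; lia. }
  { intros s t Ht. apply (HL s t Ht). }
  assert (T0 : forall s t, T s t 0%Z =
    (fst (a 0%Z) * cos (kap * s + ze * t) - snd (a 0%Z) * sin (kap * s + ze * t),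
     fst (a 0%Z) * sin (kap * s + ze * t) + snd (a 0%Z) * cos (kap * s + ze * t))).
  { intros s t. unfold T.
    assert (E0 : kappa_n d kap 0 = kap) by (unfold kappa_n; field; lra).
    assert (Z0 : zeta_n d k kap 0 = RtoC ze).
    { unfold zeta_n. rewrite E0. destruct Rlt_dec; [reflexivity|contradiction]. }
    rewrite E0, Z0. destruct (a 0%Z) as [x y]. unfold plane_wave, cexp, Cmult, Cplus, Ci, RtoC, Re, Im; simpl.
    apply injective_projections; simpl;
    repeat match goal with |- context [exp ?e] => progress replace (exp e) with 1 by (rewrite <- exp_0; f_equal; ring) end;
    repeat match goal with |- context [cos ?e] => progress replace (cos e) with (cos (kap * s + ze * t)) by (f_equal; ring) end;
    repeat match goal with |- context [sin ?e] => progress replace (sin e) with (sin (kap * s + ze * t)) by (f_equal; ring) end; ring. }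
  assert (E : forall s t, 1 < t -> fst (f s t) = fst (g1 s t) + fst (g2 s t) + fst (T s t 0%Z) /\
     snd (f s t) = snd (g1 s t) + snd (g2 s t) + snd (T s t 0%Z)).
  { intros s t Ht. destruct (HL s t Ht) as [_ [_ ->]]. unfold g1, g2. cbn. split; ring. }
  split.
  - apply (negligible_ext d (fun s t => rot_re kap g1 s t + rot_re kap g2 s t)); [|apply negligible_plus; assumption].
    intros s t Ht. destruct (E s t Ht) as [E1 E2]. unfold rot_re. rewrite E1, E2, T0. cbn [fst snd].
    replace (ze * t) with ((kap * s + ze * t) - kap * s) at 5 6 by ring. rewrite cos_minus, sin_minus. ring.
  - apply (negligible_ext d (fun s t => rot_im kap g1 s t + rot_im kap g2 s t)); [|apply negligible_plus; assumption].
    intros s t Ht. destruct (E s t Ht) as [E1 E2]. unfold rot_im. rewrite E1, E2, T0. cbn [fst snd].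
    replace (ze * t) with ((kap * s + ze * t) - kap * s) at 5 6 by ring. rewrite cos_minus, sin_minus. ring.
Qed.

(** * Energy and flux in the perforated cell *)

Lemma amgm_abs x K D lam : 0 < lam -> 0 <= K -> 0 <= D -> x ^ 2 <= K * D -> Rabs x <= lam * D + K / lam.
Proof.
  intros Hl HK HD Hx.
  assert (H0 : 0 <= lam * D) by (apply Rmult_le_pos; lra).
  assert (H1 : 0 <= K / lam) by (apply Rmult_le_pos; [assumption|left; apply Rinv_0_lt_compat, Hl]).
  rewrite <- (Rabs_pos_eq (lam * D + K / lam)) by lra.
  apply Rsqr_le_abs_0. unfold Rsqr.
  assert (E : lam * D * (K / lam) = K * D) by (field; lra).
  pose proof (pow2_ge_0 (lam * D - K / lam)). nra.
Qed.

Lemma le_of_forall_small (x y C : R) : 0 <= C -> (forall g, 0 < g <= 1 -> x <= y + C * g) -> x <= y.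
Proof.
  intros HC H. apply (le_of_forall_pos x y C HC). intros g Hg.
  assert (Hm : 0 < Rmin g 1 <= 1) by (split; [apply Rmin_pos; lra|apply Rmin_r]).
  pose proof (H _ Hm). pose proof (Rmin_l g 1).
  assert (C * Rmin g 1 <= C * g) by (apply Rmult_le_compat_l; assumption). lra.
Qed.

Definition damp (gm x : R) : R := / sqrt (1 + gm * x).

(** Here x stands for |u|^2. The identity damp^2 (1 + gm x) = 1 governs the divergence of the damped
    flux, x damp^2 <= 1 / gm controls the flux by the energy density, and the two lower bounds
    recover the undamped quantities as gm tends to 0. *)
Lemma damp_facts gm x : 0 < gm -> 0 <= x ->
  0 < damp gm x <= 1 /\ damp gm x ^ 2 * (1 + gm * x) = 1 /\ 1 - gm * x <= damp gm x /\
  x * damp gm x ^ 2 <= / gm /\ 1 - 2 * (gm * x) <= damp gm x ^ 3.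
Proof.
  intros Hg Hx. assert (Hp : 0 <= gm * x) by (apply Rmult_le_pos; lra).
  set (y := gm * x) in *. unfold damp. fold y.
  assert (S1 : 1 <= sqrt (1 + y)) by (rewrite <- sqrt_1 at 1; apply sqrt_le_1_alt; lra).
  assert (D1 : 0 < / sqrt (1 + y)) by (apply Rinv_0_lt_compat; lra).
  assert (D2 : / sqrt (1 + y) <= 1) by (rewrite <- Rinv_1 at 2; apply Rinv_le_contravar; lra).
  assert (D3 : (/ sqrt (1 + y)) ^ 2 * (1 + y) = 1).
  { rewrite <- (pow2_sqrt (1 + y)) at 2 by lra. field. lra. }
  set (q := / sqrt (1 + y)) in *. clearbody q.
  assert (Q2 : 1 - y <= q ^ 2).
  { apply (Rmult_le_reg_r (1 + y)); [lra|]. rewrite D3. pose proof (pow2_ge_0 y). lra. }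
  assert (Q21 : q ^ 2 <= q) by nra.
  split; [lra|]. split; [assumption|]. split; [lra|]. split.
  - apply (Rmult_le_reg_l gm); [assumption|]. rewrite Rinv_r by lra.
    replace (gm * (x * q ^ 2)) with (q ^ 2 * y) by (unfold y; ring).
    pose proof (pow2_ge_0 q). lra.
  - assert (Q4 : (q ^ 2) ^ 2 <= q ^ 3).
    { replace ((q ^ 2) ^ 2) with (q ^ 3 * q) by ring. assert (0 <= q ^ 3) by (apply pow_le; lra). nra. }
    assert (1 - 2 * y <= (q ^ 2) ^ 2); [|lra].
    destruct (Rle_dec y 1). assert ((1 - y) ^ 2 <= (q ^ 2) ^ 2) by (apply pow_incr; lra). nra.
    pose proof (pow2_ge_0 (q ^ 2)). lra.
Qed.

Lemma damp_derive gm x : 0 < gm -> 0 <= x -> is_derive (damp gm) x (- (gm / 2) * damp gm x ^ 3).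
Proof.
  intros Hg Hx. assert (Hp : 0 <= gm * x) by (apply Rmult_le_pos; lra).
  assert (S0 : 0 < sqrt (1 + gm * x)) by (apply sqrt_lt_R0; lra).
  unfold damp. auto_derive. split; [lra|]. split; [lra|exact I].
  field. lra.
Qed.

Lemma damp_cont gm f s t : 0 < gm -> 0 <= f s t -> continuity_2d_pt f s t ->
  continuity_2d_pt (fun s t => damp gm (f s t)) s t.
Proof.
  intros Hg Hp Hf. apply (continuity_1d_2d_pt_comp (damp gm) f); [|exact Hf].
  apply continuity_pt_filterlim.
  apply (ex_derive_continuous (K := R_AbsRing) (V := R_NormedModule)). eexists. apply damp_derive; assumption.
Qed.

(** r0 nearly attains the supremum of T. With T r the mass between the distances r and 1 from the
    slab, it makes the mass of thin layers next to the slab small. *)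
Lemma tail_small (T : R -> R) M g : (forall r, 0 < r < 1 -> T r <= M) -> 0 < g ->
  exists r0, 0 < r0 < 1 /\ forall r, 0 < r < 1 -> T r - T r0 <= g.
Proof.
  intros HT Hg.
  destruct (completeness (fun x => exists r, 0 < r < 1 /\ x = T r)) as [S [S1 S2]].
  - exists M. intros x [r [Hr ->]]. apply HT, Hr.
  - exists (T (1 / 2)). exists (1 / 2). split; [lra|reflexivity].
  - assert (N : exists r0, 0 < r0 < 1 /\ S - g < T r0).
    { apply NNPP. intros N. assert (S <= S - g); [|lra]. apply S2. intros x [r [Hr ->]].
      apply Rnot_lt_le. intros H. apply N. exists r. split; assumption. }
    destruct N as [r0 [H0 H1]]. exists r0. split; [assumption|]. intros r Hr.
    assert (T r <= S) by (apply S1; exists r; split; [assumption|reflexivity]). lra.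
Qed.

(** The slit openings belong to the domain, so the field is uniformly continuous up to them, and
    bounds on the lines just outside pass to the opening itself, at distance h = 0. *)
Lemma trace_limit (phi : R -> R -> R) x y B : x <= y -> cont_on (rect x y 0 1) phi ->
  (forall g, 0 < g -> exists h1, 0 < h1 /\ forall h, 0 < h < h1 -> RInt (fun s => phi s h) x y <= B + g) ->
  RInt (fun s => phi s 0) x y <= B.
Proof.
  intros Hxy Cp H. apply (le_of_forall_pos _ _ (1 + (y - x))); [lra|]. intros g Hg.
  destruct (H g Hg) as [h1 [Hh1 K]].
  destruct (uniform_continuity_2d phi x y 0 1) with (eps := mkposreal g Hg) as [dl Hdl].
  { intros; apply Cp; split; assumption. }
  set (h := Rmin (h1 / 2) (Rmin (dl / 2) 1)). pose proof (cond_pos dl).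
  assert (Hh : 0 < h) by (repeat apply Rmin_pos; lra).
  assert (Ha : h <= h1 / 2) by apply Rmin_l.
  assert (Hb : h <= dl / 2) by (eapply Rle_trans; [apply Rmin_r|apply Rmin_l]).
  assert (Hc : h <= 1) by (eapply Rle_trans; [apply Rmin_r|apply Rmin_r]).
  specialize (K h ltac:(lra)).
  assert (X : forall t, 0 <= t <= 1 -> ex_RInt (fun s => phi s t) x y).
  { intros t Ht. apply (ex_RInt_in' x y 0 1 Hxy phi t Cp Ht). }
  assert (L : RInt (fun s => phi s 0) x y <= RInt (fun s => phi s h + g) x y).
  { apply RInt_le_R; [assumption|apply X; lra|apply ex_RInt_plus_R; [apply X; lra|apply ex_RInt_const_R]|].
    intros s Hs. assert (D : Rabs (phi s 0 - phi s h) < g).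
    { apply (Hdl s h s 0); try lra. rewrite Rminus_diag, Rabs_R0. lra. rewrite Rabs_minus_sym, Rabs_pos_eq; lra. }
    apply Rabs_def2 in D. lra. }
  rewrite (RInt_plus_R (fun s => phi s h) (fun _ => g)) in L by (try (apply X; lra); apply ex_RInt_const_R).
  rewrite RInt_const_R in L. lra.
Qed.

Lemma small_near (f : R -> R) t0 g : continuous f t0 -> 0 < g ->
  exists h1, 0 < h1 /\ forall h, 0 < h < h1 -> Rabs (f (t0 + h) - f t0) <= g.
Proof.
  intros Hf Hg. apply continuity_pt_filterlim in Hf. destruct (Hf g Hg) as [dl [Hdl K]].
  exists dl. split; [assumption|]. intros h Hh.
  left. apply (K (t0 + h)). split. split; [exact I|lra].
  unfold dist; simpl. unfold R_dist. rewrite Rabs_pos_eq; lra.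
Qed.

Section Slab.
Variables eps d k kap M : R.
Variables a a1 a2 a11 a22 a12 b b1 b2 b11 b22 b12 : R -> R -> R.
Hypothesis Heps : 0 < eps < d.
Hypothesis Hd1 : d <= 1.
Hypothesis Hk : 0 < k <= 1.
Hypothesis Hkd : k * d <= 1 / 10.
Hypothesis Hkap : Rabs kap <= k.
Hypothesis Ca : C2r (cell eps) a a1 a2 a11 a22 a12.
Hypothesis Cb : C2r (cell eps) b b1 b2 b11 b22 b12.
Hypothesis Ea : forall s t, cell eps s t -> a11 s t + a22 s t + k ^ 2 * a s t = 0.
Hypothesis Eb : forall s t, cell eps s t -> b11 s t + b22 s t + k ^ 2 * b s t = 0.
Let uu s t := a s t ^ 2 + b s t ^ 2.
Let gg s t := a1 s t ^ 2 + b1 s t ^ 2 + a2 s t ^ 2 + b2 s t ^ 2.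
Let dens s t := uu s t + gg s t.
Hypothesis HM : forall x y c e, 0 <= x -> x <= y -> y <= d -> -2 <= c -> c <= e -> e <= 3 ->
  (forall s t, rect x y c e s t -> cell eps s t) -> I2 dens x y c e <= M.
Hypothesis W1 : forall c e g, 0 < c -> e < 1 -> 0 < g -> exists h0, 0 < h0 /\
  forall h t, 0 < h < h0 -> c <= t <= e -> (Rabs (a1 h t) <= g /\ Rabs (b1 h t) <= g) /\
    (Rabs (a1 (eps - h) t) <= g /\ Rabs (b1 (eps - h) t) <= g).
Hypothesis W2 : forall x y g, eps < x -> y < d -> 0 < g -> exists h0, 0 < h0 /\
  forall h s, 0 < h < h0 -> x <= s <= y -> (Rabs (a2 s (1 + h)) <= g /\ Rabs (b2 s (1 + h)) <= g) /\
    (Rabs (a2 s (- h)) <= g /\ Rabs (b2 s (- h)) <= g).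
Hypothesis Qa : forall t, 1 < t \/ t < 0 -> a d t = cos (kap * d) * a 0 t - sin (kap * d) * b 0 t.
Hypothesis Qb : forall t, 1 < t \/ t < 0 -> b d t = sin (kap * d) * a 0 t + cos (kap * d) * b 0 t.
Hypothesis Qa1 : forall t, 1 < t \/ t < 0 -> a1 d t = cos (kap * d) * a1 0 t - sin (kap * d) * b1 0 t.
Hypothesis Qb1 : forall t, 1 < t \/ t < 0 -> b1 d t = sin (kap * d) * a1 0 t + cos (kap * d) * b1 0 t.

Let ka0 := c2_c0 _ _ _ _ _ _ _ Ca. Let kb0 := c2_c0 _ _ _ _ _ _ _ Cb.
Let ka1 := c2_c1 _ _ _ _ _ _ _ Ca. Let kb1 := c2_c1 _ _ _ _ _ _ _ Cb.
Let ka2 := c2_c2 _ _ _ _ _ _ _ Ca. Let kb2 := c2_c2 _ _ _ _ _ _ _ Cb.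
Let ka11 := c2_c11 _ _ _ _ _ _ _ Ca. Let kb11 := c2_c11 _ _ _ _ _ _ _ Cb.
Let ka22 := c2_c22 _ _ _ _ _ _ _ Ca. Let kb22 := c2_c22 _ _ _ _ _ _ _ Cb.

Lemma uu_pos s t : 0 <= uu s t.
Proof. unfold uu. pose proof (pow2_ge_0 (a s t)). pose proof (pow2_ge_0 (b s t)). lra. Qed.
Lemma gg_pos s t : 0 <= gg s t.
Proof.
  unfold gg. pose proof (pow2_ge_0 (a1 s t)). pose proof (pow2_ge_0 (b1 s t)).
  pose proof (pow2_ge_0 (a2 s t)). pose proof (pow2_ge_0 (b2 s t)). lra.
Qed.
Let cuu : cont_on (cell eps) uu.
Proof. intros s t H. unfold uu. c2d. Qed.
Let cgg : cont_on (cell eps) gg.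
Proof. intros s t H. unfold gg. c2d. Qed.
Let cdens : cont_on (cell eps) dens.
Proof. intros s t H. unfold dens, uu, gg. c2d. Qed.
Lemma dens_pos s t : 0 <= dens s t.
Proof. unfold dens. pose proof (uu_pos s t). pose proof (gg_pos s t). lra. Qed.

Lemma cauchy2 x1 y1 x2 y2 : (x1 * x2 + y1 * y2) ^ 2 <= (x1 ^ 2 + y1 ^ 2) * (x2 ^ 2 + y2 ^ 2).
Proof. pose proof (pow2_ge_0 (x1 * y2 - y1 * x2)). lra. Qed.

(** * The damped energy inequality *)

Section Damped.
Variable gm : R.
Hypothesis Hgm : 0 < gm <= 1.
Let q s t := damp gm (uu s t).
Let F1 s t := (a s t * a1 s t + b s t * b1 s t) * q s t.
Let F2 s t := (a s t * a2 s t + b s t * b2 s t) * q s t.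
Let F11 s t := (a1 s t ^ 2 + a s t * a11 s t + (b1 s t ^ 2 + b s t * b11 s t)) * q s t
  - gm * (a s t * a1 s t + b s t * b1 s t) ^ 2 * q s t ^ 3.
Let F22 s t := (a2 s t ^ 2 + a s t * a22 s t + (b2 s t ^ 2 + b s t * b22 s t)) * q s t
  - gm * (a s t * a2 s t + b s t * b2 s t) ^ 2 * q s t ^ 3.

Let cq : cont_on (cell eps) q.
Proof. intros s t H. apply damp_cont; [lra|apply uu_pos|apply cuu, H]. Qed.
Let cq3 : cont_on (cell eps) (fun s t => q s t ^ 3).
Proof. intros s t H. apply continuity_2d_pt_ext with (fun s t => q s t * q s t ^ 2). intros; ring. c2d. Qed.

(** This is the purpose of the damping: |u|^2 q^2 <= 1 / gm, so the square of the flux is at most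
    the squared gradient divided by gm even if u is unbounded at the corners. *)
Let flux_sq x1 x2 s t : (a s t * x1 + b s t * x2) ^ 2 * q s t ^ 2 <= / gm * (x1 ^ 2 + x2 ^ 2).
Proof.
  destruct (damp_facts gm (uu s t) ltac:(lra) (uu_pos s t)) as [_ [_ [_ [H _]]]]. fold (q s t) in H.
  pose proof (cauchy2 (a s t) (b s t) x1 x2) as C. fold (uu s t) in C.
  pose proof (pow2_ge_0 (q s t)). pose proof (pow2_ge_0 x1). pose proof (pow2_ge_0 x2).
  apply Rle_trans with (uu s t * (x1 ^ 2 + x2 ^ 2) * q s t ^ 2).
  apply Rmult_le_compat_r; assumption.
  replace (uu s t * (x1 ^ 2 + x2 ^ 2) * q s t ^ 2) with (uu s t * q s t ^ 2 * (x1 ^ 2 + x2 ^ 2)) by ring.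
  apply Rmult_le_compat_r; lra.
Qed.

(** Differentiating q costs gm q^3 times the square of the real part of conj(u) grad u, hence at
    most gm q^3 |u|^2 |grad u|^2. Since q = q^3 (1 + gm |u|^2), exactly q^3 |grad u|^2 survives. *)
Lemma damped_div_lower s t : cell eps s t -> q s t ^ 3 * gg s t - k ^ 2 * (uu s t * q s t) <= F11 s t + F22 s t.
Proof.
  intros H. destruct (damp_facts gm (uu s t) ltac:(lra) (uu_pos s t)) as [[q0 q1] [q2 _]]. fold (q s t) in q0, q1, q2.
  pose proof (Ea s t H) as e1. pose proof (Eb s t H) as e2.
  assert (E : F11 s t + F22 s t = q s t * gg s t - k ^ 2 * (uu s t * q s t)
    - gm * q s t ^ 3 * ((a s t * a1 s t + b s t * b1 s t) ^ 2 + (a s t * a2 s t + b s t * b2 s t) ^ 2)).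
  { unfold F11, F22, gg, uu. replace (a11 s t) with (- a22 s t - k ^ 2 * a s t) by lra.
    replace (b11 s t) with (- b22 s t - k ^ 2 * b s t) by lra. ring. }
  rewrite E.
  pose proof (cauchy2 (a s t) (b s t) (a1 s t) (b1 s t)) as C1. pose proof (cauchy2 (a s t) (b s t) (a2 s t) (b2 s t)) as C2.
  assert (C3 : (a s t * a1 s t + b s t * b1 s t) ^ 2 + (a s t * a2 s t + b s t * b2 s t) ^ 2 <= uu s t * gg s t).
  { unfold uu, gg. lra. }
  assert (0 <= gm * q s t ^ 3) by (apply Rmult_le_pos; [lra|apply pow_le; lra]).
  apply (Rmult_le_compat_l _ _ _ H0) in C3.
  replace (q s t * gg s t) with (q s t * (q s t ^ 2 * (1 + gm * uu s t)) * gg s t) by (rewrite q2; ring).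
  lra.
Qed.

Lemma damped_green h0 g r0 : 0 < h0 <= 1 -> 0 < g -> 0 < r0 ->
  exists rho, 0 < rho < r0 /\ rho < h0 /\
  I2 (fun s t => F11 s t + F22 s t) rho (eps - rho) 0 1 + I2 (fun s t => F11 s t + F22 s t) 0 d (1 + rho) (1 + h0)
   + I2 (fun s t => F11 s t + F22 s t) 0 d (- h0) (- rho) - g
  <= RInt (fun s => F2 s (1 + h0)) 0 d - RInt (fun s => F2 s (- h0)) 0 d.
Proof.
  intros Hh Hg Hr.
  assert (Hig : 0 < / gm) by (apply Rinv_0_lt_compat; lra).
  assert (Hq : forall s t, 0 <= uu s t) by apply uu_pos.
  assert (Dq : forall (f : R -> R) x l, is_derive f x l -> 0 <= f x -> is_derive (fun y => damp gm (f y)) x (- (gm / 2) * damp gm (f x) ^ 3 * l)).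
  { intros f x l Hf Hp. apply is_der_eq with (l * (- (gm / 2) * damp gm (f x) ^ 3)); [|ring].
    apply (is_derive_comp (damp gm) f); [apply damp_derive; lra|exact Hf]. }
  destruct (cell_green eps d (/ gm) M F1 F2 F11 F22 dens) with (tp := 1 + h0) (tm := - h0) (g := g) (r0 := r0)
    as [rho [R1 [R2 [R3 R4]]]]; try lra; try assumption.
  - intros s t H. unfold F1, F11, q, uu. eapply is_der_eq.
    + apply (is_der_mult (fun x => a x t * a1 x t + b x t * b1 x t)); [der_core|].
      apply (c2_d1 _ _ _ _ _ _ _ Ca s t H). apply (c2_d11 _ _ _ _ _ _ _ Ca s t H).
      apply (c2_d1 _ _ _ _ _ _ _ Cb s t H). apply (c2_d11 _ _ _ _ _ _ _ Cb s t H).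
      apply (Dq (fun x => a x t ^ 2 + b x t ^ 2)); [der_core|apply Hq].
      apply (c2_d1 _ _ _ _ _ _ _ Ca s t H). apply (c2_d1 _ _ _ _ _ _ _ Cb s t H).
    + simpl. field.
  - intros s t H. unfold F2, F22, q, uu. eapply is_der_eq.
    + apply (is_der_mult (fun x => a s x * a2 s x + b s x * b2 s x)); [der_core|].
      apply (c2_d2 _ _ _ _ _ _ _ Ca s t H). apply (c2_d22 _ _ _ _ _ _ _ Ca s t H).
      apply (c2_d2 _ _ _ _ _ _ _ Cb s t H). apply (c2_d22 _ _ _ _ _ _ _ Cb s t H).
      apply (Dq (fun x => a s x ^ 2 + b s x ^ 2)); [der_core|apply Hq].
      apply (c2_d2 _ _ _ _ _ _ _ Ca s t H). apply (c2_d2 _ _ _ _ _ _ _ Cb s t H).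
    + simpl. field.
  - intros s t H. unfold F1. c2d.
  - intros s t H. unfold F2. c2d.
  - intros s t H. unfold F11. c2d.
  - intros s t H. unfold F22. c2d.
  - intros; apply dens_pos.
  - intros s t lam H Hlam. apply amgm_abs; [assumption|lra|apply dens_pos|].
    unfold F1. rewrite Rpow_mult_distr. eapply Rle_trans; [apply flux_sq|]. apply Rmult_le_compat_l; [lra|].
    unfold dens, gg. pose proof (uu_pos s t). pose proof (pow2_ge_0 (a2 s t)). pose proof (pow2_ge_0 (b2 s t)). lra.
  - intros s t lam H Hlam. apply amgm_abs; [assumption|lra|apply dens_pos|].
    unfold F2. rewrite Rpow_mult_distr. eapply Rle_trans; [apply flux_sq|]. apply Rmult_le_compat_l; [lra|].
    unfold dens, gg. pose proof (uu_pos s t). pose proof (pow2_ge_0 (a1 s t)). pose proof (pow2_ge_0 (b1 s t)). lra.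
  - intros s t lam H Hlam.
    destruct (damp_facts gm (uu s t) ltac:(lra) (uu_pos s t)) as [[q0 q1] [_ [_ [q4 _]]]]. fold (q s t) in q0, q1, q4.
    pose proof (damped_div_lower s t H) as D.
    assert (0 <= q s t ^ 3 * gg s t) by (apply Rmult_le_pos; [apply pow_le; lra|apply gg_pos]).
    assert (Y : Rabs (k ^ 2 * (uu s t * q s t)) <= lam * dens s t + / gm / lam).
    { apply amgm_abs; [assumption|lra|apply dens_pos|].
      replace ((k ^ 2 * (uu s t * q s t)) ^ 2) with ((k ^ 2) ^ 2 * (uu s t * q s t ^ 2) * uu s t) by ring.
      pose proof (uu_pos s t). pose proof (gg_pos s t).
      assert (k2 : 0 <= (k ^ 2) ^ 2 <= 1). { split; [apply pow2_ge_0|]. pose proof (pow_incr k 1 2 ltac:(lra)) as Hk2. rewrite pow1 in Hk2.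
        pose proof (pow_incr (k ^ 2) 1 2 (conj (pow2_ge_0 k) Hk2)) as Hk4. rewrite pow1 in Hk4. exact Hk4. }
      assert (0 <= uu s t * q s t ^ 2) by (apply Rmult_le_pos; [assumption|apply pow2_ge_0]).
      apply Rmult_le_compat; try assumption. apply Rmult_le_pos; lra.
      apply Rle_trans with (1 * (uu s t * q s t ^ 2)); [apply Rmult_le_compat_r; lra|lra].
      unfold dens. lra. }
    apply Rabs_le_between in Y. lra.
  - intros t Ht. unfold F1, q, uu. rewrite (Qa t Ht), (Qb t Ht), (Qa1 t Ht), (Qb1 t Ht).
    pose proof (cos2_sin2 (kap * d)) as S. set (co := cos (kap * d)) in *. set (si := sin (kap * d)) in *.
    f_equal. replace (a 0 t * a1 0 t + b 0 t * b1 0 t) with ((co ^ 2 + si ^ 2) * (a 0 t * a1 0 t + b 0 t * b1 0 t)) by (rewrite S; ring). ring.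
    f_equal. replace (a 0 t ^ 2 + b 0 t ^ 2) with ((co ^ 2 + si ^ 2) * (a 0 t ^ 2 + b 0 t ^ 2)) by (rewrite S; ring). ring.
  - intros c e g' Hc He Hg'.
    (* With both parts of the normal derivative below g' gm / 2, [flux_sq] gives |F1|^2 <= g'^2 gm /
       2 <= g'^2. *)
    destruct (W1 c e (g' * gm / 2) Hc He) as [h [Hh0 K]].
    { assert (0 < g' * gm) by (apply Rmult_lt_0_compat; lra). lra. }
    exists h. split; [assumption|]. intros h1 t Hh1 Ht. destruct (K h1 t Hh1 Ht) as [[K1 K2] [K3 K4]].
    assert (Z : forall s, Rabs (a1 s t) <= g' * gm / 2 -> Rabs (b1 s t) <= g' * gm / 2 -> Rabs (F1 s t) <= g').
    { intros s A1 B1. rewrite <- (Rabs_pos_eq g') by lra. apply Rsqr_le_abs_0. unfold Rsqr.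
      replace (F1 s t * F1 s t) with ((a s t * a1 s t + b s t * b1 s t) ^ 2 * q s t ^ 2) by (unfold F1; ring).
      eapply Rle_trans; [apply flux_sq|].
      assert (Sq : forall x, Rabs x <= g' * gm / 2 -> x ^ 2 <= (g' * gm / 2) ^ 2).
      { intros x Hx. rewrite <- pow2_abs. apply pow_incr. split; [apply Rabs_pos|assumption]. }
      apply Sq in A1, B1. apply (Rmult_le_reg_l gm); [lra|]. rewrite <- Rmult_assoc, Rinv_r, Rmult_1_l by lra.
      assert (0 < g' * g') by (apply Rmult_lt_0_compat; lra).
      replace ((g' * gm / 2) ^ 2) with (g' * g' * (gm * gm) / 4) in A1, B1 by field.
      assert (g' * g' * (gm * gm) <= g' * g' * gm) by (apply Rmult_le_compat_l; [lra|nra]).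
      assert (0 < g' * g' * gm) by (apply Rmult_lt_0_compat; lra). lra. }
    split; apply Z; assumption.
  - intros x y g' Hx Hy Hg'.
    destruct (W2 x y (g' * gm / 2) Hx Hy) as [h [Hh0 K]].
    { assert (0 < g' * gm) by (apply Rmult_lt_0_compat; lra). lra. }
    exists h. split; [assumption|]. intros h1 s Hh1 Hs. destruct (K h1 s Hh1 Hs) as [[K1 K2] [K3 K4]].
    assert (Z : forall t, Rabs (a2 s t) <= g' * gm / 2 -> Rabs (b2 s t) <= g' * gm / 2 -> Rabs (F2 s t) <= g').
    { intros t A1 B1. rewrite <- (Rabs_pos_eq g') by lra. apply Rsqr_le_abs_0. unfold Rsqr.
      replace (F2 s t * F2 s t) with ((a s t * a2 s t + b s t * b2 s t) ^ 2 * q s t ^ 2) by (unfold F2; ring).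
      eapply Rle_trans; [apply flux_sq|].
      assert (Sq : forall x, Rabs x <= g' * gm / 2 -> x ^ 2 <= (g' * gm / 2) ^ 2).
      { intros z Hz. rewrite <- pow2_abs. apply pow_incr. split; [apply Rabs_pos|assumption]. }
      apply Sq in A1, B1. apply (Rmult_le_reg_l gm); [lra|]. rewrite <- Rmult_assoc, Rinv_r, Rmult_1_l by lra.
      assert (0 < g' * g') by (apply Rmult_lt_0_compat; lra).
      replace ((g' * gm / 2) ^ 2) with (g' * g' * (gm * gm) / 4) in A1, B1 by field.
      assert (g' * g' * (gm * gm) <= g' * g' * gm) by (apply Rmult_le_compat_l; [lra|nra]).
      assert (0 < g' * g' * gm) by (apply Rmult_lt_0_compat; lra). lra. }
    split; apply Z; assumption.
  - exists rho. split; [lra|]. split; [lra|]. exact R4.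
Qed.
End Damped.

Let cr f x y c e : cont_on (cell eps) f -> (forall s t, rect x y c e s t -> cell eps s t) -> cont_on (rect x y c e) f.
Proof. intros Hf H. apply (cont_on_sub _ _ _ H Hf). Qed.
Let lx f t x y : cont_on (cell eps) f -> x <= y -> (forall s, x <= s <= y -> cell eps s t) -> ex_RInt (fun s => f s t) x y.
Proof. intros Hf Hxy H. apply ex_RInt_cont; [assumption|]. intros s Hs. apply (cont_2d_fst f), Hf, H, Hs. Qed.
Let cJ : cont_on (cell eps) (fun s t => a s t * a2 s t + b s t * b2 s t).
Proof. intros s t H. c2d. Qed.
Let J t := RInt (fun s => a s t * a2 s t + b s t * b2 s t) 0 d.

Section Fixed.
Variables h0 r L ell : R.
Hypothesis Hh : 0 < h0 <= 1.
Hypothesis Hr : 0 < r < eps / 2.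
Hypothesis HL : forall rho, 0 < rho < eps / 2 -> I2 uu rho (eps - rho) 0 1 <= L.
Hypothesis Hell : forall rho, 0 < rho < h0 -> I2 uu 0 d (1 + rho) (1 + h0) <= ell /\ I2 uu 0 d (- h0) (- rho) <= ell.

Let q gm s t := damp gm (uu s t).
Let Fl gm t := RInt (fun s => (a s t * a2 s t + b s t * b2 s t) * q gm s t) 0 d.

(** In the layers between the slab and the heights 1 + h0 and - h0 the gradient term is nonnegative
    and is dropped, and the mass term is bounded by [ell]. The slit term grows as rho decreases, so
    the rectangle of margin r, fixed in advance, can replace the one of margin rho. *)
Let damped_energy gm : 0 < gm <= 1 ->
  I2 (fun s t => q gm s t ^ 3 * gg s t) r (eps - r) 0 1 <= k ^ 2 * (L + 2 * ell) + (Fl gm (1 + h0) - Fl gm (- h0)).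
Proof.
  intros Hgm. apply (le_of_forall_pos _ _ 1); [lra|]. intros g Hg. rewrite Rmult_1_r || rewrite Rmult_1_l.
  destruct (damped_green gm Hgm h0 g r Hh Hg ltac:(lra)) as [rho [R1 [R2 R3]]].
  assert (cq : cont_on (cell eps) (q gm)).
  { intros s t H. apply damp_cont; [lra|apply uu_pos|apply cuu, H]. }
  assert (cq3 : cont_on (cell eps) (fun s t => q gm s t ^ 3 * gg s t)).
  { intros s t H. apply continuity_2d_pt_ext with (fun s t => q gm s t * q gm s t ^ 2 * gg s t). intros; ring. c2d. }
  set (D := fun s t => (a1 s t ^ 2 + a s t * a11 s t + (b1 s t ^ 2 + b s t * b11 s t)) * damp gm (uu s t)
  - gm * (a s t * a1 s t + b s t * b1 s t) ^ 2 * damp gm (uu s t) ^ 3 + (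
   (a2 s t ^ 2 + a s t * a22 s t + (b2 s t ^ 2 + b s t * b22 s t)) * damp gm (uu s t)
  - gm * (a s t * a2 s t + b s t * b2 s t) ^ 2 * damp gm (uu s t) ^ 3)).
  change (I2 D rho (eps - rho) 0 1 + I2 D 0 d (1 + rho) (1 + h0) + I2 D 0 d (- h0) (- rho) - g <= Fl gm (1 + h0) - Fl gm (- h0)) in R3.
  assert (cD : cont_on (cell eps) D).
  { intros s t H. apply continuity_2d_pt_ext with (fun s t => (a1 s t ^ 2 + a s t * a11 s t + (b1 s t ^ 2 + b s t * b11 s t)) * q gm s t
  - gm * (a s t * a1 s t + b s t * b1 s t) ^ 2 * (q gm s t * q gm s t ^ 2) + (
   (a2 s t ^ 2 + a s t * a22 s t + (b2 s t ^ 2 + b s t * b22 s t)) * q gm s t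
  - gm * (a s t * a2 s t + b s t * b2 s t) ^ 2 * (q gm s t * q gm s t ^ 2))). intros; unfold D, q; ring. c2d. }
  assert (Dl : forall s t, cell eps s t -> q gm s t ^ 3 * gg s t - k ^ 2 * (uu s t * q gm s t) <= D s t).
  { intros s t H. apply (damped_div_lower gm Hgm s t H). }
  assert (P3 : forall s t, 0 <= q gm s t ^ 3 * gg s t).
  { intros s t. destruct (damp_facts gm (uu s t) ltac:(lra) (uu_pos s t)) as [[q0 _] _].
    apply Rmult_le_pos; [apply pow_le; left; exact q0|apply gg_pos]. }
  assert (Dl2 : forall s t, cell eps s t -> q gm s t ^ 3 * gg s t - k ^ 2 * uu s t <= D s t).
  { intros s t H. specialize (Dl s t H).
    destruct (damp_facts gm (uu s t) ltac:(lra) (uu_pos s t)) as [[q0 q1] _]. fold (q gm s t) in q0, q1.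
    assert (uu s t * q gm s t <= uu s t * 1) by (apply Rmult_le_compat_l; [apply uu_pos|assumption]).
    assert (k ^ 2 * (uu s t * q gm s t) <= k ^ 2 * (uu s t * 1)) by (apply Rmult_le_compat_l; [apply pow2_ge_0|assumption]). lra. }
  assert (Lay : forall x y c e, x <= y -> c <= e -> (forall s t, rect x y c e s t -> cell eps s t) ->
    I2 (fun s t => q gm s t ^ 3 * gg s t) x y c e - k ^ 2 * I2 uu x y c e <= I2 D x y c e).
  { intros x y c e Hxy Hce H.
    pose proof (cr _ _ _ _ _ cD H) as rD. pose proof (cr _ _ _ _ _ cq3 H) as r3. pose proof (cr _ _ _ _ _ cuu H) as ru.
    rewrite <- (I2_scal x y c e Hxy Hce uu) by assumption.
    rewrite <- (I2_minus x y c e Hxy Hce (fun s t => q gm s t ^ 3 * gg s t) (fun s t => k ^ 2 * uu s t)).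
    - apply I2_le; try assumption. intros s t Hst. apply (continuity_2d_pt_minus (fun s t => q gm s t ^ 3 * gg s t) (fun s t => k ^ 2 * uu s t)). apply r3, Hst. c2d.
      intros s t Hst. apply Dl2, H, Hst.
    - assumption.
    - intros s t Hst; c2d. }
  assert (Nn : forall x y c e, x <= y -> c <= e -> (forall s t, rect x y c e s t -> cell eps s t) ->
    0 <= I2 (fun s t => q gm s t ^ 3 * gg s t) x y c e).
  { intros x y c e Hxy Hce H. apply I2_nonneg; try assumption. apply cr; assumption. intros; apply P3. }
  pose proof (Lay rho (eps - rho) 0 1 ltac:(lra) ltac:(lra) ltac:(rect_cell)) as A1.
  pose proof (Lay 0 d (1 + rho) (1 + h0) ltac:(lra) ltac:(lra) ltac:(rect_cell)) as A2.
  pose proof (Lay 0 d (- h0) (- rho) ltac:(lra) ltac:(lra) ltac:(rect_cell)) as A3.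
  pose proof (Nn 0 d (1 + rho) (1 + h0) ltac:(lra) ltac:(lra) ltac:(rect_cell)) as B2.
  pose proof (Nn 0 d (- h0) (- rho) ltac:(lra) ltac:(lra) ltac:(rect_cell)) as B3.
  destruct (Hell rho ltac:(lra)) as [E1 E2]. pose proof (HL rho ltac:(lra)) as E0.
  assert (Mo : I2 (fun s t => q gm s t ^ 3 * gg s t) r (eps - r) 0 1 <= I2 (fun s t => q gm s t ^ 3 * gg s t) rho (eps - rho) 0 1).
  { apply I2_mono_dom; try lra. apply cr; [assumption|rect_cell]. intros; apply P3. }
  pose proof (pow2_ge_0 k).
  assert (k ^ 2 * I2 uu rho (eps - rho) 0 1 <= k ^ 2 * L) by (apply Rmult_le_compat_l; assumption).
  assert (k ^ 2 * I2 uu 0 d (1 + rho) (1 + h0) <= k ^ 2 * ell) by (apply Rmult_le_compat_l; assumption).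
  assert (k ^ 2 * I2 uu 0 d (- h0) (- rho) <= k ^ 2 * ell) by (apply Rmult_le_compat_l; assumption).
  lra.
Qed.

(** gm tends to 0 with r and h0 fixed: u is bounded on the inner rectangle and on the two lines, so
    that the damping differs there from 1 by O(gm). *)
Lemma energy_inequality : I2 gg r (eps - r) 0 1 <= k ^ 2 * (L + 2 * ell) + (J (1 + h0) - J (- h0)).
Proof.
  set (X := I2 gg r (eps - r) 0 1).
  assert (HX : 0 <= X). { apply I2_nonneg; try lra. apply cr; [assumption|rect_cell]. intros; apply gg_pos. }
  destruct (bounded_on_rect uu r (eps - r) 0 1) as [m1 [Hm1 B1]]. { apply cr; [assumption|rect_cell]. }
  assert (Bl : forall t, 1 < t \/ t < 0 -> exists m, 0 < m /\ forall s, 0 <= s <= d -> uu s t <= m /\ Rabs (a s t * a2 s t + b s t * b2 s t) <= m).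
  { intros t Ht. destruct (bounded_on_rect uu 0 d t t) as [m2 [Hm2 B2]]. { apply cr; [assumption|]. intros s y [_ Hy]. in_cell. }
    destruct (bounded_on_rect (fun s t => a s t * a2 s t + b s t * b2 s t) 0 d t t) as [m3 [Hm3 B3]]. { apply cr; [assumption|]. intros s y [_ Hy]. in_cell. }
    exists (m2 + m3). split; [lra|]. intros s Hs.
    pose proof (B2 s t ltac:(split; lra)) as K1. pose proof (B3 s t ltac:(split; lra)) as K2.
    pose proof (Rle_abs (uu s t)). split; lra. }
  destruct (Bl (1 + h0) ltac:(lra)) as [m2 [Hm2 B2]]. destruct (Bl (- h0) ltac:(lra)) as [m3 [Hm3 B3]]. clear Bl.
  apply (le_of_forall_small _ _ (2 * m1 * X + d * (m2 * m2) + d * (m3 * m3))).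
  { assert (0 <= m1 * X) by (apply Rmult_le_pos; lra). assert (0 <= d * (m2 * m2)) by (apply Rmult_le_pos; nra).
    assert (0 <= d * (m3 * m3)) by (apply Rmult_le_pos; nra). lra. }
  intros gm Hgm. pose proof (damped_energy gm Hgm) as DE.
  assert (cq : cont_on (cell eps) (q gm)).
  { intros s t H. apply damp_cont; [lra|apply uu_pos|apply cuu, H]. }
  assert (cq3 : cont_on (cell eps) (fun s t => q gm s t ^ 3 * gg s t)).
  { intros s t H. apply continuity_2d_pt_ext with (fun s t => q gm s t * q gm s t ^ 2 * gg s t). intros; ring. c2d. }
  assert (Lo : (1 - 2 * gm * m1) * X <= I2 (fun s t => q gm s t ^ 3 * gg s t) r (eps - r) 0 1).
  { unfold X. assert (rg : cont_on (rect r (eps - r) 0 1) gg) by (apply cr; [assumption|rect_cell]).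
    rewrite <- (I2_scal r (eps - r) 0 1 ltac:(lra) ltac:(lra) gg) by assumption.
    apply I2_le; try lra. intros s t Hst; c2d. apply cr; [assumption|rect_cell].
    intros s t Hst. apply Rmult_le_compat_r; [apply gg_pos|].
    destruct (damp_facts gm (uu s t) ltac:(lra) (uu_pos s t)) as [_ [_ [_ [_ q3]]]]. fold (q gm s t) in q3.
    pose proof (B1 s t Hst) as K. pose proof (Rle_abs (uu s t)).
    assert (gm * uu s t <= gm * m1) by (apply Rmult_le_compat_l; lra). lra. }
  assert (Ln : forall t m, 0 < m -> (forall s, 0 <= s <= d -> cell eps s t) -> (forall s, 0 <= s <= d -> uu s t <= m /\ Rabs (a s t * a2 s t + b s t * b2 s t) <= m) ->
    Rabs (Fl gm t - J t) <= d * (m * m) * gm).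
  { intros t m Hm Hc Hb. unfold Fl, J.
    assert (X1 : ex_RInt (fun s => (a s t * a2 s t + b s t * b2 s t) * q gm s t) 0 d).
    { apply (lx (fun s t => (a s t * a2 s t + b s t * b2 s t) * q gm s t)); [|lra|assumption]. intros s y H. c2d. }
    assert (X2 : ex_RInt (fun s => a s t * a2 s t + b s t * b2 s t) 0 d).
    { apply (lx (fun s t => a s t * a2 s t + b s t * b2 s t)); [assumption|lra|assumption]. }
    rewrite <- (RInt_minus_R (fun s => (a s t * a2 s t + b s t * b2 s t) * q gm s t) (fun s => a s t * a2 s t + b s t * b2 s t) 0 d X1 X2).
    replace (d * (m * m) * gm) with ((d - 0) * (m * (gm * m))) by ring.
    apply abs_RInt_le_const; [lra|apply ex_RInt_minus_R; assumption|]. intros s Hs.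
    destruct (Hb s Hs) as [U V].
    destruct (damp_facts gm (uu s t) ltac:(lra) (uu_pos s t)) as [[q0 q1] [_ [q2 _]]]. fold (q gm s t) in q0, q1, q2.
    replace ((a s t * a2 s t + b s t * b2 s t) * q gm s t - (a s t * a2 s t + b s t * b2 s t)) with
      ((a s t * a2 s t + b s t * b2 s t) * (q gm s t - 1)) by ring.
    rewrite Rabs_mult. apply Rmult_le_compat; try apply Rabs_pos. exact V.
    assert (gm * uu s t <= gm * m) by (apply Rmult_le_compat_l; lra).
    apply Rabs_le. lra. }
  pose proof (Ln (1 + h0) m2 Hm2 ltac:(intros; in_cell) B2) as L2. pose proof (Ln (- h0) m3 Hm3 ltac:(intros; in_cell) B3) as L3.
  apply Rabs_le_between in L2, L3. lra.
Qed.
End Fixed.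

(** * Testing with the plane wave *)

Section Phase.
Variables c1 c2 : R.
Hypothesis Hc : c1 ^ 2 + c2 ^ 2 = 1.
(** [al] + i [be] is (c1 + i c2) e^{i kap s}, and [F1], [F2] are the real part of its conjugate
    times grad u. The unit constant c1 + i c2 selects a component of the complex flux. *)
Let al s := c1 * cos (kap * s) - c2 * sin (kap * s).
Let be s := c1 * sin (kap * s) + c2 * cos (kap * s).
Let F1 s t := al s * a1 s t + be s * b1 s t.
Let F2 s t := al s * a2 s t + be s * b2 s t.
Let F11 s t := al s * a11 s t + be s * b11 s t + kap * (al s * b1 s t - be s * a1 s t).
Let F22 s t := al s * a22 s t + be s * b22 s t.
Let unit s : al s ^ 2 + be s ^ 2 = 1.
Proof.
  unfold al, be. replace (_ + _) with ((c1 ^ 2 + c2 ^ 2) * (cos (kap * s) ^ 2 + sin (kap * s) ^ 2)) by ring.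
  rewrite Hc, cos2_sin2. ring.
Qed.
Let cal : cont_on (cell eps) (fun s t => al s).
Proof. intros s t _. unfold al. c2d. Qed.
Let cbe : cont_on (cell eps) (fun s t => be s).
Proof. intros s t _. unfold be. c2d. Qed.
Let kap2 : kap ^ 2 <= k ^ 2.
Proof. rewrite <- (pow2_abs kap). apply pow_incr. split; [apply Rabs_pos|assumption]. Qed.
Let k21 : 0 <= k ^ 2 <= 1.
Proof. split; [apply pow2_ge_0|]. pose proof (pow_incr k 1 2 ltac:(lra)) as H. rewrite pow1 in H. exact H. Qed.

Let div_sq s t : cell eps s t -> (F11 s t + F22 s t) ^ 2 <= 2 * (k ^ 2 * gg s t + k ^ 4 * uu s t).
Proof.
  intros H. pose proof (Ea s t H) as e1. pose proof (Eb s t H) as e2.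
  assert (E : F11 s t + F22 s t = kap * (al s * b1 s t + be s * - a1 s t) - k ^ 2 * (al s * a s t + be s * b s t)).
  { unfold F11, F22. replace (a11 s t) with (- a22 s t - k ^ 2 * a s t) by lra.
    replace (b11 s t) with (- b22 s t - k ^ 2 * b s t) by lra. ring. }
  rewrite E.
  pose proof (cauchy2 (al s) (be s) (b1 s t) (- a1 s t)) as C1. pose proof (cauchy2 (al s) (be s) (a s t) (b s t)) as C2.
  rewrite unit, Rmult_1_l in C1, C2.
  set (x := al s * b1 s t + be s * - a1 s t) in *. set (y := al s * a s t + be s * b s t) in *.
  assert (D1 : kap ^ 2 * x ^ 2 <= k ^ 2 * gg s t).
  { apply Rmult_le_compat; try apply pow2_ge_0. exact kap2. unfold gg.
    pose proof (pow2_ge_0 (a2 s t)). pose proof (pow2_ge_0 (b2 s t)). lra. }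
  assert (D2 : k ^ 4 * y ^ 2 <= k ^ 4 * uu s t).
  { apply Rmult_le_compat_l; [|exact C2]. replace (k ^ 4) with ((k ^ 2) ^ 2) by ring. apply pow2_ge_0. }
  pose proof (pow2_ge_0 (kap * x + k ^ 2 * y)). lra.
Qed.

(** This flux is linear in u, so its square is at most |grad u|^2 and [cell_green] applies without
    damping, with K = 2 from the bound on the divergence. The slit contributes the square root, by
    Cauchy-Schwarz on an area of at most eps; each of the two layers has area at most mu^2. *)
Lemma phase_flux h0 L X mu : 0 < h0 <= 1 -> 0 < mu -> d * h0 <= mu ^ 2 ->
  (forall rho, 0 < rho < eps / 2 -> I2 uu rho (eps - rho) 0 1 <= L) ->
  (forall rho, 0 < rho < eps / 2 -> I2 gg rho (eps - rho) 0 1 <= X) ->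
  - sqrt (2 * eps * (k ^ 2 * X + k ^ 4 * L)) - 2 * (M + 2) * mu <=
  RInt (fun s => F2 s (1 + h0)) 0 d - RInt (fun s => F2 s (- h0)) 0 d.
Proof.
  intros Hh Hmu Har HL HX. apply (le_of_forall_pos _ _ 1); [lra|]. intros g Hg.
  assert (cF11 : cont_on (cell eps) F11) by (intros s t H; unfold F11; c2d).
  assert (cF22 : cont_on (cell eps) F22) by (intros s t H; unfold F22; c2d).
  assert (k41 : k ^ 4 <= 1). { replace (k ^ 4) with (k ^ 2 * k ^ 2) by ring. nra. }
  assert (HF3 : forall s t lam, cell eps s t -> 0 < lam -> - (lam * dens s t + 2 / lam) <= F11 s t + F22 s t).
  { intros s t lam H Hlam. assert (Y : Rabs (F11 s t + F22 s t) <= lam * dens s t + 2 / lam); [|apply Rabs_le_between in Y; lra].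
    apply amgm_abs; [assumption|lra|apply dens_pos|].
    eapply Rle_trans; [apply div_sq, H|]. unfold dens.
    pose proof (uu_pos s t). pose proof (gg_pos s t).
    assert (k ^ 2 * gg s t <= 1 * gg s t) by (apply Rmult_le_compat_r; lra).
    assert (k ^ 4 * uu s t <= 1 * uu s t) by (apply Rmult_le_compat_r; lra). lra. }
  assert (Wl : forall s x y g', Rabs x <= g' / 2 -> Rabs y <= g' / 2 -> Rabs (al s * x + be s * y) <= g').
  { intros s x y g' Hx Hy. pose proof (unit s) as U.
    assert (Rabs (al s) <= 1 /\ Rabs (be s) <= 1).
    { pose proof (pow2_ge_0 (al s)). pose proof (pow2_ge_0 (be s)).
      split; rewrite <- (Rabs_pos_eq 1) by lra; apply Rsqr_le_abs_0; unfold Rsqr; lra. }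
    eapply Rle_trans; [apply Rabs_triang|]. rewrite !Rabs_mult.
    pose proof (Rabs_pos x). pose proof (Rabs_pos y).
    assert (Rabs (al s) * Rabs x <= 1 * Rabs x) by (apply Rmult_le_compat_r; lra).
    assert (Rabs (be s) * Rabs y <= 1 * Rabs y) by (apply Rmult_le_compat_r; lra). lra. }
  destruct (cell_green eps d 2 M F1 F2 F11 F22 dens) with (tp := 1 + h0) (tm := - h0) (g := g) (r0 := eps / 2)
    as [rho [R1 [R2 [R3 R4]]]]; try lra; try assumption.
  - intros s t H. unfold F1, F11, al, be. der. apply (c2_d11 _ _ _ _ _ _ _ Ca s t H).
    apply (c2_d11 _ _ _ _ _ _ _ Cb s t H). simpl; ring.
  - intros s t H. unfold F2, F22, al, be. der. apply (c2_d22 _ _ _ _ _ _ _ Ca s t H).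
    apply (c2_d22 _ _ _ _ _ _ _ Cb s t H). simpl; ring.
  - intros s t H. unfold F1. c2d.
  - intros s t H. unfold F2. c2d.
  - intros; apply dens_pos.
  - intros s t lam H Hlam. apply amgm_abs; [assumption|lra|apply dens_pos|].
    unfold F1. eapply Rle_trans; [apply cauchy2|]. rewrite unit. unfold dens, gg.
    pose proof (uu_pos s t). pose proof (pow2_ge_0 (a2 s t)). pose proof (pow2_ge_0 (b2 s t)).
    pose proof (pow2_ge_0 (a1 s t)). pose proof (pow2_ge_0 (b1 s t)). lra.
  - intros s t lam H Hlam. apply amgm_abs; [assumption|lra|apply dens_pos|].
    unfold F2. eapply Rle_trans; [apply cauchy2|]. rewrite unit. unfold dens, gg.
    pose proof (uu_pos s t). pose proof (pow2_ge_0 (a2 s t)). pose proof (pow2_ge_0 (b2 s t)).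
    pose proof (pow2_ge_0 (a1 s t)). pose proof (pow2_ge_0 (b1 s t)). lra.
  - intros t Ht. unfold F1, al, be. rewrite (Qa1 t Ht), (Qb1 t Ht), Rmult_0_r, cos_0, sin_0.
    transitivity ((cos (kap * d) ^ 2 + sin (kap * d) ^ 2) * (c1 * a1 0 t + c2 * b1 0 t)); [ring|]. rewrite cos2_sin2. ring.
  - intros c e g' Hc' He Hg'. destruct (W1 c e (g' / 2) Hc' He ltac:(lra)) as [h [Hh0 K]].
    exists h. split; [assumption|]. intros h1 t Hh1 Ht. destruct (K h1 t Hh1 Ht) as [[K1 K2] [K3 K4]].
    split; apply Wl; assumption.
  - intros x y g' Hc' He Hg'. destruct (W2 x y (g' / 2) Hc' He ltac:(lra)) as [h [Hh0 K]].
    exists h. split; [assumption|]. intros h1 s Hh1 Ht. destruct (K h1 s Hh1 Ht) as [[K1 K2] [K3 K4]].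
    split; apply Wl; assumption.
  - assert (cDv : cont_on (cell eps) (fun s t => F11 s t + F22 s t)) by (intros s t H; c2d).
    pose proof (area_lower eps d 2 M F11 F22 dens ltac:(lra) cF11 cF22 cdens HM HF3 0 d (1 + rho) (1 + h0) mu
      ltac:(lra) ltac:(lra) ltac:(lra) ltac:(lra) ltac:(lra) ltac:(lra) ltac:(rect_cell) Hmu) as A1.
    pose proof (area_lower eps d 2 M F11 F22 dens ltac:(lra) cF11 cF22 cdens HM HF3 0 d (- h0) (- rho) mu
      ltac:(lra) ltac:(lra) ltac:(lra) ltac:(lra) ltac:(lra) ltac:(lra) ltac:(rect_cell) Hmu) as A2.
    assert (dr : d * (h0 - rho) <= d * h0) by (apply Rmult_le_compat_l; lra).
    specialize (A1 ltac:(lra)). specialize (A2 ltac:(lra)).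
    assert (rD : cont_on (rect rho (eps - rho) 0 1) (fun s t => F11 s t + F22 s t)) by (apply cr; [assumption|rect_cell]).
    assert (rg : cont_on (rect rho (eps - rho) 0 1) gg) by (apply cr; [assumption|rect_cell]).
    assert (ru : cont_on (rect rho (eps - rho) 0 1) uu) by (apply cr; [assumption|rect_cell]).
    pose proof (I2_sqr_le (fun s t => F11 s t + F22 s t) rho (eps - rho) 0 1 ltac:(lra) ltac:(lra) rD) as SQ.
    assert (B : I2 (fun s t => (F11 s t + F22 s t) ^ 2) rho (eps - rho) 0 1 <= 2 * (k ^ 2 * X + k ^ 4 * L)).
    { eapply Rle_trans.
      - apply (I2_le rho (eps - rho) 0 1 ltac:(lra) ltac:(lra) _ (fun s t => 2 * (k ^ 2 * gg s t + k ^ 4 * uu s t))).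
        intros s t Hst. apply cont_2d_pow2, rD, Hst. intros s t Hst; c2d.
        intros s t Hst. apply div_sq. revert s t Hst. rect_cell.
      - rewrite I2_scal, (I2_plus rho (eps - rho) 0 1 ltac:(lra) ltac:(lra) (fun s t => k ^ 2 * gg s t) (fun s t => k ^ 4 * uu s t)), !I2_scal; try lra; try assumption; try (intros s t Hst; c2d).
        assert (k ^ 2 * I2 gg rho (eps - rho) 0 1 <= k ^ 2 * X) by (apply Rmult_le_compat_l; [lra|apply HX; lra]).
        assert (k ^ 4 * I2 uu rho (eps - rho) 0 1 <= k ^ 4 * L).
        { apply Rmult_le_compat_l; [replace (k ^ 4) with ((k ^ 2) ^ 2) by ring; apply pow2_ge_0|apply HL; lra]. }
        lra. }
    assert (B0 : 0 <= I2 (fun s t => (F11 s t + F22 s t) ^ 2) rho (eps - rho) 0 1).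
    { apply I2_nonneg; try lra. intros s t Hst. apply cont_2d_pow2, rD, Hst. intros; apply pow2_ge_0. }
    assert (S : Rabs (I2 (fun s t => F11 s t + F22 s t) rho (eps - rho) 0 1) <= sqrt (2 * eps * (k ^ 2 * X + k ^ 4 * L))).
    { rewrite <- sqrt_Rsqr_abs. apply sqrt_le_1_alt. unfold Rsqr.
      replace (2 * eps * (k ^ 2 * X + k ^ 4 * L)) with (eps * (2 * (k ^ 2 * X + k ^ 4 * L))) by ring.
      assert ((eps - rho - rho) * (1 - 0) * I2 (fun s t => (F11 s t + F22 s t) ^ 2) rho (eps - rho) 0 1 <= eps * (2 * (k ^ 2 * X + k ^ 4 * L))).
      { apply Rmult_le_compat; lra. }
      lra. }
    apply Rabs_le_between in S.
    lra.
Qed.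
End Phase.

(** On each vertical line the field differs from its value at the end [tau] by at most the L^2 norm
    of its t-derivative, the slit having length 1; the comparison functions depend on s only and are
    not differentiated. *)
Lemma slit_comparison (c1 c2 : R -> R) tau r : (tau = 0 \/ tau = 1) -> 0 < r < eps / 2 ->
  (forall s, continuous c1 s) -> (forall s, continuous c2 s) ->
  I2 (fun s t => (a s t - c1 s) ^ 2 + (b s t - c2 s) ^ 2) r (eps - r) 0 1 <=
  2 * I2 gg r (eps - r) 0 1 + 2 * RInt (fun s => (a s tau - c1 s) ^ 2 + (b s tau - c2 s) ^ 2) r (eps - r).
Proof.
  intros Htau Hr H1 H2.
  assert (Ht : 0 <= tau <= 1) by (destruct Htau; lra).
  assert (cc1 : forall D, cont_on D (fun s _ => c1 s)) by (intros D s t _; apply cont_2d_of_fst, H1).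
  assert (cc2 : forall D, cont_on D (fun s _ => c2 s)) by (intros D s t _; apply cont_2d_of_fst, H2).
  pose proof (cc1 (cell eps)) as e1. pose proof (cc2 (cell eps)) as e2.
  assert (cP : cont_on (cell eps) (fun s t => (a s t - c1 s) ^ 2 + (b s t - c2 s) ^ 2)) by (intros s t H; c2d).
  assert (rg : cont_on (rect r (eps - r) 0 1) gg) by (apply cr; [assumption|rect_cell]).
  set (K s := RInt (fun t => gg s t) 0 1).
  assert (XT : ex_RInt (fun s => (a s tau - c1 s) ^ 2 + (b s tau - c2 s) ^ 2) r (eps - r)).
  { apply (lx (fun s t => (a s t - c1 s) ^ 2 + (b s t - c2 s) ^ 2)); [assumption|lra|]. intros; in_cell. }
  assert (XK : ex_RInt K r (eps - r)) by (apply (ex_RInt_out r (eps - r) 0 1); lra || assumption).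
  unfold I2. rewrite <- (RInt_scal_R (fun s => RInt (fun t => gg s t) 0 1) 2) by exact XK.
  rewrite <- (RInt_scal_R (fun s => (a s tau - c1 s) ^ 2 + (b s tau - c2 s) ^ 2) 2) by exact XT.
  rewrite <- RInt_plus_R by (apply ex_RInt_scal_R; assumption).
  apply RInt_le_R; [lra| |apply ex_RInt_plus_R; apply ex_RInt_scal_R; assumption|].
  { apply (ex_RInt_out r (eps - r) 0 1 ltac:(lra) ltac:(lra) (fun s t => (a s t - c1 s) ^ 2 + (b s t - c2 s) ^ 2)).
    apply cr; [assumption|rect_cell]. }
  intros s Hs. fold (K s).
  assert (Pt : forall t, 0 <= t <= 1 -> (a s t - c1 s) ^ 2 + (b s t - c2 s) ^ 2 <=
     2 * K s + 2 * ((a s tau - c1 s) ^ 2 + (b s tau - c2 s) ^ 2)).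
  { intros t Ht'.
    assert (La : forall f f2 : R -> R -> R, cont_on (cell eps) f2 -> (forall s t, cell eps s t -> is_derive (fun y => f s y) t (f2 s t)) ->
      (f s t - f s tau) ^ 2 <= (1 - 0) * RInt (fun t => f2 s t ^ 2) 0 1).
    { intros f f2 Hf2 Hd. apply (increment_sqr (fun y => f s y) (fun y => f2 s y) 0 1); try lra.
      intros; apply Hd; in_cell. intros; apply (cont_2d_snd f2), Hf2; in_cell. }
    pose proof (La a a2 ka2 (c2_d2 _ _ _ _ _ _ _ Ca)) as A1. pose proof (La b b2 kb2 (c2_d2 _ _ _ _ _ _ _ Cb)) as B1.
    assert (xa : ex_RInt (fun t => a2 s t ^ 2) 0 1).
    { apply ex_RInt_cont; [lra|]. intros; apply cont_pow2, (cont_2d_snd a2), ka2. in_cell. }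
    assert (xb : ex_RInt (fun t => b2 s t ^ 2) 0 1).
    { apply ex_RInt_cont; [lra|]. intros; apply cont_pow2, (cont_2d_snd b2), kb2. in_cell. }
    assert (S : RInt (fun t => a2 s t ^ 2) 0 1 + RInt (fun t => b2 s t ^ 2) 0 1 <= K s).
    { rewrite <- RInt_plus_R by assumption. apply RInt_le_R; [lra|apply ex_RInt_plus_R; assumption| |].
      apply (ex_RInt_in r (eps - r) 0 1 ltac:(lra) gg s rg Hs).
      intros y _. unfold gg. pose proof (pow2_ge_0 (a1 s y)). pose proof (pow2_ge_0 (b1 s y)). lra. }
    pose proof (pow2_ge_0 (a s t - a s tau - (a s tau - c1 s))). pose proof (pow2_ge_0 (b s t - b s tau - (b s tau - c2 s))).
    lra. }
  eapply Rle_trans; [apply (RInt_le_R _ (fun _ => 2 * K s + 2 * ((a s tau - c1 s) ^ 2 + (b s tau - c2 s) ^ 2))); [lra| |apply ex_RInt_const_R|exact Pt]|].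
  - apply ex_RInt_cont; [lra|]. intros t Ht'. apply (cont_2d_snd (fun s t => (a s t - c1 s) ^ 2 + (b s t - c2 s) ^ 2)), cP. in_cell.
  - rewrite RInt_const_R. right. rewrite Rminus_0_r. ring.
Qed.

(** * Comparison of the slit with the two half-planes *)

Section Waves.
(* x + i y and x' + i y' are the reflection and transmission coefficients. *)
Variables ze al1 be1 al2 be2 al1' be1' al2' be2' x y x' y' L : R.
Hypothesis Hze0 : 0 <= ze.
Hypothesis Hze : ze ^ 2 + kap ^ 2 = k ^ 2.
Hypothesis Np : negligible d (fun s t => cos (kap * s) * a s t + sin (kap * s) * b s t - wave ze al1 be1 t).
Hypothesis Nq : negligible d (fun s t => cos (kap * s) * b s t - sin (kap * s) * a s t - wave ze al2 be2 t).
Hypothesis Np' : negligible d (fun s t => cos (kap * s) * a s (1 - t) + sin (kap * s) * b s (1 - t) - wave ze al1' be1' t).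
Hypothesis Nq' : negligible d (fun s t => cos (kap * s) * b s (1 - t) - sin (kap * s) * a s (1 - t) - wave ze al2' be2' t).
Hypothesis V1 : wave ze al1 be1 1 = 1 + x.
Hypothesis V2 : wave ze al2 be2 1 = y.
Hypothesis V3 : wave' ze al1 be1 1 = - ze * y.
Hypothesis V4 : wave' ze al2 be2 1 = ze * (x - 1).
Hypothesis V1' : wave ze al1' be1' 1 = x'.
Hypothesis V2' : wave ze al2' be2' 1 = y'.
Hypothesis V3' : wave' ze al1' be1' 1 = - ze * y'.
Hypothesis V4' : wave' ze al2' be2' 1 = ze * x'.
Hypothesis HL : forall rho, 0 < rho < eps / 2 -> I2 uu rho (eps - rho) 0 1 <= L.

Let wr := wave ze al1 be1. Let wi := wave ze al2 be2.
Let vr := wave' ze al1 be1. Let vi := wave' ze al2 be2.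
Let wr' := wave ze al1' be1'. Let wi' := wave ze al2' be2'.
Let vr' := wave' ze al1' be1'. Let vi' := wave' ze al2' be2'.

Lemma cont_wave c1 c2 t : continuous (wave ze c1 c2) t.
Proof. apply (cont_2d_snd (fun _ t => wave ze c1 c2 t) 0). unfold wave. c2d. Qed.
Lemma cont_wave' c1 c2 t : continuous (wave' ze c1 c2) t.
Proof. apply (cont_2d_snd (fun _ t => wave' ze c1 c2 t) 0). unfold wave'. c2d. Qed.

Let above s t : 1 < t -> cell eps s t.
Proof. intros; left; assumption. Qed.
Let below s t : 1 < t -> cell eps s (1 - t).
Proof. intros; right; left; lra. Qed.

Let dist2 (f g : R -> R -> R) (p q : R -> R) s t :=
  (f s t - (cos (kap * s) * p t - sin (kap * s) * q t)) ^ 2 + (g s t - (sin (kap * s) * p t + cos (kap * s) * q t)) ^ 2.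

Let top t : 1 < t -> exists N, 0 <= N /\ J t = d * (wr t * vr t + wi t * vi t) - N /\
  RInt (fun s => dist2 a b wr wi s t) 0 d <= 10 * d * N /\
  RInt (fun s => cos (kap * s) * a2 s t + sin (kap * s) * b2 s t) 0 d = d * vr t /\
  RInt (fun s => cos (kap * s) * b2 s t - sin (kap * s) * a2 s t) 0 d = d * vi t.
Proof.
  intros Ht. apply (half_strip_total k d kap ze al1 be1 al2 be2 a a1 a2 a11 a22 a12 b b1 b2 b11 b22 b12); try lra; try assumption.
  - apply (C2r_sub (cell eps)); assumption.
  - apply (C2r_sub (cell eps)); assumption.
  - intros; apply Ea, above; assumption.
  - intros; apply Eb, above; assumption.
  - intros; apply Qa; left; assumption.
  - intros; apply Qb; left; assumption.
  - intros; apply Qa1; left; assumption.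
  - intros; apply Qb1; left; assumption.
Qed.

(** [half_strip_total] for the reflected lower half-plane: the vertical derivative changes sign, so
    the outward flux there is minus J. *)
Let bot t : 1 < t -> exists N, 0 <= N /\ - J (1 - t) = d * (wr' t * vr' t + wi' t * vi' t) - N /\
  RInt (fun s => dist2 (fun s t => a s (1 - t)) (fun s t => b s (1 - t)) wr' wi' s t) 0 d <= 10 * d * N /\
  RInt (fun s => cos (kap * s) * a2 s (1 - t) + sin (kap * s) * b2 s (1 - t)) 0 d = - (d * vr' t) /\
  RInt (fun s => cos (kap * s) * b2 s (1 - t) - sin (kap * s) * a2 s (1 - t)) 0 d = - (d * vi' t).
Proof.
  intros Ht.
  assert (lx' : forall f, cont_on (cell eps) f -> ex_RInt (fun s => f s (1 - t)) 0 d).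
  { intros f Hf. apply lx; [assumption|lra|]. intros; apply below; assumption. }
  destruct (half_strip_total k d kap ze al1' be1' al2' be2' (fun s t => a s (1 - t)) (fun s t => a1 s (1 - t)) (fun s t => - a2 s (1 - t))
    (fun s t => a11 s (1 - t)) (fun s t => a22 s (1 - t)) (fun s t => - a12 s (1 - t))
    (fun s t => b s (1 - t)) (fun s t => b1 s (1 - t)) (fun s t => - b2 s (1 - t))
    (fun s t => b11 s (1 - t)) (fun s t => b22 s (1 - t)) (fun s t => - b12 s (1 - t))) with (t := t) as [N [N0 [N1 [N2 [N3 N4]]]]]; try lra; try assumption.
  - apply (C2r_sub (fun s t => cell eps s (1 - t))); [assumption|]. apply C2r_reflect; assumption.
  - apply (C2r_sub (fun s t => cell eps s (1 - t))); [assumption|]. apply C2r_reflect; assumption.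
  - intros; apply Ea, below; assumption.
  - intros; apply Eb, below; assumption.
  - intros; apply Qa; right; lra.
  - intros; apply Qb; right; lra.
  - intros; apply Qa1; right; lra.
  - intros; apply Qb1; right; lra.
  - exists N. split; [assumption|]. split; [|split; [exact N2|split]].
    + etransitivity; [|exact N1]. unfold J.
      assert (El : forall v : R, - v = - 1 * v) by (intros; ring). rewrite El.
      rewrite <- (RInt_scal_R (fun s => a s (1 - t) * a2 s (1 - t) + b s (1 - t) * b2 s (1 - t))) by (apply (lx' (fun s t => a s t * a2 s t + b s t * b2 s t)); assumption).
      apply RInt_ext_R; [lra|]. intros; ring.
    + unfold vr'. rewrite <- N3.
      assert (El : forall v : R, - v = - 1 * v) by (intros; ring). rewrite El.
      rewrite <- (RInt_scal_R (fun s => cos (kap * s) * - a2 s (1 - t) + sin (kap * s) * - b2 s (1 - t))).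
      apply RInt_ext_R; [lra|]. intros; ring.
      apply (lx' (fun s t => cos (kap * s) * - a2 s t + sin (kap * s) * - b2 s t)). intros s u Hs; c2d.
    + unfold vi'. rewrite <- N4.
      assert (El : forall v : R, - v = - 1 * v) by (intros; ring). rewrite El.
      rewrite <- (RInt_scal_R (fun s => cos (kap * s) * - b2 s (1 - t) - sin (kap * s) * - a2 s (1 - t))).
      apply RInt_ext_R; [lra|]. intros; ring.
      apply (lx' (fun s t => cos (kap * s) * - b2 s t - sin (kap * s) * - a2 s t)). intros s u Hs; c2d.
Qed.

(** Per unit length, the order-zero part of the real flux at the face is - 2 ze y for incident plus
    reflected wave and 0 for the transmitted wave. So only the imaginary part y of the reflection
    coefficient enters the energy bound. *)
Let RR := k ^ 2 * L + 2 * d * ze * Rabs y.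

Let Lpos : 0 <= L.
Proof.
  eapply Rle_trans; [|apply (HL (eps / 4)); lra]. apply I2_nonneg; try lra. apply cr; [assumption|rect_cell]. intros; apply uu_pos.
Qed.

(** The evanescent losses N and N' stand on the same side as the slit energy and are bounded
    together with it. The error g collects g / 2 from the masses of the two layers and g / 4 from
    each propagating flux, evaluated at 1 + h0 instead of 1. *)
Let near_one : forall g, 0 < g -> exists h1, 0 < h1 <= 1 /\ forall h0 r, 0 < h0 < h1 -> 0 < r < eps / 2 ->
  exists N N', 0 <= N /\ 0 <= N' /\ I2 gg r (eps - r) 0 1 + N + N' <= RR + g /\
  RInt (fun s => dist2 a b wr wi s (1 + h0)) 0 d <= 10 * d * N /\
  RInt (fun s => dist2 (fun s t => a s (1 - t)) (fun s t => b s (1 - t)) wr' wi' s (1 + h0)) 0 d <= 10 * d * N'.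
Proof.
  intros g Hg.
  assert (Cr : forall p p' q q' : R -> R, (forall t, continuous p t) -> (forall t, continuous p' t) -> (forall t, continuous q t) -> (forall t, continuous q' t) ->
    exists h1, 0 < h1 /\ forall h, 0 < h < h1 -> Rabs ((p (1 + h) * p' (1 + h) + q (1 + h) * q' (1 + h)) - (p 1 * p' 1 + q 1 * q' 1)) <= g / 4).
  { intros p p' q q' P P' Q Q'. apply (small_near (fun t => p t * p' t + q t * q' t) 1 (g / 4)); [|lra].
    apply (cont_2d_snd (fun _ t => p t * p' t + q t * q' t) 0). c2d; apply (cont_2d_of_snd); auto. }
  destruct (Cr wr vr wi vi (cont_wave _ _) (cont_wave' _ _) (cont_wave _ _) (cont_wave' _ _)) as [h1 [Hh1 K1]].
  destruct (Cr wr' vr' wi' vi' (cont_wave _ _) (cont_wave' _ _) (cont_wave _ _) (cont_wave' _ _)) as [h2 [Hh2 K2]].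
  assert (Tm1 : forall rho, 0 < rho < 1 -> I2 uu 0 d (1 + rho) 2 <= M).
  { intros rho Hrho. eapply Rle_trans; [|apply (HM 0 d (1 + rho) 2); try lra; rect_cell].
    apply I2_le; try lra. apply cr; [assumption|rect_cell]. apply cr; [assumption|rect_cell].
    intros; unfold dens. pose proof (gg_pos s t). lra. }
  assert (Tm2 : forall rho, 0 < rho < 1 -> I2 uu 0 d (- 1) (- rho) <= M).
  { intros rho Hrho. eapply Rle_trans; [|apply (HM 0 d (- 1) (- rho)); try lra; rect_cell].
    apply I2_le; try lra. apply cr; [assumption|rect_cell]. apply cr; [assumption|rect_cell].
    intros; unfold dens. pose proof (gg_pos s t). lra. }
  destruct (tail_small _ _ (g / 4) Tm1 ltac:(lra)) as [r1 [Hr1 T1]].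
  destruct (tail_small _ _ (g / 4) Tm2 ltac:(lra)) as [r2 [Hr2 T2]].
  set (hm := Rmin (Rmin h1 h2) (Rmin r1 r2)).
  assert (Hm : 0 < hm) by (unfold hm; repeat apply Rmin_pos; lra).
  assert (Hm1 : hm <= h1) by (eapply Rle_trans; [apply Rmin_l|apply Rmin_l]).
  assert (Hm2 : hm <= h2) by (eapply Rle_trans; [apply Rmin_l|apply Rmin_r]).
  assert (Hm3 : hm <= r1) by (eapply Rle_trans; [apply Rmin_r|apply Rmin_l]).
  assert (Hm4 : hm <= r2) by (eapply Rle_trans; [apply Rmin_r|apply Rmin_r]).
  clearbody hm. exists hm. split; [lra|]. intros h0 r Hh0 Hr.
  destruct (top (1 + h0) ltac:(lra)) as [N [N0 [N1 [N2 _]]]]. destruct (bot (1 + h0) ltac:(lra)) as [N' [N0' [N1' [N2' _]]]].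
  exists N, N'. split; [assumption|]. split; [assumption|]. split; [|split; assumption].
  replace (1 - (1 + h0)) with (- h0) in N1' by ring.
  assert (Hell : forall rho, 0 < rho < h0 -> I2 uu 0 d (1 + rho) (1 + h0) <= g / 4 /\ I2 uu 0 d (- h0) (- rho) <= g / 4).
  { intros rho Hrho. split.
    - specialize (T1 rho ltac:(lra)). cbv beta in T1.
      assert (Sp : I2 uu 0 d (1 + rho) 2 = I2 uu 0 d (1 + rho) (1 + h0) + (I2 uu 0 d (1 + h0) (1 + r1) + I2 uu 0 d (1 + r1) 2)).
      { rewrite (I2_split_t 0 d (1 + rho) 2 ltac:(lra) ltac:(lra) uu (1 + h0)), (I2_split_t 0 d (1 + h0) 2 ltac:(lra) ltac:(lra) uu (1 + r1)); try lra;
          (apply cr; [assumption|rect_cell]). }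
      assert (0 <= I2 uu 0 d (1 + h0) (1 + r1)) by (apply I2_nonneg; try lra; [apply cr; [assumption|rect_cell]|intros; apply uu_pos]). lra.
    - specialize (T2 rho ltac:(lra)). cbv beta in T2.
      assert (Sp : I2 uu 0 d (- 1) (- rho) = I2 uu 0 d (- 1) (- r2) + (I2 uu 0 d (- r2) (- h0) + I2 uu 0 d (- h0) (- rho))).
      { rewrite (I2_split_t 0 d (- 1) (- rho) ltac:(lra) ltac:(lra) uu (- r2)), (I2_split_t 0 d (- r2) (- rho) ltac:(lra) ltac:(lra) uu (- h0)); try lra;
          (apply cr; [assumption|rect_cell]). }
      assert (0 <= I2 uu 0 d (- r2) (- h0)) by (apply I2_nonneg; try lra; [apply cr; [assumption|rect_cell]|intros; apply uu_pos]). lra. }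
  pose proof (energy_inequality h0 r L (g / 4) ltac:(lra) Hr HL Hell) as EI.
  specialize (K1 h0 ltac:(lra)). specialize (K2 h0 ltac:(lra)).
  unfold wr at 2, vr at 2, wi at 2, vi at 2 in K1. rewrite V1, V2, V3, V4 in K1.
  unfold wr' at 2, vr' at 2, wi' at 2, vi' at 2 in K2. rewrite V1', V2', V3', V4' in K2.
  apply Rabs_le_between in K1, K2.
  replace (x' * (- ze * y') + y' * (ze * x')) with 0 in K2 by ring.
  replace ((1 + x) * (- ze * y) + y * (ze * (x - 1))) with (- (2 * ze * y)) in K1 by ring.
  assert (Y : - (2 * ze * y) <= 2 * ze * Rabs y).
  { pose proof (Rle_abs (- y)). rewrite Rabs_Ropp in H. assert (ze * - y <= ze * Rabs y) by (apply Rmult_le_compat_l; assumption). lra. }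
  assert (k21 : k ^ 2 <= 1). { pose proof (pow_incr k 1 2 ltac:(lra)) as H. rewrite pow1 in H. exact H. }
  assert (k ^ 2 * (g / 4) <= 1 * (g / 4)) by (apply Rmult_le_compat_r; lra).
  assert (D1 : d * (wr (1 + h0) * vr (1 + h0) + wi (1 + h0) * vi (1 + h0)) <= d * (2 * ze * Rabs y + g / 4)) by (apply Rmult_le_compat_l; lra).
  assert (D2 : d * (wr' (1 + h0) * vr' (1 + h0) + wi' (1 + h0) * vi' (1 + h0)) <= d * (g / 4)) by (apply Rmult_le_compat_l; lra).
  assert (d * (g / 4) <= 1 * (g / 4)) by (apply Rmult_le_compat_r; lra).
  unfold RR. rewrite N1 in EI. lra.
Qed.

Lemma slit_energy r : 0 < r < eps / 2 -> I2 gg r (eps - r) 0 1 <= RR.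
Proof.
  intros Hr. apply (le_of_forall_pos _ _ 1); [lra|]. intros g Hg. destruct (near_one g Hg) as [h1 [Hh1 K]].
  destruct (K (h1 / 2) r ltac:(lra) Hr) as [N [N' [N0 [N0' [E _]]]]]. lra.
Qed.

Lemma RR_nonneg : 0 <= RR.
Proof.
  unfold RR. assert (0 <= k ^ 2 * L) by (apply Rmult_le_pos; [apply pow2_ge_0|assumption]).
  assert (0 <= d * ze * Rabs y) by (repeat apply Rmult_le_pos; try lra; apply Rabs_pos). lra.
Qed.

Let dist_pos f g p q s t : 0 <= dist2 f g p q s t.
Proof. unfold dist2. apply Rplus_le_le_0_compat; apply pow2_ge_0. Qed.

(** Restricted to the opening with margin r, the lines tend to a segment of the domain and
    [trace_limit] applies. Stated for general f and g so as to cover the lower opening after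
    reflection. *)
Let trace_generic (f g : R -> R -> R) (p q : R -> R) r : 0 < r < eps / 2 ->
  (forall t, continuous p t) -> (forall t, continuous q t) ->
  (forall s h, 0 < s < eps -> 0 <= h -> continuity_2d_pt f s (1 + h) /\ continuity_2d_pt g s (1 + h)) ->
  (forall s t, 1 < t -> continuity_2d_pt f s t /\ continuity_2d_pt g s t) ->
  (forall e, 0 < e -> exists h1, 0 < h1 /\ forall h0, 0 < h0 < h1 -> RInt (fun s => dist2 f g p q s (1 + h0)) 0 d <= 10 * d * (RR + e)) ->
  RInt (fun s => dist2 f g p q s 1) r (eps - r) <= 10 * d * RR.
Proof.
  intros Hr Hp Hq Hc Hc' HN.
  assert (cpq : forall s t, continuity_2d_pt f s t -> continuity_2d_pt g s t -> continuity_2d_pt (dist2 f g p q) s t).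
  { intros s t Hf Hg. unfold dist2. c2d; apply cont_2d_of_snd; auto. }
  assert (T := trace_limit (fun s h => dist2 f g p q s (h + 1)) r (eps - r) (10 * d * RR) ltac:(lra)).
  cbv beta in T. rewrite Rplus_0_l in T. apply T; clear T.
  - intros s h [Hs Hh]. apply (cont_2d_shift (dist2 f g p q) 1). rewrite Rplus_comm.
    destruct (Hc s h ltac:(lra) ltac:(lra)). apply cpq; assumption.
  - intros e He. destruct (HN (e / 10) ltac:(lra)) as [h1 [Hh1 K]]. exists h1. split; [assumption|].
    intros h Hh. specialize (K h Hh). rewrite (Rplus_comm h 1).
    apply Rle_trans with (RInt (fun s => dist2 f g p q s (1 + h)) 0 d).
    + apply RInt_mono_dom; try lra; [|intros; apply dist_pos]. apply ex_RInt_cont; [lra|]. intros s _.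
      apply (cont_2d_fst (dist2 f g p q)). destruct (Hc' s (1 + h) ltac:(lra)). apply cpq; assumption.
    + assert (d * e <= 1 * e) by (apply Rmult_le_compat_r; lra). lra.
Qed.

(** 22 is 2 + 20: [slit_comparison] takes twice the energy and twice the trace term 10 d RR, and d
    <= 1. *)
Lemma slit_vs_top r : 0 < r < eps / 2 ->
  I2 (fun s t => (a s t - (cos (kap * s) * (1 + x) - sin (kap * s) * y)) ^ 2 + (b s t - (sin (kap * s) * (1 + x) + cos (kap * s) * y)) ^ 2) r (eps - r) 0 1 <= 22 * RR.
Proof.
  intros Hr.
  assert (T : RInt (fun s => dist2 a b wr wi s 1) r (eps - r) <= 10 * d * RR).
  { apply trace_generic; [assumption|apply cont_wave|apply cont_wave|..].
    - intros s h Hs Hh. split; [apply ka0|apply kb0]; in_cell.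
    - intros s t Ht. split; [apply ka0|apply kb0]; apply above; assumption.
    - intros e He. destruct (near_one e He) as [h1 [Hh1 K]]. exists h1. split; [lra|]. intros h0 Hh0.
      destruct (K h0 r Hh0 Hr) as [N [N' [N0 [N0' [E [E1 E2]]]]]].
      assert (0 <= I2 gg r (eps - r) 0 1) by (apply I2_nonneg; try lra; [apply cr; [assumption|rect_cell]|intros; apply gg_pos]).
      eapply Rle_trans; [exact E1|]. apply Rmult_le_compat_l; lra. }
  eapply Rle_trans; [apply (slit_comparison (fun s => cos (kap * s) * (1 + x) - sin (kap * s) * y) (fun s => sin (kap * s) * (1 + x) + cos (kap * s) * y) 1 r); try assumption|].
  - right; reflexivity.
  - intros s. apply (cont_2d_fst (fun s _ => cos (kap * s) * (1 + x) - sin (kap * s) * y) s 0). c2d.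
  - intros s. apply (cont_2d_fst (fun s _ => sin (kap * s) * (1 + x) + cos (kap * s) * y) s 0). c2d.
  - unfold dist2, wr, wi in T. rewrite V1, V2 in T. pose proof (slit_energy r Hr). pose proof RR_nonneg.
    assert (d * RR <= 1 * RR) by (apply Rmult_le_compat_r; lra). lra.
Qed.

Lemma slit_vs_bottom r : 0 < r < eps / 2 ->
  I2 (fun s t => (a s t - (cos (kap * s) * x' - sin (kap * s) * y')) ^ 2 + (b s t - (sin (kap * s) * x' + cos (kap * s) * y')) ^ 2) r (eps - r) 0 1 <= 22 * RR.
Proof.
  intros Hr.
  assert (Cf : forall f s t, continuity_2d_pt f s (1 - t) -> continuity_2d_pt (fun x y => f x (1 - y)) s t).
  { intros f s t Hf e. destruct (Hf e) as [dl Hdl]. exists dl. intros u v Hu Hv. apply Hdl. exact Hu.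
    replace (1 - v - (1 - t)) with (- (v - t)) by ring. rewrite Rabs_Ropp. exact Hv. }
  assert (T : RInt (fun s => dist2 (fun s t => a s (1 - t)) (fun s t => b s (1 - t)) wr' wi' s 1) r (eps - r) <= 10 * d * RR).
  { apply trace_generic; [assumption|apply cont_wave|apply cont_wave|..].
    - intros s h Hs Hh. split; apply Cf; [apply ka0|apply kb0]; replace (1 - (1 + h)) with (- h) by ring; unfold cell;
        (destruct (Rlt_dec (- h) 0); [right; left; assumption|right; right; lra]).
    - intros s t Ht. split; apply Cf; [apply ka0|apply kb0]; apply below; assumption.
    - intros e He. destruct (near_one e He) as [h1 [Hh1 K]]. exists h1. split; [lra|]. intros h0 Hh0.
      destruct (K h0 r Hh0 Hr) as [N [N' [N0 [N0' [E [E1 E2]]]]]].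
      assert (0 <= I2 gg r (eps - r) 0 1) by (apply I2_nonneg; try lra; [apply cr; [assumption|rect_cell]|intros; apply gg_pos]).
      eapply Rle_trans; [exact E2|]. apply Rmult_le_compat_l; lra. }
  eapply Rle_trans; [apply (slit_comparison (fun s => cos (kap * s) * x' - sin (kap * s) * y') (fun s => sin (kap * s) * x' + cos (kap * s) * y') 0 r); try assumption|].
  - left; reflexivity.
  - intros s. apply (cont_2d_fst (fun s _ => cos (kap * s) * x' - sin (kap * s) * y') s 0). c2d.
  - intros s. apply (cont_2d_fst (fun s _ => sin (kap * s) * x' + cos (kap * s) * y') s 0). c2d.
  - unfold dist2, wr', wi' in T. rewrite V1', V2', Rminus_diag in T. pose proof (slit_energy r Hr). pose proof RR_nonneg.
    assert (d * RR <= 1 * RR) by (apply Rmult_le_compat_r; lra). lra.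
Qed.

(** The evanescent part does not contribute on either line, its vertical derivative having mean zero
    after removal of the phase. What remains is the order-zero flux, whose limits at the two faces
    are given by the reflection and transmission coefficients. *)
Lemma flux_balance c1 c2 : c1 ^ 2 + c2 ^ 2 = 1 ->
  - sqrt (2 * eps * (k ^ 2 * RR + k ^ 4 * L)) <= d * ze * (c1 * - (y + y') + c2 * (x - 1 + x')).
Proof.
  intros Hc.
  assert (HM0 : 0 <= M).
  { eapply Rle_trans; [|apply (HM 0 d 2 3)]; try lra. 2: rect_cell.
    apply I2_nonneg; try lra. apply cr; [assumption|rect_cell]. intros; apply dens_pos. }
  apply (le_of_forall_small _ _ (2 * (M + 2) + d)); [lra|]. intros g Hg.
  assert (Hg2 : 0 < g ^ 2) by (apply pow_lt; lra).
  destruct (small_near (fun t => c1 * (vr t + vr' t) + c2 * (vi t + vi' t)) 1 g) as [h1 [Hh1 K]]; [|lra|].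
  { apply (cont_2d_snd (fun _ t => c1 * (vr t + vr' t) + c2 * (vi t + vi' t)) 0).
    c2d; apply cont_2d_of_snd; apply cont_wave'. }
  (* h0 <= g^2 makes the layers small enough for [phase_flux] with mu = g. *)
  set (h0 := Rmin (h1 / 2) (Rmin (g ^ 2) 1)).
  assert (Hh : 0 < h0) by (unfold h0; repeat apply Rmin_pos; lra).
  assert (Ha : h0 <= h1 / 2) by apply Rmin_l.
  assert (Hb : h0 <= g ^ 2) by (eapply Rle_trans; [apply Rmin_r|apply Rmin_l]).
  assert (Hcc : h0 <= 1) by (eapply Rle_trans; [apply Rmin_r|apply Rmin_r]).
  clearbody h0. specialize (K h0 ltac:(lra)).
  assert (Hmu : d * h0 <= g ^ 2).
  { assert (d * h0 <= 1 * h0) by (apply Rmult_le_compat_r; lra). lra. }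
  pose proof (phase_flux c1 c2 Hc h0 L RR g ltac:(lra) ltac:(lra) Hmu HL slit_energy) as PF. cbv beta in PF.
  destruct (top (1 + h0) ltac:(lra)) as [_ [_ [_ [_ [F1 F2]]]]].
  destruct (bot (1 + h0) ltac:(lra)) as [_ [_ [_ [_ [F1' F2']]]]].
  replace (1 - (1 + h0)) with (- h0) in F1', F2' by ring.
  assert (Sp : forall t, (forall s, 0 <= s <= d -> cell eps s t) ->
    RInt (fun s => (c1 * cos (kap * s) - c2 * sin (kap * s)) * a2 s t + (c1 * sin (kap * s) + c2 * cos (kap * s)) * b2 s t) 0 d =
    c1 * RInt (fun s => cos (kap * s) * a2 s t + sin (kap * s) * b2 s t) 0 d + c2 * RInt (fun s => cos (kap * s) * b2 s t - sin (kap * s) * a2 s t) 0 d).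
  { intros t Ht.
    assert (X1 : ex_RInt (fun s => cos (kap * s) * a2 s t + sin (kap * s) * b2 s t) 0 d).
    { apply (lx (fun s t => cos (kap * s) * a2 s t + sin (kap * s) * b2 s t)); [intros s u Hs; c2d|lra|assumption]. }
    assert (X2 : ex_RInt (fun s => cos (kap * s) * b2 s t - sin (kap * s) * a2 s t) 0 d).
    { apply (lx (fun s t => cos (kap * s) * b2 s t - sin (kap * s) * a2 s t)); [intros s u Hs; c2d|lra|assumption]. }
    rewrite <- (RInt_scal_R _ c1 0 d X1), <- (RInt_scal_R _ c2 0 d X2).
    rewrite <- RInt_plus_R by (apply ex_RInt_scal_R; assumption).
    apply RInt_ext_R; [lra|]. intros; ring. }
  rewrite (Sp (1 + h0)), (Sp (- h0)), F1, F2, F1', F2' in PF by (intros; in_cell).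
  unfold vr at 2, vr' at 2, vi at 2, vi' at 2 in K. rewrite V3, V4, V3', V4' in K. apply Rabs_le_between in K.
  assert (d * (c1 * (vr (1 + h0) + vr' (1 + h0)) + c2 * (vi (1 + h0) + vi' (1 + h0))) <= d * (c1 * (- ze * y + - ze * y') + c2 * (ze * (x - 1) + ze * x') + g)) by (apply Rmult_le_compat_l; lra).
  lra.
Qed.
End Waves.
End Slab.

(** * Closing the estimates *)

(** w and l stand for RR / eps and L / eps. Half the sum of 1 + x - x' and x - 1 + x' is x, and
    similarly for y, so q = x^2 + y^2 is controlled by w + k^2 l, while l is controlled by 1 + w +
    q. For small k the terms in k^2 l are absorbed, and Young's inequality splits G k |y| into a
    quarter of w and O(k^2). This leaves w = O(k^2), and then q = O(k^2). *)
Lemma scaled_bootstrap (K G : R) : 0 < K -> 0 < G -> exists C k0, 0 < C /\ 0 < k0 <= 1 /\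
  forall k w l x y x' y', 0 < k <= k0 -> 0 <= w -> 0 <= l ->
  l <= 44 * w + 2 * ((1 + x) ^ 2 + y ^ 2) ->
  (1 + x - x') ^ 2 + (y - y') ^ 2 <= 176 * w ->
  (y + y') ^ 2 <= K * (w + k ^ 2 * l) -> (x - 1 + x') ^ 2 <= K * (w + k ^ 2 * l) ->
  w <= k ^ 2 * l + G * (k * Rabs y) ->
  w <= C * k ^ 2 /\ x ^ 2 + y ^ 2 <= C * k ^ 2.
Proof.
  (* C4 is 2 (44 + 4 (88 + K)): the coefficient of w in the bound for l once q is inserted, doubled
     to absorb the term in k^2 l. *)
  intros HK HG. set (C4 := 792 + 8 * K). set (C5 := 88 + K + C4 / 8 + 8 * K).
  assert (H4 : 0 < C4) by (unfold C4; lra). assert (H5 : 0 < C5) by (unfold C5; lra).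
  set (Cw := 17 + 2 * C5 * G ^ 2). assert (HG2 : 0 < G ^ 2) by (apply pow_lt; assumption).
  assert (H5G : 0 < C5 * G ^ 2) by (apply Rmult_lt_0_compat; assumption).
  assert (Hw : 0 < Cw) by (unfold Cw; lra).
  assert (H5w : 0 < C5 * (Cw + 1)) by (apply Rmult_lt_0_compat; lra).
  exists (Cw + C5 * (Cw + 1)), (/ (4 * C4)). split; [lra|]. split.
  { split; [apply Rinv_0_lt_compat; lra|]. rewrite <- Rinv_1. apply Rinv_le_contravar; unfold C4; lra. }
  intros k w l x y x' y' Hk Hw0 Hl0 H1 H2 H3 H3' HW.
  assert (Hk1 : C4 * k <= 1 / 4).
  { apply Rle_trans with (C4 * / (4 * C4)). apply Rmult_le_compat_l; lra. right; field; lra. }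
  assert (k1 : k <= 1). { unfold C4 in Hk1. nra. }
  assert (Hk2 : k ^ 2 <= k) by nra. assert (Hkp : 0 < k ^ 2) by (apply pow_lt; lra).
  assert (C4k : C4 * k ^ 2 <= 1 / 4) by (eapply Rle_trans; [apply Rmult_le_compat_l; [lra|exact Hk2]|exact Hk1]).
  assert (Kk : 8 * K * k ^ 2 <= 1 / 4). { unfold C4 in C4k. lra. }
  set (q := x ^ 2 + y ^ 2).
  assert (Hq : q <= (88 + K) * w + K * (k ^ 2 * l)).
  { unfold q. pose proof (pow2_ge_0 ((1 + x - x') - (x - 1 + x'))). pose proof (pow2_ge_0 ((y - y') - (y + y'))).
    replace (x ^ 2) with (((1 + x - x') + (x - 1 + x')) ^ 2 / 4) by field.
    replace (y ^ 2) with (((y - y') + (y + y')) ^ 2 / 4) by field. lra. }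
  assert (Hl : l <= 44 * w + 4 + 4 * q).
  { unfold q. pose proof (pow2_ge_0 (1 - x)). pose proof (pow2_ge_0 y). lra. }
  assert (L1 : 8 * K * k ^ 2 * l <= 1 / 4 * l) by (apply Rmult_le_compat_r; lra).
  assert (Hl2 : l <= 8 + C4 * w). { unfold C4. lra. }
  assert (Kw : 0 <= K * w) by (apply Rmult_le_pos; lra).
  assert (Hq2 : q <= C5 * (w + k ^ 2)).
  { assert (K * k ^ 2 * l <= K * k ^ 2 * (8 + C4 * w)) by (apply Rmult_le_compat_l; [apply Rmult_le_pos; lra|lra]).
    assert (8 * K * k ^ 2 * (C4 * w) <= 1 / 4 * (C4 * w)) by (apply Rmult_le_compat_r; [apply Rmult_le_pos; lra|lra]).
    assert (0 <= C4 * w) by (apply Rmult_le_pos; lra). assert (0 <= C4 * k ^ 2) by (apply Rmult_le_pos; lra).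
    assert (0 <= K * k ^ 2) by (apply Rmult_le_pos; lra).
    unfold C5. lra. }
  assert (Hy : y ^ 2 <= q). { unfold q. pose proof (pow2_ge_0 x). lra. }
  (* Young's inequality with weight 1 / (4 C5), chosen so that y^2 <= C5 (w + k^2) turns into a
     quarter of w + k^2. *)
  assert (Hy2 : G * (k * Rabs y) <= w / 4 + k ^ 2 / 4 + C5 * G ^ 2 * k ^ 2).
  { apply Rle_trans with (/ (4 * C5) * y ^ 2 + C5 * G ^ 2 * k ^ 2).
    - assert (P : 0 <= / (4 * C5) * (Rabs y - 2 * C5 * (G * k)) ^ 2).
      { apply Rmult_le_pos; [left; apply Rinv_0_lt_compat; lra|apply pow2_ge_0]. }
      rewrite <- (pow2_abs y).
      replace (/ (4 * C5) * (Rabs y - 2 * C5 * (G * k)) ^ 2) with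
        (/ (4 * C5) * Rabs y ^ 2 - G * (k * Rabs y) + C5 * G ^ 2 * k ^ 2) in P by (field; lra). lra.
    - assert (/ (4 * C5) * y ^ 2 <= / (4 * C5) * (C5 * (w + k ^ 2))).
      { apply Rmult_le_compat_l; [left; apply Rinv_0_lt_compat; lra|lra]. }
      replace (/ (4 * C5) * (C5 * (w + k ^ 2))) with (w / 4 + k ^ 2 / 4) in H by (field; lra). lra. }
  assert (Hkl : k ^ 2 * l <= 8 * k ^ 2 + w / 4).
  { apply Rle_trans with (k ^ 2 * (8 + C4 * w)). apply Rmult_le_compat_l; lra.
    assert (C4 * k ^ 2 * w <= 1 / 4 * w) by (apply Rmult_le_compat_r; lra). lra. }
  assert (Fw : w <= Cw * k ^ 2) by (unfold Cw; lra).
  assert (0 <= Cw * k ^ 2) by (apply Rmult_le_pos; lra).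
  assert (0 <= C5 * (Cw + 1) * k ^ 2) by (apply Rmult_le_pos; lra).
  split; [lra|]. fold q.
  assert (C5 * (w + k ^ 2) <= C5 * (Cw * k ^ 2 + k ^ 2)) by (apply Rmult_le_compat_l; lra). lra.
Qed.

(** * From the scattering problem to its real form *)

Lemma incident_real kap ze s t : incident_field kap ze (s, t) =
  (cos (kap * s - ze * (t - 1)), sin (kap * s - ze * (t - 1))).
Proof.
  unfold incident_field, cexp, Cmult, Ci, RtoC, Re, Im; simpl.
  apply injective_projections; simpl;
    repeat match goal with |- context [exp ?e] => progress replace (exp e) with 1 by (rewrite <- exp_0; f_equal; ring) end;
    repeat match goal with |- context [cos ?e] => progress replace (cos e) with (cos (kap * s - ze * (t - 1))) by (f_equal; ring) end;
    repeat match goal with |- context [sin ?e] => progress replace (sin e) with (sin (kap * s - ze * (t - 1))) by (f_equal; ring) end; ring.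
Qed.

Lemma waves_above d k kap ze u : 0 < d -> 0 < k -> k * d <= 1 / 10 -> Rabs kap < k ->
  ze = sqrt (k ^ 2 - kap ^ 2) ->
  upward_outgoing d k kap (fun x => Cminus (u x) (incident_field kap ze x)) ->
  exists al1 be1 al2 be2 x y,
   negligible d (fun s t => cos (kap * s) * ure u s t + sin (kap * s) * uim u s t - wave ze al1 be1 t) /\
   negligible d (fun s t => cos (kap * s) * uim u s t - sin (kap * s) * ure u s t - wave ze al2 be2 t) /\
   wave ze al1 be1 1 = 1 + x /\ wave ze al2 be2 1 = y /\
   wave' ze al1 be1 1 = - ze * y /\ wave' ze al2 be2 1 = ze * (x - 1).
Proof.
  intros Hd Hk Hkd Hkap Hze [a0 H].
  destruct (outgoing_real d k kap (fun s t => Cminus (u (s, t)) (incident_field kap ze (s, t))) Hd Hk Hkd Hkap) as [x0 [y0 N]].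
  { exists a0. intros s t Ht. apply (H (s, t) Ht). }
  cbv zeta in N. rewrite <- Hze in N. destruct N as [N1 N2].
  (* Without its phase e^{i kap s} the incident wave is e^{-i ze (t - 1)}; it is added to (x0 + i
     y0) e^{i ze t}. The reflection coefficient x + i y is (x0 + i y0) e^{i ze}, normalised at the
     upper face t = 1. *)
  exists (cos ze + x0), (sin ze - y0), (sin ze + y0), (x0 - cos ze), (x0 * cos ze - y0 * sin ze), (x0 * sin ze + y0 * cos ze).
  pose proof (cos2_sin2 ze) as S.
  assert (E : forall s t, rot_re kap (fun s t => Cminus (u (s, t)) (incident_field kap ze (s, t))) s t =
      cos (kap * s) * ure u s t + sin (kap * s) * uim u s t - cos (ze * t - ze) /\
      rot_im kap (fun s t => Cminus (u (s, t)) (incident_field kap ze (s, t))) s t =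
      cos (kap * s) * uim u s t - sin (kap * s) * ure u s t + sin (ze * t - ze)).
  { intros s t. unfold rot_re, rot_im. rewrite incident_real. unfold ure, uim.
    set (ph := kap * s - ze * (t - 1)). replace (ze * t - ze) with (kap * s - ph) by (unfold ph; ring).
    rewrite cos_minus, sin_minus. unfold Cminus, Cplus, Copp; simpl. split; ring. }
  split; [|split; [|split; [|split; [|split]]]].
  - refine (negligible_ext d _ _ _ N1). intros s t _. cbv beta. rewrite (proj1 (E s t)), cos_minus. unfold wave. ring.
  - refine (negligible_ext d _ _ _ N2). intros s t _. cbv beta. rewrite (proj2 (E s t)), sin_minus. unfold wave. ring.
  - unfold wave. rewrite Rmult_1_r, <- S. ring.
  - unfold wave. rewrite Rmult_1_r. ring.
  - unfold wave'. rewrite Rmult_1_r. ring.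
  - unfold wave'. rewrite Rmult_1_r, <- S. ring.
Qed.

Lemma cexp_plus z w : cexp (Cplus z w) = Cmult (cexp z) (cexp w).
Proof.
  destruct z as [a b], w as [c e]. unfold cexp, Cplus, Cmult, Re, Im; simpl.
  rewrite exp_plus, cos_plus, sin_plus. apply injective_projections; simpl; ring.
Qed.

Lemma waves_below d k kap ze u : 0 < d -> 0 < k -> k * d <= 1 / 10 -> Rabs kap < k ->
  ze = sqrt (k ^ 2 - kap ^ 2) -> downward_outgoing d k kap u ->
  exists al1 be1 al2 be2 x y,
   negligible d (fun s t => cos (kap * s) * ure u s (1 - t) + sin (kap * s) * uim u s (1 - t) - wave ze al1 be1 t) /\
   negligible d (fun s t => cos (kap * s) * uim u s (1 - t) - sin (kap * s) * ure u s (1 - t) - wave ze al2 be2 t) /\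
   wave ze al1 be1 1 = x /\ wave ze al2 be2 1 = y /\
   wave' ze al1 be1 1 = - ze * y /\ wave' ze al2 be2 1 = ze * x.
Proof.
  intros Hd Hk Hkd Hkap Hze [a0 H].
  destruct (outgoing_real d k kap (fun s t => u (s, 1 - t)) Hd Hk Hkd Hkap) as [x0 [y0 N]].
  (* Under t -> 1 - t the downward waves become upward ones, each coefficient picking up the factor
     e^{-i zeta_n}. *)
  { exists (fun n => Cmult (a0 n) (cexp (Cmult Ci (Copp (zeta_n d k kap n))))). intros s t Ht.
    destruct (H (s, 1 - t) ltac:(simpl; lra)) as [l1 [l2 [S1 [S2 E]]]].
    assert (T : forall n, Cmult (a0 n) (plane_wave (RtoC (kappa_n d kap n)) (Copp (zeta_n d k kap n)) (s, 1 - t)) =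
      Cmult (Cmult (a0 n) (cexp (Cmult Ci (Copp (zeta_n d k kap n))))) (plane_wave (RtoC (kappa_n d kap n)) (zeta_n d k kap n) (s, t))).
    { intros n. unfold plane_wave. rewrite <- Cmult_assoc, <- cexp_plus. f_equal. f_equal. simpl.
      rewrite RtoC_minus. ring. }
    exists l1, l2. split; [|split; [|exact E]].
    - eapply is_series_ext; [|exact S1]. intros n. apply T.
    - eapply is_series_ext; [|exact S2]. intros n. apply T. }
  cbv zeta in N. rewrite <- Hze in N. destruct N as [N1 N2].
  exists x0, (- y0), y0, x0, (x0 * cos ze - y0 * sin ze), (x0 * sin ze + y0 * cos ze).
  split; [|split; [|split; [|split; [|split]]]].
  - refine (negligible_ext d _ _ _ N1). intros s t _. unfold rot_re, ure, uim, wave. ring.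
  - refine (negligible_ext d _ _ _ N2). intros s t _. unfold rot_im, ure, uim, wave. ring.
  - unfold wave. rewrite Rmult_1_r. ring.
  - unfold wave. rewrite Rmult_1_r. ring.
  - unfold wave'. rewrite Rmult_1_r. ring.
  - unfold wave'. rewrite Rmult_1_r. ring.
Qed.

Lemma wall_limit (v : R * R -> C) (D : R * R -> Prop) y g :
  filterlim v (within D (locally y)) (locally (RtoC 0)) -> 0 < g ->
  exists dl, 0 < dl /\ forall s t, D (s, t) -> Rabs (s - fst y) < dl -> Rabs (t - snd y) < dl ->
    Rabs (ure v s t) <= g /\ Rabs (uim v s t) <= g.
Proof.
  intros H Hg.
  assert (L : locally (T := prod_UniformSpace R_UniformSpace R_UniformSpace) (RtoC 0) (fun z : R * R => Rabs (fst z) <= g /\ Rabs (snd z) <= g)).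
  { exists (mkposreal g Hg). intros [z1 z2] [B1 B2].
    unfold ball in B1, B2; simpl in B1, B2. unfold AbsRing_ball, abs, minus, plus, opp in B1, B2; simpl in B1, B2.
    rewrite Ropp_0, Rplus_0_r in B1, B2. simpl. lra. }
  destruct (H _ L) as [dl Hdl]. exists dl. split; [apply cond_pos|]. intros s t HD Hs Ht.
  apply (Hdl (s, t)); [|exact HD]. split; assumption.
Qed.

Lemma neumann_vertical eps d u : 0 < eps < d -> neumann eps d u ->
  forall c e g, 0 < c -> e < 1 -> 0 < g -> exists h0, 0 < h0 /\
  forall h t, 0 < h < h0 -> c <= t <= e -> (Rabs (ure (d1 u) h t) <= g /\ Rabs (uim (d1 u) h t) <= g) /\
    (Rabs (ure (d1 u) (eps - h) t) <= g /\ Rabs (uim (d1 u) (eps - h) t) <= g).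
Proof.
  intros Heps [H _] c e g Hc He Hg.
  apply (uniform_on_segment (fun h t => (Rabs (ure (d1 u) h t) <= g /\ Rabs (uim (d1 u) h t) <= g) /\
    (Rabs (ure (d1 u) (eps - h) t) <= g /\ Rabs (uim (d1 u) (eps - h) t) <= g))).
  intros y Hy.
  destruct (wall_limit (d1 u) (Omega eps d) (0, y) g) as [dl1 [P1 K1]]; [|assumption|].
  { apply H. split; [simpl; lra|]. exists 0%Z. left. simpl. ring. }
  destruct (wall_limit (d1 u) (Omega eps d) (eps, y) g) as [dl2 [P2 K2]]; [|assumption|].
  { apply H. split; [simpl; lra|]. exists 0%Z. right. simpl. ring. }
  set (dl := Rmin (Rmin dl1 dl2) (Rmin eps (Rmin y (1 - y)))).
  assert (Hdl : 0 < dl) by (unfold dl; repeat apply Rmin_pos; lra).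
  assert (B1 : dl <= dl1) by (eapply Rle_trans; [apply Rmin_l|apply Rmin_l]).
  assert (B2 : dl <= dl2) by (eapply Rle_trans; [apply Rmin_l|apply Rmin_r]).
  assert (B3 : dl <= eps) by (eapply Rle_trans; [apply Rmin_r|apply Rmin_l]).
  assert (B4 : dl <= y) by (eapply Rle_trans; [apply Rmin_r|]; eapply Rle_trans; [apply Rmin_r|apply Rmin_l]).
  assert (B5 : dl <= 1 - y) by (eapply Rle_trans; [apply Rmin_r|]; eapply Rle_trans; [apply Rmin_r|apply Rmin_r]).
  clearbody dl. exists dl. split; [assumption|]. intros h t Hh Ht. apply Rabs_def2 in Ht.
  split.
  - apply K1; [apply cell_Omega; in_cell| |]; simpl; apply Rabs_def1; lra.
  - apply K2; [apply cell_Omega; in_cell| |]; simpl; apply Rabs_def1; lra.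
Qed.

Lemma neumann_horizontal eps d u : 0 < eps < d -> neumann eps d u ->
  forall a b g, eps < a -> b < d -> 0 < g -> exists h0, 0 < h0 /\
  forall h s, 0 < h < h0 -> a <= s <= b -> (Rabs (ure (d2 u) s (1 + h)) <= g /\ Rabs (uim (d2 u) s (1 + h)) <= g) /\
    (Rabs (ure (d2 u) s (- h)) <= g /\ Rabs (uim (d2 u) s (- h)) <= g).
Proof.
  intros Heps [_ H] a b g Ha Hb Hg.
  apply (uniform_on_segment (fun h s => (Rabs (ure (d2 u) s (1 + h)) <= g /\ Rabs (uim (d2 u) s (1 + h)) <= g) /\
    (Rabs (ure (d2 u) s (- h)) <= g /\ Rabs (uim (d2 u) s (- h)) <= g))).
  intros y Hy.
  destruct (wall_limit (d2 u) (Omega eps d) (y, 1) g) as [dl1 [P1 K1]]; [|assumption|].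
  { apply H. split; [right; reflexivity|]. exists 0%Z. simpl. lra. }
  destruct (wall_limit (d2 u) (Omega eps d) (y, 0) g) as [dl2 [P2 K2]]; [|assumption|].
  { apply H. split; [left; reflexivity|]. exists 0%Z. simpl. lra. }
  set (dl := Rmin dl1 dl2).
  assert (Hdl : 0 < dl) by (unfold dl; repeat apply Rmin_pos; lra).
  assert (B1 : dl <= dl1) by apply Rmin_l. assert (B2 : dl <= dl2) by apply Rmin_r.
  clearbody dl. exists dl. split; [assumption|]. intros h s Hh Hs.
  split.
  - apply K1; [apply cell_Omega; in_cell| |]; simpl; [lra|apply Rabs_def1; lra].
  - apply K2; [apply cell_Omega; in_cell| |]; simpl; [lra|apply Rabs_def1; lra].
Qed.

Lemma helmholtz_real eps d k u : (forall x, Omega eps d x -> Cplus (laplacian u x) (Cmult (RtoC (k ^ 2)) (u x)) = RtoC 0) ->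
  forall s t, cell eps s t ->
  ure (d1 (d1 u)) s t + ure (d2 (d2 u)) s t + k ^ 2 * ure u s t = 0 /\
  uim (d1 (d1 u)) s t + uim (d2 (d2 u)) s t + k ^ 2 * uim u s t = 0.
Proof.
  intros H s t Hst. specialize (H (s, t) (cell_Omega eps d s t Hst)). unfold laplacian in H.
  set (p := d1 (d1 u) (s, t)) in *. set (q := d2 (d2 u) (s, t)) in *. set (v := u (s, t)) in *.
  unfold ure, uim. fold p q v. destruct p as [p1 p2], q as [q1 q2], v as [v1 v2].
  unfold Cplus, Cmult, RtoC in H. simpl in H. injection H as H1 H2. simpl. lra.
Qed.

Lemma energy_real eps d u : 0 < eps < d -> C2_on (Omega eps d) u -> locally_finite_energy (Omega eps d) u ->
  exists M, forall x y c e, 0 <= x -> x <= y -> y <= d -> -2 <= c -> c <= e -> e <= 3 ->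
  (forall s t, rect x y c e s t -> cell eps s t) ->
  I2 (fun s t => (ure u s t ^ 2 + uim u s t ^ 2) + (ure (d1 u) s t ^ 2 + uim (d1 u) s t ^ 2 + ure (d2 u) s t ^ 2 + uim (d2 u) s t ^ 2)) x y c e <= M.
Proof.
  intros Heps _ H. destruct (H (3 + d)) as [M HM]. exists M. intros x y c e H1 H2 H3 H4 H5 H6 Hc.
  eapply Rle_trans; [|apply (HM x y c e H2 H5)].
  - right. apply I2_ext; try assumption. intros s t _. unfold energy_density. rewrite !Cmod2_alt. unfold ure, uim, Re, Im. ring.
  - intros s t Hs Ht. split; [apply cell_Omega, Hc; split; assumption|]. split; apply Rabs_le; lra.
Qed.

(** The relation for the s-derivative comes from computing the derivative of u(s + d, t) at s = 0 in
    two ways. *)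
Lemma quasi_real eps d kap u : 0 < eps < d -> C2_on (Omega eps d) u ->
  (forall x, Omega eps d x -> u (fst x + d, snd x) = Cmult (cexp (Cmult Ci (RtoC (kap * d)))) (u x)) ->
  forall t, 1 < t \/ t < 0 ->
  (ure u d t = cos (kap * d) * ure u 0 t - sin (kap * d) * uim u 0 t /\
   uim u d t = sin (kap * d) * ure u 0 t + cos (kap * d) * uim u 0 t) /\
  (ure (d1 u) d t = cos (kap * d) * ure (d1 u) 0 t - sin (kap * d) * uim (d1 u) 0 t /\
   uim (d1 u) d t = sin (kap * d) * ure (d1 u) 0 t + cos (kap * d) * uim (d1 u) 0 t).
Proof.
  intros Heps HC H t Ht.
  assert (Hcell : forall s, cell eps s t) by (intros s; destruct Ht; [left|right; left]; assumption).
  assert (E : forall s, ure u (s + d) t = cos (kap * d) * ure u s t - sin (kap * d) * uim u s t /\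
    uim u (s + d) t = sin (kap * d) * ure u s t + cos (kap * d) * uim u s t).
  { intros s. pose proof (H (s, t) (cell_Omega eps d s t (Hcell s))) as Hs. simpl in Hs.
    assert (X : cexp (Cmult Ci (RtoC (kap * d))) = (cos (kap * d), sin (kap * d))).
    { unfold cexp, Cmult, Ci, RtoC, Re, Im; simpl.
      apply injective_projections; simpl;
      repeat match goal with |- context [exp ?e] => progress replace (exp e) with 1 by (rewrite <- exp_0; f_equal; ring) end;
      repeat match goal with |- context [cos ?e] => progress replace (cos e) with (cos (kap * d)) by (f_equal; ring) end;
      repeat match goal with |- context [sin ?e] => progress replace (sin e) with (sin (kap * d)) by (f_equal; ring) end; ring. }
    rewrite X in Hs. unfold ure, uim. rewrite Hs. unfold Cmult; simpl. split; ring. }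
  destruct (C2_real eps d u HC) as [Ca Cb].
  split.
  - specialize (E 0). rewrite Rplus_0_l in E. exact E.
  - assert (Da : is_derive (fun s => ure u (s + d) t) 0 (ure (d1 u) d t)).
    { apply (is_der_shift (fun s => ure u s t)). rewrite Rplus_0_l. apply (c2_d1 _ _ _ _ _ _ _ Ca), Hcell. }
    assert (Db : is_derive (fun s => uim u (s + d) t) 0 (uim (d1 u) d t)).
    { apply (is_der_shift (fun s => uim u s t)). rewrite Rplus_0_l. apply (c2_d1 _ _ _ _ _ _ _ Cb), Hcell. }
    assert (Da' : is_derive (fun s => ure u (s + d) t) 0 (cos (kap * d) * ure (d1 u) 0 t - sin (kap * d) * uim (d1 u) 0 t)).
    { apply (is_derive_ext (fun s => cos (kap * d) * ure u s t - sin (kap * d) * uim u s t)). intros s; symmetry; apply E.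
      eapply is_der_eq; [der_core; [apply (c2_d1 _ _ _ _ _ _ _ Ca), Hcell|apply (c2_d1 _ _ _ _ _ _ _ Cb), Hcell]|]. simpl; ring. }
    assert (Db' : is_derive (fun s => uim u (s + d) t) 0 (sin (kap * d) * ure (d1 u) 0 t + cos (kap * d) * uim (d1 u) 0 t)).
    { apply (is_derive_ext (fun s => sin (kap * d) * ure u s t + cos (kap * d) * uim u s t)). intros s; symmetry; apply E.
      eapply is_der_eq; [der_core; [apply (c2_d1 _ _ _ _ _ _ _ Ca), Hcell|apply (c2_d1 _ _ _ _ _ _ _ Cb), Hcell]|]. simpl; ring. }
    apply is_derive_unique in Da, Db, Da', Db'. split; [rewrite <- Da|rewrite <- Db]; assumption.
Qed.

(** 2 - 2 cos x is |e^{i x} - 1|^2 = 4 sin^2 (x / 2). It serves to replace the phase e^{i kap s} in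
    the slit by 1 with a squared error of at most k^2. *)
Lemma one_minus_cos_le x : 2 - 2 * cos x <= x ^ 2.
Proof.
  assert (S : forall z, sin z ^ 2 <= z ^ 2).
  { assert (P : forall z, 0 < z -> sin z ^ 2 <= z ^ 2).
    { intros z Hz. rewrite <- (pow2_abs (sin z)). apply pow_incr. split; [apply Rabs_pos|].
      apply Rabs_le. pose proof (sin_lt_x z Hz). split; [|lra].
      destruct (Rle_dec z 1). pose proof PI2_1. pose proof (sin_ge_0 z ltac:(lra) ltac:(lra)). lra.
      pose proof (SIN_bound z). lra. }
    intros z. destruct (Rtotal_order z 0) as [H|[->|H]].
    - replace (sin z ^ 2) with (sin (- z) ^ 2) by (rewrite sin_neg; ring). replace (z ^ 2) with ((- z) ^ 2) by ring. apply P; lra.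
    - rewrite sin_0. lra.
    - apply P, H. }
  specialize (S (x / 2)). replace (cos x) with (cos (2 * (x / 2))) by (f_equal; field).
  rewrite cos_2a_sin. nra.
Qed.

Lemma strip_of_cell eps k z z1 z2 z11 z22 z12 : C2r (cell eps) z z1 z2 z11 z22 z12 ->
  (forall s t, cell eps s t -> z11 s t + z22 s t + k ^ 2 * z s t = 0) ->
  (forall c e g, 0 < c -> e < 1 -> 0 < g -> exists h0, 0 < h0 /\
    forall h t, 0 < h < h0 -> c <= t <= e -> Rabs (z1 h t) <= g /\ Rabs (z1 (eps - h) t) <= g) ->
  neumann_strip k eps 0 1 z z1 z2 z11 z22 z12.
Proof.
  intros [D1 D2 D11 D22 D12 K0 K1 K2 K11 K22 K12] E W.
  assert (Cl : forall s t, 0 < s < eps /\ 0 < t < 1 -> cell eps s t).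
  { intros s t H. right; right. lra. }
  split; try (apply (cont_on_sub _ _ _ Cl); assumption); try (intros; apply W; assumption);
   intros s t Hs Ht; assert (Hc : cell eps s t) by (apply Cl; split; assumption).
  - apply D1, Hc.
  - apply D2, Hc.
  - apply D11, Hc.
  - apply D22, Hc.
  - apply D12, Hc.
  - apply E, Hc.
Qed.

(** All quantities are measured in units of eps. With d = eps / eta the incoming flux d ze equals
    eps k c / eta, of the same order in eps as the slit width, so the flux relation keeps its
    strength as eps tends to 0 and the constants depend on eta and c = cos theta alone. *)
Lemma slit_estimates (eta c : R) : 0 < eta < 1 -> 0 < c -> exists C k0, 0 < C /\ 0 < k0 <= 1 /\
  forall eps k kap u, 0 < eps -> eps / eta <= 1 / 10 -> 0 < k <= k0 -> Rabs kap < k ->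
    k * c = sqrt (k ^ 2 - kap ^ 2) ->
    scattering_solution eps (eps / eta) k kap (incident_field kap (k * c)) u ->
    forall r, 0 < r < eps / 2 ->
      I2 (fun s t => ure (d1 u) s t ^ 2 + uim (d1 u) s t ^ 2 + ure (d2 u) s t ^ 2 + uim (d2 u) s t ^ 2) r (eps - r) 0 1 <= C * k ^ 2 * eps /\
      I2 (fun s t => (ure u s t - 1) ^ 2 + uim u s t ^ 2) r (eps - r) 0 1 <= C * k ^ 2 * eps.
Proof.
  intros Heta Hc.
  (* The first constant comes from dividing the squared flux relation by (d ze)^2 = (eps k c /
     eta)^2, the second from 2 d ze / eps = (2 c / eta) k. *)
  destruct (scaled_bootstrap (2 * eta ^ 2 / c ^ 2) (2 * c / eta)) as [C [k0 [HC [Hk0 Boot]]]].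
  { assert (0 < eta ^ 2) by (apply pow_lt; lra). assert (0 < c ^ 2) by (apply pow_lt; lra). apply Rdiv_lt_0_compat; lra. }
  { apply Rdiv_lt_0_compat; lra. }
  (* 44 C is twice the 22 RR of [slit_vs_top]; the remaining 4 C + 4 bounds twice |(1 + x + i y)
     e^{i kap s} - 1|^2, in units of k^2. *)
  exists (48 * C + 4), k0. split; [lra|]. split; [assumption|].
  intros eps k kap u Heps Hd10 Hk Hkap Hze [S1 S2 S3 S4 S5 S6 S7] r Hr.
  set (d := eps / eta) in *. set (ze := k * c) in *.
  assert (Hed : 0 < eps < d).
  { split; [assumption|]. unfold d. apply (Rmult_lt_reg_r eta); [lra|]. unfold Rdiv. rewrite Rmult_assoc, Rinv_l by lra. nra. }
  assert (Hkd : k * d <= 1 / 10). { assert (k * d <= 1 * d) by (apply Rmult_le_compat_r; lra). lra. }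
  destruct (C2_real eps d u S1) as [Ca Cb].
  pose proof (helmholtz_real eps d k u S2) as EH.
  destruct (energy_real eps d u Hed S1 S4) as [M HM].
  pose proof (neumann_vertical eps d u Hed S3) as W1. pose proof (neumann_horizontal eps d u Hed S3) as W2.
  pose proof (quasi_real eps d kap u Hed S1 S5) as QR.
  destruct (waves_above d k kap ze u ltac:(lra) ltac:(lra) Hkd Hkap Hze S6) as [al1 [be1 [al2 [be2 [x [y [N1 [N2 [V1 [V2 [V3 V4]]]]]]]]]]].
  destruct (waves_below d k kap ze u ltac:(lra) ltac:(lra) Hkd Hkap Hze S7) as [al1' [be1' [al2' [be2' [x' [y' [N1' [N2' [V1' [V2' [V3' V4']]]]]]]]]]].
  set (a := ure u) in *. set (b := uim u) in *. set (a1 := ure (d1 u)) in *. set (b1 := uim (d1 u)) in *.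
  set (a2 := ure (d2 u)) in *. set (b2 := uim (d2 u)) in *.
  set (a11 := ure (d1 (d1 u))) in *. set (b11 := uim (d1 (d1 u))) in *.
  set (a22 := ure (d2 (d2 u))) in *. set (b22 := uim (d2 (d2 u))) in *.
  set (a12 := ure (d2 (d1 u))) in *. set (b12 := uim (d2 (d1 u))) in *.
  assert (Ea : forall s t, cell eps s t -> a11 s t + a22 s t + k ^ 2 * a s t = 0) by exact (fun s t H => proj1 (EH s t H)).
  assert (Eb : forall s t, cell eps s t -> b11 s t + b22 s t + k ^ 2 * b s t = 0) by exact (fun s t H => proj2 (EH s t H)).
  assert (Qa := fun t Ht => proj1 (proj1 (QR t Ht))). assert (Qb := fun t Ht => proj2 (proj1 (QR t Ht))).
  assert (Qa1 := fun t Ht => proj1 (proj2 (QR t Ht))). assert (Qb1 := fun t Ht => proj2 (proj2 (QR t Ht))).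
  assert (Hze0 : 0 < ze) by (apply Rmult_lt_0_compat; lra).
  assert (Hze2 : ze ^ 2 + kap ^ 2 = k ^ 2).
  { rewrite Hze. rewrite pow2_sqrt. ring.
    assert (kap ^ 2 <= k ^ 2) by (rewrite <- (pow2_abs kap); apply pow_incr; split; [apply Rabs_pos|lra]). lra. }
  set (uu := fun s t => a s t ^ 2 + b s t ^ 2).
  assert (cuu : cont_on (cell eps) uu).
  { pose proof (c2_c0 _ _ _ _ _ _ _ Ca). pose proof (c2_c0 _ _ _ _ _ _ _ Cb). intros s t H'. unfold uu. c2d. }
  assert (cgg : cont_on (cell eps) (fun s t => a1 s t ^ 2 + b1 s t ^ 2 + a2 s t ^ 2 + b2 s t ^ 2)).
  { pose proof (c2_c1 _ _ _ _ _ _ _ Ca). pose proof (c2_c1 _ _ _ _ _ _ _ Cb).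
    pose proof (c2_c2 _ _ _ _ _ _ _ Ca). pose proof (c2_c2 _ _ _ _ _ _ _ Cb). intros s t H'. c2d. }
  assert (cr : forall f rho, 0 < rho < eps / 2 -> cont_on (cell eps) f -> cont_on (rect rho (eps - rho) 0 1) f).
  { intros f rho Hrho Hf. apply (cont_on_sub (cell eps)); [rect_cell|assumption]. }
  (* L is the mass of the whole slit, obtained as the supremum over inner rectangles; finite energy
     makes it finite. *)
  destruct (completeness (fun v => exists rho, 0 < rho < eps / 2 /\ v = I2 uu rho (eps - rho) 0 1)) as [L [L1 L2]].
  { exists M. intros v [rho [Hrho ->]]. eapply Rle_trans; [|apply (HM rho (eps - rho) 0 1); try lra; rect_cell].
    apply I2_le; try lra. apply cr; assumption.
    apply cr; [assumption|]. intros s t H'. apply (continuity_2d_pt_plus uu); [apply cuu, H'|apply cgg, H'].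
    intros s t _. unfold uu. pose proof (pow2_ge_0 (a1 s t)). pose proof (pow2_ge_0 (b1 s t)).
    pose proof (pow2_ge_0 (a2 s t)). pose proof (pow2_ge_0 (b2 s t)). lra. }
  { exists (I2 uu (eps / 4) (eps - eps / 4) 0 1), (eps / 4). split; [lra|reflexivity]. }
  assert (HL : forall rho, 0 < rho < eps / 2 -> I2 uu rho (eps - rho) 0 1 <= L).
  { intros rho Hrho. apply L1. exists rho. split; [assumption|reflexivity]. }
  assert (L0 : 0 <= L).
  { eapply Rle_trans; [|apply (HL (eps / 4)); lra]. apply I2_nonneg; try lra. apply cr; [lra|assumption].
    intros s t _. unfold uu. pose proof (pow2_ge_0 (a s t)). pose proof (pow2_ge_0 (b s t)). lra. }
  set (RR := k ^ 2 * L + 2 * d * ze * Rabs y).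
  assert (SE : forall rho, 0 < rho < eps / 2 -> I2 (fun s t => a1 s t ^ 2 + b1 s t ^ 2 + a2 s t ^ 2 + b2 s t ^ 2) rho (eps - rho) 0 1 <= RR).
  { exact (slit_energy eps d k kap M a a1 a2 a11 a22 a12 b b1 b2 b11 b22 b12 Hed ltac:(lra) ltac:(lra) Hkd ltac:(lra) Ca Cb Ea Eb HM W1 W2 Qa Qb Qa1 Qb1
     ze al1 be1 al2 be2 al1' be1' al2' be2' x y x' y' L ltac:(lra) Hze2 N1 N2 N1' N2' V1 V2 V3 V4 V1' V2' V3' V4' HL). }
  assert (ST : forall rho, 0 < rho < eps / 2 -> I2 (fun s t => (a s t - (cos (kap * s) * (1 + x) - sin (kap * s) * y)) ^ 2 + (b s t - (sin (kap * s) * (1 + x) + cos (kap * s) * y)) ^ 2) rho (eps - rho) 0 1 <= 22 * RR).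
  { exact (slit_vs_top eps d k kap M a a1 a2 a11 a22 a12 b b1 b2 b11 b22 b12 Hed ltac:(lra) ltac:(lra) Hkd ltac:(lra) Ca Cb Ea Eb HM W1 W2 Qa Qb Qa1 Qb1
     ze al1 be1 al2 be2 al1' be1' al2' be2' x y x' y' L ltac:(lra) Hze2 N1 N2 N1' N2' V1 V2 V3 V4 V1' V2' V3' V4' HL). }
  assert (SB : forall rho, 0 < rho < eps / 2 -> I2 (fun s t => (a s t - (cos (kap * s) * x' - sin (kap * s) * y')) ^ 2 + (b s t - (sin (kap * s) * x' + cos (kap * s) * y')) ^ 2) rho (eps - rho) 0 1 <= 22 * RR).
  { exact (slit_vs_bottom eps d k kap M a a1 a2 a11 a22 a12 b b1 b2 b11 b22 b12 Hed ltac:(lra) ltac:(lra) Hkd ltac:(lra) Ca Cb Ea Eb HM W1 W2 Qa Qb Qa1 Qb1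
     ze al1 be1 al2 be2 al1' be1' al2' be2' x y x' y' L ltac:(lra) Hze2 N1 N2 N1' N2' V1 V2 V3 V4 V1' V2' V3' V4' HL). }
  assert (FB : forall c1 c2, c1 ^ 2 + c2 ^ 2 = 1 -> - sqrt (2 * eps * (k ^ 2 * RR + k ^ 4 * L)) <= d * ze * (c1 * - (y + y') + c2 * (x - 1 + x'))).
  { exact (flux_balance eps d k kap M a a1 a2 a11 a22 a12 b b1 b2 b11 b22 b12 Hed ltac:(lra) ltac:(lra) Hkd ltac:(lra) Ca Cb Ea Eb HM W1 W2 Qa Qb Qa1 Qb1
     ze al1 be1 al2 be2 al1' be1' al2' be2' x y x' y' L ltac:(lra) Hze2 N1 N2 N1' N2' V1 V2 V3 V4 V1' V2' V3' V4' HL). }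
  assert (HRR : 0 <= RR).
  { unfold RR. assert (0 <= k ^ 2 * L) by (apply Rmult_le_pos; [apply pow2_ge_0|assumption]).
    assert (0 <= d * ze * Rabs y) by (apply Rmult_le_pos; [apply Rmult_le_pos; lra|apply Rabs_pos]). lra. }
  assert (k40 : 0 <= k ^ 4) by (replace (k ^ 4) with ((k ^ 2) ^ 2) by ring; apply pow2_ge_0).
  assert (cdist : forall p q, cont_on (cell eps) (fun s t => (a s t - (cos (kap * s) * p - sin (kap * s) * q)) ^ 2 + (b s t - (sin (kap * s) * p + cos (kap * s) * q)) ^ 2)).
  { pose proof (c2_c0 _ _ _ _ _ _ _ Ca). pose proof (c2_c0 _ _ _ _ _ _ _ Cb). intros p q s t H'. c2d. }
  set (w := RR / eps). set (l := L / eps).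
  assert (Ew : RR = w * eps) by (unfold w; field; lra). assert (El : L = l * eps) by (unfold l; field; lra).
  assert (Hw : 0 <= w) by (apply Rmult_le_pos; [assumption|left; apply Rinv_0_lt_compat; assumption]).
  assert (Hl : 0 <= l) by (apply Rmult_le_pos; [assumption|left; apply Rinv_0_lt_compat; assumption]).
  clearbody w l.
  assert (B1 : l <= 44 * w + 2 * ((1 + x) ^ 2 + y ^ 2)).
  { apply (Rmult_le_reg_r eps); [assumption|]. rewrite <- El. apply L2. intros v [rho [Hrho ->]].
    assert (Z : I2 uu rho (eps - rho) 0 1 <= I2 (fun s t => 2 * ((a s t - (cos (kap * s) * (1 + x) - sin (kap * s) * y)) ^ 2 + (b s t - (sin (kap * s) * (1 + x) + cos (kap * s) * y)) ^ 2) + 2 * ((1 + x) ^ 2 + y ^ 2)) rho (eps - rho) 0 1).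
    { apply I2_le; try lra. apply cr; assumption.
      pose proof (cr _ rho Hrho (cdist (1 + x) y)) as cd. intros s t Hst. specialize (cd s t Hst).
      apply (continuity_2d_pt_plus (fun s t => 2 * ((a s t - (cos (kap * s) * (1 + x) - sin (kap * s) * y)) ^ 2 + (b s t - (sin (kap * s) * (1 + x) + cos (kap * s) * y)) ^ 2)) (fun _ _ => 2 * ((1 + x) ^ 2 + y ^ 2))).
      apply (continuity_2d_pt_mult (fun _ _ => 2)). apply continuity_2d_pt_const. exact cd. apply continuity_2d_pt_const.
      intros s t _. unfold uu. pose proof (cos2_sin2 (kap * s)) as S.
      set (co := cos (kap * s)) in *. set (si := sin (kap * s)) in *.
      assert (E : (co * (1 + x) - si * y) ^ 2 + (si * (1 + x) + co * y) ^ 2 = (1 + x) ^ 2 + y ^ 2).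
      { replace (_ + _) with ((co ^ 2 + si ^ 2) * ((1 + x) ^ 2 + y ^ 2)) by ring. rewrite S. ring. }
      rewrite <- E. generalize (co * (1 + x) - si * y) (si * (1 + x) + co * y). intros p q.
      pose proof (pow2_ge_0 (a s t - 2 * p)). pose proof (pow2_ge_0 (b s t - 2 * q)). lra. }
    rewrite (I2_plus rho (eps - rho) 0 1 ltac:(lra) ltac:(lra) (fun s t => 2 * ((a s t - (cos (kap * s) * (1 + x) - sin (kap * s) * y)) ^ 2 + (b s t - (sin (kap * s) * (1 + x) + cos (kap * s) * y)) ^ 2)) (fun _ _ => 2 * ((1 + x) ^ 2 + y ^ 2))) in Z.
    rewrite I2_scal in Z; [|lra|lra|apply cr; [assumption|apply cdist]]. rewrite I2_const in Z.
    pose proof (ST rho Hrho). pose proof (pow2_ge_0 (1 + x)). pose proof (pow2_ge_0 y).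
    assert ((eps - rho - rho) * (1 - 0) * (2 * ((1 + x) ^ 2 + y ^ 2)) <= eps * (2 * ((1 + x) ^ 2 + y ^ 2))) by (apply Rmult_le_compat_r; lra).
    rewrite Ew in H. lra.
    intros s t Hst. apply (continuity_2d_pt_mult (fun _ _ => 2)). apply continuity_2d_pt_const. revert s t Hst. apply cr; [assumption|apply cdist].
    intros s t _. apply continuity_2d_pt_const. }
  (* The two constants are compared through the field on a rectangle of area eps / 2: twice 22 RR
     from each end gives 88 RR, and dividing by eps / 2 gives 176 w. *)
  assert (B2 : (1 + x - x') ^ 2 + (y - y') ^ 2 <= 176 * w).
  { set (rho := eps / 4). assert (Hrho : 0 < rho < eps / 2) by (unfold rho; lra).
    set (Dt := fun s t => (a s t - (cos (kap * s) * (1 + x) - sin (kap * s) * y)) ^ 2 + (b s t - (sin (kap * s) * (1 + x) + cos (kap * s) * y)) ^ 2).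
    set (Db := fun s t => (a s t - (cos (kap * s) * x' - sin (kap * s) * y')) ^ 2 + (b s t - (sin (kap * s) * x' + cos (kap * s) * y')) ^ 2).
    pose proof (cr _ rho Hrho (cdist (1 + x) y)) as cDt. fold Dt in cDt. pose proof (cr _ rho Hrho (cdist x' y')) as cDb. fold Db in cDb.
    assert (Z : I2 (fun _ _ => (1 + x - x') ^ 2 + (y - y') ^ 2) rho (eps - rho) 0 1 <= I2 (fun s t => 2 * Dt s t + 2 * Db s t) rho (eps - rho) 0 1).
    { apply I2_le; try (unfold rho; lra). intros s t _. apply continuity_2d_pt_const. intros s t Hst. c2d.
      intros s t _. pose proof (cos2_sin2 (kap * s)) as S. unfold Dt, Db.
      set (co := cos (kap * s)) in *. set (si := sin (kap * s)) in *.
      replace ((1 + x - x') ^ 2 + (y - y') ^ 2) with (((co * (1 + x) - si * y) - (co * x' - si * y')) ^ 2 + ((si * (1 + x) + co * y) - (si * x' + co * y')) ^ 2).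
      2:{ replace (_ + _) with ((co ^ 2 + si ^ 2) * ((1 + x - x') ^ 2 + (y - y') ^ 2)) by ring. rewrite S. ring. }
      generalize (co * (1 + x) - si * y) (si * (1 + x) + co * y) (co * x' - si * y') (si * x' + co * y'). intros p q p' q'.
      pose proof (pow2_ge_0 (a s t - p + (a s t - p'))). pose proof (pow2_ge_0 (b s t - q + (b s t - q'))). lra. }
    rewrite I2_const, I2_plus, !I2_scal in Z by (try assumption; try (unfold rho; lra); intros s t Hst; c2d).
    pose proof (ST rho Hrho) as T1. pose proof (SB rho Hrho) as T2. fold Dt in T1. fold Db in T2.
    apply (Rmult_le_reg_l (eps / 2)); [lra|]. unfold rho in Z, T1, T2.
    replace ((eps - eps / 4 - eps / 4) * (1 - 0)) with (eps / 2) in Z by field. rewrite Ew in T1, T2. lra. }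
  (* [flux_balance] bounds from below only, so it is used with opposite choices of (c1, c2), that is
     for v and for - v. *)
  assert (Sq : forall v, - sqrt (2 * eps * (k ^ 2 * RR + k ^ 4 * L)) <= d * ze * v -> - sqrt (2 * eps * (k ^ 2 * RR + k ^ 4 * L)) <= d * ze * - v ->
    v ^ 2 <= 2 * eta ^ 2 / c ^ 2 * (w + k ^ 2 * l)).
  { intros v Hv1 Hv2.
    assert (HP : 0 <= 2 * eps * (k ^ 2 * RR + k ^ 4 * L)).
    { apply Rmult_le_pos; [lra|]. apply Rplus_le_le_0_compat; apply Rmult_le_pos; try assumption. apply pow2_ge_0. }
    assert (A : (d * ze * v) ^ 2 <= 2 * eps * (k ^ 2 * RR + k ^ 4 * L)).
    { rewrite <- (pow2_sqrt _ HP). rewrite <- pow2_abs. apply pow_incr. split; [apply Rabs_pos|].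
      apply Rabs_le. lra. }
    assert (Hdz : d * ze = eps * k * c / eta) by (unfold d, ze; field; lra). rewrite Hdz, Ew, El in A.
    assert (F : 0 < (eps * k) ^ 2) by (apply pow_lt, Rmult_lt_0_compat; lra).
    assert (F2 : 0 < c ^ 2 / eta ^ 2) by (apply Rdiv_lt_0_compat; apply pow_lt; lra).
    apply (Rmult_le_reg_l ((eps * k) ^ 2 * (c ^ 2 / eta ^ 2))); [apply Rmult_lt_0_compat; assumption|].
    replace ((eps * k) ^ 2 * (c ^ 2 / eta ^ 2) * v ^ 2) with ((eps * k * c / eta * v) ^ 2) by (field; lra).
    replace ((eps * k) ^ 2 * (c ^ 2 / eta ^ 2) * (2 * eta ^ 2 / c ^ 2 * (w + k ^ 2 * l))) with
      (2 * eps * (k ^ 2 * (w * eps) + k ^ 4 * (l * eps))) by (field; lra). exact A. }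
  assert (B3 : (y + y') ^ 2 <= 2 * eta ^ 2 / c ^ 2 * (w + k ^ 2 * l)).
  { apply Sq. pose proof (FB (-1) 0 ltac:(ring)) as F. replace (-1 * - (y + y') + 0 * (x - 1 + x')) with (y + y') in F by ring. exact F.
    pose proof (FB 1 0 ltac:(ring)) as F. replace (1 * - (y + y') + 0 * (x - 1 + x')) with (- (y + y')) in F by ring. exact F. }
  assert (B4 : (x - 1 + x') ^ 2 <= 2 * eta ^ 2 / c ^ 2 * (w + k ^ 2 * l)).
  { apply Sq. pose proof (FB 0 1 ltac:(ring)) as F. replace (0 * - (y + y') + 1 * (x - 1 + x')) with (x - 1 + x') in F by ring. exact F.
    pose proof (FB 0 (-1) ltac:(ring)) as F. replace (0 * - (y + y') + -1 * (x - 1 + x')) with (- (x - 1 + x')) in F by ring. exact F. }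
  assert (B5 : w <= k ^ 2 * l + 2 * c / eta * (k * Rabs y)).
  { right. apply (Rmult_eq_reg_r eps); [|lra]. rewrite <- Ew. unfold RR. rewrite El. unfold d, ze. field. lra. }
  destruct (Boot k w l x y x' y' Hk Hw Hl B1 B2 B3 B4 B5) as [R1 R2].
  assert (RRb : RR <= C * k ^ 2 * eps) by (rewrite Ew; apply Rmult_le_compat_r; lra).
  assert (Ck : 0 <= C * k ^ 2 * eps) by lra. assert (ke : 0 <= k ^ 2 * eps) by (apply Rmult_le_pos; [apply pow2_ge_0|lra]).
  split.
  - eapply Rle_trans; [apply SE, Hr|]. lra.
  - set (Dt := fun s t => (a s t - (cos (kap * s) * (1 + x) - sin (kap * s) * y)) ^ 2 + (b s t - (sin (kap * s) * (1 + x) + cos (kap * s) * y)) ^ 2).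
    pose proof (cr _ r Hr (cdist (1 + x) y)) as cDt. fold Dt in cDt.
    assert (Z : I2 (fun s t => (a s t - 1) ^ 2 + b s t ^ 2) r (eps - r) 0 1 <= I2 (fun s t => 2 * Dt s t + (4 * C * k ^ 2 + 4 * k ^ 2)) r (eps - r) 0 1).
    { apply I2_le; try lra.
      apply cr; [assumption|]. pose proof (c2_c0 _ _ _ _ _ _ _ Ca). pose proof (c2_c0 _ _ _ _ _ _ _ Cb). intros s t H'. c2d.
      intros s t Hst. c2d.
      intros s t [Hs Ht]. pose proof (cos2_sin2 (kap * s)) as S. pose proof (one_minus_cos_le (kap * s)) as O.
      assert (P2 : (kap * s) ^ 2 <= k ^ 2).
      { rewrite <- pow2_abs. apply pow_incr. split; [apply Rabs_pos|]. rewrite Rabs_mult, (Rabs_pos_eq s) by lra.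
        assert (Rabs kap * s <= k * 1) by (apply Rmult_le_compat; try lra; apply Rabs_pos). lra. }
      unfold Dt. set (co := cos (kap * s)) in *. set (si := sin (kap * s)) in *.
      assert (E : (co * (1 + x) - si * y - 1) ^ 2 + (si * (1 + x) + co * y) ^ 2 <= 2 * (x ^ 2 + y ^ 2) + 2 * k ^ 2).
      { replace (co * (1 + x) - si * y - 1) with ((co * x - si * y) + (co - 1)) by ring.
        replace (si * (1 + x) + co * y) with ((si * x + co * y) + si) by ring.
        assert (E1 : (co * x - si * y) ^ 2 + (si * x + co * y) ^ 2 = x ^ 2 + y ^ 2).
        { replace (_ + _) with ((co ^ 2 + si ^ 2) * (x ^ 2 + y ^ 2)) by ring. rewrite S. ring. }
        assert (E2 : (co - 1) ^ 2 + si ^ 2 <= k ^ 2) by lra.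
        pose proof (pow2_ge_0 ((co * x - si * y) - (co - 1))). pose proof (pow2_ge_0 ((si * x + co * y) - si)). lra. }
      revert E. generalize (co * (1 + x) - si * y) (si * (1 + x) + co * y). intros p q E.
      pose proof (pow2_ge_0 ((a s t - p) - (p - 1))). pose proof (pow2_ge_0 ((b s t - q) - q)). lra. }
    rewrite (I2_plus r (eps - r) 0 1 ltac:(lra) ltac:(lra) (fun s t => 2 * Dt s t) (fun _ _ => 4 * C * k ^ 2 + 4 * k ^ 2)) in Z.
    2: { intros s t Hst. c2d. }
    2: { intros s t _. apply continuity_2d_pt_const. }
    rewrite (I2_scal r (eps - r) 0 1 ltac:(lra) ltac:(lra) Dt 2 cDt), I2_const in Z.
    pose proof (ST r Hr) as T1. fold Dt in T1.
    pose proof (pow2_ge_0 k) as kp. assert (Ckp : 0 <= C * k ^ 2) by (apply Rmult_le_pos; lra).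
    assert ((eps - r - r) * (1 - 0) * (4 * C * k ^ 2 + 4 * k ^ 2) <= eps * (4 * C * k ^ 2 + 4 * k ^ 2)) by (apply Rmult_le_compat_r; lra).
    lra.
Qed.

(** * Pointwise bounds and conclusion *)

Lemma Cmod_le_of_components (z : C) B k : 0 <= B -> 0 <= k -> fst z ^ 2 + snd z ^ 2 <= B * k ^ 2 -> Cmod z <= sqrt B * k.
Proof.
  intros HB Hk H. unfold Cmod. rewrite <- (sqrt_pow2 k) by assumption. rewrite <- sqrt_mult by (try assumption; apply pow2_ge_0).
  apply sqrt_le_1_alt. exact H.
Qed.

Theorem mainTheorem10 :
  forall (sigma theta eta tau0 mu0 delta : R),
    0 < sigma -> Rabs theta < PI / 2 -> 0 < eta < 1 ->
    0 < tau0 -> 0 < mu0 -> 0 < delta < 1 / 2 ->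
    exists M eps0 : R, 0 < eps0 /\
      forall (eps k omega : R) (u : R * R -> C),
        0 < eps < eps0 ->
        k = Rpower eps sigma ->
        k = omega * sqrt (tau0 * mu0) ->
        scattering_solution eps (eps / eta) k (k * sin theta)
          (incident_field (k * sin theta) (k * cos theta)) u ->
        forall x : R * R,
          0 < fst x < eps -> delta <= snd x <= 1 - delta ->
          Cmod (Cminus (u x) (RtoC 1)) <= M * Rpower eps sigma /\
          Cmod (E1 omega tau0 u x) <= M.
Proof.
  intros sigma theta eta tau0 mu0 delta Hsig Hth Heta Htau Hmu Hdel.
  assert (Hc : 0 < cos theta).
  { apply Rabs_def2 in Hth. apply cos_gt_0; lra. }
  destruct (slit_estimates eta (cos theta) Heta Hc) as [C [k0 [HC [Hk0 SE]]]].
  destruct (interior_bounds delta Hdel) as [C1 [HC1 IB]].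
  (* Real and imaginary part each contribute C1 (A + A) / eps with A = C k^2 eps, together 4 C1 C
     k^2. *)
  set (B := 4 * (C1 * C)). assert (HB : 0 < B) by (unfold B; assert (0 < C1 * C) by (apply Rmult_lt_0_compat; assumption); lra).
  set (q := sqrt (tau0 * mu0)). assert (Hq : 0 < q) by (apply sqrt_lt_R0, Rmult_lt_0_compat; assumption).
  assert (HqT : 0 < q / tau0) by (apply Rdiv_lt_0_compat; assumption).
  (* The two thresholds ensure d <= 1/10 and k <= k0. One constant serves both bounds: sqrt B for
     the magnetic field and sqrt B q / tau0 for the electric one, since 1 / (omega tau0) = q / (tau0
     k). *)
  exists (sqrt B * (1 + q / tau0)), (Rmin (eta / 10) (Rpower k0 (/ sigma))).
  assert (HsB : 0 <= sqrt B) by apply sqrt_pos.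
  split. { apply Rmin_pos; [lra|apply exp_pos]. }
  intros eps k omega u Heps Hk Hom Hsol [s t] Hs Ht. simpl in Hs, Ht. rewrite <- Hk.
  assert (He1 : eps < eta / 10) by (eapply Rlt_le_trans; [apply Heps|apply Rmin_l]).
  assert (He2 : eps < Rpower k0 (/ sigma)) by (eapply Rlt_le_trans; [apply Heps|apply Rmin_r]).
  assert (Hkp : 0 < k) by (rewrite Hk; apply exp_pos).
  assert (Hkk : k <= k0).
  { rewrite Hk. replace k0 with (Rpower (Rpower k0 (/ sigma)) sigma).
    left. apply Rlt_Rpower_l; lra. rewrite Rpower_mult, Rinv_l, Rpower_1; lra. }
  assert (Hsc : sin theta ^ 2 + cos theta ^ 2 = 1) by (pose proof (cos2_sin2 theta); lra).
  assert (Hc2 : 0 < cos theta ^ 2) by (apply pow_lt; assumption).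
  assert (Hkap : Rabs (k * sin theta) < k).
  { rewrite Rabs_mult, (Rabs_pos_eq k) by lra. rewrite <- (Rmult_1_r k) at 2. apply Rmult_lt_compat_l; [assumption|].
    rewrite <- (Rabs_pos_eq 1) by lra. apply Rsqr_lt_abs_0. unfold Rsqr. lra. }
  assert (Hze : k * cos theta = sqrt (k ^ 2 - (k * sin theta) ^ 2)).
  { replace (k ^ 2 - (k * sin theta) ^ 2) with ((k * cos theta) ^ 2).
    rewrite sqrt_pow2; [reflexivity|]. left; apply Rmult_lt_0_compat; assumption.
    rewrite !Rpow_mult_distr. replace (cos theta ^ 2) with (1 - sin theta ^ 2) by lra. ring. }
  assert (Hd : eps / eta <= 1 / 10).
  { apply (Rmult_le_reg_r eta); [lra|]. unfold Rdiv. rewrite Rmult_assoc, Rinv_l by lra. lra. }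
  pose proof (SE eps k (k * sin theta) u ltac:(lra) Hd (conj Hkp Hkk) Hkap Hze Hsol) as Est.
  assert (Hed : 0 < eps < eps / eta).
  { split; [lra|]. apply (Rmult_lt_reg_r eta); [lra|]. unfold Rdiv. rewrite Rmult_assoc, Rinv_l by lra. nra. }
  destruct Hsol as [S1 S2 S3 S4 S5 S6 S7].
  destruct (C2_real eps _ u S1) as [Ca Cb]. pose proof (helmholtz_real eps _ k u S2) as EH.
  pose proof (neumann_vertical eps _ u Hed S3) as W1.
  set (A := C * k ^ 2 * eps) in *.
  assert (HA : 0 <= A). { unfold A. repeat apply Rmult_le_pos; try lra. }
  assert (cr : forall f r c e, 0 < r < eps / 2 -> 0 <= c -> e <= 1 -> cont_on (cell eps) f -> cont_on (rect r (eps - r) c e) f).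
  { intros f r c e Hr Hc0 He Hf. apply (cont_on_sub (cell eps)); [rect_cell|assumption]. }
  pose proof (c2_c0 _ _ _ _ _ _ _ Ca) as ka0. pose proof (c2_c0 _ _ _ _ _ _ _ Cb) as kb0.
  pose proof (c2_c1 _ _ _ _ _ _ _ Ca) as ka1. pose proof (c2_c1 _ _ _ _ _ _ _ Cb) as kb1.
  pose proof (c2_c2 _ _ _ _ _ _ _ Ca) as ka2. pose proof (c2_c2 _ _ _ _ _ _ _ Cb) as kb2.
  assert (Dom : forall f F r c e, 0 < r < eps / 2 -> 0 < c -> c <= e -> e < 1 -> cont_on (cell eps) f -> cont_on (cell eps) F ->
    (forall s t, 0 <= f s t <= F s t) -> I2 F r (eps - r) 0 1 <= A -> I2 f r (eps - r) c e <= A).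
  { intros f F r c e Hr Hc0 Hce He Hf HF Hle HI. eapply Rle_trans; [|exact HI].
    apply Rle_trans with (I2 f r (eps - r) 0 1).
    apply I2_mono_dom; try lra. apply cr; try assumption; lra. intros; apply Hle.
    apply I2_le; try lra. apply cr; try assumption; lra. apply cr; try assumption; lra. intros; apply Hle. }
  set (gg := fun s t => ure (d1 u) s t ^ 2 + uim (d1 u) s t ^ 2 + ure (d2 u) s t ^ 2 + uim (d2 u) s t ^ 2) in *.
  set (dd := fun s t => (ure u s t - 1) ^ 2 + uim u s t ^ 2) in *.
  assert (cgg : cont_on (cell eps) gg) by (intros x y H; unfold gg; c2d).
  assert (cdd : cont_on (cell eps) dd) by (intros x y H; unfold dd; c2d).
  (* The field is compared with the constant 1, so m0 = 1 for the real part and m0 = 0 for the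
     imaginary part. *)
  assert (Ia := IB k eps 1 A A (ure u) (ure (d1 u)) (ure (d2 u)) (ure (d1 (d1 u))) (ure (d2 (d2 u))) (ure (d2 (d1 u))) ltac:(lra) ltac:(lra) HA HA).
  assert (Ib := IB k eps 0 A A (uim u) (uim (d1 u)) (uim (d2 u)) (uim (d1 (d1 u))) (uim (d2 (d2 u))) (uim (d2 (d1 u))) ltac:(lra) ltac:(lra) HA HA).
  assert (Na : neumann_strip k eps 0 1 (ure u) (ure (d1 u)) (ure (d2 u)) (ure (d1 (d1 u))) (ure (d2 (d2 u))) (ure (d2 (d1 u)))).
  { apply (strip_of_cell _ _ _ _ _ _ _ _ Ca (fun y1 y2 H => proj1 (EH y1 y2 H))). intros c e g H1 H2 H3.
    destruct (W1 c e g H1 H2 H3) as [h0 [P Q]]. exists h0. split; [assumption|]. intros h y Hh Hy.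
    destruct (Q h y Hh Hy) as [[Q1 _] [Q2 _]]. split; assumption. }
  assert (Nb : neumann_strip k eps 0 1 (uim u) (uim (d1 u)) (uim (d2 u)) (uim (d1 (d1 u))) (uim (d2 (d2 u))) (uim (d2 (d1 u)))).
  { apply (strip_of_cell _ _ _ _ _ _ _ _ Cb (fun y1 y2 H => proj2 (EH y1 y2 H))). intros c e g H1 H2 H3.
    destruct (W1 c e g H1 H2 H3) as [h0 [P Q]]. exists h0. split; [assumption|]. intros h y Hh Hy.
    destruct (Q h y Hh Hy) as [[_ Q1] [_ Q2]]. split; assumption. }
  specialize (Ia Na). specialize (Ib Nb).
  assert (Pa : (ure u s t - 1) ^ 2 <= C1 * (A + A) / eps /\ ure (d2 u) s t ^ 2 <= C1 * A / eps).
  { apply Ia; try assumption. intros r c e Hr H1 H2 H3. destruct (Est r Hr) as [E1 E2].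
    split; [|split].
    - apply (Dom _ gg); try assumption. intros x y H; c2d.
      intros x y. unfold gg. pose proof (pow2_ge_0 (ure (d1 u) x y)). pose proof (pow2_ge_0 (uim (d1 u) x y)).
      pose proof (pow2_ge_0 (ure (d2 u) x y)). pose proof (pow2_ge_0 (uim (d2 u) x y)). lra.
    - apply (Dom _ gg); try assumption. intros x y H; c2d.
      intros x y. unfold gg. pose proof (pow2_ge_0 (ure (d1 u) x y)). pose proof (pow2_ge_0 (uim (d1 u) x y)).
      pose proof (pow2_ge_0 (ure (d2 u) x y)). pose proof (pow2_ge_0 (uim (d2 u) x y)). lra.
    - apply (Dom _ dd); try assumption. intros x y H; c2d.
      intros x y. unfold dd. pose proof (pow2_ge_0 (ure u x y - 1)). pose proof (pow2_ge_0 (uim u x y)). lra. }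
  assert (Pb : (uim u s t - 0) ^ 2 <= C1 * (A + A) / eps /\ uim (d2 u) s t ^ 2 <= C1 * A / eps).
  { apply Ib; try assumption. intros r c e Hr H1 H2 H3. destruct (Est r Hr) as [E1 E2].
    split; [|split].
    - apply (Dom _ gg); try assumption. intros x y H; c2d.
      intros x y. unfold gg. pose proof (pow2_ge_0 (ure (d1 u) x y)). pose proof (pow2_ge_0 (uim (d1 u) x y)).
      pose proof (pow2_ge_0 (ure (d2 u) x y)). pose proof (pow2_ge_0 (uim (d2 u) x y)). lra.
    - apply (Dom _ gg); try assumption. intros x y H; c2d.
      intros x y. unfold gg. pose proof (pow2_ge_0 (ure (d1 u) x y)). pose proof (pow2_ge_0 (uim (d1 u) x y)).
      pose proof (pow2_ge_0 (ure (d2 u) x y)). pose proof (pow2_ge_0 (uim (d2 u) x y)). lra.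
    - apply (Dom _ dd); try assumption. intros x y H; c2d.
      intros x y. unfold dd. rewrite Rminus_0_r. pose proof (pow2_ge_0 (ure u x y - 1)). pose proof (pow2_ge_0 (uim u x y)). lra. }
  replace (C1 * (A + A) / eps) with (B / 2 * k ^ 2) in Pa, Pb by (unfold A, B; field; lra).
  replace (C1 * A / eps) with (B / 4 * k ^ 2) in Pa, Pb by (unfold A, B; field; lra).
  assert (Bk : 0 <= B * k ^ 2) by (apply Rmult_le_pos; [lra|apply pow2_ge_0]).
  assert (Hsk : 0 <= sqrt B * k) by (apply Rmult_le_pos; lra).
  split.
  - apply Rle_trans with (sqrt B * k).
    + apply Cmod_le_of_components; try lra.
      replace (fst (Cminus (u (s, t)) (RtoC 1))) with (ure u s t - 1) by (unfold ure; reflexivity).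
      replace (snd (Cminus (u (s, t)) (RtoC 1))) with (uim u s t - 0) by (unfold uim; reflexivity). lra.
    + assert (0 <= sqrt B * k * (q / tau0)) by (apply Rmult_le_pos; lra). lra.
  - assert (Hom0 : omega = k / q) by (rewrite Hom; fold q; field; lra).
    assert (Hom1 : 0 < omega) by (rewrite Hom0; apply Rdiv_lt_0_compat; assumption).
    assert (Hot : 0 < omega * tau0) by (apply Rmult_lt_0_compat; assumption).
    assert (M2 : Cmod (d2 u (s, t)) <= sqrt B * k).
    { apply Cmod_le_of_components; try lra. change (ure (d2 u) s t ^ 2 + uim (d2 u) s t ^ 2 <= B * k ^ 2). lra. }
    assert (Mc : Cmod (Copp (Cmult Ci (RtoC (omega * tau0)))) = omega * tau0).
    { rewrite Cmod_opp, Cmod_mult, Cmod_R, (Rabs_pos_eq (omega * tau0)) by lra.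
      replace (Cmod Ci) with 1. ring. symmetry. transitivity (sqrt 1); [unfold Cmod, Ci; simpl; f_equal; ring|apply sqrt_1]. }
    unfold E1, electric_field. cbn [fst snd]. unfold Cdiv. rewrite Cmod_mult, Cmod_inv.
    rewrite Mc. apply Rle_trans with (sqrt B * k * / (omega * tau0)).
    + apply Rmult_le_compat_r; [left; apply Rinv_0_lt_compat; assumption|exact M2].
    + replace (sqrt B * k * / (omega * tau0)) with (sqrt B * (q / tau0)) by (rewrite Hom0; field; lra). lra.
    + intros H0. rewrite H0, Cmod_0 in Mc. lra.
Qed.
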